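(* Let $n\ge 3$, let $\alpha=(\alpha_1,\dots,\alpha_n)\in(0,2\pi)^n$ satisfy $\alpha_1+\dots+\alpha_n>2\pi(n-1)$, and let $\mathrm{Rep}^{DT}_\alpha$ be the associated Deroin–Tholozan relative character variety with Goldman symplectic form $\omega_{\mathcal G}$. Let $a_0,\dots,a_{n-3}$ be the area parameters and $\sigma_1,\dots,\sigma_{n-3}$ the angle parameters, $\sigma_i=\gamma_1+\dots+\gamma_i$. Then $\{a_1,\dots,a_{n-3},\sigma_1,\dots,\sigma_{n-3}\}$ are action-angle coordinates for $\mathrm{Rep}^{DT}_\alpha$ (with its Hamiltonian action of the torus $\mathbb T^{n-3}$). That is, on the open dense subset $\mathring{\mathrm{Rep}}{}^{DT}_\alpha=\{a_i>0 \text{ for all } i=0,\dots,n-3\}$, the map $(a_1,\dots,a_{n-3},\sigma_1,\dots,\sigma_{n-3})$ is a diffeomorphism onto an open subset of $\mathbb R^{n-3}\times(\mathbb R/2\pi\mathbb Z)^{n-3}$; the $a_i$ are invariant under the torus action, while $\sigma_i(\theta\cdot[\phi])=\sigma_i([\phi])-\theta_i$ for $\theta\in\mathbb T^{n-3}$; and the coordinates are canonical: $\omega_{\mathcal G}=\tfrac12\sum_{i=1}^{n-3}da_i\wedge d\sigma_i$.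
   Context: Representations. $G=\mathrm{PSL}(2,\mathbb R)$ acts on the upper half-plane $\mathbb H$ by orientation-preserving isometries. $\Sigma_n$ is an oriented connected sphere with $n$ labelled punctures and $\pi_1(\Sigma_n)=\langle c_1,\dots,c_n : c_1c_2\cdots c_n=1\rangle$, with $c_i$ a loop around the $i$-th puncture. An elliptic $A\in G$ has a unique fixed point $\mathrm{fix}(A)\in\mathbb H$ and an anti-clockwise rotation angle $\vartheta(A)\in(0,2\pi)$ (the complex derivative of $A$ at $\mathrm{fix}(A)$ is $e^{i\vartheta(A)}$); $\mathrm{rot}_\theta(z)$ is the anti-clockwise rotation by angle $\theta$ about $z\in\mathbb H$. $\mathrm{Rep}_\alpha$ is the set of conjugacy classes $[\phi]$ of homomorphisms $\phi:\pi_1(\Sigma_n)\to G$ with $\phi(c_i)$ elliptic and $\vartheta(\phi(c_i))=\alpha_i$ for all $i$; it is an analytic manifold of dimension $2(n-3)$. Volume. $[\Delta(z_1,z_2,z_3)]$ denotes the signed hyperbolic area of the oriented geodesic triangle with vertices $z_1,z_2,z_3\in\mathbb H$, positive when clockwise oriented. Fix $z\in\mathbb H$ and put $c(A_1,A_2)=[\Delta(z,A_1z,A_1A_2z)]$ for $A_1,A_2\in G$ (a bounded 2-cocycle). For $\phi:\pi_1(\Sigma_n)\to G$ let $k_i:\langle c_i\rangle\to\mathbb R$ be the unique bounded function with $k_i(g)+k_i(h)-k_i(gh)=c(\phi(g),\phi(h))$. Then $\mathrm{vol}([\phi])=\sum_{m=1}^{n-1}c(\phi(c_1\cdots c_m),\phi(c_{m+1}))-\sum_{i=1}^nk_i(c_i)$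 (independent of $z$); this is the class of $c$ pulled back by $\phi$, lifted to relative bounded cohomology and evaluated on the relative fundamental class. Put $\lambda=\alpha_1+\dots+\alpha_n-2\pi(n-1)\in(0,2\pi)$. The Deroin–Tholozan relative character variety $\mathrm{Rep}^{DT}_\alpha$ is $\{[\phi]\in\mathrm{Rep}_\alpha:\mathrm{vol}([\phi])=-\lambda\}$. It is known that it is a nonempty compact connected component of $\mathrm{Rep}_\alpha$ and that for $[\phi]$ in it, $\phi$ maps every simple closed curve to an elliptic element. Chains of triangles. Let $b_i=(c_1\cdots c_{i+1})^{-1}$ for $0\le i\le n-2$ (so $b_0=c_1^{-1}$, $b_{n-2}=c_n$), $C_i=\mathrm{fix}(\phi(c_i))$, $B_i=\mathrm{fix}(\phi(b_i))$ (so $B_0=C_1$, $B_{n-2}=C_n$), $\beta_i=\vartheta(\phi(b_i))$ (so $\beta_0=2\pi-\alpha_1$, $\beta_{n-2}=\alpha_n$), and $\Delta_i=\Delta(B_i,C_{i+2},B_{i+1})$ for $0\le i\le n-3$. Area parameters: $a_i([\phi])=2[\Delta_i]$; it is known that $a_i\ge0$ and $a_0+\dots+a_{n-3}=\lambda$. If all $a_i([\phi])>0$, $\gamma_i([\phi])\in\mathbb R/2\pi\mathbb Z$ ($1\le i\le n-3$) is the anti-clockwise oriented angle from the geodesic ray $\overrightarrow{B_iC_{i+2}}$ to the geodesic ray $\overrightarrow{B_iC_{i+1}}$. Torus action. $\mathbb T^{n-3}=(\mathbb R/2\pi\mathbb Z)^{n-3}$ acts on $\mathrm{Rep}^{DT}_\alpha$: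 with $\bar\theta_j=\theta_j-\theta_{j-1}$, $\theta_0=0$, set $(\theta\cdot\phi)(c_1)=\phi(c_1)$ and, for $2\le i\le n$, $(\theta\cdot\phi)(c_i)=R_i\phi(c_i)R_i^{-1}$ with $R_i=\prod_{j=1}^{\min(i-2,n-3)}\mathrm{rot}_{\bar\theta_j}(B_j)$ (factors in increasing order of $j$). Symplectic form. $T_{[\phi]}\mathrm{Rep}^{DT}_\alpha$ is the space of classes in $H^1(\pi_1(\Sigma_n);\mathfrak{sl}(2,\mathbb R)_{\mathrm{Ad}\phi})$ restricting to $0$ on each $\langle c_i\rangle$; $\omega_{\mathcal G}(u,v)$ is obtained by lifting $u$ to relative cohomology of $(\pi_1(\Sigma_n),\{\langle c_i\rangle\})$, taking the cup product with $v$ using the trace form $(A,B)\mapsto\mathrm{tr}(AB)$, and evaluating on the relative fundamental class. The overall sign is normalized so that $\omega_{\mathcal G}(\Theta,\cdot)=\tfrac12\sum_i\theta_i\,da_i$, where $\Theta$ is the vector field generated by $\theta\in\mathbb R^{n-3}$. *)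

(* Defs.v *)
From HB Require Import structures.
From mathcomp Require Import all_boot all_order all_algebra.
From mathcomp Require Import complex.
From mathcomp Require Import all_classical all_reals all_analysis.
Set Implicit Arguments.
Unset Strict Implicit.
Unset Printing Implicit Defensive.
Import Order.TTheory GRing.Theory Num.Theory.
Import numFieldNormedType.Exports.
Local Open Scope classical_set_scope.
Local Open Scope ring_scope.
Local Open Scope complex_scope.

(** * Smooth quotient spaces

A space is presented as a pair (X, E): a subset X of a finite-dimensional
normed space together with an equivalence relation E on X, standing for X / E
with the quotient topology and the smooth functions of X / E, i.e. the
E-invariant functions on X that locally extend to smooth functions on the
ambient space.  When X is an embedded submanifold and X -> X / E is a
submersion, this is the manifold X / E. *)

Section SmoothQuotient.
Context {R : realType}.

Section OneSpace.
Context {V : normedModType R}.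
Implicit Types (X S O : set V) (E : V -> V -> Prop).

Definition iter_derive {W : normedModType R} (vs : seq V) (f : V -> W) : V -> W :=
  foldr (fun v g x => 'D_v g x) f vs.

(* In finite dimension this is C^oo on the open set O. *)
Definition smooth_on {W : normedModType R} O (f : V -> W) : Prop :=
  forall (vs : seq V) (x : V), O x ->
    {for x, continuous (iter_derive vs f)} /\
    forall v, derivable (iter_derive vs f) x v.

Definition saturated X E S : Prop :=
  S `<=` X /\ forall x y, S x -> X y -> E x y -> S y.

Definition qopen X E S : Prop :=
  saturated X E S /\ exists O, open O /\ S = X `&` O.

Definition qdense X E S : Prop :=
  S `<=` X /\ forall S', qopen X E S' -> S' !=set0 -> (S' `&` S) !=set0.

Definition invariant_on E S (f : V -> R) : Prop :=
  forall x y, S x -> S y -> E x y -> f x = f y.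

Definition qsmooth E S (f : V -> R) : Prop :=
  invariant_on E S f /\
  forall x, S x -> exists O, exists g : V -> R,
    [/\ open O, O x, smooth_on O g & forall y, S y -> O y -> g y = f y].

End OneSpace.

(* F induces a homeomorphism X / E -> Y / E' identifying the smooth functions
   on corresponding open sets. *)
Definition qdiffeo {V W : normedModType R}
    (X : set V) (E : V -> V -> Prop) (Y : set W) (E' : W -> W -> Prop)
    (F : V -> W) : Prop :=
  [/\ forall x, X x -> Y (F x),
      forall y, Y y -> exists2 x, X x & E' (F x) y,
      forall x x', X x -> X x' -> (E x x' <-> E' (F x) (F x')),
      forall S, saturated Y E' S ->
        (qopen Y E' S <-> qopen X E (X `&` F @^-1` S)) &
      forall S (g : W -> R), qopen Y E' S -> invariant_on E' S g ->
        (qsmooth E' S g <-> qsmooth E (X `&` F @^-1` S) (g \o F))].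

Definition eqmod2pi (x y : R) : Prop := exists m : int, x = y + m%:~R * (2 * pi).

(* (R^k x R^k) / torus_rel is R^k x (R / 2 pi Z)^k. *)
Definition torus_rel (k : nat) (p q : 'rV[R]_k * 'rV[R]_k) : Prop :=
  p.1 = q.1 /\ forall j, eqmod2pi (p.2 ord0 j) (q.2 ord0 j).

End SmoothQuotient.

(** * The upper half-plane

An element of PSL(2,R) is represented by either of its two lifts to SL(2,R);
all notions below are insensitive to the choice of lift. *)

Section UpperHalfPlane.
Context {R : realType}.
Implicit Types (A : 'M[R]_2) (z w : R[i]).

Definition inH z : Prop := 0 < complex.Im z.

Definition mobius A z : R[i] :=
  ((A 0 0)%:C * z + (A 0 1)%:C) / ((A 1 0)%:C * z + (A 1 1)%:C).

(* Complex derivative at z of [mobius A], for A of determinant 1. *)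
Definition mobius_deriv A z : R[i] :=
  (((A 1 0)%:C * z + (A 1 1)%:C) ^+ 2)^-1.

Definition cis (t : R) : R[i] := cos t +i* sin t.

Definition elliptic A : Prop :=
  [/\ A <> 1, A <> -1 & exists2 z, inH z & mobius A z = z].

Definition fixpt A : R[i] := xget (0 +i* 1) [set z | inH z /\ mobius A z = z].

Definition rot_angle A : R :=
  xget 0 [set t | 0 < t < 2 * pi /\ mobius_deriv A (fixpt A) = cis t].

Definition rotation (t : R) z : 'M[R]_2 :=
  xget 1 [set A | [/\ \det A = 1, mobius A z = z & mobius_deriv A z = cis t]].

Definition normsq z : R := complex.Re z ^+ 2 + complex.Im z ^+ 2.

(* The geodesics of H are the curves p + q Re z + r |z|^2 = 0.  Hence
   z |-> (Re z, |z|^2), which preserves orientation, sends them to straight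
   lines, and geodesic triangles to Euclidean ones. *)
Definition triangle (z1 z2 z3 : R[i]) : set (R * R) :=
  [set p | 0 < p.2 /\ exists t1 t2 t3 : R,
     [/\ [/\ 0 <= t1, 0 <= t2 & 0 <= t3], t1 + t2 + t3 = 1,
         p.1 = t1 * complex.Re z1 + t2 * complex.Re z2 + t3 * complex.Re z3 &
         p.1 ^+ 2 + p.2 ^+ 2 =
           t1 * normsq z1 + t2 * normsq z2 + t3 * normsq z3]].

(* Positive iff (z1, z2, z3) is anti-clockwise, zero iff the three points lie
   on a geodesic. *)
Definition orientation (z1 z2 z3 : R[i]) : R :=
  Num.sg ((complex.Re z2 - complex.Re z1) * (normsq z3 - normsq z1)
        - (complex.Re z3 - complex.Re z1) * (normsq z2 - normsq z1)).

(* Clockwise triangles have positive area; dx dy / y^2 is the hyperbolic area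
   form. *)
Definition signed_area (z1 z2 z3 : R[i]) : R :=
  - orientation z1 z2 z3 *
  \int[(lebesgue_measure \x lebesgue_measure)%E]_(p in triangle z1 z2 z3)
     (p.2 ^+ 2)^-1.

(* This Cayley map sends z to 0, and the geodesic rays issued from z to
   straight rays issued from 0; being conformal, it preserves oriented angles. *)
Definition cayley z w : R[i] := (w - z) / (w - conjc z).

(* Anti-clockwise angle in [0, 2 pi[ from the ray z w to the ray z w'. *)
Definition ray_angle z w w' : R :=
  xget 0 [set t | 0 <= t < 2 * pi /\
    exists2 r : R, 0 < r & cayley z w' = r%:C * cis t * cayley z w].

(* The basepoint is i; vol below does not depend on it. *)
Definition area_cocycle A1 A2 : R :=
  let z := 0 +i* 1 in signed_area z (mobius A1 z) (mobius (A1 * A2) z).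

(* k(c) for the bounded k : <c> -> R cobounding the pulled back cocycle, where
   <c> is infinite cyclic and c acts by A. *)
Definition bounded_primitive A : R :=
  xget 0 [set r | exists k : int -> R,
    [/\ exists M : R, forall a, `|k a| <= M,
        forall a b, k a + k b - k (a + b) = area_cocycle (A ^ a) (A ^ b) &
        r = k 1]].

End UpperHalfPlane.

(** * Representations of the fundamental group of the punctured sphere

A homomorphism phi from <c_1, ..., c_n | c_1 ... c_n = 1> to PSL(2,R) is
given by the n-tuple of the phi(c_i), lifted to SL(2,R).  Tuples of 2 x 2
matrices are stored as the rows of an n x 4 matrix. *)

Section Representations.
Context {R : realType} {n : nat}.

Definition mtuple := 'M[R]_(n, 2 * 2).

Implicit Types (X Y u v : mtuple) (alpha : 'I_n -> R) (theta : 'rV[R]_(n - 3)).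

Definition mk_mtuple (f : 'I_n -> 'M[R]_2) : mtuple := \matrix_(i < n) mxvec (f i).

(* phi(c_i), for 1 <= i <= n; the other values are irrelevant. *)
Definition gen X (i : nat) : 'M[R]_2 :=
  if i is j.+1 then oapp (fun o : 'I_n => vec_mx (row o X) : 'M[R]_2) 1 (insub j)
  else 1.

(* phi(c_1 ... c_m) *)
Definition gens X (m : nat) : 'M[R]_2 := \prod_(1 <= j < m.+1) gen X j.

Definition conj_rel X Y : Prop :=
  exists2 g : 'M[R]_2, \det g = 1 &
    forall i, (1 <= i <= n)%N ->
      gen Y i = g * gen X i * g^-1 \/ gen Y i = - (g * gen X i * g^-1).

(* [alpha i] is the angle at the puncture i + 1. *)
Definition Rep alpha : set mtuple :=
  [set X | [/\ forall i, (1 <= i <= n)%N -> \det (gen X i) = 1,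
               gens X n = 1 \/ gens X n = -1 &
               forall i : 'I_n, elliptic (gen X i.+1) /\
                                rot_angle (gen X i.+1) = alpha i]].

Definition vol X : R :=
  \sum_(1 <= m < n) area_cocycle (gens X m) (gen X m.+1)
  - \sum_(1 <= i < n.+1) bounded_primitive (gen X i).

Definition lambda alpha : R := \sum_i alpha i - 2 * pi * (n%:R - 1).

Definition RepDT alpha : set mtuple :=
  [set X | Rep alpha X /\ vol X = - lambda alpha].

Definition Cpt X (i : nat) : R[i] := fixpt (gen X i).
Definition Bpt X (i : nat) : R[i] := fixpt (gens X i.+1)^-1.

Definition area_param X (i : nat) : R :=
  2 * signed_area (Bpt X i) (Cpt X i.+2) (Bpt X i.+1).

Definition gamma X (i : nat) : R :=
  ray_angle (Bpt X i) (Cpt X i.+2) (Cpt X i.+1).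

(* A representative of the angle parameter, meaningful modulo 2 pi. *)
Definition sigma X (i : nat) : R := \sum_(1 <= j < i.+1) gamma X j.

Definition RepDT_open alpha : set mtuple :=
  [set X | RepDT alpha X /\ forall i, (i <= n - 3)%N -> 0 < area_param X i].

Definition coords X : 'rV[R]_(n - 3) * 'rV[R]_(n - 3) :=
  (\row_j area_param X j.+1, \row_j sigma X j.+1).

(* theta_j for 1 <= j <= n - 3, and theta_0 = 0. *)
Definition theta_ theta (j : nat) : R :=
  if j is k.+1 then oapp (fun o : 'I_(n - 3) => theta ord0 o) 0 (insub k) else 0.

Definition torus_conj theta X (i : nat) : 'M[R]_2 :=
  \prod_(1 <= j < (minn (i - 2) (n - 3)).+1)
    rotation (theta_ theta j - theta_ theta j.-1) (Bpt X j).

(* For i = 1 the conjugating product is empty. *)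
Definition torus_act theta X : mtuple :=
  mk_mtuple (fun i : 'I_n =>
    torus_conj theta X i.+1 * gen X i.+1 * (torus_conj theta X i.+1)^-1).

Definition Ad (g x : 'M[R]_2) : 'M[R]_2 := g * x * g^-1.

(* u(c_1 ... c_m) for the crossed homomorphism u, u(gh) = u(g) + Ad(phi g) u(h),
   with given values on the generators. *)
Definition cocycle_gens X u (m : nat) : 'M[R]_2 :=
  \sum_(1 <= j < m.+1) Ad (gens X j.-1) (gen u j).

Definition is_primitive (A x xi : 'M[R]_2) : Prop :=
  \tr xi = 0 /\ x = Ad A xi - xi.

(* Crossed homomorphisms with values in sl(2,R) whose restriction to each <c_i>
   is a coboundary; they represent the tangent vectors at [phi]. *)
Definition parabolic_cocycle X u : Prop :=
  [/\ forall i, (1 <= i <= n)%N -> \tr (gen u i) = 0,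
      cocycle_gens X u n = 0 &
      forall i, (1 <= i <= n)%N -> exists xi, is_primitive (gen X i) (gen u i) xi].

(* The lift of u to relative cohomology is (u, (xi_i)_i) with
   delta xi_i = u on <c_i>, and the relative fundamental class is
   (sum_m (c_1 ... c_m | c_(m+1)), (c_i)_i), as in the definition of vol.
   With this sign, omega(Theta, .) = 1/2 sum_i theta_i da_i. *)
Definition goldman X u v : R :=
  \sum_(1 <= m < n)
     \tr (cocycle_gens X u m * Ad (gens X m) (gen v m.+1))
  - \sum_(1 <= i < n.+1)
     \tr (xget 0 [set xi | is_primitive (gen X i) (gen u i) xi] * gen v i).

(* A path with velocity u at X is phi_t(g) = exp(t u(g) + o(t)) phi(g). *)
Definition path_through alpha X u (p : R -> mtuple) : Prop :=
  [/\ smooth_on setT p, forall t, Rep alpha (p t), p 0 = X &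
      forall i, (1 <= i <= n)%N -> gen ('D_(1 : R) p 0) i = gen u i * gen X i].

(* df(u), for a function f on Rep with values in the reals modulo ~: the
   derivative at 0 of a real lift s of t |-> f(p(t)). *)
Definition differential (sim : R -> R -> Prop) alpha (f : mtuple -> R) X u : R :=
  xget 0 [set d | exists p : R -> mtuple, exists s : R -> R,
    [/\ path_through alpha X u p, \forall t \near (0 : R), sim (s t) (f (p t)) &
        is_derive (0 : R) 1 s d]].

Definition d_area alpha X (i : nat) u : R :=
  differential eq alpha (area_param^~ i) X u.

Definition d_sigma alpha X (i : nat) u : R :=
  differential eqmod2pi alpha (sigma^~ i) X u.

End Representations.
Arguments mtuple : clear implicits.

(* Main.v *)
(* Lift phi(c_i) to the matrix with positive lower left entry, which is conjugate
   to the rotation matrix of angle h_i = pi - alpha_i / 2.  By Gauss-Bonnet, the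
   condition vol = - lambda says that all products P_m of the first m < n lifts
   are conjugate to rotation matrices of angles H_m in ]0, pi[, and then
   a_i = 2 (H_(i+2) - H_(i+1) - h_(i+2)).  Conversely, the areas determine the
   shapes of the triangles and the angles gamma_i the way to glue them: building
   the chain vertex by vertex gives a smooth section of (a, sigma) over a simplex,
   and smooth local lifts of (a, sigma) then make it a diffeomorphism.  The torus
   acts by bending the chain at its vertices B_i.

   Write the velocity of P_m as H'_m J + x_m - Ad P_m x_m, where J generates the
   rotations about B_(m-1).  On each triangle the contributions to the Goldman form
   telescope, and only the jumps kappa_i J of the fields x across the B_i survive:
   omega(u, v) = 2 sum_i (kappa_i(u) H'_(i+1)(v) - H'_(i+1)(u) kappa_i(v)).  Since
   dgamma_i = 2 kappa_i and da_i = 2 (H'_(i+2) - H'_(i+1)), this is the theorem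
   after a summation by parts.  A cocycle on which all H' and kappa vanish is a
   coboundary; hence every cocycle is the velocity of a path, obtained from the
   section by conjugation. *)
Require Import Defs.
From HB Require Import structures.
From mathcomp Require Import all_boot all_order all_algebra.
From mathcomp Require Import complex.
From mathcomp Require Import all_classical all_reals all_analysis.
From mathcomp Require Import measurable_realfun zify ring lra.
Set Implicit Arguments.
Unset Strict Implicit.
Unset Printing Implicit Defensive.
Import Order.TTheory GRing.Theory Num.Theory.
Import numFieldNormedType.Exports.
Local Open Scope classical_set_scope.
Local Open Scope ring_scope.
Local Open Scope complex_scope.

(** * Areas of triangles *)

(** Areas are Lebesgue integrals and the volume involves a chosen bounded primitive, whereas the
    argument needs angles. The bridge is Stokes: dx dy / y^2 = d(dx / y), and half the integral of
    dx / y along a side from [z] to [w] is the argument [Larg z w] of -i (z - conj w). An isometry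
    changes it by the difference of the arguments of the automorphy factor cz + d at the two ends.
    Hence vol equals twice the sum of the h_i minus twice the total turning of the automorphy factor
    along c_1 ... c_n, and vol = - lambda singles out the turning pi, the least that a closed chain
    allows. Two obstacles shape the rest. Matrices are known up to sign and angles, chosen in [0, 2
    pi[, jump; so the coordinates are never differentiated themselves, but replaced by explicit
    formulas, smooth in the ambient matrix space, that agree with them modulo 2 pi. And tangent
    vectors are cocycles, on which differentials are defined only through paths of representations;
    this is why the formula for the symplectic form needs a path for every cocycle. *)

Section Area.
Context {R : realType}.
Implicit Types (x y s m : R) (z w : R[i]).
Notation mu := (@lebesgue_measure R).

(** Half the integral of dx / y along the geodesic from [z] to [w]; a vertical geodesic gives 0. It
    is the argument of -i (z - conj w), which explains the bound pi / 2 and the simple behaviour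
    under isometries. *)
Definition Larg z w : R :=
  atan ((complex.Re w - complex.Re z) / (complex.Im z + complex.Im w)).

Lemma LargC z w : Larg w z = - Larg z w.
Proof. by rewrite /Larg -atanN -mulNr opprB addrC [_ + complex.Im w]addrC. Qed.

Lemma Largxx z : Larg z z = 0.
Proof. by rewrite /Larg subrr mul0r atan0. Qed.

Lemma is_derive_ext (V W : normedModType R) (f : V -> W) (p v : V) (d d' : W) :
  is_derive p v f d -> d = d' -> is_derive p v f d'.
Proof. by move=> + <-. Qed.

(** On a half circle x = c + r sin f, y = r cos f one has dx / y = df, and the half-angle formula
    tan ((f - f0) / 2) = (sin f - sin f0) / (cos f + cos f0) gives the primitive. The equation x^2 +
    y^2 = x0^2 + y0^2 + m (x - x0) describes the circle without its centre and radius. *)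
Lemma is_derive_geodesic x0 y0 m x : 0 < y0 ->
  0 < x0 ^+ 2 + y0 ^+ 2 + m * (x - x0) - x ^+ 2 ->
  is_derive x 1 (fun t => 2 * atan ((t - x0) /
      (y0 + Num.sqrt (x0 ^+ 2 + y0 ^+ 2 + m * (t - x0) - t ^+ 2))))
    (Num.sqrt (x0 ^+ 2 + y0 ^+ 2 + m * (x - x0) - x ^+ 2))^-1.
Proof.
move=> y00 H.
have de : is_derive x 1 (fun t => x0 ^+ 2 + y0 ^+ 2 + m * (t - x0) - t ^+ 2)
   (m - 2 * x).
  apply: is_derive_eq; rewrite /GRing.scale /=; ring.
have ds : is_derive x 1 (fun t => Num.sqrt (x0 ^+ 2 + y0 ^+ 2 + m * (t - x0) - t ^+ 2))
   ((2 * Num.sqrt (x0 ^+ 2 + y0 ^+ 2 + m * (x - x0) - x ^+ 2))^-1 * (m - 2 * x)).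
  exact: (@is_derive1_comp _ Num.sqrt _ x _ _ (is_derive1_sqrt H) de).
set y := Num.sqrt (_ - x ^+ 2) in ds *.
have y_gt0 : 0 < y by rewrite sqrtr_gt0.
have yE : y ^+ 2 = x0 ^+ 2 + y0 ^+ 2 + m * (x - x0) - x ^+ 2 by rewrite sqr_sqrtr// ltW.
have dn : y0 + y != 0 by rewrite gt_eqF// addr_gt0.
have dd : is_derive x 1 (fun t => y0 + Num.sqrt (x0 ^+ 2 + y0 ^+ 2 + m * (t - x0) - t ^+ 2))
    ((2 * y)^-1 * (m - 2 * x)).
  by apply: (is_derive_ext (is_deriveD (is_derive_cst y0 x 1) ds)); rewrite add0r.
have di : is_derive x 1 (fun t => (y0 + Num.sqrt (x0 ^+ 2 + y0 ^+ 2 + m * (t - x0) - t ^+ 2))^-1)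
    (- (y0 + y) ^- 2 * ((2 * y)^-1 * (m - 2 * x))).
  exact: (@is_deriveV _ (fun t => y0 + Num.sqrt (x0 ^+ 2 + y0 ^+ 2 + m * (t - x0) - t ^+ 2)) x _ 1 dn dd).
have dq : is_derive x 1 (fun t => (t - x0) * (y0 + Num.sqrt (x0 ^+ 2 + y0 ^+ 2 + m * (t - x0) - t ^+ 2))^-1)
   ((x - x0) * (- (y0 + y) ^- 2 * ((2 * y)^-1 * (m - 2 * x))) + (y0 + y)^-1).
  have dx : is_derive x 1 (fun t => t - x0) 1.
    by apply: is_derive_eq; rewrite subr0.
  by apply: (is_derive_ext (is_deriveM dx di)); rewrite /GRing.scale /= /y; ring.
have da := @is_derive1_comp _ atan _ x _ _ (is_derive1_atan _) dq.
have d2 := @is_deriveZ _ _ _ _ 2 _ _ _ da.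
apply: (is_derive_ext d2).
rewrite /GRing.scale /=  -/y.
have n1 : (y0 + y) ^+ 2 + (x - x0) ^+ 2 != 0.
  by rewrite gt_eqF// ltr_pwDl ?sqr_ge0// exprn_gt0// addr_gt0.
have n2 : (x - x0) ^+ 2 + (y0 + y) ^+ 2 != 0 by rewrite addrC.
have -> : (1 + ((x - x0) * (y0 + y)^-1) ^+ 2)^-1 =
   (y0 + y) ^+ 2 / ((y0 + y) ^+ 2 + (x - x0) ^+ 2).
  by field; rewrite ?n1 ?dn ?n2.
(* The slope [m] enters only through m (x - x0), which the equation of the circle expresses by
   coordinates. *)
have : m * (x - x0) = y ^+ 2 - x0 ^+ 2 - y0 ^+ 2 + x ^+ 2 by rewrite yE; ring.
move=> E.
have yn : y != 0 by rewrite gt_eqF.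
apply: (mulfI yn); rewrite mulfV//.
have -> : y * (2 * ((y0 + y) ^+ 2 / ((y0 + y) ^+ 2 + (x - x0) ^+ 2) *
     ((x - x0) * (- (y0 + y) ^- 2 * ((2 * y)^-1 * (m - 2 * x))) + (y0 + y)^-1))) =
  (2 * y * (y0 + y) - (m * (x - x0) - 2 * x * (x - x0))) / ((y0 + y) ^+ 2 + (x - x0) ^+ 2).
  by field; rewrite n1 dn yn.
rewrite E; apply/eqP; rewrite -(inj_eq (mulIf n1)) mulfVK// mul1r; apply/eqP; ring.
Qed.

(** In the coordinates (x, s) with s = x^2 + y^2, where geodesics are straight, this is the line
    through [z] and [w]; [height] then gives the ordinate y on the geodesic above x. *)
Definition chord z w (x : R) : R := normsq z +
  (normsq w - normsq z) / (complex.Re w - complex.Re z) * (x - complex.Re z).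

Definition height z w x : R := Num.sqrt (chord z w x - x ^+ 2).

(** In the coordinates (x, s) the boundary of H is the parabola s = x^2. It is convex, so a chord
    with both ends above it stays above it. *)
Lemma chord_gt z w x : inH z -> inH w -> complex.Re z < complex.Re w ->
  complex.Re z <= x <= complex.Re w -> 0 < chord z w x - x ^+ 2.
Proof.
rewrite /inH /chord /normsq; case: z w => [x1 y1] [x2 y2] /= z0 w0 xx /andP[h1 h2].
have d0 : 0 < x2 - x1 by rewrite subr_gt0.
have -> : x1 ^+ 2 + y1 ^+ 2 + (x2 ^+ 2 + y2 ^+ 2 - (x1 ^+ 2 + y1 ^+ 2)) / (x2 - x1) * (x - x1) - x ^+ 2
  = ((x2 - x) * y1 ^+ 2 + (x - x1) * y2 ^+ 2) / (x2 - x1) + (x - x1) * (x2 - x).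
  by field; rewrite gt_eqF.
apply: ltr_pwDl; last by rewrite mulr_ge0// subr_ge0.
apply: divr_gt0 => //.
have [->|xn] := eqVneq x x1.
  by rewrite subrr mul0r addr0 mulr_gt0// ?subr_gt0// exprn_gt0.
apply: ltr_wpDl; first by rewrite mulr_ge0// ?subr_ge0// sqr_ge0.
by rewrite mulr_gt0// ?exprn_gt0// subr_gt0 lt_neqAle eq_sym xn.
Qed.

Lemma heightr z w : inH w -> complex.Re z < complex.Re w ->
  height z w (complex.Re w) = complex.Im w.
Proof.
move=> z0 zw; rewrite /height /chord mulfVK ?subr_eq0 ?gt_eqF//.
by rewrite addrCA subrr addr0 /normsq addrAC subrr add0r sqrtr_sqr gtr0_norm.
Qed.

Lemma continuous_chord z w : continuous (chord z w).
Proof.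
move=> x; rewrite /chord; apply: cvgD; first exact: cvg_cst.
by apply: cvgM; [exact: cvg_cst|apply: cvgB; [exact: cvg_id|exact: cvg_cst]].
Qed.

Lemma height_continuous z w : continuous (height z w).
Proof.
move=> x; apply: (@continuous_comp _ _ _ (fun x => chord z w x - x ^+ 2) Num.sqrt).
  apply: cvgB; first exact: continuous_chord.
  exact: (@exprn_continuous _ 2).
exact: sqrt_continuous.
Qed.

Lemma integral_height z w : inH z -> inH w -> complex.Re z <= complex.Re w ->
  (\int[mu]_(x in `[complex.Re z, complex.Re w]) ((height z w x)^-1)%:E =
   (2 * Larg z w)%:E)%E.
Proof.
move=> z0 w0; rewrite le_eqVlt => /predU1P[e|zw].
  by rewrite e set_itv1 integral_set1 /Larg e subrr mul0r atan0 mulr0.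
pose F t : R := 2 * atan ((t - complex.Re z) / (complex.Im z + height z w t)).
have dF x : complex.Re z <= x <= complex.Re w -> is_derive x 1 F (height z w x)^-1.
  move=> xb; rewrite /F /height /chord.
  by apply: is_derive_geodesic => //; exact: chord_gt.
have -> : 2 * Larg z w = F (complex.Re w) - F (complex.Re z).
  by rewrite /F subrr mul0r atan0 mulr0 subr0 heightr.
rewrite EFinB; apply: continuous_FTC2 => //.
- move=> x; apply: continuous_in_subspaceT => t.
  rewrite inE /= in_itv/= => tb; apply: continuousV; last exact: height_continuous.
  by rewrite gt_eqF// sqrtr_gt0; exact: chord_gt.
- split.
  + move=> x; rewrite in_itv/= => /andP[xa xb].
    by have [] : is_derive x 1 F (height z w x)^-1 by apply: dF; rewrite !ltW.
  + have [+ _] : is_derive (complex.Re z) 1 F (height z w (complex.Re z))^-1.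
      by apply: dF; rewrite lexx ltW.
    by move=> /derivable1_diffP/differentiable_continuous/cvg_at_right_filter.
  + have [+ _] : is_derive (complex.Re w) 1 F (height z w (complex.Re w))^-1.
      by apply: dF; rewrite lexx ltW.
    by move=> /derivable1_diffP/differentiable_continuous/cvg_at_left_filter.
- move=> x; rewrite in_itv/= => /andP[xa xb].
  by rewrite derive1E; apply: derive_val; apply: dF; rewrite !ltW.
Qed.

Lemma integral_invsq x y : 0 < x <= y ->
  (\int[mu]_(t in `[x, y]) ((t ^+ 2)^-1)%:E = (x^-1 - y^-1)%:E)%E.
Proof.
move=> /andP[x0]; rewrite le_eqVlt => /predU1P[<-|xy].
  by rewrite set_itv1 integral_set1 subrr.
pose F (t : R) : R := - t^-1.
have dF t : x <= t <= y -> is_derive t 1 F (t ^+ 2)^-1.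
  move=> /andP[xt ty]; have t0 : t != 0 by rewrite gt_eqF// (lt_le_trans x0).
  have := @is_deriveN _ _ _ _ _ _ _ (@is_deriveV _ id t 1 1 t0 (is_derive_id _ _)).
  by move=> H; apply: (is_derive_ext H); rewrite /GRing.scale /= mulr1 opprK.
have -> : x^-1 - y^-1 = F y - F x by rewrite /F opprK addrC.
rewrite EFinB; apply: continuous_FTC2 => //.
- move=> t; apply: continuous_in_subspaceT => u.
  rewrite inE /= in_itv/= => /andP[xu uy]; apply: (@cvgV _ _ _ _ (fun v : R => v ^+ 2)).
    by rewrite gt_eqF// exprn_gt0// (lt_le_trans x0).
  exact: (@exprn_continuous _ 2).
- split.
  + move=> t; rewrite in_itv/= => /andP[xa xb].
    by have [] : is_derive t 1 F (t ^+ 2)^-1 by apply: dF; rewrite !ltW.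
  + have [+ _] : is_derive x 1 F (x ^+ 2)^-1 by apply: dF; rewrite lexx ltW.
    by move=> /derivable1_diffP/differentiable_continuous/cvg_at_right_filter.
  + have [+ _] : is_derive y 1 F (y ^+ 2)^-1 by apply: dF; rewrite lexx ltW.
    by move=> /derivable1_diffP/differentiable_continuous/cvg_at_left_filter.
- move=> t; rewrite in_itv/= => /andP[xa xb].
  by rewrite derive1E; apply: derive_val; apply: dF; rewrite !ltW.
Qed.

Notation mu2 := (mu \x mu)%E.

Lemma measurable_le_set d (T : measurableType d) (f g : T -> R) :
  measurable_fun setT f -> measurable_fun setT g ->
  measurable [set p | f p <= g p].
Proof.
move=> mf mg; rewrite -[X in measurable X]setTI.
under eq_set do rewrite -lee_fin.
by apply: measurable_lee => //; exact/measurable_EFinP.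
Qed.

Lemma measurable_lt_set d (T : measurableType d) (f g : T -> R) :
  measurable_fun setT f -> measurable_fun setT g ->
  measurable [set p | f p < g p].
Proof.
move=> mf mg; rewrite -[X in measurable X]setTI.
under eq_set do rewrite -lte_fin.
by apply: measurable_lte => //; exact/measurable_EFinP.
Qed.

Lemma measurable_inv : measurable_fun setT (fun y : R => y^-1).
Proof.
have -> : [set: R] = [set 0] `|` ~` [set 0] by rewrite setUv.
apply/measurable_funU => //; first exact: measurableC.
split; first exact: measurable_fun_set1.
apply: open_continuous_measurable_fun.
  by apply: closed_openC; exact: closed_eq.
by move=> y; rewrite inE /= => /eqP y0; exact: inv_continuous.
Qed.

Definition region (a b : R) (l u : R -> R) : set (R * R) :=
  [set p | [/\ a <= p.1 <= b, 0 < p.2 & l p.1 <= p.1 ^+ 2 + p.2 ^+ 2 <= u p.1]].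

Lemma measurable_region a b l u :
  measurable_fun setT l -> measurable_fun setT u -> measurable (region a b l u).
Proof.
move=> ml mu0.
have m1 : measurable_fun [set: R * R] (fst : R * R -> R) by exact: measurable_fst.
have m2 : measurable_fun [set: R * R] (snd : R * R -> R) by exact: measurable_snd.
have ms : measurable_fun [set: R * R] (fun p : R * R => p.1 ^+ 2 + p.2 ^+ 2).
  by apply: measurable_funD; apply: measurable_funX.
have -> : region a b l u = [set p : R * R | a <= p.1] `&` [set p | p.1 <= b] `&`
  ([set p | 0 < p.2] `&` ([set p | l p.1 <= p.1 ^+ 2 + p.2 ^+ 2] `&`
   [set p | p.1 ^+ 2 + p.2 ^+ 2 <= u p.1])).
  apply/seteqP; split => p /=.
    by move=> [/andP[-> ->] -> /andP[-> ->]].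
  by move=> [[pa pb] [p0 [pl pu]]]; split => //; apply/andP; split.
apply: measurableI; [apply: measurableI|apply: measurableI; last apply: measurableI].
- exact: (@measurable_le_set _ _ (cst a) fst).
- exact: (@measurable_le_set _ _ fst (cst b)).
- exact: (@measurable_lt_set _ _ (cst 0) snd).
- apply: measurable_le_set => //.
  exact: (measurableT_comp ml m1).
- apply: measurable_le_set => //.
  exact: (measurableT_comp mu0 m1).
Qed.

(** Tonelli: the slice at x is a segment in y, over which y^-2 integrates to the difference of the
    inverse heights of its ends. Conditions are imposed on the open interval only, because a
    vertical side of a triangle lies over an end point. *)
Lemma integral_region a b l u (gl gu : R -> R) (Al Au : R) :
  measurable_fun setT l -> measurable_fun setT u ->
  (forall x, a < x < b -> x ^+ 2 < l x <= u x) ->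
  (forall x, a < x < b -> gl x = (Num.sqrt (l x - x ^+ 2))^-1) ->
  (forall x, a < x < b -> gu x = (Num.sqrt (u x - x ^+ 2))^-1) ->
  measurable_fun setT gl -> measurable_fun setT gu ->
  (\int[mu]_(x in `[a, b]) (gl x)%:E = Al%:E)%E ->
  (\int[mu]_(x in `[a, b]) (gu x)%:E = Au%:E)%E ->
  \int[mu2]_(p in region a b l u) (p.2 ^+ 2)^-1 = Al - Au.
Proof.
move=> ml mu0 lu glE guE mgl mgu intl intu.
have sect x : a < x < b ->
    (\int[mu]_(y in [set y | region a b l u (x, y)]) ((y ^+ 2)^-1)%:E =
     (gl x - gu x)%:E)%E.
  move=> xab; have /andP[xl xu] := lu _ xab.
  have l0 : 0 < l x - x ^+ 2 by rewrite subr_gt0.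
  have u0 : 0 < u x - x ^+ 2 by rewrite subr_gt0 (lt_le_trans xl).
  rewrite glE// guE// -integral_invsq; last first.
    by rewrite sqrtr_gt0 l0/= ler_sqrt// ?lerD2r// ltW.
  congr (integral _ _ _); apply/seteqP; split => y /=; rewrite /region /= in_itv/=.
    move=> [_ y0 /andP[h1 h2]]; rewrite -[y]gtr0_norm// -sqrtr_sqr !ler_sqrt ?sqr_ge0//; last exact: ltW.
    by apply/andP; split; lra.
  move=> /andP[h1 h2]; have y0 : 0 < y by rewrite (lt_le_trans _ h1)// sqrtr_gt0.
  split => //; first by case/andP: xab => h3 h4; rewrite !ltW.
  move: h1 h2; rewrite -{1 2}[y]gtr0_norm// -sqrtr_sqr !ler_sqrt ?sqr_ge0//; last exact: ltW.
  by move=> h1 h2; apply/andP; split; lra.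
rewrite /Rintegral.
have mR := @measurable_region a b l u ml mu0.
rewrite integral_mkcond fubini_tonelli1; last 2 first.
- apply/(measurable_restrictT _ mR).
  apply/measurable_EFinP.
  have m2 : measurable_fun [set: R * R] (snd : R * R -> R) by exact: measurable_snd.
  have mi : measurable_fun [set: R * R] (fun p : R * R => (p.2 ^+ 2)^-1).
    exact: (measurableT_comp measurable_inv (measurable_funX 2 m2)).
  exact: measurable_funTS.
- move=> p; rewrite patchE; case: ifPn => // _.
  by rewrite lee_fin invr_ge0 sqr_ge0.
have FE x : fubini_F mu ((fun p : R * R => ((p.2 ^+ 2)^-1)%:E) \_ (region a b l u)) x =
    (\int[mu]_(y in [set y | region a b l u (x, y)]) ((y ^+ 2)^-1)%:E)%E.
  rewrite /fubini_F [RHS]integral_mkcond; apply: eq_integral => y _ /=.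
  by rewrite !patchE /=; congr (if _ then _ else _); apply/idP/idP; rewrite !inE.
have -> : (\int[mu]_x fubini_F mu ((fun p : R * R => ((p.2 ^+ 2)^-1)%:E) \_ (region a b l u)) x =
   \int[mu]_(x in `[a, b]) fubini_F mu ((fun p : R * R => ((p.2 ^+ 2)^-1)%:E) \_ (region a b l u)) x)%E.
  rewrite [RHS]integral_mkcond; apply: eq_integral => x _.
  rewrite patchE; case: ifPn => //; rewrite notin_setE /= in_itv/= => xab.
  rewrite FE (_ : [set y | _] = set0) ?integral_set0//.
  by apply/seteqP; split => y //= [].
have mg : measurable_fun `]a, b[ (fun x => (gl x - gu x)%:E).
  apply: measurable_funTS; apply/measurable_EFinP; exact: measurable_funB.
have Fg : {in `]a, b[%classic, fubini_F mu ((fun p : R * R => ((p.2 ^+ 2)^-1)%:E) \_ (region a b l u)) =1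
    (fun x => (gl x - gu x)%:E)}.
  by move=> x; rewrite inE /= in_itv/= => xab; rewrite FE sect.
rewrite integral_itv_bndoo; last first.
  by apply: eq_measurable_fun mg => x xab; rewrite Fg.
have -> : (\int[mu]_(x in `]a, b[) fubini_F mu ((fun p : R * R => ((p.2 ^+ 2)^-1)%:E) \_ (region a b l u)) x =
   \int[mu]_(x in `]a, b[) (gl x - gu x)%:E)%E.
  by apply: eq_integral => x xab; exact: Fg.
have gint (g : R -> R) A : measurable_fun setT g -> (forall x, a < x < b -> 0 <= g x) ->
    (\int[mu]_(x in `[a, b]) (g x)%:E = A%:E)%E -> mu.-integrable `]a, b[ (EFin \o g).
  move=> mg0 g0 ig; apply/integrableP; split.
    by apply/measurable_EFinP; exact: measurable_funTS.
  rewrite (_ : (\int[mu]_(x in `]a, b[) _)%E = A%:E) ?ltry//.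
  rewrite -ig [RHS]integral_itv_bndoo; last by apply/measurable_EFinP; exact: measurable_funTS.
  apply: eq_integral => x; rewrite inE /= in_itv/= => xab.
  by rewrite ger0_norm// g0.
under eq_integral do rewrite EFinB.
rewrite integralB_EFin//; last 2 first.
- by apply: (gint _ Al) => // x xab; rewrite glE// invr_ge0 sqrtr_ge0.
- by apply: (gint _ Au) => // x xab; rewrite guE// invr_ge0 sqrtr_ge0.
rewrite -(@integral_itv_bndoo _ a b (EFin \o gl) true false); last first.
  by apply/measurable_EFinP; exact: measurable_funTS.
rewrite -(@integral_itv_bndoo _ a b (EFin \o gu) true false); last first.
  by apply/measurable_EFinP; exact: measurable_funTS.
by rewrite /= intl intu.
Qed.

Lemma measurable_chord z w : measurable_fun setT (chord z w).
Proof. by apply: continuous_measurable_fun; exact: continuous_chord. Qed.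

Lemma measurable_inv_height z w : measurable_fun setT (fun x => (height z w x)^-1).
Proof.
apply: (measurableT_comp measurable_inv).
by apply: continuous_measurable_fun; exact: height_continuous.
Qed.

(* The part of the boundary of a triangle running from z1 to z3 through z2. *)
Definition broken z1 z2 z3 (x : R) : R :=
  if x < complex.Re z2 then chord z1 z2 x else chord z2 z3 x.

Lemma broken_integral z1 z2 z3 : inH z1 -> inH z2 -> inH z3 ->
  complex.Re z1 <= complex.Re z2 <= complex.Re z3 ->
  let g x := if x < complex.Re z2 then (height z1 z2 x)^-1 else (height z2 z3 x)^-1 in
  measurable_fun setT g /\
  (\int[mu]_(x in `[complex.Re z1, complex.Re z3]) (g x)%:E =
     (2 * (Larg z1 z2 + Larg z2 z3))%:E)%E.
Proof.
move=> z10 z20 z30 /andP[h12 h23] g.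
have mg : measurable_fun setT g.
  apply: measurable_fun_ifT; [|exact: measurable_inv_height..].
  exact: measurable_fun_ltr.
split => //.
have -> : `[complex.Re z1, complex.Re z3]%classic =
   `[complex.Re z1, complex.Re z2[ `|` `[complex.Re z2, complex.Re z3].
  by rewrite -itv_bndbnd_setU// bnd_simp.
rewrite integral_setU//=; last 2 first.
- by apply: measurable_funTS; exact/measurable_EFinP.
- apply/disj_setPS => x [/=]; rewrite !in_itv/= => /andP[_ xb] /andP[xa _].
  by move: (lt_le_trans xb xa); rewrite ltxx.
rewrite mulrDr EFinD; congr (_ + _)%E.
  rewrite -integral_height// -integral_itv_bndo_bndc; last first.
    by apply: measurable_funTS; apply/measurable_EFinP; exact: measurable_inv_height.
  by apply: eq_integral => x; rewrite inE /= in_itv/= /g => /andP[_ ->].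
rewrite -integral_height//.
by apply: eq_integral => x; rewrite inE /= in_itv/= /g => /andP[xa _]; rewrite ltNge xa.
Qed.

Definition cross z1 z2 z3 : R := (complex.Re z2 - complex.Re z1) * (normsq z3 - normsq z1)
        - (complex.Re z3 - complex.Re z1) * (normsq z2 - normsq z1).

Lemma broken_gt z1 z2 z3 x : inH z1 -> inH z2 -> inH z3 ->
  complex.Re z1 <= complex.Re z2 <= complex.Re z3 ->
  complex.Re z1 < x < complex.Re z3 -> x ^+ 2 < broken z1 z2 z3 x.
Proof.
move=> z10 z20 z30 /andP[h12 h23] /andP[hx1 hx3]; rewrite /broken -subr_gt0; case: (ltP x (complex.Re z2)) => h.
  by apply: chord_gt => //; [exact: lt_trans h|rewrite !ltW].
by apply: chord_gt => //; [exact: le_lt_trans hx3|rewrite h ltW].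
Qed.

(** Plane geometry in the coordinates (x, s): a positive determinant puts the middle vertex below
    the long side, so the triangle lies between the broken line through that vertex and the long
    side. A vertical side is met only at an end of the interval, where the slope 0 produced by
    division by 0 is harmless. *)
Lemma barycentric (x1 x2 x3 s1 s2 s3 x s : R) : x1 <= x2 <= x3 -> x1 < x3 ->
  0 < (x2 - x1) * (s3 - s1) - (x3 - x1) * (s2 - s1) ->
  (exists t1 t2 t3 : R, [/\ [/\ 0 <= t1, 0 <= t2 & 0 <= t3], t1 + t2 + t3 = 1,
     x = t1 * x1 + t2 * x2 + t3 * x3 & s = t1 * s1 + t2 * s2 + t3 * s3]) <->
  (x1 <= x <= x3 /\
   (if x < x2 then s1 + (s2 - s1) / (x2 - x1) * (x - x1)
    else s2 + (s3 - s2) / (x3 - x2) * (x - x2)) <= s <=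
    s1 + (s3 - s1) / (x3 - x1) * (x - x1)).
Proof.
move=> /andP[h12 h23] h13 D0; set D := _ - _ in D0.
have d13 : 0 < x3 - x1 by rewrite subr_gt0.
split.
  move=> [t1 [t2 [t3 [[t10 t20 t30] te xe se]]]].
  have t1E : t1 = 1 - t2 - t3 by lra.
  split; first by apply/andP; split; rewrite xe t1E; nra.
  apply/andP; split.
    case: ltP => h.
      have d12 : 0 < x2 - x1.
        rewrite subr_gt0 lt_neqAle h12 andbT; apply/eqP => e.
        by move: h; rewrite xe -e t1E; nra.
      rewrite -subr_ge0 (_ : _ - _ = t3 * D / (x2 - x1)); last first.
        by rewrite xe se t1E /D; field; rewrite gt_eqF.
      by rewrite divr_ge0// ?mulr_ge0// ltW.
    have [e|n] := eqVneq x2 x3.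
      rewrite e subrr invr0 mulr0 mul0r addr0.
      have t1x : t1 * (x3 - x1) = 0.
        by apply: le_anti; rewrite mulr_ge0 ?(ltW d13)// andbT; move: h; rewrite xe e t1E; nra.
      have t10' : t1 = 0 by move/eqP: t1x; rewrite mulf_eq0 (gt_eqF d13) orbF => /eqP.
      have : 0 < s3 - s2.
        by rewrite -(pmulr_rgt0 _ d13); move: D0; rewrite /D e; congr (_ < _); ring.
      by move=> h32; rewrite se t10' (_ : t2 = 1 - t3); [nra|lra].
    have d23 : 0 < x3 - x2 by rewrite subr_gt0 lt_neqAle n.
    rewrite -subr_ge0 (_ : _ - _ = t1 * D / (x3 - x2)); last first.
      by rewrite xe se /D (_ : t3 = 1 - t1 - t2); [field; rewrite gt_eqF|lra].
    by rewrite divr_ge0// ?mulr_ge0// ltW.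
  rewrite -subr_ge0 (_ : _ - _ = t2 * D / (x3 - x1)); last first.
    by rewrite xe se t1E /D; field; rewrite gt_eqF.
  by rewrite divr_ge0// ?mulr_ge0// ltW.
move=> [/andP[hx1 hx3] /andP[hl hu]].
(* Twice the signed areas spanned by the point and each side. They add up to [D], and their
   quotients by [D] are the barycentric coordinates. *)
pose C12 := (x2 - x1) * (s - s1) - (x - x1) * (s2 - s1).
pose C23 := (x3 - x2) * (s - s2) - (x - x2) * (s3 - s2).
pose C31 := (x1 - x3) * (s - s3) - (x - x3) * (s1 - s3).
have C31_ge0 : 0 <= C31.
  move: hu; rewrite -subr_ge0 (_ : _ - s = C31 / (x3 - x1)).
    by rewrite pmulr_lge0// invr_gt0.
  by rewrite /C31; field; rewrite gt_eqF.
have CE : C12 + C23 + C31 = D by rewrite /C12 /C23 /C31 /D; ring.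
have E1 : (x2 - x1) * C23 = (x3 - x2) * C12 + (x2 - x) * D.
  by rewrite /C12 /C23 /D; ring.
suff [c1 c2] : 0 <= C12 /\ 0 <= C23.
  exists (C23 / D), (C31 / D), (C12 / D).
  have Dn : D != 0 by rewrite gt_eqF.
  split.
  - by split; rewrite divr_ge0// ltW.
  - by rewrite -!mulrDl (_ : C23 + C31 + C12 = D) ?divff// -CE; ring.
  - by move: Dn; rewrite /C12 /C23 /C31 /D => Dn; field.
  - by move: Dn; rewrite /C12 /C23 /C31 /D => Dn; field.
move: hl; case: ltP => h hl.
  have d12 : 0 < x2 - x1 by rewrite subr_gt0 (le_lt_trans hx1).
  have c12 : 0 <= C12.
    move: hl; rewrite -subr_ge0 (_ : s - _ = C12 / (x2 - x1)).
      by rewrite pmulr_lge0// invr_gt0.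
    by rewrite /C12; field; rewrite gt_eqF.
  split => //; rewrite -(pmulr_rge0 _ d12) E1.
  apply: addr_ge0; apply: mulr_ge0 => //; [by rewrite subr_ge0|by rewrite subr_ge0 ltW|exact: ltW].
have [e|n] := eqVneq x2 x3.
  have xe : x = x3 by apply/eqP; rewrite eq_le hx3 -e h.
  have C23E : C23 = 0 by rewrite /C23 xe e !subrr !mul0r subrr.
  split; last by rewrite C23E.
  have E2 : s <= s3.
    by move: hu; rewrite xe mulfVK ?gt_eqF//; lra.
  move: hl; rewrite e subrr invr0 mulr0 mul0r addr0 => E3.
  rewrite /C12 e xe -mulrBr; apply: mulr_ge0; first exact: ltW.
  lra.
have d23 : 0 < x3 - x2 by rewrite subr_gt0 lt_neqAle n.
have c23 : 0 <= C23.
  move: hl; rewrite -subr_ge0 (_ : s - _ = C23 / (x3 - x2)).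
    by rewrite pmulr_lge0// invr_gt0.
  by rewrite /C23; field; rewrite gt_eqF.
split => //; rewrite -(pmulr_rge0 _ d23).
rewrite (_ : _ * _ = (x2 - x1) * C23 + (x - x2) * D); last by rewrite E1; ring.
apply: addr_ge0; apply: mulr_ge0 => //; [by rewrite subr_ge0|by rewrite subr_ge0|exact: ltW].
Qed.

Lemma triangle_region_pos z1 z2 z3 :
  complex.Re z1 <= complex.Re z2 <= complex.Re z3 -> complex.Re z1 < complex.Re z3 ->
  0 < cross z1 z2 z3 ->
  triangle z1 z2 z3 =
  region (complex.Re z1) (complex.Re z3) (broken z1 z2 z3) (chord z1 z3).
Proof.
move=> h12 h13 D0; apply/seteqP; split => -[x y] /=; rewrite /region /triangle /broken /chord /=.
  move=> [y0 H]; have [xb sb] := (barycentric x (x ^+ 2 + y ^+ 2) h12 h13 D0).1 H.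
  by [].
move=> [xb y0 sb]; split => //.
exact: (barycentric x (x ^+ 2 + y ^+ 2) h12 h13 D0).2.
Qed.

(* Negating the ordinate s exchanges the two orientations. *)
Lemma triangle_region_neg z1 z2 z3 :
  complex.Re z1 <= complex.Re z2 <= complex.Re z3 -> complex.Re z1 < complex.Re z3 ->
  cross z1 z2 z3 < 0 ->
  triangle z1 z2 z3 =
  region (complex.Re z1) (complex.Re z3) (chord z1 z3) (broken z1 z2 z3).
Proof.
move=> h12 h13 D0.
have D1 : 0 < (complex.Re z2 - complex.Re z1) * (- normsq z3 - - normsq z1)
        - (complex.Re z3 - complex.Re z1) * (- normsq z2 - - normsq z1).
  by move: D0; rewrite /cross -oppr_gt0; congr (_ < _); ring.
apply/seteqP; split => -[x y] /=; rewrite /region /triangle /broken /chord /=.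
  move=> [y0 [t1 [t2 [t3 [t0 te xe se]]]]]; split => //.
    have [|//] := (barycentric x (- (x ^+ 2 + y ^+ 2)) h12 h13 D1).1 _.
    by exists t1, t2, t3; split => //; rewrite se; ring.
  have [|_] := (barycentric x (- (x ^+ 2 + y ^+ 2)) h12 h13 D1).1 _.
    by exists t1, t2, t3; split => //; rewrite se; ring.
  by case: ltP => _ /andP[ha hb]; apply/andP; split; lra.
move=> [xb y0 sb]; split => //.
have [|t1 [t2 [t3 [t0 te xe se]]]] := (barycentric x (- (x ^+ 2 + y ^+ 2)) h12 h13 D1).2.
  by split => //; move: sb; case: ltP => _ /andP[ha hb]; apply/andP; split; lra.
by exists t1, t2, t3; split => //; lra.
Qed.

Lemma signed_area_sorted z1 z2 z3 : inH z1 -> inH z2 -> inH z3 ->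
  complex.Re z1 <= complex.Re z2 <= complex.Re z3 ->
  signed_area z1 z2 z3 = - 2 * (Larg z1 z2 + Larg z2 z3 + Larg z3 z1).
Proof.
move=> z10 z20 z30 h123.
have [h12 h23] := andP h123.
have [e|n] := eqVneq (complex.Re z1) (complex.Re z3).
  have e2 : complex.Re z2 = complex.Re z1 by lra.
  rewrite /signed_area /orientation e2 -e !subrr !mul0r subrr sgr0 oppr0 mul0r.
  by rewrite /Larg e2 -e !subrr !mul0r atan0 !addr0 mulr0.
have h13 : complex.Re z1 < complex.Re z3 by rewrite lt_neqAle n (le_trans h12).
have [mg ig] := broken_integral z10 z20 z30 h123.
set g := fun x => _ in mg ig.
have gE x : g x = (Num.sqrt (broken z1 z2 z3 x - x ^+ 2))^-1.
  by rewrite /g /broken /height; case: ifP.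
have mb : measurable_fun setT (broken z1 z2 z3).
  apply: measurable_fun_ifT; [|exact: measurable_chord..].
  exact: measurable_fun_ltr.
have mc := @measurable_chord z1 z3.
have mh := @measurable_inv_height z1 z3.
have ih := integral_height z10 z30 (ltW h13).
have bgt x : complex.Re z1 < x < complex.Re z3 -> x ^+ 2 < broken z1 z2 z3 x.
  exact: broken_gt.
have cgt x : complex.Re z1 < x < complex.Re z3 -> x ^+ 2 < chord z1 z3 x.
  by move=> /andP[xa xb]; rewrite -subr_gt0; apply: chord_gt => //; rewrite !ltW.
rewrite [Larg z3 z1]LargC /signed_area /orientation -/(cross z1 z2 z3).
(* The gap between the long side and the broken line is the determinant times a nonnegative factor,
   so the orientation decides which of the two is on top. *)
have cb x : complex.Re z1 <= x <= complex.Re z3 ->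
    (0 <= cross z1 z2 z3 -> broken z1 z2 z3 x <= chord z1 z3 x) /\
    (cross z1 z2 z3 <= 0 -> chord z1 z3 x <= broken z1 z2 z3 x).
  move=> /andP[xa xb].
  suff [q q0 qE] : exists2 q, 0 <= q & chord z1 z3 x - broken z1 z2 z3 x = cross z1 z2 z3 * q.
    split => D0; first by rewrite -subr_ge0 qE mulr_ge0.
    by rewrite -subr_le0 qE mulr_le0_ge0.
  rewrite /broken /chord.
  have d13 : 0 < complex.Re z3 - complex.Re z1 by rewrite subr_gt0.
  case: (ltP x (complex.Re z2)) => h.
    have d12 : 0 < complex.Re z2 - complex.Re z1 by rewrite subr_gt0 (le_lt_trans xa).
    exists ((x - complex.Re z1) /
        ((complex.Re z2 - complex.Re z1) * (complex.Re z3 - complex.Re z1))).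
      by rewrite divr_ge0 ?subr_ge0// mulr_ge0// ltW.
    by rewrite /cross; field; rewrite !gt_eqF.
  have [e|n'] := eqVneq (complex.Re z2) (complex.Re z3).
    have xe : x = complex.Re z3 by apply: le_anti; rewrite xb -e.
    exists ((complex.Re z3 - complex.Re z1)^-1); first by rewrite invr_ge0 ltW.
    by rewrite /cross xe e subrr mulr0 addr0; field; rewrite !gt_eqF.
  have d23 : 0 < complex.Re z3 - complex.Re z2 by rewrite subr_gt0 lt_neqAle n'.
  exists ((complex.Re z3 - x) /
        ((complex.Re z3 - complex.Re z2) * (complex.Re z3 - complex.Re z1))).
    by rewrite divr_ge0 ?subr_ge0// mulr_ge0// ltW.
  by rewrite /cross; field; rewrite !gt_eqF.
case: (sgrP (cross z1 z2 z3)) => [D0|D0|D0].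
(* Collinear points: the area is 0 through [orientation], and the boundary integrals agree because
   the broken line is the long side. *)
- rewrite oppr0 mul0r.
  suff : (2 * (Larg z1 z2 + Larg z2 z3))%:E = (2 * Larg z1 z3)%:E :> \bar R by case; lra.
  rewrite -ig -ih; apply: eq_integral => x; rewrite inE /= in_itv/= => xb.
  rewrite -/(g x) gE /height (_ : broken z1 z2 z3 x = chord z1 z3 x)//.
  by have [c1 c2] := cb x xb; apply: le_anti; rewrite c1 ?c2 ?D0.
- rewrite triangle_region_pos//.
  rewrite (@integral_region _ _ _ _ g (fun x => (height z1 z3 x)^-1)
    (2 * (Larg z1 z2 + Larg z2 z3)) (2 * Larg z1 z3))//; first by ring.
  by move=> x xb; rewrite bgt//=; apply: (cb x _).1; rewrite ?(ltW D0)//; case/andP: xb => *; rewrite !ltW.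
- rewrite triangle_region_neg//.
  rewrite (@integral_region _ _ _ _ (fun x => (height z1 z3 x)^-1) g
    (2 * Larg z1 z3) (2 * (Larg z1 z2 + Larg z2 z3)))//; first by ring.
  by move=> x xb; rewrite cgt//=; apply: (cb x _).2; rewrite ?(ltW D0)//; case/andP: xb => *; rewrite !ltW.
Qed.

Lemma triangle_swap z1 z2 z3 : triangle z2 z1 z3 = triangle z1 z2 z3.
Proof.
apply/seteqP; split => p [p0 [t1 [t2 [t3 [[a b c] h1 h2 h3]]]]]; split => //;
  by exists t2, t1, t3; split => //; lra.
Qed.

Lemma triangle_rot z1 z2 z3 : triangle z2 z3 z1 = triangle z1 z2 z3.
Proof.
apply/seteqP; split => p [p0 [t1 [t2 [t3 [[a b c] h1 h2 h3]]]]]; split => //.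
  by exists t3, t1, t2; split => //; lra.
by exists t2, t3, t1; split => //; lra.
Qed.

Lemma signed_area_swap z1 z2 z3 : signed_area z2 z1 z3 = - signed_area z1 z2 z3.
Proof.
rewrite /signed_area triangle_swap -mulNr; congr (_ * _).
by rewrite /orientation -[LHS]sgrN -[in RHS]sgrN -sgrN; congr (Num.sg _); ring.
Qed.

Lemma signed_area_rot z1 z2 z3 : signed_area z2 z3 z1 = signed_area z1 z2 z3.
Proof.
rewrite /signed_area triangle_rot; congr (- _ * _).
by rewrite /orientation; congr (Num.sg _); ring.
Qed.

(** Stokes for dx dy / y^2 = d(dx / y). Both sides are alternating in the vertices, which reduces
    the claim to vertices sorted by real part; the sign appears because clockwise triangles count as
    positive. *)
Theorem signed_areaE z1 z2 z3 : inH z1 -> inH z2 -> inH z3 ->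
  signed_area z1 z2 z3 = - 2 * (Larg z1 z2 + Larg z2 z3 + Larg z3 z1).
Proof.
wlog h12 : z1 z2 z3 / complex.Re z1 <= complex.Re z2 => [H|] z10 z20 z30.
  have [h|/ltW h] := leP (complex.Re z1) (complex.Re z2); first exact: H.
  rewrite -[LHS]opprK -signed_area_swap H//.
  by rewrite [Larg z2 z1]LargC [Larg z1 z3]LargC [Larg z3 z2]LargC; ring.
have [h23|/ltW h23] := leP (complex.Re z2) (complex.Re z3).
  by apply: signed_area_sorted => //; rewrite h12.
have [h13|/ltW h13] := leP (complex.Re z1) (complex.Re z3).
  rewrite -signed_area_rot -[LHS]opprK -signed_area_swap -signed_area_rot signed_area_rot.
  rewrite -signed_area_rot -signed_area_rot signed_area_sorted//; last by rewrite h13.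
  by rewrite [Larg z1 z3]LargC [Larg z3 z2]LargC [Larg z2 z1]LargC; ring.
rewrite -signed_area_rot -signed_area_rot signed_area_sorted//; last by rewrite h13.
ring.
Qed.

End Area.

(** * Rotations of the upper half-plane *)

Section Mx2.
Context {R : realType}.
Implicit Types (A B : 'M[R]_2) (z w : R[i]).

Definition mx2 (a b c d : R) : 'M[R]_2 :=
  \matrix_(i < 2, j < 2) if i == 0 then (if j == 0 then a else b)
                         else (if j == 0 then c else d).

Lemma mx2E a b c d : ((mx2 a b c d 0 0 = a) * (mx2 a b c d 0 1 = b) *
  (mx2 a b c d 1 0 = c) * (mx2 a b c d 1 1 = d))%type.
Proof. by rewrite /mx2 !mxE. Qed.

Lemma mx2_eq A B : A 0 0 = B 0 0 -> A 0 1 = B 0 1 -> A 1 0 = B 1 0 ->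
  A 1 1 = B 1 1 -> A = B.
Proof.
move=> h00 h01 h10 h11; apply/matrixP => i j.
have P (k : 'I_2) : k = 0 \/ k = 1.
  by case: k => -[|[|//]] Hk; [left|right]; apply/val_inj.
by case: (P i) => ->; case: (P j) => ->.
Qed.

Lemma ord2_lift : lift ord0 ord0 = 1 :> 'I_2.
Proof. exact/val_inj. Qed.

Lemma mulmx2E A B i j : (A * B) i j = A i 0 * B 0 j + A i 1 * B 1 j.
Proof.
rewrite -[A * B]/(A *m B) mxE big_ord_recl big_ord_recl big_ord0 addr0.
by rewrite ord2_lift.
Qed.

Lemma addmx2E A B i j : (A + B) i j = A i j + B i j.
Proof. by rewrite mxE. Qed.

Lemma oppmx2E A i j : (- A) i j = - A i j.
Proof. by rewrite mxE. Qed.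

Lemma scalemx2E a A i j : (a *: A) i j = a * A i j.
Proof. by rewrite mxE. Qed.

Lemma onemx2E : (((1 : 'M[R]_2) 0 0 = 1) * ((1 : 'M[R]_2) 0 1 = 0) *
  ((1 : 'M[R]_2) 1 0 = 0) * ((1 : 'M[R]_2) 1 1 = 1))%type.
Proof. by rewrite -[1 : 'M[R]_2]/(1%:M) !mxE. Qed.

Lemma zeromx2E i j : (0 : 'M[R]_2) i j = 0.
Proof. by rewrite mxE. Qed.

Definition mxE2 := (mulmx2E, addmx2E, oppmx2E, scalemx2E, onemx2E, zeromx2E, mx2E).

Lemma trmx2E A : \tr A = A 0 0 + A 1 1.
Proof.
by rewrite /mxtrace big_ord_recl big_ord_recl big_ord0 addr0 ord2_lift.
Qed.

Lemma detmx2E A : \det A = A 0 0 * A 1 1 - A 0 1 * A 1 0.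
Proof.
rewrite (expand_det_row _ ord0) big_ord_recl big_ord_recl big_ord0 addr0.
rewrite /cofactor !det_mx11 !mxE /= addn0 add0n expr0 expr1 mul1r mulN1r mulrN.
have -> : lift (lift ord0 ord0) 0 = 0 :> 'I_2 by exact/val_inj.
by rewrite !ord2_lift.
Qed.

Lemma detM2 A B : \det (A * B) = \det A * \det B.
Proof. by rewrite -[A * B]/(A *m B) det_mulmx. Qed.

Lemma det1_2 : \det (1 : 'M[R]_2) = 1.
Proof. exact: det1. Qed.

Lemma detN2 A : \det (- A) = \det A.
Proof. by rewrite !detmx2E !mxE2; ring. Qed.

Lemma unit_det1 A : \det A = 1 -> A \is a GRing.unit.
Proof. by move=> d; rewrite -[_ \is a _]/(A \in unitmx) unitmxE d unitr1. Qed.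

Lemma invmx2 A : \det A = 1 -> A^-1 = mx2 (A 1 1) (- A 0 1) (- A 1 0) (A 0 0).
Proof.
move=> d; apply: (mulrI (unit_det1 d)); rewrite divrr ?unit_det1//.
move: d; rewrite detmx2E => d.
by apply: mx2_eq; rewrite !mxE2; lra.
Qed.

Lemma det_inv1 A : \det A = 1 -> \det A^-1 = 1.
Proof. by move=> d; rewrite invmx2// -d !detmx2E !mxE2; ring. Qed.

Lemma mulVmx2 A : \det A = 1 -> A^-1 * A = 1.
Proof. by move=> d; rewrite mulVr// unit_det1. Qed.

Lemma mulmxV2 A : \det A = 1 -> A * A^-1 = 1.
Proof. by move=> d; rewrite divrr// unit_det1. Qed.

Lemma mxtraceM A B : \tr (A * B) = \tr (B * A).
Proof. exact: mxtrace_mulC. Qed.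

(** The point z of H corresponds to the matrix Jm z, of square -1, generating
    the rotations about z. *)
Definition Jm z : 'M[R]_2 :=
  mx2 (complex.Re z / complex.Im z) (- normsq z / complex.Im z)
      (complex.Im z)^-1 (- complex.Re z / complex.Im z).

(** In PSL(2,R) this is the anti-clockwise rotation by -2h about [z]: there cz + d = e^(ih), and the
    derivative is its power -2. *)
Definition rotm (h : R) z : 'M[R]_2 := cos h *: 1 + sin h *: Jm z.

Lemma Jm_sqr z : inH z -> Jm z * Jm z = - 1.
Proof.
rewrite /inH => z0; apply: mx2_eq; rewrite !mxE2 /normsq; field; rewrite gt_eqF//.
Qed.

Lemma trJm z : \tr (Jm z) = 0.
Proof. by rewrite trmx2E !mxE2 mulNr subrr. Qed.

Lemma det_rotm h z : inH z -> \det (rotm h z) = 1.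
Proof.
rewrite /inH => z0; rewrite detmx2E !mxE2 /normsq.
by rewrite -[RHS](cos2Dsin2 h); field; rewrite gt_eqF.
Qed.

Lemma tr_rotm h z : \tr (rotm h z) = 2 * cos h.
Proof. by rewrite trmx2E !mxE2; ring. Qed.

Lemma Jm_inj z w : inH z -> inH w -> Jm z = Jm w -> z = w.
Proof.
rewrite /inH; case: z w => [x y] [x' y'] /= y0 y0' e.
have e2 : y^-1 = y'^-1 by have := congr1 (fun A : 'M[R]_2 => A 1 0) e; rewrite !mxE2.
have e1 : x / y = x' / y' by have := congr1 (fun A : 'M[R]_2 => A 0 0) e; rewrite !mxE2.
have yy : y = y' by apply: invr_inj.
move: e1; rewrite yy => /mulIf -> //.
by rewrite invr_eq0 gt_eqF.
Qed.

Lemma eq_cplx z w : complex.Re z = complex.Re w -> complex.Im z = complex.Im w -> z = w.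
Proof. by case: z w => [x y] [x' y'] /= -> ->. Qed.

(** The squared modulus of cz + d, the common denominator in the coordinates of [mobius A z]. *)
Definition jden A z : R := (A 1 0 * complex.Re z + A 1 1) ^+ 2 + (A 1 0 * complex.Im z) ^+ 2.

Lemma jden_gt0 A z : \det A = 1 -> inH z -> 0 < jden A z.
Proof.
rewrite /inH /jden detmx2E => d z0.
have [c0|c0] := eqVneq (A 1 0) 0.
  rewrite c0 !mul0r add0r expr0n addr0 exprn_even_gt0//=.
  by apply/eqP => e; move: d; rewrite c0 e !mulr0 subrr => /eqP; rewrite eq_sym oner_eq0.
by rewrite ltr_wpDl ?sqr_ge0// exprn_even_gt0//= mulf_neq0// gt_eqF.
Qed.

Lemma jden_neq0 A z : \det A = 1 -> inH z -> (A 1 0)%:C * z + (A 1 1)%:C != 0.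
Proof.
move=> d z0; have := jden_gt0 d z0; case: z z0 => x y z0; rewrite /jden /=.
apply: contraTneq => /eqP; rewrite eq_complex /= => /andP[/eqP e1 /eqP e2].
rewrite ?mul0r ?subr0 ?addr0 in e1 e2.
by rewrite e1 e2 expr0n addr0 ltxx.
Qed.

Lemma mobiusE A z : \det A = 1 -> inH z -> mobius A z =
  (((A 0 0 * complex.Re z + A 0 1) * (A 1 0 * complex.Re z + A 1 1)
     + A 0 0 * A 1 0 * complex.Im z ^+ 2) / jden A z) +i* (complex.Im z / jden A z).
Proof.
move=> d z0; have n0 := jden_neq0 d z0; have j0 := jden_gt0 d z0.
rewrite /mobius; apply: (mulIf n0); rewrite divfK//.
move: d; rewrite detmx2E => d.
case: z z0 n0 j0 => x y z0 n0; rewrite /jden /= => j0.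
have dE : A 0 1 * A 1 0 = A 0 0 * A 1 1 - 1 by lra.
apply/eqP; rewrite eq_complex /=; rewrite ?mul0r ?subr0 ?addr0 ?add0r.
set n := _ + (A 1 0 * y) ^+ 2 in j0 *.
have nn : n != 0 by rewrite gt_eqF.
apply/andP; split; apply/eqP; apply: (mulIf nn).
  rewrite (_ : (_ - _) * n = ((A 0 0 * x + A 0 1) * (A 1 0 * x + A 1 1) + A 0 0 * A 1 0 * y ^+ 2) *
    (A 1 0 * x + A 1 1) - y * (A 1 0 * y)); last by field.
  apply/eqP; rewrite -subr_eq0 /n (_ : _ - _ = A 1 0 * y ^+ 2 *
    (1 - (A 0 0 * A 1 1 - A 0 1 * A 1 0))); last by ring.
  by rewrite d subrr mulr0.
rewrite (_ : (_ + _) * n = ((A 0 0 * x + A 0 1) * (A 1 0 * x + A 1 1) + A 0 0 * A 1 0 * y ^+ 2) *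
    (A 1 0 * y) + y * (A 1 0 * x + A 1 1)); last by field.
apply/eqP; rewrite -subr_eq0 /n (_ : _ - _ = y * (A 1 0 * x + A 1 1) *
    ((A 0 0 * A 1 1 - A 0 1 * A 1 0) - 1)); last by ring.
by rewrite d subrr mulr0.
Qed.

Lemma mobius_inH A z : \det A = 1 -> inH z -> inH (mobius A z).
Proof.
by move=> d z0; rewrite /inH mobiusE//= divr_gt0// jden_gt0.
Qed.

(** Equivariance of [Jm]. It turns fixed point questions into commutation in the matrix ring, where
    associativity replaces computation with fractions. *)
Lemma mobius_Jm A z : \det A = 1 -> inH z -> A * Jm z = Jm (mobius A z) * A.
Proof.
move=> d z0; have j0 := jden_gt0 d z0; rewrite mobiusE//.
move: d; rewrite detmx2E => d; move: j0 z0; rewrite /jden /inH.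
case: z => x y /= j0 z0.
have jn : (A 1 0 * x + A 1 1) ^+ 2 + (A 1 0 * y) ^+ 2 != 0 by rewrite gt_eqF.
have yn : y != 0 by rewrite gt_eqF.
have [cn|cn] := eqVneq (A 1 0) 0.
  have an : A 1 1 != 0.
    by apply/eqP => e; move: d; rewrite cn e !mulr0 subrr => /eqP; rewrite eq_sym oner_eq0.
  have aE : A 0 0 = (A 1 1)^-1 by apply: (mulIf an); rewrite mulVf//; move: d; rewrite cn; lra.
  by apply: mx2_eq; rewrite !mxE2 /normsq /= ?cn ?aE; field; rewrite ?yn ?an ?expf_neq0.
have bE : A 0 1 = (A 0 0 * A 1 1 - 1) / A 1 0 by apply: (mulIf cn); rewrite divfK//; lra.
by apply: mx2_eq; rewrite !mxE2 /normsq /= ?bE; field; rewrite ?yn ?jn ?cn.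
Qed.

Lemma mobius_eq A z w : \det A = 1 -> inH z -> inH w ->
  mobius A z = w <-> A * Jm z = Jm w * A.
Proof.
move=> d z0 w0; split => [<-|]; first exact: mobius_Jm.
rewrite mobius_Jm// => e; apply: Jm_inj => //; first exact: mobius_inH.
exact: (mulIr (unit_det1 d)).
Qed.

Lemma mobiusM A B z : \det A = 1 -> \det B = 1 -> inH z ->
  mobius (A * B) z = mobius A (mobius B z).
Proof.
move=> dA dB z0; apply/mobius_eq => //; first by rewrite detM2 dA dB mulr1.
  by do !apply: mobius_inH => //.
by rewrite -mulrA mobius_Jm// mulrA mobius_Jm ?mulrA//; exact: mobius_inH.
Qed.

Lemma mobius1 z : inH z -> mobius 1 z = z.
Proof. by move=> z0; apply/mobius_eq => //; rewrite ?det1_2// mul1r mulr1. Qed.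

Lemma mobiusN A z : mobius (- A) z = mobius A z.
Proof.
rewrite /mobius !mxE2 !rmorphN !mulNr -!opprD invrN mulrNN.
by [].
Qed.

Lemma mobiusK A z : \det A = 1 -> inH z -> mobius A^-1 (mobius A z) = z.
Proof. by move=> d z0; rewrite -mobiusM ?det_inv1// mulVmx2// mobius1. Qed.

Lemma mobiusVK A z : \det A = 1 -> inH z -> mobius A (mobius A^-1 z) = z.
Proof. by move=> d z0; rewrite -mobiusM ?det_inv1// mulmxV2// mobius1. Qed.

Lemma rotm_conj A h z : \det A = 1 -> inH z ->
  A * rotm h z * A^-1 = rotm h (mobius A z).
Proof.
move=> d z0; apply: (mulIr (unit_det1 d)); rewrite divrK ?unit_det1//.
rewrite /rotm mulrDr mulrDl -!scalerAr -!scalerAl mulr1 mul1r mobius_Jm//.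
Qed.

Lemma comm_Jm A z : inH z -> A * Jm z = Jm z * A <->
  A 0 1 = - normsq z * A 1 0 /\ A 0 0 - A 1 1 = 2 * complex.Re z * A 1 0.
Proof.
rewrite /inH /normsq; case: z => x y /= y0; have yn : y != 0 by rewrite gt_eqF.
split.
  move=> e.
  have e1 := congr1 (fun A : 'M[R]_2 => A 0 0 * y) e.
  have e2 := congr1 (fun A : 'M[R]_2 => A 1 0 * y) e.
  move: e1 e2; rewrite !mxE2 /normsq /= !mulrDl.
  have -> : A 0 0 * (x / y) * y = A 0 0 * x by field.
  have -> : A 0 1 / y * y = A 0 1 by field.
  have -> : x / y * A 0 0 * y = x * A 0 0 by field.
  have -> : - (x ^+ 2 + y ^+ 2) / y * A 1 0 * y = - (x ^+ 2 + y ^+ 2) * A 1 0 by field.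
  have -> : A 1 0 * (x / y) * y = A 1 0 * x by field.
  have -> : A 1 1 / y * y = A 1 1 by field.
  have -> : y^-1 * A 0 0 * y = A 0 0 by field.
  have -> : - x / y * A 1 0 * y = - x * A 1 0 by field.
  by move=> e1 e2; split; lra.
move=> [e1 e2]; have e3 : A 0 0 = A 1 1 + 2 * x * A 1 0 by lra.
by apply: mx2_eq; rewrite !mxE2 /normsq /= ?e1 ?e3; field.
Qed.

(** The root in H of c z^2 + (d - a) z - b = 0, written out in the entries. Unlike [fixpt], which is
    defined by choice, these formulas can be differentiated. *)
Definition fix_re A : R := (A 0 0 - A 1 1) / (2 * A 1 0).
Definition fix_im A : R := Num.sqrt ((4 - (\tr A) ^+ 2) / (4 * A 1 0 ^+ 2)).
(** An arc cotangent of tr A / (2 c y), where c y is the imaginary part of cz + d at the fixed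
    point. Numerator and denominator change sign with [A], so this is a function on PSL(2,R); the
    lift with c > 0 is then [rotm (hang A)] about the fixed point. *)
Definition hang A : R := pi / 2 - atan (\tr A / (2 * (A 1 0 * fix_im A))).

Lemma ell_c A : \det A = 1 -> (\tr A) ^+ 2 < 4 -> A 1 0 != 0.
Proof.
rewrite detmx2E trmx2E => d t; apply/eqP => c0.
have := sqr_ge0 (A 0 0 - A 1 1); rewrite leNgt => /negP; apply.
rewrite (_ : _ ^+ 2 = (A 0 0 + A 1 1) ^+ 2 - 4 * (A 0 0 * A 1 1 - A 0 1 * A 1 0)).
  by rewrite d mulr1 subr_lt0.
by rewrite c0; ring.
Qed.

Lemma fix_im_gt0 A : \det A = 1 -> (\tr A) ^+ 2 < 4 -> 0 < fix_im A.
Proof.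
move=> d t; rewrite sqrtr_gt0 divr_gt0 ?subr_gt0//.
by rewrite mulr_gt0// exprn_even_gt0//= ell_c.
Qed.

Lemma fix_im_sqr A : \det A = 1 -> (\tr A) ^+ 2 < 4 ->
  (A 1 0 * fix_im A) ^+ 2 = 1 - (\tr A) ^+ 2 / 4.
Proof.
move=> d t; rewrite exprMn sqr_sqrtr; last first.
  by rewrite divr_ge0// ?subr_ge0 ?(ltW t)// mulr_ge0// sqr_ge0.
by field; rewrite ell_c.
Qed.

Lemma fix_comm A : \det A = 1 -> (\tr A) ^+ 2 < 4 ->
  A * Jm (fix_re A +i* fix_im A) = Jm (fix_re A +i* fix_im A) * A.
Proof.
move=> d t; apply/comm_Jm; first exact: fix_im_gt0.
have cn := ell_c d t; split; last by rewrite /= /fix_re; field.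
rewrite /normsq /=; apply: (mulIf cn).
rewrite (_ : _ * _ * _ = - ((fix_re A * A 1 0) ^+ 2 + (A 1 0 * fix_im A) ^+ 2)); last by ring.
rewrite fix_im_sqr//.
have -> : fix_re A * A 1 0 = (A 0 0 - A 1 1) / 2 by rewrite /fix_re; field.
by move: d; rewrite trmx2E detmx2E; lra.
Qed.

Lemma fixed_uniq A z w : A 1 0 != 0 -> inH z -> inH w ->
  A * Jm z = Jm z * A -> A * Jm w = Jm w * A -> z = w.
Proof.
move=> c0 z0 w0 /(comm_Jm _ z0)[h1 h2] /(comm_Jm _ w0)[h3 h4].
have n : normsq z = normsq w.
  by apply: oppr_inj; apply: (mulIf c0); rewrite -h1.
have x : complex.Re z = complex.Re w.
  apply: (mulfI (_ : 2 != 0 :> R)) => //.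
  by apply: (mulIf c0); rewrite -h2.
apply: eq_cplx => //.
move: n; rewrite /normsq x => /addrI /eqP; rewrite eqf_sqr => /orP[/eqP//|/eqP e].
by move: z0 w0; rewrite /inH e oppr_gt0 => h /ltW; rewrite leNgt h.
Qed.

Lemma fixpt_uniq A z : \det A = 1 -> A 1 0 != 0 -> inH z -> A * Jm z = Jm z * A ->
  fixpt A = z.
Proof.
move=> d c0 z0 h; have zP : [set z | inH z /\ mobius A z = z] z.
  by split => //; apply/mobius_eq.
rewrite /fixpt; have := xgetI (0 +i* 1) zP.
by move=> [w0 /mobius_eq e]; apply: (fixed_uniq c0) => //; exact: e.
Qed.

Lemma fixptE A : \det A = 1 -> (\tr A) ^+ 2 < 4 -> fixpt A = fix_re A +i* fix_im A.
Proof.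
move=> d t; apply: fixpt_uniq => //; [exact: ell_c|exact: fix_im_gt0|exact: fix_comm].
Qed.

Lemma fixpt_inH A : \det A = 1 -> (\tr A) ^+ 2 < 4 -> inH (fixpt A).
Proof. by move=> d t; rewrite fixptE//; exact: fix_im_gt0. Qed.

Lemma fixpt_comm A : \det A = 1 -> (\tr A) ^+ 2 < 4 ->
  A * Jm (fixpt A) = Jm (fixpt A) * A.
Proof. by move=> d t; rewrite fixptE//; exact: fix_comm. Qed.

Lemma cos_pi2B (x : R) : cos (pi / 2 - x) = sin x.
Proof. by rewrite cosB cos_pihalf sin_pihalf mul0r mul1r add0r. Qed.

Lemma hang_bounds A : 0 < hang A < pi.
Proof.
rewrite /hang; set t := \tr A / _; have := atan_gtNpi2 t; have := atan_ltpi2 t.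
by move=> h1 h2; apply/andP; split; lra.
Qed.

Lemma sin_atan (u : R) : sin (atan u) = u * cos (atan u).
Proof.
rewrite -{2}[u]atanK /tan divfK//.
by rewrite cos_atan invr_eq0 sqrtr_eq0 -ltNge ltr_wpDr ?sqr_ge0.
Qed.

Lemma ell_rotm A : \det A = 1 -> (\tr A) ^+ 2 < 4 ->
  A = Num.sg (A 1 0) *: rotm (hang A) (fixpt A).
Proof.
move=> d t; have cn := ell_c d t; have f0 := fix_im_gt0 d t.
have fs := fix_im_sqr d t.
set b := A 1 0 * fix_im A in fs.
have bn : b != 0 by rewrite mulf_neq0// gt_eqF.
set u := \tr A / (2 * b).
have uE : 1 + u ^+ 2 = b ^- 2.
  rewrite /u; apply: (mulIf (expf_neq0 2 bn)); rewrite mulVf ?expf_neq0//.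
  have -> : (1 + (\tr A / (2 * b)) ^+ 2) * b ^+ 2 = b ^+ 2 + (\tr A) ^+ 2 / 4 by field.
  by rewrite fs subrK.
have ca : cos (atan u) = `|b|.
  by rewrite cos_atan uE -exprVn sqrtr_sqr normfV invrK.
have sb : `|b| = Num.sg (A 1 0) * b.
  by rewrite normrEsg /b sgrM (gtr0_sg f0) mulr1.
have sg2 : Num.sg (A 1 0) * Num.sg (A 1 0) = 1 by rewrite -expr2 sqr_sg cn.
have ch : Num.sg (A 1 0) * cos (hang A) = \tr A / 2.
  rewrite /hang -/b -/u cos_pi2B sin_atan ca sb.
  rewrite (_ : _ * _ = (Num.sg (A 1 0) * Num.sg (A 1 0)) * (u * b)); last by ring.
  by rewrite sg2 mul1r /u; field.
have sh : Num.sg (A 1 0) * sin (hang A) = b.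
  have -> : sin (hang A) = cos (atan u).
    by rewrite -[sin _]cos_pi2B /hang -/b -/u opprB addrCA subrr addr0.
  by rewrite ca sb mulrA sg2 mul1r.
rewrite /rotm scalerDr !scalerA ch sh fixptE//.
have f0' : inH (fix_re A +i* fix_im A) by [].
have [] := (comm_Jm A f0').1 (fix_comm d t).
rewrite /= /normsq /= => e1 e2.
have yn : fix_im A != 0 by rewrite gt_eqF.
apply: mx2_eq; rewrite !mxE2 /normsq /= trmx2E /b ?mulr1 ?mulr0 ?add0r.
- by rewrite (_ : _ * (fix_re A / _) = A 1 0 * fix_re A); [lra|field].
- by rewrite e1; field.
- by field.
- by rewrite (_ : _ * (- fix_re A / _) = - (A 1 0 * fix_re A)); [lra|field].
Qed.

End Mx2.

(** * Arguments of complex numbers and of automorphy factors *)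

Section Angles.
Context {R : realType}.
Implicit Types (A B : 'M[R]_2) (z w : R[i]) (s t : R).

Lemma Re_cis t : complex.Re (cis t) = cos t. Proof. by []. Qed.

Lemma cisD s t : cis (s + t) = cis s * cis t.
Proof. by apply: eq_cplx; rewrite /= ?cosD ?sinD; ring. Qed.

Lemma cis0 : cis 0 = 1 :> R[i].
Proof. by rewrite /cis cos0 sin0. Qed.

Lemma cisNK t : cis t * cis (- t) = 1.
Proof. by rewrite -cisD subrr cis0. Qed.

Lemma cis_neq0 t : cis t != 0.
Proof. by apply/eqP => e; have := cisNK t; rewrite e mul0r => /eqP; rewrite eq_sym oner_eq0. Qed.

Lemma cisN t : cis (- t) = (cis t)^-1.
Proof. by apply: (mulfI (cis_neq0 t)); rewrite cisNK divff// cis_neq0. Qed.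

Lemma cis_conj t : conjc (cis t) = cis (- t).
Proof. by rewrite /cis cosN sinN. Qed.

Lemma cis_pi : cis pi = -1 :> R[i].
Proof. by apply: eq_cplx; rewrite /= ?cospi ?sinpi ?oppr0. Qed.

Lemma cis_2pi : cis (2 * pi) = 1 :> R[i].
Proof. by rewrite mulr_natl mulr2n cisD cis_pi mulrNN mulr1. Qed.

Lemma cos_eq1 (d : R) : cos d = 1 -> `|d| < 2 * pi -> d = 0.
Proof.
wlog d0 : d / 0 <= d => [H|].
  have [h|h] := leP 0 d; first exact: H.
  move=> c n; apply/eqP; rewrite -oppr_eq0; apply/eqP; apply: H.
  - by rewrite oppr_ge0 ltW.
  - by rewrite cosN.
  - by rewrite normrN.
move=> c; rewrite ger0_norm// => d1.
apply/eqP; rewrite eq_le d0 andbT leNgt; apply/negP => dp.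
have : 0 < sin (d / 2) by apply: sin_gt0_pi; apply/andP; split; lra.
move: c; rewrite {1}(_ : d = d / 2 + d / 2); last by lra.
rewrite cosD; have := cos2Dsin2 (d / 2); set x := sin _; set y := cos _ => h1 h2.
by move=> x0; have : 0 < x * x by [exact: mulr_gt0]; nra.
Qed.

Lemma cos_sub_cis s t : cis s = cis t -> cos (s - t) = 1.
Proof.
move=> e; have := cisD s (- t); rewrite e cisNK => h.
by have := congr1 (@complex.Re R) h; rewrite Re_cis.
Qed.

Lemma cis_inj s t : cis s = cis t -> `|s - t| < 2 * pi -> s = t.
Proof. by move=> /cos_sub_cis h1 h2; apply/eqP; rewrite -subr_eq0 (cos_eq1 h1). Qed.

Lemma cis_int (m : int) : cis (m%:~R * (2 * pi)) = 1 :> R[i].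
Proof.
have P (k : nat) : cis (k%:R * (2 * pi)) = 1 :> R[i].
  elim: k => [|k IH]; first by rewrite mul0r cis0.
  by rewrite -natr1 mulrDl mul1r cisD IH mul1r cis_2pi.
case: m => k; first exact: P.
by rewrite NegzE rmorphN /= mulNr cisN P invr1.
Qed.

Lemma eqmod2piP s t : cis s = cis t <-> eqmod2pi s t.
Proof.
split; last by move=> [m ->]; rewrite cisD cis_int mulr1.
move=> e; pose m := Num.floor ((s - t) / (2 * pi)); exists m.
have p0 : 0 < 2 * pi :> R by rewrite mulr_gt0// pi_gt0.
have /andP[h1 h2] : m%:~R <= (s - t) / (2 * pi) < (m + 1)%:~R.
  by rewrite floor_le_tmp floorD1_gt.
rewrite ler_pdivlMr// in h1; rewrite ltr_pdivrMr// rmorphD /= mulrDl mul1r in h2.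
apply: cis_inj; first by rewrite cisD cis_int mulr1.
by rewrite opprD addrA ger0_norm; lra.
Qed.

Lemma eqmod2pi_refl s : eqmod2pi s s. Proof. exact/eqmod2piP. Qed.

Lemma eqmod2pi_sym s t : eqmod2pi s t -> eqmod2pi t s.
Proof. by move=> /eqmod2piP h; apply/eqmod2piP. Qed.

Lemma eqmod2piD s t s' t' : eqmod2pi s t -> eqmod2pi s' t' -> eqmod2pi (s + s') (t + t').
Proof. by move=> /eqmod2piP h /eqmod2piP h'; apply/eqmod2piP; rewrite !cisD h h'. Qed.

Lemma eqmod2piN s t : eqmod2pi s t -> eqmod2pi (- s) (- t).
Proof. by move=> /eqmod2piP h; apply/eqmod2piP; rewrite !cisN h. Qed.

(** [t] is an argument of [w]. A relation rather than a function, because arguments are added as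
    real numbers and compared only at the end, by means of bounds ([polar_inj]). *)
Definition polar w t := exists2 r : R, 0 < r & w = r%:C * cis t.

Lemma polarM w w' s t : polar w s -> polar w' t -> polar (w * w') (s + t).
Proof.
move=> [r r0 ->] [r' r0' ->]; exists (r * r'); first exact: mulr_gt0.
by rewrite rmorphM cisD /=; ring.
Qed.

Lemma polar_conj w t : polar w t -> polar (conjc w) (- t).
Proof.
move=> [r r0 ->]; exists r => //.
by rewrite -cis_conj rmorphM /= oppr0.
Qed.

Lemma polar_cis w s t : polar w s -> polar w t -> cis s = cis t.
Proof.
move=> [r r0 ->] [r' r0' e].
have n (a : R) u : normsq (a%:C * cis u) = a ^+ 2.
  rewrite /normsq /= !mul0r subr0 addr0 !exprMn -mulrDr cos2Dsin2 mulr1 //.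
have : r ^+ 2 = r' ^+ 2 by rewrite -(n r s) e n.
move=> /eqP; rewrite eqf_sqr => /orP[/eqP rr|/eqP rr]; last first.
  by exfalso; move: r0; rewrite rr oppr_gt0 => h; move: (lt_trans r0' h); rewrite ltxx.
move: e; rewrite rr => /mulfI; apply.
by rewrite eq_complex /= eqxx andbT gt_eqF.
Qed.

Lemma polar_inj w s t : polar w s -> polar w t -> `|s - t| < 2 * pi -> s = t.
Proof. by move=> h1 h2; apply: cis_inj; exact: polar_cis h1 h2. Qed.

Lemma polar_atan (a b : R) : 0 < a -> polar (a +i* b) (atan (b / a)).
Proof.
move=> a0; exists (a / cos (atan (b / a))).
  by rewrite divr_gt0// cos_atan invr_gt0 sqrtr_gt0 ltr_pwDl// sqr_ge0.
have c0 : cos (atan (b / a)) != 0.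
  by rewrite cos_atan invr_eq0 sqrtr_eq0 -ltNge ltr_wpDr ?sqr_ge0.
by apply: eq_cplx; rewrite /= ?sin_atan; field; rewrite ?c0 ?gt_eqF.
Qed.

Lemma cis_pihalf : cis (pi / 2) = 0 +i* 1 :> R[i].
Proof. by rewrite /cis cos_pihalf sin_pihalf. Qed.

Lemma polar_acot (a b : R) : 0 < b -> polar (a +i* b) (pi / 2 - atan (a / b)).
Proof.
move=> b0; have /polar_conj h := polar_atan a b0.
have := polarM (_ : polar (0 +i* 1) (pi / 2)) h.
rewrite (_ : (0 +i* 1) * _ = a +i* b); last by apply: eq_cplx; rewrite /=; ring.
by apply; exists 1 => //; rewrite mul1r cis_pihalf.
Qed.

Lemma polar_Larg z w : inH z -> inH w ->
  polar ((complex.Im z + complex.Im w) +i* (complex.Re w - complex.Re z)) (Larg z w).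
Proof. by move=> z0 w0; apply: polar_atan; exact: addr_gt0. Qed.

(* An argument of the automorphy factor c z + d of A, or of its opposite;
   for c = 0 the division by 0 yields the constant pi / 2. *)
Definition ang A z : R :=
  pi / 2 - atan ((A 1 0 * complex.Re z + A 1 1) / (A 1 0 * complex.Im z)).

Definition autf A z : R[i] := (A 1 0)%:C * z + (A 1 1)%:C.

Lemma autfE A z : autf A z = (A 1 0 * complex.Re z + A 1 1) +i* (A 1 0 * complex.Im z).
Proof. by case: z => x y; apply: eq_cplx; rewrite /autf /=; ring. Qed.

Lemma ang_bounds A z : 0 < ang A z < pi.
Proof.
rewrite /ang; set t := _ / (_ * complex.Im z); have := atan_gtNpi2 t; have := atan_ltpi2 t.
by move=> h1 h2; apply/andP; split; lra.
Qed.

Lemma angN A z : ang (- A) z = ang A z.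
Proof. by rewrite /ang !oppmx2E !mulNr -opprD invrN mulrNN. Qed.

Lemma autfN A z : autf (- A) z = - autf A z.
Proof. by rewrite /autf !oppmx2E !rmorphN mulNr opprD. Qed.

Lemma polar_ang A z : inH z -> 0 < A 1 0 -> polar (autf A z) (ang A z).
Proof. by move=> z0 c0; rewrite autfE; apply: polar_acot; exact: mulr_gt0. Qed.

(** For c < 0 the number [ang] is an argument of the opposite factor; the sign cancels against the
    value at the second point. For c = 0 the factor is a real constant and the two values of [ang]
    are equal. *)
Lemma polar_ang2 A z w : \det A = 1 -> inH z -> inH w ->
  polar (autf A z * conjc (autf A w)) (ang A z - ang A w).
Proof.
move=> d z0 w0; have [c0|c0|c0] := ltgtP (A 1 0) 0.
- have h u (u0 : inH u) : polar (- autf A u) (ang A u).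
    by rewrite -autfN -angN; apply: polar_ang => //; rewrite oppmx2E oppr_gt0.
  have := polarM (h z z0) (polar_conj (h w w0)).
  by rewrite rmorphN mulrNN.
- exact: polarM (polar_ang z0 c0) (polar_conj (polar_ang w0 c0)).
- rewrite /ang /autf c0 !mul0r invr0 !mulr0 subrr.
  move: d; rewrite detmx2E c0 mulr0 subr0 => d.
  exists (A 1 1 ^+ 2).
    rewrite exprn_even_gt0//=; apply/eqP => e; move: d; rewrite e mulr0 => /eqP.
    by rewrite eq_sym oner_eq0.
  by rewrite cis0; apply: eq_cplx; rewrite /=; ring.
Qed.

Lemma autfM A B z : \det B = 1 -> inH z ->
  autf (A * B) z = autf A (mobius B z) * autf B z.
Proof.
move=> d z0; have n0 := jden_neq0 d z0.
rewrite /autf /mobius !mulmx2E mulrDl mulrA divfK//.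
by rewrite !rmorphD !rmorphM /=; ring.
Qed.

(** The number z - conj w is divided by j(z) conj(j(w)), where j is the automorphy factor. This
    gives the identity modulo 2 pi; since [Larg] is smaller than pi / 2 in absolute value and [ang]
    lies in ]0, pi[, it holds exactly. Every passage from areas to angles rests on it. *)
Lemma Larg_mobius A z w : \det A = 1 -> inH z -> inH w ->
  Larg (mobius A z) (mobius A w) = Larg z w - ang A z + ang A w.
Proof.
move=> d z0 w0.
have h1 := polarM (polar_Larg (mobius_inH d z0) (mobius_inH d w0)) (polar_ang2 d z0 w0).
have h2 := polar_Larg z0 w0.
set u := _ * _ in h1; set v := _ +i* _ in h2.
have uv : u = v.
  have VE a b : (complex.Im a + complex.Im b) +i* (complex.Re b - complex.Re a) =
      (0 -i* 1) * (a - conjc b) :> R[i].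
    by case: a b => [? ?] [? ?]; apply: eq_cplx; rewrite /=; ring.
  rewrite /u /v !VE; have jz := jden_neq0 d z0; have jw := jden_neq0 d w0.
  rewrite -mulrA; congr (_ * _); rewrite /mobius /autf.
  have cj (p q : R) : conjc (p%:C * w + q%:C) = p%:C * conjc w + q%:C.
    by case: (w) => ? ?; apply: eq_cplx; rewrite /=; ring.
  have jw' : (A 1 0)%:C * conjc w + (A 1 1)%:C != 0.
    by rewrite -cj conjc_eq0.
  have cd (x y : R[i]) : conjc (x / y) = conjc x / conjc y by rewrite rmorphM /= fmorphV.
  rewrite cd !cj.
  have dd : (A 0 0)%:C * (A 1 1)%:C - (A 0 1)%:C * (A 1 0)%:C = 1 :> R[i].
    by rewrite -!rmorphM -rmorphB -detmx2E d.
  set a := (A 0 0)%:C in dd *; set b := (A 0 1)%:C in dd *.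
  set c := (A 1 0)%:C in dd jz jw jw' *; set e := (A 1 1)%:C in dd jz jw jw' *.
  transitivity ((a * e - b * c) * (z - conjc w)); last by rewrite dd mul1r.
  by field; rewrite jz jw'.
rewrite uv in h1; have E := polar_inj h1 h2.
rewrite -{1}E; first by ring.
have /andP[a1 a2] := ang_bounds A z; have /andP[a3 a4] := ang_bounds A w.
have := atan_ltpi2 ((complex.Re w - complex.Re z) / (complex.Im z + complex.Im w)).
have := atan_gtNpi2 ((complex.Re w - complex.Re z) / (complex.Im z + complex.Im w)).
have := atan_ltpi2 ((complex.Re (mobius A w) - complex.Re (mobius A z)) / (complex.Im (mobius A z) + complex.Im (mobius A w))).
have := atan_gtNpi2 ((complex.Re (mobius A w) - complex.Re (mobius A z)) / (complex.Im (mobius A z) + complex.Im (mobius A w))).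
rewrite -/(Larg z w) -/(Larg (mobius A z) (mobius A w)) => b1 b2 b3 b4.
rewrite ltr_norml; apply/andP; split; lra.
Qed.

Lemma hangN A : hang (- A) = hang A.
Proof. by rewrite /hang /fix_im !trmx2E !oppmx2E sqrrN -opprD sqrrN !mulNr mulrN invrN mulrN opprK. Qed.

Lemma fixptN A : fixpt (- A) = fixpt A.
Proof.
rewrite /fixpt; congr (xget _ _); apply/seteqP; split => z /= [z0].
  by rewrite mobiusN.
by rewrite mobiusN.
Qed.

Lemma rotm10 h z : rotm h z 1 0 = sin h / complex.Im z.
Proof. by rewrite /rotm !mxE2; ring. Qed.

Lemma rotm10_gt0 h z : 0 < h < pi -> inH z -> 0 < rotm h z 1 0.
Proof. by move=> h0 z0; rewrite rotm10 divr_gt0// sin_gt0_pi. Qed.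

Lemma tr_rotm_lt h z : 0 < h < pi -> (\tr (rotm h z)) ^+ 2 < 4.
Proof.
move=> /sin_gt0_pi s0; rewrite tr_rotm.
by have := cos2Dsin2 h; have : 0 < sin h ^+ 2 by [rewrite exprn_gt0]; nra.
Qed.

Lemma rotm_comm h z : rotm h z * Jm z = Jm z * rotm h z.
Proof. by rewrite /rotm mulrDl mulrDr -!scalerAl -!scalerAr mulr1 mul1r. Qed.

Lemma fixpt_rotm h z : 0 < h < pi -> inH z -> fixpt (rotm h z) = z.
Proof.
move=> h0 z0; apply: fixpt_uniq => //; first exact: det_rotm.
  by rewrite gt_eqF// rotm10_gt0.
exact: rotm_comm.
Qed.

Lemma hang_rotm h z : 0 < h < pi -> inH z -> hang (rotm h z) = h.
Proof.
move=> h0 z0; have s0 := sin_gt0_pi h0.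
have : fix_im (rotm h z) = complex.Im z.
  have := fixpt_rotm h0 z0; rewrite fixptE ?det_rotm ?tr_rotm_lt//.
  by move=> /(congr1 (@complex.Im R)).
rewrite /hang => ->; rewrite tr_rotm rotm10 divfK; last by rewrite gt_eqF.
have -> : 2 * cos h / (2 * sin h) = tan (pi / 2 - h).
  rewrite /tan cos_pi2B.
  have -> : sin (pi / 2 - h) = cos h by rewrite -cos_pi2B opprB addrCA subrr addr0.
  by field; rewrite gt_eqF.
rewrite tanK; first by rewrite opprB addrCA subrr addr0.
by rewrite in_itv/=; move/andP: h0 => [h1 h2]; apply/andP; split; lra.
Qed.

Lemma ang_fixpt A : \det A = 1 -> (\tr A) ^+ 2 < 4 -> ang A (fixpt A) = hang A.
Proof.
move=> d t; rewrite /ang /hang fixptE//= /fix_re; have cn := ell_c d t.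
have yn : fix_im A != 0 by rewrite gt_eqF// fix_im_gt0.
by congr (_ - atan _); rewrite trmx2E; field; rewrite cn yn.
Qed.

(** At the fixed point cz + d has modulus 1 and, for c > 0, argument [hang A]; the derivative is its
    power -2. The case c < 0 follows by passing to the opposite matrix. *)
Lemma mobius_deriv_fixpt A : \det A = 1 -> (\tr A) ^+ 2 < 4 ->
  mobius_deriv A (fixpt A) = cis (2 * pi - 2 * hang A).
Proof.
move=> d t; have z0 := fixpt_inH d t.
wlog c0 : A d t z0 / 0 < A 1 0 => [H|].
  have [h|h|h] := ltgtP (A 1 0) 0.
  - rewrite -hangN -fixptN -(H (- A)) ?detN2 ?fixptN ?oppmx2E ?oppr_gt0//.
      by rewrite /mobius_deriv !oppmx2E !rmorphN mulNr -opprD sqrrN.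
    by rewrite trmx2E !oppmx2E -opprD sqrrN -trmx2E.
  - exact: H.
  - by have := ell_c d t; rewrite h eqxx.
have := polar_ang z0 c0; rewrite ang_fixpt// => -[r r0 rE].
have rr : r = 1.
  have cs := cos2Dsin2 (hang A).
  have jr : normsq (autf A (fixpt A)) = r ^+ 2.
    by rewrite rE /normsq /= !mul0r subr0 addr0 !exprMn -mulrDr cs mulr1.
  have j1 : normsq (autf A (fixpt A)) = 1.
    have fs := fix_im_sqr d t.
    rewrite fixptE// autfE /normsq /= fs /fix_re; have cn := ell_c d t.
    move: d; rewrite detmx2E trmx2E => d.
    have -> : A 1 0 * ((A 0 0 - A 1 1) / (2 * A 1 0)) = (A 0 0 - A 1 1) / 2 by field.
    by nra.
  by apply/eqP; rewrite -(@eqrXn2 _ 2)// ?ltW// expr1n -jr j1.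
rewrite /mobius_deriv -/(autf A (fixpt A)) rE rr mul1r.
rewrite [RHS]cisD cis_2pi mul1r cisN expr2 -cisD; congr (cis _)^-1; ring.
Qed.

Lemma rot_angle_hang A : \det A = 1 -> (\tr A) ^+ 2 < 4 ->
  rot_angle A = 2 * pi - 2 * hang A.
Proof.
move=> d t; have /andP[h1 h2] := hang_bounds A.
pose P : set R := [set t | 0 < t < 2 * pi /\ mobius_deriv A (fixpt A) = cis t].
have PP : P (2 * pi - 2 * hang A).
  by split; [apply/andP; split; lra|exact: mobius_deriv_fixpt].
rewrite /rot_angle -/P; have [/andP[r1 r2] r3] := xgetI 0 PP.
apply: cis_inj; first by rewrite -r3 mobius_deriv_fixpt.
by rewrite ltr_norml; apply/andP; split; lra.
Qed.

Lemma ellipticP A : \det A = 1 -> elliptic A <-> (\tr A) ^+ 2 < 4.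
Proof.
move=> d; split.
  move=> [n1 n2 [z z0 /(mobius_eq d z0 z0) /(comm_Jm _ z0)[e1 e2]]].
  have [c0|c0] := eqVneq (A 1 0) 0.
    rewrite c0 mulr0 in e1 e2; move: d; rewrite detmx2E c0 mulr0 subr0.
    have -> : A 0 0 = A 1 1 by lra.
    rewrite -expr2 => /eqP; rewrite sqrf_eq1 => /orP[|] /eqP a1.
      by case: n1; apply: mx2_eq; rewrite !mxE2//; lra.
    by case: n2; apply: mx2_eq; rewrite !mxE2//; lra.
  rewrite -subr_gt0 trmx2E.
  have -> : 4 - (A 0 0 + A 1 1) ^+ 2 = 4 * (A 1 0 * complex.Im z) ^+ 2.
    move: d; rewrite detmx2E e1 /normsq => d.
    transitivity (4 * (A 0 0 * A 1 1 - - (complex.Re z ^+ 2 + complex.Im z ^+ 2) * A 1 0 * A 1 0)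
       - (A 0 0 + A 1 1) ^+ 2); first by rewrite d mulr1.
    have -> : A 0 0 = A 1 1 + 2 * complex.Re z * A 1 0 by lra.
    ring.
  by rewrite mulr_gt0// exprn_even_gt0//= mulf_neq0// gt_eqF.
move=> t; split.
- by move=> e; move: t; rewrite e trmx2E !mxE2; lra.
- by move=> e; move: t; rewrite e trmx2E !mxE2; lra.
- exists (fixpt A); first exact: fixpt_inH.
  by apply/mobius_eq => //; [exact: fixpt_inH|exact: fixpt_inH|exact: fixpt_comm].
Qed.

End Angles.

(** * The volume *)

Section Chains.
Context {R : realType}.
Implicit Types (A B : 'M[R]_2) (z w : R[i]) (c : nat -> 'M[R]_2) (m n : nat).

(* Positive elliptic: conjugate to [[cos h, - sin h], [sin h, cos h]] with 0 < h < pi. *)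
Definition posell A := [/\ \det A = 1, 0 < A 1 0 & (\tr A) ^+ 2 < 4].

Lemma posell_rotm A : posell A -> A = rotm (hang A) (fixpt A).
Proof. by move=> [d c0 t]; rewrite {1}(ell_rotm d t) gtr0_sg// scale1r. Qed.

Lemma rotm_posell h z : 0 < h < pi -> inH z -> posell (rotm h z).
Proof. by move=> h0 z0; split; [exact: det_rotm|exact: rotm10_gt0|exact: tr_rotm_lt]. Qed.

Lemma posell_conj A (g : 'M[R]_2) : posell A -> \det g = 1 -> posell (g * A * g^-1).
Proof.
move=> pA dg; have [d c0 t] := pA; rewrite (posell_rotm pA) rotm_conj//; last exact: fixpt_inH.
apply: rotm_posell; [exact: hang_bounds|apply: mobius_inH => //]; exact: fixpt_inH.
Qed.

Definition prodc c m : 'M[R]_2 := \prod_(1 <= j < m.+1) c j.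

Lemma prodc0 c : prodc c 0 = 1. Proof. by rewrite /prodc big_geq. Qed.

Lemma prodcS c m : prodc c m.+1 = prodc c m * c m.+1.
Proof. by rewrite /prodc big_nat_recr. Qed.

Lemma prodc1 c : prodc c 1 = c 1%N. Proof. by rewrite prodcS prodc0 mul1r. Qed.

Lemma eq_prodc c c' m : (forall i, (1 <= i <= m)%N -> c i = c' i) -> prodc c m = prodc c' m.
Proof. by move=> h; apply: eq_big_nat => i; rewrite ltnS => /h. Qed.

Lemma prodc_conj c (g : 'M[R]_2) m : \det g = 1 ->
  prodc (fun i => g * c i * g^-1) m = g * prodc c m * g^-1.
Proof.
move=> dg; elim: m => [|m IH]; first by rewrite !prodc0 mulr1 mulmxV2.
by rewrite !prodcS IH !mulrA -(mulrA _ g^-1 g) mulVmx2// mulr1.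
Qed.

(* A continuous determination of the argument of the automorphy factor of
   the product c_1 ... c_m. *)
Fixpoint turn c m z : R :=
  if m is k.+1 then turn c k (mobius (c m) z) + ang (c m) z else 0.

Section Chain.
Variables (n : nat) (c : nat -> 'M[R]_2).
Hypothesis n_gt1 : (1 < n)%N.
Hypothesis cP : forall i, (1 <= i <= n)%N -> posell (c i).

Let detc i : (1 <= i <= n)%N -> \det (c i) = 1.
Proof. by move=> /cP[]. Qed.

Lemma det_prodc m : (m <= n)%N -> \det (prodc c m) = 1.
Proof.
elim: m => [|m IH] mn; first by rewrite prodc0 det1_2.
by rewrite prodcS detM2 IH 1?ltnW// detc// mulr1.
Qed.

Lemma mobius_prodcS m z : (m < n)%N -> inH z ->
  mobius (prodc c m.+1) z = mobius (prodc c m) (mobius (c m.+1) z).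
Proof. by move=> mn z0; rewrite prodcS mobiusM// ?det_prodc ?detc// ltnW. Qed.

Lemma Larg_prodc m z w : (m <= n)%N -> inH z -> inH w ->
  Larg (mobius (prodc c m) z) (mobius (prodc c m) w) = Larg z w - turn c m z + turn c m w.
Proof.
elim: m z w => [|m IH] z w mn z0 w0.
  by rewrite prodc0 !mobius1//= subr0 addr0.
rewrite !mobius_prodcS// IH ?(ltnW mn)//; last 2 first.
- by apply: mobius_inH; rewrite ?detc.
- by apply: mobius_inH; rewrite ?detc.
by rewrite Larg_mobius ?detc//=; ring.
Qed.

Lemma polar_turn m z : (m <= n)%N -> inH z -> polar (autf (prodc c m) z) (turn c m z).
Proof.
elim: m z => [|m IH] z mn z0.
  exists 1 => //; rewrite /= cis0 prodc0 /autf onemx2E /=.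
  by apply: eq_cplx; case: z {z0} => x y /=; rewrite ?onemx2E; ring.
rewrite prodcS autfM ?detc//=; apply: polarM.
  by apply: IH; [exact: ltnW|apply: mobius_inH; rewrite ?detc].
by apply: polar_ang => //; have [] := cP (_ : (1 <= m.+1 <= n)%N).
Qed.

Lemma turn_gt0 m z : (m <= n)%N -> (0 < turn c m z) = (0 < m)%N.
Proof.
elim: m z => [|m IH] z mn /=; first by rewrite ltxx.
have /andP[a0 _] := ang_bounds (c m.+1) z.
rewrite ltr_wpDl//; case: m IH mn a0 => [|m] IH mn a0 //=.
by apply: ltW; rewrite -[X in 0 < X]/(turn c m.+1 _) IH// ltnW.
Qed.

Lemma turn_sin m z : (m <= n)%N -> inH z ->
  exists2 r : R, 0 < r & prodc c m 1 0 * complex.Im z = r * sin (turn c m z).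
Proof.
move=> mn z0; have [r r0 e] := polar_turn mn z0; exists r => //.
by have := congr1 (@complex.Im R) e; rewrite autfE /= mul0r addr0.
Qed.

(** Take for [z] the preimage of [w] under c_(m+1) ... c_n: the turning of the whole product at [z]
    adds positive angles to that of the first [m] factors at [w]. *)
Lemma turn_extend k m w : (m + k = n)%N -> inH w ->
  exists2 z, inH z & turn c m w <= turn c n z ?= iff (k == 0)%N.
Proof.
elim: k m w => [|k IH] m w mn w0.
  by exists w => //; rewrite -mn addn0; apply/leifP; rewrite eqxx.
have mi : (1 <= m.+1 <= n)%N by rewrite /= -mn addnS ltnS leq_addr.
have [||z z0 h] := IH m.+1 (mobius (c m.+1)^-1 w); first by rewrite addSn -addnS.
  by apply: mobius_inH; rewrite ?det_inv1 ?detc.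
exists z => //; move: h => /=; rewrite mobiusVK ?detc// => /leif_le h.
have /andP[a0 _] := ang_bounds (c m.+1) (mobius (c m.+1)^-1 w).
by apply/leifP => /=; rewrite (lt_le_trans _ h)// ltrDl.
Qed.

Definition closes := prodc c n = 1 \/ prodc c n = -1.

Lemma turn_const z w : closes -> inH z -> inH w -> turn c n z = turn c n w.
Proof.
move=> cl z0 w0; have := Larg_prodc (leqnn n) z0 w0.
have e u : inH u -> mobius (prodc c n) u = u.
  by move=> u0; case: cl => ->; rewrite ?mobiusN mobius1.
by rewrite !e//; lra.
Qed.

(** A proper partial product turns by a positive amount strictly below the total pi, and its lower
    left entry is a positive multiple of the sine of this turning. *)
Lemma prodc10_gt0 m : closes -> (exists2 z, inH z & turn c n z = pi) ->
  (1 <= m < n)%N -> 0 < prodc c m 1 0.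
Proof.
move=> cl [z0' z0'0 tz] /andP[m0 mn].
have i0 : inH (0 +i* 1 : R[i]) by rewrite /inH /=.
have [z z0 [h1 h2]] := turn_extend (subnKC (ltnW mn)) i0.
have tp : turn c n z = pi by rewrite -tz; exact: turn_const.
have t1 : turn c m (0 +i* 1) < pi.
  by rewrite lt_neqAle -tp h1 andbT h2 subn_eq0 -ltnNge.
have [r r0] := turn_sin (ltnW mn) i0; rewrite /= mulr1 => ->.
by rewrite mulr_gt0// sin_gt0_pi// t1 turn_gt0 ?m0// ltnW.
Qed.

(** Each factor adds less than pi, and a positive lower left entry means a positive sine, so the
    turning of a proper partial product cannot jump past pi. The last factor brings the total into
    ]0, 2 pi[, where closing up leaves only the zero pi of the sine. *)
Lemma turn_pi : closes -> (forall m, (1 <= m < n)%N -> 0 < prodc c m 1 0) ->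
  forall z, inH z -> turn c n z = pi.
Proof.
move=> cl pos z z0.
have lt m w : (1 <= m < n)%N -> inH w -> 0 < turn c m w < pi.
  elim: m w => [//|m IH] w mn w0.
  have mn' : (m.+1 <= n)%N by case/andP: mn => _ /ltnW.
  rewrite turn_gt0//=.
  have /andP[a0 a1] := ang_bounds (c m.+1) w.
  case: m IH mn mn' a0 a1 => [|m] IH mn mn' a0 a1; first by rewrite /= add0r.
  have w1 : inH (mobius (c m.+2) w) by apply: mobius_inH; rewrite ?detc// mn'.
  have /andP[b0 b1] := IH (mobius (c m.+2) w) mn' w1.
  have [r r0] := turn_sin mn' w0.
  have : 0 < prodc c m.+2 1 0 * complex.Im w by rewrite mulr_gt0// pos.
  move=> + e; rewrite e pmulr_rgt0// => s0.
  rewrite ltNge; apply/negP => h.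
  have : 0 <= sin (turn c m.+2 w - pi).
    by apply: sin_ge0_pi; apply/andP; split; rewrite -[turn c m.+2 w]/(turn c m.+1 (mobius (c m.+2) w) + ang (c m.+2) w) in h *; lra.
  by rewrite sinB cospi sinpi mulr0 subr0 mulrN1; lra.
have t2 : 0 < turn c n z < 2 * pi.
  rewrite turn_gt0// ltnW//=; case: n n_gt1 lt detc => [//|n'] n1 lt dc.
  rewrite -[turn c _ z]/(turn c n' (mobius (c n'.+1) z) + ang (c n'.+1) z).
  have /andP[a0 a1] := ang_bounds (c n'.+1) z.
  have /andP[b0 b1] : 0 < turn c n' (mobius (c n'.+1) z) < pi.
    by apply: lt; [rewrite ltnSn andbT|apply: mobius_inH; rewrite ?dc ?leqnn].
  by rewrite mulr_natl mulr2n ltrD.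
have [r r0] := turn_sin (leqnn n) z0.
have -> : prodc c n 1 0 = 0 by case: cl => ->; rewrite !mxE2 ?oppr0.
rewrite mul0r => /esym/eqP; rewrite mulf_eq0 gt_eqF//= => /eqP s0.
case/andP: t2 => t0 t2.
have [h|h|//] := ltgtP (turn c n z) pi.
  by have := sin_gt0_pi (_ : 0 < turn c n z < pi); rewrite t0 h s0 ltxx => /(_ isT).
have := sin_gt0_pi (_ : 0 < turn c n z - pi < pi).
rewrite sinB cospi sinpi s0 mulr0 subr0 mul0r ltxx => H; exfalso.
apply: notF; apply: H; apply/andP; split; lra.
Qed.

Definition chain_pos := forall m, (1 <= m < n)%N -> posell (prodc c m).

(** The correction is the difference of [ang g] between the end point and the starting point, so the
    turning of a closed chain is invariant under conjugation. *)
Lemma turn_conj (g : 'M[R]_2) m z : \det g = 1 -> (m <= n)%N -> inH z ->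
  turn (fun i => g * c i * g^-1) m (mobius g z) =
  turn c m z + ang g (mobius (prodc c m) z) - ang g z.
Proof.
move=> dg; elim: m z => [|m IH] z mn z0.
  by rewrite prodc0 mobius1//= add0r subrr.
have mi : (1 <= m.+1 <= n)%N by [].
have z1 : inH (mobius (c m.+1) z) by apply: mobius_inH; rewrite ?detc.
have pc := posell_conj (cP mi) dg; have [dc' c0' _] := pc; have [_ c0 _] := cP mi.
have e1 : mobius (g * c m.+1 * g^-1) (mobius g z) = mobius g (mobius (c m.+1) z).
  by rewrite -!mobiusM ?detM2 ?det_inv1 ?dg ?detc ?mulr1// divrK// unit_det1.
have e2 : ang (g * c m.+1 * g^-1) (mobius g z) =
    ang (c m.+1) z + ang g (mobius (c m.+1) z) - ang g z.
  have gz := mobius_inH dg z0.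
  have p1 := polar_ang gz c0'.
  have p2 := polarM (polar_ang z0 c0) (polar_ang2 dg z1 z0).
  have e3 : autf (g * c m.+1 * g^-1) (mobius g z) * autf g z =
     autf g (mobius (c m.+1) z) * autf (c m.+1) z.
    by rewrite -!autfM ?detc// divrK// unit_det1.
  have p3 := polarM p1 (polar_ang2 dg z0 z0).
  rewrite mulrA e3 -mulrA mulrCA mulrA subrr addr0 -mulrA in p3.
  have p4 : polar (autf (c m.+1) z * (autf g (mobius (c m.+1) z) * (autf g z)^*%C)) (ang (g * c m.+1 / g) (mobius g z)).
    by rewrite mulrCA in p3 *.
  rewrite [RHS](_ : _ = ang (c m.+1) z + (ang g (mobius (c m.+1) z) - ang g z)); last by ring.
  apply: (polar_inj p4 p2).
  have /andP[a0 a1] := ang_bounds (g * c m.+1 / g) (mobius g z).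
  have /andP[b0 b1] := ang_bounds (c m.+1) z.
  have /andP[d0 d1] := ang_bounds g (mobius (c m.+1) z).
  have /andP[f0 f1] := ang_bounds g z.
  by rewrite ltr_norml; apply/andP; split; lra.
rewrite /= e1 e2 IH// 1?ltnW//.
by rewrite mobius_prodcS//; ring.
Qed.

End Chain.

(** Turning pi makes the lower left entries of the partial products positive, not only for the chain
    but, by [turn_conj], for every conjugate of it. Positivity in a suitable conjugate forces
    ellipticity. *)
Lemma chain_posP n c : (1 < n)%N -> (forall i, (1 <= i <= n)%N -> posell (c i)) ->
  closes n c -> chain_pos n c <-> (exists2 z, inH z & turn c n z = pi).
Proof.
move=> n1 cP cl.
have i0 : inH (0 +i* 1 : R[i]) by rewrite /inH /=.
split=> [pos|[z z0 tz] m mn].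
  exists (0 +i* 1) => //; apply: turn_pi => // m mn.
  by have [_ + _] := pos m mn.
have mn' : (m <= n)%N by case/andP: mn => _ /ltnW.
have d := det_prodc cP mn'.
have c0 : 0 < prodc c m 1 0 by apply: (prodc10_gt0 cP cl _ mn); exists z.
split => //.
set A := prodc c m in d c0 *.
(* Chosen so that the lower left entry of g A g^-1 is [A 1 0] times 4 det A - (tr A)^2. *)
pose g := mx2 0 (- (2 * A 1 0)^-1) (2 * A 1 0) (A 1 1 - A 0 0).
have dg : \det g = 1.
  rewrite detmx2E !mxE2 mul0r add0r mulNr opprK mulVf// mulf_neq0// gt_eqF//.
have cP' i : (1 <= i <= n)%N -> posell (g * c i * g^-1) by move=> /cP /posell_conj; exact.
have cl' : closes n (fun i => g * c i * g^-1).
  rewrite /closes prodc_conj//; case: cl => ->; [left|right].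
    by rewrite mulr1 mulmxV2.
  by rewrite mulrN1 mulNr mulmxV2.
have t' : exists2 w, inH w & turn (fun i => g * c i * g^-1) n w = pi.
  exists (mobius g z); first exact: mobius_inH.
  rewrite (turn_conj cP)// tz (_ : mobius (prodc c n) z = z); first by rewrite addrK.
  by case: cl => ->; rewrite ?mobiusN mobius1.
have := prodc10_gt0 cP' cl' t' mn.
rewrite prodc_conj// -/A invmx2// !mxE2.
rewrite (_ : _ + _ = A 1 0 * (4 * (A 0 0 * A 1 1 - A 0 1 * A 1 0) - (A 0 0 + A 1 1) ^+ 2)).
  by rewrite pmulr_rgt0// -detmx2E d mulr1 subr_gt0 -trmx2E.
ring.
Qed.

End Chains.

#[global] Arguments gen : simpl never.

(** * The volume as a turning number *)

Section Volume.
Context {R : realType}.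
Implicit Types (A B : 'M[R]_2) (z w : R[i]).

Let i0 : inH ('i : R[i]). Proof. by rewrite /inH /=. Qed.

Lemma area_cocycleE A B : \det A = 1 -> \det B = 1 -> area_cocycle A B =
  - 2 * (Larg 'i (mobius A 'i) + Larg (mobius A 'i) (mobius (A * B) 'i)
         - Larg 'i (mobius (A * B) 'i)).
Proof.
move=> dA dB; rewrite /area_cocycle -/('i : R[i]) signed_areaE//.
- by rewrite [Larg _ 'i]LargC.
- exact: mobius_inH.
- by apply: mobius_inH; rewrite // detM2 dA dB mulr1.
Qed.

Lemma Larg_bound z w : `|Larg z w| < pi / 2.
Proof.
rewrite ltr_norml /Larg; set u := _ / _ in |- *.
by rewrite -/u atan_gtNpi2 atan_ltpi2.
Qed.

Lemma det_expz A (a : int) : \det A = 1 -> \det (A ^ a) = 1.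
Proof.
move=> d; have P (k : nat) : \det (A ^+ k) = 1.
  by elim: k => [|k IH]; rewrite ?expr0 ?det1_2// exprS detM2 d IH mulr1.
case: a => k; first exact: P.
by rewrite NegzE -exprnN det_inv1.
Qed.

Lemma comm_expz A B (a : int) : A \is a GRing.unit -> A * B = B * A -> A ^ a * B = B * A ^ a.
Proof.
move=> u h; have P (k : nat) : A ^+ k * B = B * A ^+ k.
  by apply: commr_sym; apply: commrX; rewrite /GRing.comm h.
case: a => k; first exact: P.
rewrite NegzE -exprnN; set C := A ^+ k.+1.
have uC : C \is a GRing.unit by rewrite unitrX.
apply: (mulrI uC); rewrite mulrA divrr// mul1r.
by rewrite mulrA P -mulrA divrr// mulr1.
Qed.

(** The area of the triangle with vertices i, A^a i and the fixed point is bounded in a, and it is a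
    primitive because A^a fixes the third vertex. Two bounded primitives differ by a bounded
    homomorphism from Z to R, which is 0. *)
Lemma bounded_primitiveE A : \det A = 1 -> (\tr A) ^+ 2 < 4 ->
  bounded_primitive A = signed_area 'i (mobius A 'i) (fixpt A).
Proof.
move=> d t; have F0 := fixpt_inH d t; set F := fixpt A in F0 *.
have uA := unit_det1 d.
have da a := det_expz a d.
have fixF a : mobius (A ^ a) F = F.
  by apply/mobius_eq => //; apply: comm_expz => //; exact: fixpt_comm.
pose k0 (a : int) := signed_area 'i (mobius (A ^ a) 'i) F.
have k0E a : k0 a = - 2 * (Larg 'i (mobius (A ^ a) 'i) + Larg (mobius (A ^ a) 'i) F + Larg F 'i).
  by rewrite /k0 signed_areaE//; exact: mobius_inH.
pose P : set R := [set r | exists k : int -> R,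
    [/\ exists M : R, forall a, `|k a| <= M,
        forall a b, k a + k b - k (a + b) = area_cocycle (A ^ a) (A ^ b) &
        r = k 1]].
have bound0 a : `|k0 a| <= 3 * pi.
  rewrite k0E mulNr normrN normrM [`|2|]ger0_norm//.
  have := Larg_bound 'i (mobius (A ^ a) 'i); have := Larg_bound (mobius (A ^ a) 'i) F.
  have := Larg_bound F 'i; set x := Larg F 'i; set y := Larg _ F; set v := Larg 'i _ => h1 h2 h3.
  have := ler_normD (v + y) x; have := ler_normD v y; lra.
have coc a b : k0 a + k0 b - k0 (a + b) = area_cocycle (A ^ a) (A ^ b).
  rewrite area_cocycleE// -exprzDr// !k0E.
  have m1 : mobius (A ^ (a + b)) 'i = mobius (A ^ a) (mobius (A ^ b) 'i).
    by rewrite exprzDr// mobiusM.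
  have b0 := mobius_inH (da b) i0.
  have e1 := Larg_mobius (da a) i0 b0; have e2 := Larg_mobius (da a) b0 F0.
  have e3 := Larg_mobius (da a) F0 i0.
  rewrite fixF in e2 e3; rewrite m1.
  by rewrite (LargC F (mobius (A ^ a) 'i)) in e3 *; lra.
have P0 : P (k0 1) by exists k0; split => //; exists (3 * pi).
rewrite /bounded_primitive -/P.
have [k [[M hM] kc ->]] := xgetI 0 P0.
pose e a := k a - k0 a.
have eD a b : e (a + b) = e a + e b.
  by have := kc a b; rewrite -coc /e; lra.
have eN (j : nat) : e j%:Z = j%:R * e 1.
  elim: j => [|j IH]; first by have := eD 0 0; rewrite add0r mul0r; lra.
  by rewrite -addn1 PoszD eD IH natrD mulrDl mul1r.
have M0 a : `|e a| <= M + 3 * pi.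
  by apply: (le_trans (ler_normB _ _)); apply: lerD.
suff e1 : e 1 = 0.
  by rewrite -[A in RHS]expr1z; move/eqP: e1; rewrite subr_eq0 => /eqP.
apply/eqP/negP => /negP e1.
have e1p : 0 < `|e 1| by rewrite normr_gt0.
pose j := (Num.truncn ((M + 3 * pi) / `|e 1|)).+1.
have := M0 j%:Z; rewrite eN normrM ger0_norm ?ler0n// -ler_pdivlMr// leNgt => /negP; apply.
exact: truncnS_gt.
Qed.

Variable n : nat.
Implicit Types (X : mtuple R n) (alpha : 'I_n -> R).

Definition ngen X (i : nat) : 'M[R]_2 := Num.sg (gen X i 1 0) *: gen X i.

Lemma gen_ngen X i : gen X i 1 0 != 0 -> gen X i = ngen X i \/ gen X i = - ngen X i.
Proof.
rewrite /ngen; case: sgrP => // _ _; [left|right]; first by rewrite scale1r.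
by rewrite scaleN1r opprK.
Qed.

Lemma ngen_posell X i : \det (gen X i) = 1 -> (\tr (gen X i)) ^+ 2 < 4 -> posell (ngen X i).
Proof.
move=> d t; have c0 := ell_c d t; split.
- by case: (gen_ngen c0) => e; move: d; rewrite e ?detN2.
- rewrite /ngen scalemx2E -normrEsg normr_gt0 //.
- by case: (gen_ngen c0) => e; move: t; rewrite e ?trmx2E ?oppmx2E -?opprD ?sqrrN ?trmx2E.
Qed.

Lemma gensE X m : gens X m = prodc (gen X) m. Proof. by []. Qed.

Lemma gens_ngen X m : (forall i, (1 <= i <= m)%N -> gen X i 1 0 != 0) ->
  gens X m = prodc (ngen X) m \/ gens X m = - prodc (ngen X) m.
Proof.
rewrite gensE; elim: m => [|m IH] h; first by left; rewrite !prodc0.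
rewrite !prodcS.
have h' i : (1 <= i <= m)%N -> gen X i 1 0 != 0.
  by move=> /andP[a b]; apply: h; rewrite a leqW.
have hm : (1 <= m.+1 <= m.+1)%N by rewrite /= leqnn.
case: (IH h') => ->; case: (gen_ngen (h _ hm)) => ->;
  rewrite ?mulrN ?mulNr ?opprK; by [left|right].
Qed.

Section InRep.
Variables (alpha : 'I_n -> R) (X : mtuple R n).
Hypothesis XR : Rep alpha X.

Lemma Rep_det i : (1 <= i <= n)%N -> \det (gen X i) = 1.
Proof. by move: XR => [h _ _]; exact: h. Qed.

Lemma Rep_tr i : (1 <= i <= n)%N -> (\tr (gen X i)) ^+ 2 < 4.
Proof.
move=> ib; apply/ellipticP; first exact: Rep_det.
case: i ib => // i ib; move: XR => [_ _ /(_ (Ordinal ib))[]]; by [].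
Qed.

Lemma Rep_c i : (1 <= i <= n)%N -> gen X i 1 0 != 0.
Proof. by move=> ib; apply: ell_c; [exact: Rep_det|exact: Rep_tr]. Qed.

Lemma Rep_posell i : (1 <= i <= n)%N -> posell (ngen X i).
Proof. by move=> ib; apply: ngen_posell; [exact: Rep_det|exact: Rep_tr]. Qed.

Lemma Rep_gen i : (1 <= i <= n)%N -> gen X i = ngen X i \/ gen X i = - ngen X i.
Proof. by move=> /Rep_c; exact: gen_ngen. Qed.

Lemma Rep_gens m : (m <= n)%N ->
  gens X m = prodc (ngen X) m \/ gens X m = - prodc (ngen X) m.
Proof.
move=> mn; apply: gens_ngen => i /andP[a b]; apply: Rep_c.
by rewrite a (leq_trans b).
Qed.

Lemma Rep_closes : closes n (ngen X).
Proof.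
move: XR => [_ h _]; rewrite /closes.
case: (Rep_gens (leqnn n)) => e; rewrite -[prodc _ n]opprK in h *; move: h; rewrite e.
  by rewrite opprK.
by case=> [h|h]; [right|left]; rewrite -[prodc _ _]opprK h ?opprK.
Qed.

Lemma Rep_hang (i : 'I_n) : hang (ngen X i.+1) = pi - alpha i / 2.
Proof.
have ib : (1 <= i.+1 <= n)%N by case: i.
move: XR => [_ _ /(_ i)[_]].
rewrite rot_angle_hang ?Rep_det ?Rep_tr//.
have -> : hang (gen X i.+1) = hang (ngen X i.+1).
  by case: (Rep_gen ib) => ->; rewrite ?hangN.
by move=> <-; lra.
Qed.

Lemma Rep_mobius_gen i z : (1 <= i <= n)%N -> mobius (gen X i) z = mobius (ngen X i) z.
Proof. by move=> /Rep_gen[] ->; rewrite ?mobiusN. Qed.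

Lemma Rep_mobius_gens m z : (m <= n)%N -> mobius (gens X m) z = mobius (prodc (ngen X) m) z.
Proof. by move=> /Rep_gens[] ->; rewrite ?mobiusN. Qed.

Lemma Cpt_ngen i : (1 <= i <= n)%N -> Cpt X i = fixpt (ngen X i).
Proof. by rewrite /Cpt => /Rep_gen[] ->; rewrite ?fixptN. Qed.

(** In the sum of the cocycle values the sides issued from i telescope, because c_1 ... c_n fixes i.
    The side from P_m i to P_(m+1) i is pulled back by P_m, and the primitive of c_(m+1) is expanded
    by [Larg_mobius] at its fixed point; only turnings and angles survive. *)
Lemma vol_turn : (0 < n)%N ->
  vol X = - 2 * turn (ngen X) n 'i + 2 * \sum_(1 <= i < n.+1) hang (ngen X i).
Proof.
move=> n0; pose P m := prodc (ngen X) m.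
have P0 : mobius (P 0%N) 'i = 'i by rewrite /P prodc0 mobius1.
have Pn : mobius (P n) 'i = 'i.
  by rewrite /P; case: Rep_closes => ->; rewrite ?mobiusN mobius1.
have s1 : \sum_(1 <= m < n) area_cocycle (gens X m) (gen X m.+1) =
   - 2 * \sum_(0 <= m < n) Larg (mobius (P m) 'i) (mobius (P m.+1) 'i).
  transitivity (\sum_(0 <= m < n) (- 2 * (Larg (mobius (P m) 'i) (mobius (P m.+1) 'i)
     - (Larg 'i (mobius (P m.+1) 'i) - Larg 'i (mobius (P m) 'i))))).
    rewrite [RHS]big_ltn// P0 Largxx subr0 subrr mulr0 add0r.
    apply: eq_big_nat => m /andP[m0 mn].
    have dm : \det (gens X m) = 1.
      by case: (Rep_gens (ltnW mn)) => ->; rewrite ?detN2 (det_prodc Rep_posell)// ltnW.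
    rewrite area_cocycleE ?Rep_det//.
    rewrite (_ : gens X m * gen X m.+1 = gens X m.+1); last by rewrite !gensE prodcS.
    by rewrite !Rep_mobius_gens// ?(ltnW mn)// -!/(P _); ring.
  rewrite -mulr_sumr; congr (_ * _); rewrite sumrB telescope_sumr// Pn P0 Largxx subrr subr0.
  by [].
rewrite /vol s1 [\sum_(1 <= i < n.+1) bounded_primitive _]big_add1 /=.
have s2 : turn (ngen X) n 'i = \sum_(0 <= m < n) (turn (ngen X) m.+1 'i - turn (ngen X) m 'i).
  by rewrite telescope_sumr//= subr0.
rewrite s2 [\sum_(1 <= i < n.+1) hang _]big_add1 /= !mulr_sumr -sumrB -big_split /=.
apply: eq_big_nat => m /andP[_ mn].
have mb : (1 <= m.+1 <= n)%N by [].
rewrite bounded_primitiveE ?Rep_det ?Rep_tr//.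
have [d c0 t] := Rep_posell mb.
have F0 := fixpt_inH d t.
rewrite Rep_mobius_gen// -/(Cpt X m.+1) Cpt_ngen// signed_areaE//; last exact: mobius_inH.
have e1 : Larg (mobius (P m) 'i) (mobius (P m.+1) 'i) =
   Larg 'i (mobius (ngen X m.+1) 'i) - turn (ngen X) m 'i + turn (ngen X) m (mobius (ngen X m.+1) 'i).
  rewrite /P (mobius_prodcS Rep_posell)// (Larg_prodc Rep_posell)//; first exact: ltnW.
  exact: mobius_inH.
have fF : mobius (ngen X m.+1) (fixpt (ngen X m.+1)) = fixpt (ngen X m.+1).
  by apply/mobius_eq => //; exact: fixpt_comm.
have e2 := Larg_mobius d i0 F0; rewrite fF ang_fixpt// in e2.
rewrite e1 e2 [Larg (fixpt _) 'i]LargC /=; ring.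
Qed.

Lemma sum_hang : \sum_(1 <= i < n.+1) hang (ngen X i) = pi * n%:R - (\sum_i alpha i) / 2.
Proof.
rewrite big_add1 /= big_mkord.
rewrite (eq_bigr (fun i => pi - alpha i / 2)); last by move=> i _; exact: Rep_hang.
by rewrite sumrB sumr_const card_ord mulr_suml [pi * _]mulr_natr.
Qed.

(** By [vol_turn] and [sum_hang], vol + lambda is 2 pi minus twice the total turning. *)
Lemma vol_lambda : (1 < n)%N -> vol X = - lambda alpha <-> chain_pos n (ngen X).
Proof.
move=> n1; rewrite (chain_posP n1 Rep_posell Rep_closes) vol_turn ?(ltnW n1)// sum_hang /lambda.
have -> : (exists2 z : R[i], inH z & turn (ngen X) n z = pi) <-> turn (ngen X) n 'i = pi.
  split => [[z z0 <-]|h]; last by exists 'i.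
  exact: (turn_const Rep_posell Rep_closes).
by split; lra.
Qed.

End InRep.

Lemma RepDTP alpha X : (1 < n)%N ->
  RepDT alpha X <-> Rep alpha X /\ chain_pos n (ngen X).
Proof.
by move=> n1; split=> -[XR]; move/(vol_lambda XR n1).
Qed.

End Volume.

(** * Trigonometry of triangles *)

Section Triangles.
Context {R : realType}.
Implicit Types (A B : 'M[R]_2) (p q r z w : R[i]).

Let i0 : inH ('i : R[i]). Proof. by rewrite /inH /=. Qed.

(* The hyperbolic cosine of the distance of p and q. *)
Definition kappa p q : R := - \tr (Jm p * Jm q) / 2.

Lemma kappaE p q : inH p -> inH q -> kappa p q =
  1 + ((complex.Re p - complex.Re q) ^+ 2 + (complex.Im p - complex.Im q) ^+ 2)
      / (2 * (complex.Im p * complex.Im q)).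
Proof.
rewrite /inH /kappa trmx2E !mxE2 /normsq => p0 q0.
by field; rewrite !gt_eqF.
Qed.

Lemma kappa_ge1 p q : inH p -> inH q -> 1 <= kappa p q.
Proof.
move=> p0 q0; rewrite kappaE// lerDl divr_ge0 ?addr_ge0 ?sqr_ge0//.
by rewrite mulr_ge0// mulr_ge0// ltW.
Qed.

Lemma kappa_eq1 p q : inH p -> inH q -> (kappa p q == 1) = (p == q).
Proof.
move=> p0 q0; apply/eqP/eqP => [|->]; last first.
  by rewrite kappaE// !subrr expr0n addr0 mul0r addr0.
rewrite kappaE// => /eqP; rewrite -subr_eq0 addrAC subrr add0r mulf_eq0 invr_eq0.
rewrite [X in _ || X]gt_eqF ?orbF; last by rewrite mulr_gt0// mulr_gt0.
rewrite paddr_eq0 ?sqr_ge0// !sqrf_eq0 !subr_eq0 => /andP[/eqP e1 /eqP e2].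
exact: eq_cplx.
Qed.

(** The second hyperbolic law of cosines: if the product has trace 2 cos l, the triangle has angles
    h, k and pi - l, and [kappa] is the cosh of the side joining the first two vertices. *)
Lemma tr_rotmM h k p q : \tr (rotm h p * rotm k q) / 2 =
  cos h * cos k - sin h * sin k * kappa p q.
Proof.
have e z : Jm z 1 1 = - Jm z 0 0 by rewrite /Jm !mx2E mulNr.
by rewrite /kappa /rotm !trmx2E !(mulmx2E, addmx2E, scalemx2E, onemx2E) !e; field.
Qed.

Lemma signed_area_mobius (g : 'M[R]_2) p q r : \det g = 1 -> inH p -> inH q -> inH r ->
  signed_area (mobius g p) (mobius g q) (mobius g r) = signed_area p q r.
Proof.
move=> d p0 q0 r0; rewrite !signed_areaE//; try exact: mobius_inH.
by rewrite !Larg_mobius//; ring.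
Qed.

Lemma rotm_i (h : R) : rotm h 'i = mx2 (cos h) (- sin h) (sin h) (cos h).
Proof. by apply: mx2_eq; rewrite !mxE2 /normsq /=; field. Qed.

Lemma to_i p : inH p -> exists2 g : 'M[R]_2, \det g = 1 & mobius g p = 'i.
Proof.
rewrite /inH => p0; pose s := Num.sqrt (complex.Im p).
have s0 : 0 < s by rewrite sqrtr_gt0.
have sn : s != 0 by rewrite gt_eqF.
have s2 : s ^+ 2 = complex.Im p by rewrite sqr_sqrtr// ltW.
exists (mx2 s^-1 (- complex.Re p / s) 0 s).
  by rewrite detmx2E !mxE2 mulr0 subr0 mulVf.
rewrite mobiusE//; last by rewrite detmx2E !mxE2 mulr0 subr0 mulVf.
by apply: eq_cplx; rewrite /jden !mxE2 /= -s2; field.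
Qed.

Lemma to_axis p q : inH p -> inH q -> exists2 g : 'M[R]_2, \det g = 1 &
  mobius g p = 'i /\ exists2 t : R, 0 < t & mobius g q = 0 +i* t.
Proof.
move=> p0 q0; have [g1 d1 e1] := to_i p0.
have q1 := mobius_inH d1 q0; set w := mobius g1 q in q1.
have [th thE] : exists th : R, complex.Re (mobius (rotm th 'i) w) = 0.
  pose u := complex.Re w; pose n := normsq w.
  have [u0|un] := eqVneq u 0.
    exists 0; rewrite mobiusE ?det_rotm// rotm_i /= !mxE2 cos0 sin0 -/u u0.
    by rewrite !(mulr0, mul0r, addr0, oppr0).
  (* After the rotation by [th] about i the real part has numerator (n - 1) sin ph / 2 + u cos ph
     with ph = 2 th; it vanishes when [ph] has cotangent [c]. *)
  pose c := (1 - n) / (2 * u); pose ph := pi / 2 - atan c.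
  exists (ph / 2); rewrite mobiusE ?det_rotm//= rotm_i !mxE2 -/u.
  set C := cos (ph / 2); set S := sin (ph / 2).
  have e2 : cos ph = C ^+ 2 - S ^+ 2.
    by rewrite {1}(_ : ph = ph / 2 + ph / 2); [rewrite cosD !expr2|lra].
  have e3 : sin ph = 2 * (C * S).
    by rewrite {1}(_ : ph = ph / 2 + ph / 2); [rewrite sinD -/C -/S; ring|lra].
  have e4 : cos ph = c * sin ph.
    rewrite /ph cos_pi2B sin_atan; congr (_ * _).
    by rewrite -[RHS]cos_pi2B opprB addrCA subrr addr0.
  have cu : 2 * u * c = 1 - n by rewrite /c; field.
  have nE : complex.Im w ^+ 2 = n - u ^+ 2 by rewrite /n /normsq addrAC subrr add0r.
  apply/eqP; rewrite mulf_eq0; apply/orP; left; rewrite nE.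
  rewrite (_ : _ + _ = (n - 1) * (C * S) + u * (C ^+ 2 - S ^+ 2)); last by ring.
  rewrite -e2 e4 e3; apply/eqP; rewrite (_ : u * _ = (2 * u * c) * (C * S)); last by ring.
  by rewrite cu; ring.
have dr : \det (rotm th 'i) = 1 by exact: det_rotm.
exists (rotm th 'i * g1); first by rewrite detM2 dr d1 mulr1.
rewrite !mobiusM// e1; split.
  by apply/mobius_eq => //; exact: rotm_comm.
exists (complex.Im (mobius (rotm th 'i) w)); first exact: mobius_inH.
by apply: eq_cplx => //=; rewrite -thE.
Qed.

Lemma Larg_reflect z (t : R) : Larg (- complex.Re z +i* complex.Im z) (0 +i* t) = - Larg z (0 +i* t).
Proof. by rewrite /Larg /= !sub0r opprK mulNr atanN opprK. Qed.

Lemma hang_ang_mul A B z : posell A -> posell B -> posell (A * B) -> inH z ->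
  ang (A * B) z = ang A (mobius B z) + ang B z.
Proof.
move=> [dA cA tA] [dB cB tB] [dAB cAB tAB] z0.
have p1 := polar_ang z0 cAB.
have p2 := polarM (polar_ang (mobius_inH dB z0) cA) (polar_ang z0 cB).
rewrite -autfM// in p2; apply: (polar_inj p1 p2).
have /andP[a0 a1] := ang_bounds (A * B) z.
have /andP[b0 b1] := ang_bounds B z.
have /andP[d0 d1] := ang_bounds A (mobius B z).
by rewrite ltr_norml; apply/andP; split; lra.
Qed.

Lemma mobius_rotm h p : inH p -> mobius (rotm h p) p = p.
Proof. by move=> p0; apply/mobius_eq => //; [exact: det_rotm|exact: rotm_comm]. Qed.

(** Gauss-Bonnet for a triangle with angles h, k and pi - l, where l is the angle of the product.
    With p and q on the imaginary axis, the second rotation sends the third vertex r to its mirror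
    image, so [Larg] to a point of the axis only changes sign. [Larg_mobius] for each rotation then
    gives the two sides at r, and the two arguments occurring add up to l. *)
Lemma triangle_area h k p q : 0 < h < pi -> 0 < k < pi -> inH p -> inH q ->
  posell (rotm h p * rotm k q) ->
  signed_area p q (fixpt (rotm h p * rotm k q)) = hang (rotm h p * rotm k q) - h - k.
Proof.
wlog [pE [t t0 qE]] : p q / p = 'i /\ exists2 t : R, 0 < t & q = 0 +i* t => [H|].
  move=> h0 k0 p0 q0 pAB.
  have [g d [gp [t t0 gq]]] := to_axis p0 q0.
  have gp0 := mobius_inH d p0; have gq0 := mobius_inH d q0.
  have [dAB cAB tAB] := pAB; have r0 := fixpt_inH dAB tAB.
  have e : rotm h (mobius g p) * rotm k (mobius g q) = g * (rotm h p * rotm k q) * g^-1.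
    by rewrite -!rotm_conj// !mulrA divrK ?unit_det1.
  have pAB' := posell_conj pAB d.
  have := H (mobius g p) (mobius g q); rewrite e => /(_ _ h0 k0 gp0 gq0 pAB') H'.
  have e2 : g * (rotm h p * rotm k q) * g^-1 =
      rotm (hang (rotm h p * rotm k q)) (mobius g (fixpt (rotm h p * rotm k q))).
    by rewrite {1}(posell_rotm pAB) rotm_conj.
  rewrite -(signed_area_mobius d p0 q0 r0).
  have gr0 := mobius_inH d r0; have l0 := hang_bounds (rotm h p * rotm k q).
  move: H'; rewrite e2 fixpt_rotm// hang_rotm//; apply.
  by split => //; exists t.
move=> h0 k0 p0 q0 pAB.
set A := rotm h p in pAB *; set B := rotm k q in pAB *.
have pA : posell A by exact: rotm_posell.
have pB : posell B by exact: rotm_posell.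
have [dA cA tA] := pA; have [dB cB tB] := pB; have [dAB cAB tAB] := pAB.
set r := fixpt (A * B); have r0 : inH r by exact: fixpt_inH.
have ABr : mobius (A * B) r = r by apply/mobius_eq => //; exact: fixpt_comm.
(* Reflection in the axis inverts [A] and [B], hence carries A B to the inverse of B A; and [B] maps
   the fixed point of A B to that of B A. *)
have rr : mobius B r = - complex.Re r +i* complex.Im r.
  have B0 := mobius_inH dB r0.
  have fB : fixpt (B * A) = mobius B r.
    apply: fixpt_uniq => //; first by rewrite detM2 dA dB mulr1.
      by rewrite mulmx2E /A /B !rotm10 /= pE qE; move: cAB; rewrite mulmx2E /A /B pE qE !mxE2 /normsq /= => cAB; rewrite gt_eqF//; move: cAB; congr (_ < _); field; rewrite gt_eqF.
    apply/mobius_eq => //; first by rewrite detM2 dA dB mulr1.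
    by rewrite mobiusM// -(mobiusM dA dB)// ABr.
  have dBA : \det (B * A) = 1 by rewrite detM2 dA dB mulr1.
  have trBA : \tr (B * A) = \tr (A * B) by rewrite mxtraceM.
  have tBA : (\tr (B * A)) ^+ 2 < 4 by rewrite trBA.
  rewrite -fB (fixptE dBA tBA) /r (fixptE dAB tAB) /=.
  have e10 : (B * A) 1 0 = (A * B) 1 0.
    by rewrite /A /B pE qE !mxE2 /normsq /=; field; rewrite gt_eqF.
  apply: eq_cplx; last by rewrite /= /fix_im trBA e10.
  rewrite /= /fix_re e10 -mulNr opprB; congr (_ / _).
  by rewrite /A /B pE qE !mxE2 /normsq /=; field; rewrite gt_eqF.
have lE : hang (A * B) = ang A (mobius B r) + ang B r.
  by rewrite -ang_fixpt// -/r (hang_ang_mul pA pB pAB r0).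
have Bq : mobius B q = q by exact: mobius_rotm.
have Ap : mobius A p = p by exact: mobius_rotm.
have e1 := Larg_mobius dB r0 q0.
have e2 := Larg_mobius dA (mobius_inH dB r0) p0.
rewrite Bq in e1; rewrite Ap -mobiusM// ABr in e2.
have aBq : ang B q = k by rewrite -[RHS](hang_rotm k0 q0) -ang_fixpt// fixpt_rotm.
have aAp : ang A p = h by rewrite -[RHS](hang_rotm h0 p0) -ang_fixpt// fixpt_rotm.
rewrite aBq rr qE Larg_reflect in e1; rewrite aAp rr pE Larg_reflect in e2.
rewrite signed_areaE// lE [Larg q r]LargC qE pE.
have -> : Larg ('i : R[i]) (0 +i* t) = 0 by rewrite /Larg /= subrr mul0r atan0.
rewrite rr -/('i : R[i]) in e2 *; lra.
Qed.

Lemma cos_hang A : posell A -> cos (hang A) = \tr A / 2.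
Proof. by move=> pA; rewrite {2}(posell_rotm pA) tr_rotm; field. Qed.

Lemma cos_lt (x y : R) : 0 <= x -> y <= pi -> x < y -> cos y < cos x.
Proof.
move=> x0 y1 xy; rewrite -subr_gt0.
have s1 : 0 < sin ((x + y) / 2) by apply: sin_gt0_pi; apply/andP; split; lra.
have s2 : 0 < sin ((y - x) / 2) by apply: sin_gt0_pi; apply/andP; split; lra.
have -> : cos x - cos y = 2 * (sin ((x + y) / 2) * sin ((y - x) / 2)).
  have cx : cos x = cos ((x + y) / 2 - (y - x) / 2) by congr cos; lra.
  have cy : cos y = cos ((x + y) / 2 + (y - x) / 2) by congr cos; lra.
  by rewrite cx cy cosB cosD; ring.
by rewrite mulr_gt0// mulr_gt0.
Qed.

Lemma cos_le (x y : R) : 0 <= x <= pi -> 0 <= y <= pi -> (cos x <= cos y) = (y <= x).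
Proof.
move=> /andP[x0 x1] /andP[y0 y1]; have [h|h] := leP y x.
  by move: h; rewrite le_eqVlt => /predU1P[->|h]; [exact: lexx|apply/ltW/cos_lt].
by apply/negbTE; rewrite -ltNge cos_lt.
Qed.

Lemma posell01 A : posell A -> A 0 1 < 0.
Proof.
move=> [d c0 t]; have z0 := fixpt_inH d t.
have [-> _] := (comm_Jm A z0).1 (fixpt_comm d t).
rewrite mulNr oppr_lt0 mulr_gt0// /normsq.
by rewrite ltr_wpDl ?sqr_ge0// exprn_gt0.
Qed.

(** Once h + k < pi is known, [kappa] >= 1 in the law of cosines gives cos l <= cos (h + k). *)
Lemma triangle_angles h k p q : 0 < h < pi -> 0 < k < pi -> inH p -> inH q ->
  posell (rotm h p * rotm k q) -> h + k <= hang (rotm h p * rotm k q).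
Proof.
move=> h0 k0 p0 q0 pAB.
have hk : h + k < pi.
  rewrite ltNge; apply/negP => hk.
  have s0 : sin (h + k) <= 0.
    have : 0 <= sin (h + k - pi).
      by apply: sin_ge0_pi; move/andP: h0 => [? ?]; move/andP: k0 => [? ?]; apply/andP; split; lra.
    by rewrite sinB cospi sinpi mulr0 subr0 mulrN1; lra.
  have [g d [gp [t t0 gq]]] := to_axis p0 q0.
  have e : rotm h 'i * rotm k (0 +i* t) = g * (rotm h p * rotm k q) * g^-1.
    by rewrite -gp -gq -!rotm_conj// !mulrA divrK ?unit_det1.
  have pAB' := posell_conj pAB d; rewrite -e in pAB'.
  have [_ c0 _] := pAB'; have b0 := posell01 pAB'.
  move: c0 b0; rewrite rotm_i !mxE2 /normsq /= => c0 b0.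
  rewrite sinD in s0.
  (* The off-diagonal entries of a positive elliptic matrix have opposite known signs. For centres i
     and i t they combine to (1 + t) sin (h + k). *)
  have c1 : 0 < (1 + t) * (sin h * cos k + cos h * sin k).
    have t' : 0 < t * (sin h * (cos k + sin k * (0 / t)) + cos h * (sin k / t)).
      rewrite mulr_gt0//; move: c0; congr (_ < _); field; rewrite gt_eqF//.
    move: t'; have -> : t * (sin h * (cos k + sin k * (0 / t)) + cos h * (sin k / t)) =
       t * (sin h * cos k) + cos h * sin k by field; rewrite gt_eqF.
    move: b0; rewrite (_ : _ + _ = - (t * (cos h * sin k) + sin h * cos k)); last first.
      by field; rewrite gt_eqF.
    nra.
  have t1 : 0 < 1 + t by rewrite addr_gt0.
  by move: c1; rewrite (pmulr_rgt0 _ t1); lra.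
have /andP[l0 l1] := hang_bounds (rotm h p * rotm k q).
move/andP: h0 => [h0 h1]; move/andP: k0 => [k0 k1].
rewrite -cos_le; [|by apply/andP; split; lra..].
rewrite cos_hang// tr_rotmM cosD lerD2l lerN2 ler_peMr ?kappa_ge1//.
by rewrite mulr_ge0// sin_ge0_pi//; apply/andP; split; lra.
Qed.

(** The law of cosines prescribes the trace, hence ellipticity and the angle up to the lift. If the
    lower left entry were negative, the off-diagonal signs of the opposite product would give (1 +
    t) sin (h + k) < 0, although h + k < pi. *)
Lemma triangle_compose h k l p q : 0 < h -> 0 < k -> h + k <= l < pi ->
  inH p -> inH q -> cos l = cos h * cos k - sin h * sin k * kappa p q ->
  posell (rotm h p * rotm k q) /\ hang (rotm h p * rotm k q) = l.
Proof.
move=> h0 k0 /andP[l0 l1] p0 q0 lE.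
have lb : 0 < l < pi by apply/andP; split; lra.
have trE : \tr (rotm h p * rotm k q) = 2 * cos l.
  by rewrite lE -tr_rotmM; field.
have d : \det (rotm h p * rotm k q) = 1 by rewrite detM2 !det_rotm// mulr1.
have t4 : (\tr (rotm h p * rotm k q)) ^+ 2 < 4.
  rewrite trE; have := sin_gt0_pi lb; have := cos2Dsin2 l => h1 h2.
  by have : 0 < sin l ^+ 2 by [rewrite exprn_gt0]; nra.
suff pAB : posell (rotm h p * rotm k q).
  split => //; have lb' := hang_bounds (rotm h p * rotm k q).
  have := cos_hang pAB; rewrite trE (_ : _ / 2 = cos l); last by field.
  move=> e; apply: cos_inj => //; rewrite in_itv /=.
    by case/andP: lb' => ? ?; rewrite !ltW.
  by case/andP: lb => ? ?; rewrite !ltW.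
split => //.
have [g dg [gp [t t0 gq]]] := to_axis p0 q0.
set M := rotm h p * rotm k q in d t4 trE *.
have e : rotm h 'i * rotm k (0 +i* t) = g * M * g^-1.
  by rewrite -gp -gq -!rotm_conj// !mulrA divrK ?unit_det1.
have [c0|c0|c0] := ltgtP 0 (M 1 0) => //; last first.
  by have := ell_c d t4; rewrite -c0 eqxx.
have pN : posell (- M).
  split; first by rewrite detN2.
    by rewrite oppmx2E oppr_gt0.
  by rewrite trmx2E !oppmx2E -opprD sqrrN -trmx2E.
have pN' := posell_conj pN dg.
have [_ c1 _] := pN'; have b1 := posell01 pN'.
move: c1 b1; rewrite mulrN mulNr -e rotm_i !mxE2 /normsq /= => c1 b1.
have s0 : 0 < sin (h + k) by apply: sin_gt0_pi; apply/andP; split; lra.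
rewrite sinD in s0; exfalso.
have c2 : (1 + t) * (sin h * cos k + cos h * sin k) < 0.
  have t' : 0 < t * - (sin h * (cos k + sin k * (0 / t)) + cos h * (sin k / t)).
    by rewrite mulr_gt0//; move: c1; congr (_ < _); field; rewrite gt_eqF.
  move: t'; have -> : t * - (sin h * (cos k + sin k * (0 / t)) + cos h * (sin k / t)) =
     - (t * (sin h * cos k) + cos h * sin k) by field; rewrite gt_eqF.
  move: b1; rewrite (_ : - (_ + _) = (t * (cos h * sin k) + sin h * cos k)); last first.
    by field; rewrite gt_eqF.
  nra.
have t1 : 0 < 1 + t by rewrite addr_gt0.
by move: c2; rewrite (pmulr_rlt0 _ t1); lra.
Qed.

End Triangles.

(** * Smooth functions *)

Section Smooth.
Context {R : realType}.

Section Ck.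
Context {V W : normedModType R}.
Implicit Types (O : set V) (f g : V -> W).

(** A recursion on the order of differentiation, equivalent to [smooth_on] when all orders are taken
    together and suited to induction. *)
Fixpoint Ck k O f : Prop :=
  match k with
  | 0 => forall x, O x -> {for x, continuous f}
  | k'.+1 => (forall x, O x -> {for x, continuous f} /\ forall v, derivable f x v) /\
             forall v, Ck k' O (fun x => 'D_v f x)
  end.

Lemma iter_derive_rcons vs v f :
  iter_derive (rcons vs v) f = iter_derive vs (fun x => 'D_v f x).
Proof. by rewrite /iter_derive -cats1 foldr_cat. Qed.

Lemma smooth_onP O f : smooth_on O f <-> forall k, Ck k O f.
Proof.
split=> [s k|h].
  elim: k f s => [|k IH] f s.
    by move=> x Ox; have [] := s [::] x Ox.
  split=> [x Ox|v]; first exact: s [::] x Ox.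
  by apply: IH => vs x Ox; rewrite -iter_derive_rcons; exact: s.
move=> vs; elim/last_ind: vs f h => [|vs v IH] f h x Ox.
  by have [+ _] := h 1%N; exact.
rewrite iter_derive_rcons; apply: IH => // k.
by have [_ +] := h k.+1; exact.
Qed.

Lemma Ck_continuous k O f x : Ck k O f -> O x -> {for x, continuous f}.
Proof. by case: k => [|k] /=; [exact|move=> [h _] /h[]]. Qed.

Lemma Ck_derivable k O f x v : Ck k.+1 O f -> O x -> derivable f x v.
Proof. by move=> [h _] /h[_]; exact. Qed.

Lemma Ck_le k O f : Ck k.+1 O f -> Ck k O f.
Proof.
elim: k f => [|k IH] f [h1 h2]; first by move=> x /h1[].
by split=> // v; exact/IH/h2.
Qed.

Lemma Ck_sub k O O' f : O' `<=` O -> Ck k O f -> Ck k O' f.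
Proof.
move=> s; elim: k f => [|k IH] f; first by move=> h x /s/h.
by move=> [h1 h2]; split=> [x /s/h1//|v]; exact/IH/h2.
Qed.

Lemma eq_Ck k O f g : open O -> (forall x, O x -> f x = g x) -> Ck k O f -> Ck k O g.
Proof.
move=> oO.
have near_fg f1 g1 x : (forall x, O x -> f1 x = g1 x) -> O x -> {near x, f1 =1 g1}.
  by move=> e Ox; have := open_nbhs_nbhs (conj oO Ox); apply: filterS => y /e.
elim: k f g => [|k IH] f g e.
  move=> h x Ox; rewrite /prop_for /continuous_at -e//.
  apply: cvg_trans (h x Ox); apply: near_eq_cvg.
  by have := near_fg _ _ _ e Ox; apply: filterS => y ->.
move=> [h1 h2]; split => [x Ox|v].
  have [c d] := h1 x Ox; split.
    rewrite /prop_for /continuous_at -e//.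
    apply: cvg_trans c; apply: near_eq_cvg.
    by have := near_fg _ _ _ e Ox; apply: filterS => y ->.
  by move=> v; apply: near_eq_derivable (d v); exact: near_fg.
by apply: IH (h2 v) => x Ox; apply: near_eq_derive; exact: near_fg.
Qed.

Lemma derivable_continuous_cst (w : W) k O : Ck k O (fun=> w).
Proof.
elim: k w => [|k IH] w; first by move=> x _; exact: cvg_cst.
split=> [x _|v]; first by split=> [|v]; [exact: cvg_cst|exact: derivable_cst].
have -> : 'D_v (fun=> w : W) = (fun=> 0) by apply/funext => x; exact: derive_cst.
exact: IH.
Qed.

Lemma CkD k O f g : open O -> Ck k O f -> Ck k O g -> Ck k O (fun x => f x + g x).
Proof.
move=> oO; elim: k f g => [|k IH] f g.
  by move=> hf hg x Ox; apply: cvgD; [exact: hf|exact: hg].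
move=> [f1 f2] [g1 g2]; split=> [x Ox|v].
  have [cf df] := f1 x Ox; have [cg dg] := g1 x Ox.
  by split=> [|v]; [exact: cvgD|exact: derivableD].
apply: (eq_Ck oO _ (IH _ _ (f2 v) (g2 v))) => x Ox.
by rewrite -deriveD//; [exact: (f1 x Ox).2|exact: (g1 x Ox).2].
Qed.

Lemma Ck_sum (I : finType) k O (F : I -> V -> W) : open O -> (forall i, Ck k O (F i)) ->
  Ck k O (fun x => \sum_i F i x).
Proof.
move=> oO h; rewrite (_ : (fun x => _) = fun x => \sum_(i <- enum I) F i x); last first.
  by apply/funext => x; rewrite big_enum.
elim: (enum I) => [|i s IH].
  apply: (eq_Ck oO _ (@derivable_continuous_cst 0 k O)) => x _; by rewrite big_nil.
apply: (eq_Ck oO _ (CkD oO (h i) IH)) => x _; by rewrite big_cons.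
Qed.

End Ck.

Section CkLin.
Context {V W W' : normedModType R}.

Lemma is_derive_linear (g : V -> W) (L : {linear W -> W'}) (x v : V) : continuous L ->
  derivable g x v -> is_derive x v (L \o g) (L ('D_v g x)).
Proof.
move=> cL dg; have h : (fun h => h^-1 *: ((L \o g \o shift x) (h *: v) - (L \o g) x)) @ 0^' --> L ('D_v g x).
  rewrite (_ : (fun h => _) = L \o (fun h => h^-1 *: ((g \o shift x) (h *: v) - g x))).
    by apply: continuous_cvg; [exact: cL|exact: dg].
  apply/funext => t; rewrite [RHS]/= linearZ_LR; congr (_ *: _).
  by rewrite linearB.
split; last exact/cvg_lim.
by apply/cvg_ex; exists (L ('D_v g x)).
Qed.

Lemma Ck_linear k (O : set V) (f : V -> W) (L : {linear W -> W'}) : open O ->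
  continuous L -> Ck k O f -> Ck k O (L \o f).
Proof.
move=> oO cL; have D g x v := @is_derive_linear g L x v cL.
elim: k f => [|k IH] f.
  by move=> hf x Ox; apply: continuous_comp; [exact: hf|exact: cL].
move=> [f1 f2]; split=> [x Ox|v].
  have [cf df] := f1 x Ox; split=> [|v].
    by apply: continuous_comp; [exact: cf|exact: cL].
  by have [] := D f x v (df v).
apply: (eq_Ck oO _ (IH _ (f2 v))) => x Ox /=.
by have [_ ->] := D f x v ((f1 x Ox).2 v).
Qed.

End CkLin.

Section CkScal.
Context {V : normedModType R}.
Implicit Types (O : set V) (f g : V -> R).

Lemma CkM k O f g : open O -> Ck k O f -> Ck k O g -> Ck k O (fun x => f x * g x).
Proof.
move=> oO; elim: k f g => [|k IH] f g.
  by move=> hf hg x Ox; apply: cvgM; [exact: hf|exact: hg].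
move=> hf hg; have [f1 f2] := hf; have [g1 g2] := hg; split=> [x Ox|v].
  have [cf df] := f1 x Ox; have [cg dg] := g1 x Ox.
  by split=> [|v]; [exact: cvgM|exact: derivableM].
have h1 := IH _ _ (Ck_le hf) (g2 v); have h2 := IH _ _ (Ck_le hg) (f2 v).
apply: (eq_Ck oO _ (CkD oO h1 h2)) => x Ox.
by rewrite -[RHS]/('D_v (f * g) x) deriveM//; [exact: (f1 x Ox).2|exact: (g1 x Ox).2].
Qed.

End CkScal.

(** Finite dimension in the form needed: finitely many continuous linear coordinates and vectors
    that reconstruct every point. The instances are the reals, matrices and pairs of row vectors. *)
Record coords_of (W : normedModType R) := CoordsOf {
  cidx : finType;
  cvec : cidx -> W;
  cfun : cidx -> {linear W -> R^o};
  cfun_continuous : forall i, continuous (cfun i);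
  cfunK : forall w, w = \sum_i cfun i w *: cvec i }.

Arguments cidx {W} c.
Arguments cvec {W} c i.
Arguments cfun {W} c i.
Arguments cfunK {W} c w.
Arguments cfun_continuous {W} c i.

Section Compose.
Context {V W : normedModType R} (B : coords_of W).

Lemma Ck_coords k (O : set V) (F : V -> W) : open O ->
  (forall i, Ck k O (fun x => cfun B i (F x) : R)) -> Ck k O F.
Proof.
move=> oO h; apply: (eq_Ck oO (fun x _ => esym (cfunK B (F x)))).
apply: Ck_sum => // i.
have cL : continuous (fun r : R^o => r *: cvec B i).
  by move=> r; apply: cvgZr_tmp; exact: cvg_id.
have lL : linear (fun r : R^o => r *: cvec B i).
  by move=> a x y; rewrite scalerDl scalerA.
pose L := GRing.isLinear.Build _ _ _ _ _ lL.
pose L' : {linear R^o -> W} := HB.pack (fun r : R^o => r *: cvec B i) L.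
exact: (@Ck_linear _ _ _ _ _ (fun x => cfun B i (F x)) L').
Qed.

Lemma coords_Ck k (O : set V) (F : V -> W) i : open O -> Ck k O F -> Ck k O (fun x => cfun B i (F x) : R).
Proof. by move=> oO; apply: Ck_linear => //; exact: cfun_continuous. Qed.

Lemma derive_line (g : W -> R) (w e : W) (t : R) : derivable g (w + t *: e) e ->
  is_derive t 1 (fun t : R => g (w + t *: e)) ('D_e g (w + t *: e)).
Proof.
have E : (fun h : R => h^-1 *: (((fun t : R => g (w + t *: e)) \o shift t) (h *: 1) - g (w + t *: e))) =
   (fun h : R => h^-1 *: ((g \o shift (w + t *: e)) (h *: e) - g (w + t *: e))).
  apply/funext => h /=; congr (_ *: (g _ - _)).
  by rewrite [h *: 1]mulr1 scalerDl addrCA.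
move=> d; split; last by rewrite /derive E.
by rewrite /derivable E.
Qed.

(** The mean value theorem in one direction, uniform in the base point [w] near [w0]. The uniformity
    allows coordinates to be changed one at a time. *)
Lemma increment_bound (g : W -> R) O (w0 e : W) (eps : R) : open O -> O w0 -> Ck 1 O g -> 0 < eps ->
  exists2 r, 0 < r & forall w (d : R), `|w - w0| < r -> `|d| < r ->
    `|g (w + d *: e) - g w - d * 'D_e g w0| <= eps * `|d|.
Proof.
move=> oO Ow0 [g1 g2] eps0.
have cD : {for w0, continuous (fun x => 'D_e g x)} by exact: g2.
have [r1 r10 h1] : exists2 r, 0 < r & forall w, `|w - w0| < r -> O w.
  have /nbhs_normP[r /= r0 h] := open_nbhs_nbhs (conj oO Ow0).
  by exists r => // w wr; apply: h; rewrite /ball_/= distrC.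
have [r2 r20 h2] : exists2 r, 0 < r & forall w, `|w - w0| < r -> `|'D_e g w - 'D_e g w0| <= eps.
  move/cvgrPdist_le : cD => /(_ _ eps0) /nbhs_normP[r /= r0 h].
  by exists r => // w wr; rewrite distrC; apply: h; rewrite /ball_/= distrC.
pose m := Num.min r1 r2.
have m0 : 0 < m by rewrite lt_min r10.
pose r := m / (1 + `|e|).
have e1 : 0 < 1 + `|e| by rewrite ltr_pwDl.
have r0 : 0 < r by rewrite divr_gt0.
exists r => // w d wr dr.
have near_m t : `|t| <= `|d| -> `|w + t *: e - w0| < m.
  move=> td; rewrite addrAC; apply: (le_lt_trans (ler_normD _ _)).
  rewrite normrZ; have -> : m = r + r * `|e| by rewrite /r; field; rewrite gt_eqF.
  apply: ltr_leD => //; apply: ler_wpM2r => //.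
  by rewrite (le_trans td)// ltW.
have dl (t : R) : `|t| <= `|d| -> is_derive t 1 (fun t : R => g (w + t *: e)) ('D_e g (w + t *: e)).
  move=> td; apply: derive_line; apply: (g1 _ _).2; apply: h1.
  by rewrite (lt_le_trans (near_m t td))// ge_min lexx.
have bd (t : R) : `|t| <= `|d| -> `|'D_e g (w + t *: e) - 'D_e g w0| <= eps.
  by move=> td; apply: h2; rewrite (lt_le_trans (near_m t td))// ge_min lexx orbT.
have [c cd cE] : exists2 c, `|c| <= `|d| & g (w + d *: e) - g w = 'D_e g (w + c *: e) * d.
  have [d0|d0] := leP 0 d.
    have nt t : t \in `[0, d] -> `|t| <= `|d|.
      by rewrite in_itv/= => /andP[a b]; rewrite !ger0_norm.
    have [||c cI cE] := @MVT_segment R (fun t => g (w + t *: e)) (fun t => 'D_e g (w + t *: e)) 0 d d0.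
    - by move=> t tI; apply/dl/nt; apply: subset_itv_oo_cc tI.
    - apply: derivable_within_continuous => t /nt td; by have [] := dl t td.
    by exists c; [exact: nt|move: cE; rewrite scale0r addr0 subr0].
  have nt t : t \in `[d, 0] -> `|t| <= `|d|.
    by rewrite in_itv/= => /andP[a b]; rewrite !ler0_norm ?lerN2// (le_trans a b).
  have [||c cI cE] := @MVT_segment R (fun t => g (w + t *: e)) (fun t => 'D_e g (w + t *: e)) d 0 (ltW d0).
  - by move=> t tI; apply/dl/nt; apply: subset_itv_oo_cc tI.
  - apply: derivable_within_continuous => t /nt td; by have [] := dl t td.
  exists c; first exact: nt.
  by move: cE; rewrite scale0r addr0 sub0r mulrN => /(congr1 -%R); rewrite opprB opprK.
rewrite cE [d * _]mulrC -mulrBl normrM.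
by apply: ler_wpM2r => //; exact: bd.
Qed.

(** Along a broken path parallel to the axes the errors add up; continuous partial derivatives thus
    yield a linear approximation. *)
Lemma increment_sum (g : W -> R) O (w0 : W) (eps : R) (s : seq (cidx B)) : open O -> O w0 ->
  Ck 1 O g -> 0 < eps ->
  exists2 r, 0 < r & forall w (d : cidx B -> R), `|w - w0| < r -> (forall i, `|d i| < r) ->
    `|g (w + \sum_(i <- s) d i *: cvec B i) - g w - \sum_(i <- s) d i * 'D_(cvec B i) g w0|
      <= eps * \sum_(i <- s) `|d i|.
Proof.
move=> oO Ow0 g1 eps0; elim: s => [|i s [r r0 IH]].
  by exists 1 => // w d _ _; rewrite !big_nil addr0 subrr subr0 normr0 mulr0.
have [r' r'0 h] := increment_bound (cvec B i) oO Ow0 g1 eps0.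
pose e1 := 1 + `|cvec B i|.
have e10 : 0 < e1 by rewrite ltr_pwDl.
exists (Num.min r' (r / e1)); first by rewrite lt_min r'0 divr_gt0.
have re : r / e1 <= r by rewrite ler_pdivrMr// /e1 mulrDr mulr1 lerDl mulr_ge0// ltW.
move=> w d; rewrite lt_min => /andP[w1 w2] hd.
have di j : `|d j| < r' /\ `|d j| < r / e1 by apply/andP; rewrite -lt_min.
rewrite !big_cons addrA; set w' := w + d i *: cvec B i.
have h1 := h w (d i) w1 (di i).1.
have w'r : `|w' - w0| < r.
  rewrite /w' addrAC; apply: (le_lt_trans (ler_normD _ _)); rewrite normrZ.
  have -> : r = r / e1 + r / e1 * `|cvec B i| by rewrite /e1; field; rewrite gt_eqF.
  by apply: ltr_leD => //; apply: ler_wpM2r => //; apply/ltW/(di i).2.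
have h2 := IH w' d w'r (fun j => lt_le_trans (di j).2 re).
set S := \sum_(j <- s) _ * _ in h2 *; set T := \sum_(j <- s) _ *: _ in h2 *.
rewrite mulrDr.
have -> : g (w' + T) - g w - (d i * 'D_(cvec B i) g w0 + S) =
  (g w' - g w - d i * 'D_(cvec B i) g w0) + (g (w' + T) - g w' - S) by ring.
by apply: (le_trans (ler_normD _ _)); apply: lerD.
Qed.

Lemma cvg_sumr (I T : Type) (s : seq I) (G : set_system T) (f : I -> T -> R) (l : I -> R) :
  Filter G -> (forall i, f i @ G --> l i) ->
  (fun t => \sum_(i <- s) f i t) @ G --> \sum_(i <- s) l i.
Proof.
move=> FG h; elim: s => [|i s IH].
  by rewrite big_nil; under eq_fun do rewrite big_nil; exact: cvg_cst.
by rewrite big_cons; under eq_fun do rewrite big_cons; exact: cvgD.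
Qed.

(** The chain rule from partial derivatives. Near 0 the difference quotients of the coordinates of
    [F] are bounded, so the error in [increment_sum] stays small after division by the increment. *)
Lemma derive_compose (g : W -> R) O (F : V -> W) (x v : V) : open O -> O (F x) -> Ck 1 O g ->
  (forall i, derivable (fun y => cfun B i (F y) : R) x v) ->
  is_derive x v (g \o F) (\sum_i 'D_(cvec B i) g (F x) * 'D_v (fun y => cfun B i (F y) : R) x).
Proof.
move=> oO OF g1 dF.
pose a i := 'D_(cvec B i) g (F x); pose b i := 'D_v (fun y => cfun B i (F y) : R) x.
pose q i (h : R) : R := h^-1 * (cfun B i (F (h *: v + x)) - cfun B i (F x)).
have qb i : q i @ 0^' --> b i by exact: dF.
suff H : (fun h : R => h^-1 *: ((g \o F \o shift x) (h *: v) - (g \o F) x)) @ 0^' --> \sum_i a i * b i.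
  by split; [apply/cvg_ex; exists (\sum_i a i * b i)|exact/cvg_lim].
have Hq : (fun h => \sum_i a i * q i h) @ 0^' --> \sum_i a i * b i.
  apply: (@cvg_sumr _ _ (index_enum (cidx B)) (0^') (fun i h => a i * q i h) (fun i => a i * b i)) => i.
  by apply: cvgM; [exact: cvg_cst|exact: qb].
suff H0 : (fun h : R => h^-1 *: ((g \o F \o shift x) (h *: v) - (g \o F) x) - \sum_i a i * q i h) @ 0^' --> (0 : R).
  have H1 := cvgD H0 Hq; rewrite add0r in H1.
  pose A (h : R) : R := h^-1 *: ((g \o F \o shift x) (h *: v) - (g \o F) x).
  rewrite -/A (_ : A = (fun h => A h - \sum_i a i * q i h) + (fun h => \sum_i a i * q i h)).
    exact: H1.
  by apply/funext => h; rewrite -[RHS]/(_ - _ + _) subrK.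
apply/cvgrPdist_le => eps eps0.
pose M := \sum_i (`|b i| + 1).
have M0 : 0 <= M by apply: sumr_ge0 => i _; rewrite addr_ge0.
have eM : 0 < eps / (M + 1) by rewrite divr_gt0// ltr_wpDl.
have [r r0 hr] := increment_sum (index_enum (cidx B)) oO OF g1 eM.
have hq i : \forall h \near 0^', `|q i h| <= `|b i| + 1.
  have /cvgrPdist_le/(_ 1 ltr01) := qb i; apply: filterS => h hh.
  rewrite -lerBlDl; apply: le_trans (lerB_dist _ _) _; by rewrite distrC.
have hd i : \forall h \near 0^', `|h * q i h| < r.
  have : (fun h => h * q i h) @ 0^' --> 0 * b i.
    by apply: cvgM; [exact: nbhs_dnbhs|exact: qb].
  rewrite mul0r => /cvgrPdist_lt/(_ _ r0); apply: filterS => h.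
  by rewrite sub0r normrN.
have hq' : \forall h \near 0^', forall i, `|q i h| <= `|b i| + 1 by exact: filter_forall.
have hd' : \forall h \near 0^', forall i, `|h * q i h| < r by exact: filter_forall.
near=> h.
have hn : h != 0 by near: h; exact: nbhs_dnbhs_neq.
have h1 : forall i, `|q i h| <= `|b i| + 1 by near: h.
have h2 : forall i, `|h * q i h| < r by near: h.
have hE i : h * q i h = cfun B i (F (h *: v + x)) - cfun B i (F x) by rewrite /q mulVKf.
have := hr (F x) (fun i => h * q i h) _ h2; rewrite subrr normr0 => /(_ r0).
have -> : F x + \sum_i (h * q i h) *: cvec B i = F (h *: v + x).
  rewrite [RHS](cfunK B) [F x in LHS](cfunK B) -big_split /=.
  by apply: eq_bigr => i _; rewrite hE -scalerDl addrC subrK.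
move=> H; rewrite sub0r normrN /=.
have hi : 0 < `|h|^-1 by rewrite invr_gt0 normr_gt0.
have -> : h^-1 *: (g (F (h *: v + x)) - g (F x)) - \sum_i a i * q i h =
   h^-1 * (g (F (h *: v + x)) - g (F x) - \sum_i (h * q i h) * a i).
  rewrite mulrBr; congr (_ - _); rewrite mulr_sumr; apply: eq_bigr => i _.
  by field.
rewrite normrM normfV mulrC ler_pdivrMr ?normr_gt0//; apply: (le_trans H).
have -> : \sum_i `|h * q i h| = `|h| * \sum_i `|q i h|.
  by rewrite mulr_sumr; apply: eq_bigr => i _; rewrite normrM.
rewrite mulrCA mulrC; apply: ler_wpM2r => //.
rewrite mulrAC ler_pdivrMr ?ltr_wpDl//; apply: ler_wpM2l; first exact: ltW.
apply: (@le_trans _ _ M); last by rewrite lerDl.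
by apply: ler_sum => i _.
Unshelve. all: by end_near. Qed.

(** By the chain rule the derivative of a composite is a sum of products, each factor being of the
    same kind and of order one less. *)
Theorem Ck_compose k (O : set V) (O1 : set W) (g : W -> R) (F : V -> W) : open O -> open O1 ->
  (forall x, O x -> O1 (F x)) -> Ck k O F -> Ck k O1 g -> Ck k O (g \o F).
Proof.
move=> oO oO1 FO; elim: k g => [|k IH] g hF hg.
  by move=> x Ox; apply: continuous_comp; [exact: hF|exact/hg/FO].
have dF x v i : O x -> derivable (fun y => cfun B i (F y) : R) x v.
  by move=> Ox; exact: Ck_derivable (coords_Ck i oO hF) Ox.
have g1 : Ck 1 O1 g by elim: (k) hg => // j IHj /Ck_le.
have D x v (Ox : O x) := derive_compose oO1 (FO x Ox) g1 (fun i => dF x v i Ox).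
split=> [x Ox|v].
  split=> [|v]; last by have [] := D x v Ox.
  apply: continuous_comp; first exact: Ck_continuous hF Ox.
  exact: Ck_continuous hg (FO _ Ox).
have h : Ck k O (fun x => \sum_i 'D_(cvec B i) g (F x) * 'D_v (fun y => cfun B i (F y) : R) x).
  apply: Ck_sum => // i; apply: CkM => //.
    by apply: (IH (fun w => 'D_(cvec B i) g w) (Ck_le hF)); exact: hg.2.
  exact: (coords_Ck i oO hF).2.
apply: (eq_Ck oO _ h) => x Ox.
by have [_ <-] := D x v Ox.
Qed.

End Compose.

Lemma idr_linear : linear (fun x : R^o => x : R^o).
Proof. by []. Qed.

Definition coordsR : coords_of (R : normedModType R).
Proof.
pose L : {linear (R : normedModType R) -> R^o} :=
  HB.pack (fun x : R^o => x : R^o) (GRing.isLinear.Build _ _ _ _ _ idr_linear).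
refine (@CoordsOf R unit (fun=> 1 : R) (fun=> L) _ _).
- by move=> _ x; exact: cvg_id.
- move=> w; rewrite (bigD1 tt) //= big1 ?addr0.
    by rewrite [_ *: _]mulr1.
  by case.
Defined.

Section CoordsMx.
Variables m n : nat.

Lemma coord_linear (i : 'I_m) (j : 'I_n) : linear (fun M : 'M[R]_(m, n) => M i j : R^o).
Proof. by move=> a x y; rewrite !mxE. Qed.

Definition coordsMx : coords_of ('M[R]_(m, n) : normedModType R).
Proof.
refine (@CoordsOf _ ('I_m * 'I_n)%type (fun p => delta_mx p.1 p.2)
  (fun p => HB.pack (fun M : 'M[R]_(m, n) => M p.1 p.2 : R^o)
     (GRing.isLinear.Build _ _ _ _ _ (coord_linear p.1 p.2))) _ _).
- by move=> [i j]; exact: coord_continuous.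
- move=> w; rewrite {1}[w]matrix_sum_delta pair_bigA /=.
  by apply: eq_bigr.
Defined.

End CoordsMx.

Section CoordsPair.
Variables k l : nat.
Let W := ('rV[R]_k * 'rV[R]_l)%type.

Lemma fst_coord_linear (j : 'I_k) : linear (fun p : W => p.1 ord0 j : R^o).
Proof. by move=> a x y; rewrite !mxE. Qed.

Lemma snd_coord_linear (j : 'I_l) : linear (fun p : W => p.2 ord0 j : R^o).
Proof. by move=> a x y; rewrite !mxE. Qed.

Definition coordsPair : coords_of (W : normedModType R).
Proof.
refine (@CoordsOf _ ('I_k + 'I_l)%type
  (fun s => match s with inl j => (delta_mx ord0 j, 0) | inr j => (0, delta_mx ord0 j) end : W)
  (fun s => match s with
     | inl j => HB.pack (fun p : W => p.1 ord0 j : R^o)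
         (GRing.isLinear.Build _ _ _ _ _ (fst_coord_linear j))
     | inr j => HB.pack (fun p : W => p.2 ord0 j : R^o)
         (GRing.isLinear.Build _ _ _ _ _ (snd_coord_linear j)) end) _ _).
- case=> j p.
  + apply: (@continuous_comp _ _ _ fst (fun M : 'rV[R]_k => M ord0 j)); first exact: cvg_fst.
    exact: coord_continuous.
  + apply: (@continuous_comp _ _ _ snd (fun M : 'rV[R]_l => M ord0 j)); first exact: cvg_snd.
    exact: coord_continuous.
- move=> [a b]; rewrite big_sumType /=.
  apply: injective_projections => /=.
    rewrite (raddf_sum fst) (raddf_sum fst) /= [X in _ + X]big1 ?addr0.
      by rewrite {1}[a]row_sum_delta.
    by move=> j _; rewrite scaler0.
  rewrite (raddf_sum snd) (raddf_sum snd) /= [X in X + _]big1 ?add0r.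
    by rewrite {1}[b]row_sum_delta.
  by move=> j _; rewrite scaler0.
Defined.

End CoordsPair.

Section OneVariable.
Implicit Types (U : set R) (f g : R -> R).

Lemma is_derive_dir f (x d v : R) : is_derive x 1 f d -> is_derive x v f (v * d).
Proof.
move=> [df <-]; have df' : differentiable f x by exact/derivable1_diffP.
split; first exact: diff_derivable.
by rewrite !deriveE// -[v in LHS]mulr1 -[v * 1]/(v *: 1) linearZ.
Qed.

(** In one variable D_v f = v f'. Smoothness of sine, cosine, inverse and square root follows by
    induction on the order, since their derivatives are built from these same functions. *)
Lemma Ck_primitive k U f g : open U -> (forall x, U x -> is_derive x 1 f (g x)) ->
  Ck k U g -> Ck k.+1 U f.
Proof.
move=> oU D hg; split=> [x Ux|v].
  have [df _] := D x Ux; split.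
    by apply: differentiable_continuous; exact/derivable1_diffP.
  by move=> v; have [] := is_derive_dir v (D x Ux).
apply: (eq_Ck oU _ (CkM oU (@derivable_continuous_cst _ _ v k U) hg)) => x Ux.
by have [_ ->] := is_derive_dir v (D x Ux).
Qed.

Lemma Ck_id1 k U : open U -> Ck k U (fun x : R => x).
Proof.
move=> oU; case: k => [|k]; first by move=> x _; exact: cvg_id.
by apply: (@Ck_primitive k U id (fun=> 1)) => //; exact: derivable_continuous_cst.
Qed.

Lemma CkN1 k U f : open U -> Ck k U f -> Ck k U (fun x => - f x).
Proof.
move=> oU hf; have := CkM oU (@derivable_continuous_cst R R (-1) k U) hf.
by apply: eq_Ck => // x _; rewrite mulN1r.
Qed.

Lemma Ck_cos_sin k U : open U -> Ck k U (@cos R) /\ Ck k U (@sin R).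
Proof.
move=> oU; elim: k => [|k [IHc IHs]].
  by split=> x _; [exact: continuous_cos|exact: continuous_sin].
split.
  by apply: (Ck_primitive oU _ (CkN1 oU IHs)) => x _; exact: is_derive_cos.
by apply: (Ck_primitive oU _ IHc) => x _; exact: is_derive_sin.
Qed.

Let neq0 : set R := [set x | x != 0].
Let open_neq0 : open neq0.
Proof. by rewrite (_ : neq0 = ~` [set 0]); [apply: closed_openC; exact: closed_eq|apply/seteqP; split => x /= /eqP]. Qed.

Lemma Ck_inv1 k : Ck k neq0 (fun x : R => x^-1).
Proof.
elim: k => [|k IH]; first by move=> x x0; exact: inv_continuous.
apply: (Ck_primitive open_neq0 _ (CkN1 open_neq0 (CkM open_neq0 IH IH))) => x x0.
have := @is_deriveV _ id x 1 1 x0 (is_derive_id _ _).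
by rewrite /GRing.scale /= mulr1 -expr2 exprVn.
Qed.

End OneVariable.

Section Operations.
Context {V : normedModType R}.
Variables (O : set V) (oO : open O).
Implicit Types (f g : V -> R).

Lemma Ck_comp1 k (U : set R) f (h : R -> R) : open U -> (forall x, O x -> U (f x)) ->
  Ck k O f -> Ck k U h -> Ck k O (fun x => h (f x)).
Proof. by move=> oU fU hf hh; exact: (Ck_compose coordsR oO oU fU hf hh). Qed.

Definition Cinf f := forall k, Ck k O f.

Lemma Cinf_cst (c : R) : Cinf (fun=> c).
Proof. by move=> k; exact: derivable_continuous_cst. Qed.

Lemma CinfD f g : Cinf f -> Cinf g -> Cinf (fun x => f x + g x).
Proof. by move=> hf hg k; exact: CkD. Qed.

Lemma CinfM f g : Cinf f -> Cinf g -> Cinf (fun x => f x * g x).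
Proof. by move=> hf hg k; exact: CkM. Qed.

Lemma CinfX f n : Cinf f -> Cinf (fun x => f x ^+ n).
Proof.
move=> hf; elim: n => [|n IH]; first exact: Cinf_cst.
by move=> k; have := CinfM hf IH k; apply: eq_Ck => // x _; rewrite exprS.
Qed.

Lemma CinfV f : (forall x, O x -> f x != 0) -> Cinf f -> Cinf (fun x => (f x)^-1).
Proof.
move=> f0 hf k; apply: (Ck_comp1 _ f0 (hf k) (Ck_inv1 k)).
by rewrite (_ : [set x : R | x != 0] = ~` [set 0]); [apply: closed_openC; exact: closed_eq|apply/seteqP; split => x /= /eqP].
Qed.

Lemma Cinf_cos f : Cinf f -> Cinf (fun x => cos (f x)).
Proof. by move=> hf k; apply: (Ck_comp1 openT _ (hf k) (Ck_cos_sin k openT).1). Qed.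

Lemma Cinf_sin f : Cinf f -> Cinf (fun x => sin (f x)).
Proof. by move=> hf k; apply: (Ck_comp1 openT _ (hf k) (Ck_cos_sin k openT).2). Qed.

End Operations.

Lemma Ck_sqrt1 k : Ck k [set x : R | 0 < x] Num.sqrt.
Proof.
have oU : open [set x : R | 0 < x] by exact: open_gt.
elim: k => [|k IH]; first by move=> x _; exact: sqrt_continuous.
have h : Ck k [set x : R | 0 < x] (fun x => (2 * Num.sqrt x)^-1).
  apply: (Ck_comp1 oU (U := [set x | x != 0]) (f := fun x => 2 * Num.sqrt x)).
  - by rewrite (_ : [set x : R | x != 0] = ~` [set 0]); [apply: closed_openC; exact: closed_eq|apply/seteqP; split => x /= /eqP].
  - by move=> x /= x0; rewrite mulf_neq0// gt_eqF// sqrtr_gt0.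
  - by apply: CkM => //; exact: derivable_continuous_cst.
  - exact: Ck_inv1.
by apply: (Ck_primitive oU _ h) => x x0; exact: is_derive1_sqrt.
Qed.

Lemma Ck_atan1 k : Ck k setT (@atan R).
Proof.
case: k => [|k]; first by move=> x _; exact: continuous_atan.
apply: (@Ck_primitive k setT _ (fun x => (1 + x ^+ 2)^-1)) => //; first exact: openT.
apply: CinfV => //; first exact: openT.
  by move=> x _; rewrite gt_eqF// ltr_pwDl// sqr_ge0.
apply: CinfD => //; [exact: openT|exact: Cinf_cst|].
by apply: CinfX; [exact: openT|move=> j; exact: Ck_id1 openT].
Qed.

Section Operations2.
Context {V : normedModType R}.
Variables (O : set V) (oO : open O).
Implicit Types (f g : V -> R).

Lemma Cinf_sqrt f : (forall x, O x -> 0 < f x) -> Cinf O f -> Cinf O (fun x => Num.sqrt (f x)).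
Proof. move=> f0 hf k; have oU : open [set x : R | 0 < x] by exact: open_gt.
exact: (@Ck_comp1 V O oO k [set x : R | 0 < x] f Num.sqrt oU f0 (hf k) (Ck_sqrt1 k)). Qed.

Lemma Cinf_atan f : Cinf O f -> Cinf O (fun x => atan (f x)).
Proof. by move=> hf k; apply: (Ck_comp1 oO openT _ (hf k) (Ck_atan1 k)). Qed.

End Operations2.

Lemma Ck_id (V : normedModType R) k (O : set V) : open O -> Ck k O (fun x => x).
Proof.
move=> oO; case: k => [|k]; first by move=> x _; exact: cvg_id.
split=> [x _|v]; first by split=> [|v]; [exact: cvg_id|exact: derivable_id].
apply: (eq_Ck oO _ (@derivable_continuous_cst _ _ v k O)) => x _.
by rewrite -[RHS]/('D_v id x) derive_id.
Qed.

Lemma Cinf_coord m n (O : set 'M[R]_(m, n)) i j : open O -> Cinf O (fun M : 'M[R]_(m, n) => M i j).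
Proof.
move=> oO k.
exact: (@coords_Ck _ _ (coordsMx m n) k O id (i, j) oO (Ck_id k oO)).
Qed.

End Smooth.

(** * Rays and angles *)

Section Rays.
Context {R : realType}.
Implicit Types (g : 'M[R]_2) (z w u : R[i]).

(* A positive multiple of cayley z w, polynomial in the coordinates. *)
Definition dirv z w : R[i] :=
  ((complex.Re w - complex.Re z) ^+ 2 + complex.Im w ^+ 2 - complex.Im z ^+ 2)
  +i* (- 2 * complex.Im z * (complex.Re w - complex.Re z)).

Definition cden z w : R := (complex.Re w - complex.Re z) ^+ 2 + (complex.Im w + complex.Im z) ^+ 2.

Lemma cden_gt0 z w : inH z -> inH w -> 0 < cden z w.
Proof. by move=> z0 w0; rewrite ltr_wpDl ?sqr_ge0// exprn_gt0// addr_gt0. Qed.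

Lemma conj_neq z w : inH z -> inH w -> w - conjc z != 0.
Proof.
move=> z0 w0; have := cden_gt0 z0 w0; apply: contraTneq; rewrite /cden.
case: z {z0} => x y; case: w {w0} => p q /= /eqP; rewrite eq_complex /= opprK => /andP[/eqP -> /eqP ->].
by rewrite expr0n addr0 ltxx.
Qed.

Lemma cayleyE z w : inH z -> inH w -> cayley z w = (cden z w)^-1%:C * dirv z w.
Proof.
move=> z0 w0; have n0 := conj_neq z0 w0; have := cden_gt0 z0 w0; rewrite /cayley.
move=> d0; apply: (mulIf n0); rewrite divfK//.
have dn : cden z w != 0 by rewrite gt_eqF.
have e : (cden z w)%:C * (w - z) = dirv z w * (w - conjc z).
  case: z {z0 n0 d0 dn} => x y; case: w {w0} => p q.
  by apply: eq_cplx; rewrite /cden /dirv /=; ring.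
rewrite -mulrA -e mulrA -rmorphM /= mulVf// mul1r.
by [].
Qed.

Lemma normsqM z w : normsq (z * w) = normsq z * normsq w.
Proof. by case: z => x y; case: w => p q; rewrite /normsq /=; ring. Qed.

Lemma normsqC (r : R) : normsq (r%:C) = r ^+ 2.
Proof. by rewrite /normsq /= expr0n addr0. Qed.

Lemma normsq_ge0 z : 0 <= normsq z.
Proof. by rewrite /normsq addr_ge0// sqr_ge0. Qed.

Lemma normsq_eq0 z : (normsq z == 0) = (z == 0).
Proof. by rewrite /normsq paddr_eq0 ?sqr_ge0// !sqrf_eq0 eq_complex. Qed.

Lemma mul_conj z : z * conjc z = (normsq z)%:C.
Proof. by case: z => x y; apply: eq_cplx; rewrite /normsq /=; ring. Qed.

(** This is tanh (d / 2)^2 in terms of cosh d: the Cayley map turns the hyperbolic distance d from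
    [z] into the Euclidean radius tanh (d / 2). *)
Lemma normsq_cayley z w : inH z -> inH w ->
  normsq (cayley z w) = (kappa z w - 1) / (kappa z w + 1).
Proof.
move=> z0 w0; rewrite cayleyE// normsqM normsqC kappaE//.
have dn : cden z w != 0 by rewrite gt_eqF// cden_gt0.
move: z0 w0; rewrite /inH => z0 w0.
set a := _ + (complex.Im z - _) ^+ 2; set b := 2 * _.
have bn : b != 0 by rewrite gt_eqF// mulr_gt0// mulr_gt0.
have e1 : 1 + a / b - 1 = a / b by rewrite addrAC subrr add0r.
have e2 : 1 + a / b + 1 = cden z w / b.
  by apply: (mulIf bn); rewrite !mulrDl !divfK// /a /b /cden; ring.
have e3 : normsq (dirv z w) = a * cden z w by rewrite /normsq /dirv /a /cden /=; ring.
by rewrite e1 e2 e3; field; rewrite bn dn.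
Qed.

Lemma cayley_eq0 z w : inH z -> inH w -> (cayley z w == 0) = (z == w).
Proof.
move=> z0 w0; rewrite /cayley mulf_eq0 invr_eq0 (negbTE (conj_neq z0 w0)) orbF subr_eq0.
by rewrite eq_sym.
Qed.

Lemma cayley_inj z w w' : inH z -> inH w -> inH w' -> cayley z w = cayley z w' -> w = w'.
Proof.
move=> z0 w0 w0' e; have n0 := conj_neq z0 w0; have n0' := conj_neq z0 w0'.
have e' : (w - z) * (w' - conjc z) = (w' - z) * (w - conjc z).
  apply: (mulIf (invr_neq0 n0)); rewrite mulfK// mulrAC -/(cayley z w) e /cayley.
  by rewrite divfK.
have : (w - w') * (z - conjc z) = 0.
  transitivity ((w - z) * (w' - conjc z) - (w' - z) * (w - conjc z)); first by ring.
  by rewrite e' subrr.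
move=> /eqP; rewrite mulf_eq0 => /orP[|]; first by rewrite subr_eq0 => /eqP.
case: z {e e' n0 n0'} z0 => x y; rewrite /inH /= => y0.
rewrite eq_complex /= => /andP[_]; rewrite opprK -mulr2n mulrn_eq0 /= => /eqP y00.
by move: y0; rewrite y00 ltxx.
Qed.

(** The inverse of [cayley z], namely (z - u conj z) / (1 - u), in real coordinates. *)
Definition pt z u : R[i] :=
  (complex.Re z - 2 * complex.Im z * complex.Im u / ((1 - complex.Re u) ^+ 2 + complex.Im u ^+ 2))
  +i* (complex.Im z * (1 - normsq u) / ((1 - complex.Re u) ^+ 2 + complex.Im u ^+ 2)).

Lemma pt_den_gt0 u : normsq u < 1 -> 0 < (1 - complex.Re u) ^+ 2 + complex.Im u ^+ 2.
Proof.
rewrite /normsq => u1; rewrite lt_neqAle addr_ge0 ?sqr_ge0// andbT eq_sym.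
rewrite paddr_eq0 ?sqr_ge0// !sqrf_eq0 subr_eq0; apply/negP => /andP[/eqP e1 /eqP e2].
by move: u1; rewrite -e1 e2 expr0n addr0 expr1n ltxx.
Qed.

Lemma pt_inH z u : inH z -> normsq u < 1 -> inH (pt z u).
Proof.
move=> z0 u1; rewrite /inH /pt /= divr_gt0 ?pt_den_gt0// mulr_gt0//.
by rewrite subr_gt0.
Qed.

Lemma cayley_pt z u : inH z -> normsq u < 1 -> cayley z (pt z u) = u.
Proof.
move=> z0 u1; have d0 := pt_den_gt0 u1; have w0 := pt_inH z0 u1.
have n0 := conj_neq z0 w0; rewrite /cayley; apply: (mulIf n0); rewrite divfK//.
move: d0 {n0 w0 u1}; case: z z0 => x y; rewrite /inH; case: u => a b /= y0 d0.
have dn : (1 - a) ^+ 2 + b ^+ 2 != 0 by rewrite gt_eqF.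
by apply: eq_cplx; rewrite /pt /normsq /=; field.
Qed.

(** An isometry multiplies the Cayley coordinate by the unit number conj(j) / j, where j is its
    automorphy factor at the centre; so angles between rays are preserved. *)
Lemma cayley_mobius g z w : \det g = 1 -> inH z -> inH w ->
  cayley (mobius g z) (mobius g w) * autf g z = conjc (autf g z) * cayley z w.
Proof.
move=> d z0 w0; have jz := jden_neq0 d z0; have jw := jden_neq0 d w0.
have n0 := conj_neq z0 w0.
have n1 := conj_neq (mobius_inH d z0) (mobius_inH d w0).
have dd : (g 0 0)%:C * (g 1 1)%:C - (g 0 1)%:C * (g 1 0)%:C = 1 :> R[i].
  by rewrite -!rmorphM -rmorphB -detmx2E d.
have e1 : (mobius g w - mobius g z) * (autf g w * autf g z) = w - z.
  rewrite /mobius /autf; transitivity (((g 0 0)%:C * (g 1 1)%:C - (g 0 1)%:C * (g 1 0)%:C) * (w - z)).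
    by field; rewrite jz jw.
  by rewrite dd mul1r.
have e2 : (mobius g w - conjc (mobius g z)) * (autf g w * conjc (autf g z)) = w - conjc z.
  have cj (p q : R) : conjc (p%:C * z + q%:C) = p%:C * conjc z + q%:C.
    by case: (z) => ? ?; apply: eq_cplx; rewrite /=; ring.
  have jz' : (g 1 0)%:C * conjc z + (g 1 1)%:C != 0 by rewrite -cj conjc_eq0.
  have cd (x y : R[i]) : conjc (x / y) = conjc x / conjc y by rewrite rmorphM /= fmorphV.
  rewrite /mobius /autf cd !cj.
  transitivity (((g 0 0)%:C * (g 1 1)%:C - (g 0 1)%:C * (g 1 0)%:C) * (w - conjc z)).
    by field; rewrite jz' jw.
  by rewrite dd mul1r.
have cz : conjc (autf g z) != 0 by rewrite conjc_eq0.
rewrite /cayley -e1 -e2.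
set A := mobius g w - mobius g z; set B := mobius g w - _ in n1 *.
by field; rewrite n1 cz /autf jw.
Qed.

Lemma polar_exists u : u != 0 -> exists2 t : R, 0 <= t < 2 * pi & polar u t.
Proof.
case: u => a b un; have p0 := pi_gt0 R.
have [b0|b0|b0] := ltgtP b 0.
- have b0' : 0 < - b by rewrite oppr_gt0.
  have := polar_acot a b0' => /polar_conj; rewrite /= opprK => h.
  have bd : 0 < pi / 2 - atan (a / - b) < pi.
    by have := atan_gtNpi2 (a / - b); have := atan_ltpi2 (a / - b) => h1 h2; apply/andP; split; lra.
  case/andP: bd => b1 b2.
  exists (2 * pi - (pi / 2 - atan (a / - b))); first by apply/andP; split; lra.
  by have [r r0 e] := h; exists r => //; rewrite cisD cis_2pi mul1r.
- exists (pi / 2 - atan (a / b)); last exact: polar_acot.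
  by have := atan_gtNpi2 (a / b); have := atan_ltpi2 (a / b) => h1 h2; apply/andP; split; lra.
- have [a0|a0|a0] := ltgtP a 0.
  + exists pi; first by apply/andP; split; lra.
    exists (- a); first by rewrite oppr_gt0.
    by rewrite cis_pi b0; apply: eq_cplx; rewrite /=; ring.
  + exists 0; first by apply/andP; split; lra.
    by exists a => //; rewrite cis0 b0 mulr1.
  + by move: un; rewrite a0 b0 eqxx.
Qed.

Lemma ray_angleP z w w' : inH z -> inH w -> inH w' -> z != w -> z != w' ->
  0 <= ray_angle z w w' < 2 * pi /\
  polar (cayley z w' * conjc (cayley z w)) (ray_angle z w w').
Proof.
move=> z0 w0 w0' zw zw'.
have cw : cayley z w != 0 by rewrite cayley_eq0.
have cw' : cayley z w' != 0 by rewrite cayley_eq0.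
have nw : 0 < normsq (cayley z w) by rewrite lt_neqAle normsq_ge0 andbT eq_sym normsq_eq0.
pose P : set R := [set t | 0 <= t < 2 * pi /\
    exists2 r : R, 0 < r & cayley z w' = r%:C * cis t * cayley z w].
have u0 : cayley z w' * conjc (cayley z w) != 0 by rewrite mulf_neq0// conjc_eq0.
have [t tb [r r0 e]] := polar_exists u0.
have Pt : P t.
  split => //; exists (r / normsq (cayley z w)); first by rewrite divr_gt0.
  have cn : conjc (cayley z w) != 0 by rewrite conjc_eq0.
  apply: (mulIf cn); rewrite e -[RHS]mulrA mul_conj [RHS]mulrAC -rmorphM /= divfK// gt_eqF//.
rewrite /ray_angle -/P; have [h1 [s s0 h2]] := xgetI 0 Pt.
split => //; exists (s * normsq (cayley z w)); first exact: mulr_gt0.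
by rewrite h2 -mulrA mul_conj rmorphM /=; ring.
Qed.

Lemma polar_scale (r : R) u (t : R) : 0 < r -> polar (r%:C * u) t <-> polar u t.
Proof.
move=> r0; split => [[s s0 e]|[s s0 ->]].
  exists (s / r); first exact: divr_gt0.
  have rn : r%:C != 0 :> R[i] by rewrite eq_complex /= eqxx andbT gt_eqF.
  apply: (mulfI rn); rewrite e [RHS]mulrA -rmorphM /= [r * _]mulrC divfK// gt_eqF//.
by exists (r * s); [exact: mulr_gt0|rewrite rmorphM /= mulrA].
Qed.

Lemma polar_dirv z w w' (t : R) : inH z -> inH w -> inH w' ->
  polar (cayley z w' * conjc (cayley z w)) t <-> polar (dirv z w' * conjc (dirv z w)) t.
Proof.
move=> z0 w0 w0'; rewrite !cayleyE//.
have d1 : 0 < (cden z w')^-1 by rewrite invr_gt0 cden_gt0.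
have d2 : 0 < (cden z w)^-1 by rewrite invr_gt0 cden_gt0.
have -> : (cden z w')^-1%:C * dirv z w' * conjc ((cden z w)^-1%:C * dirv z w) =
  ((cden z w')^-1 * (cden z w)^-1)%:C * (dirv z w' * conjc (dirv z w)).
  by case: (dirv z w) => a b; case: (dirv z w') => c e; apply: eq_cplx; rewrite /=; ring.
by apply: polar_scale; exact: mulr_gt0.
Qed.

Lemma ray_angle_uniq z w w' (t : R) : inH z -> inH w -> inH w' -> z != w -> z != w' ->
  polar (cayley z w' * conjc (cayley z w)) t -> eqmod2pi (ray_angle z w w') t.
Proof.
move=> z0 w0 w0' zw zw' h; have [_ h'] := ray_angleP z0 w0 w0' zw zw'.
exact/eqmod2piP/(polar_cis h' h).
Qed.

Lemma ray_angle_mobius g z w w' : \det g = 1 -> inH z -> inH w -> inH w' -> z != w -> z != w' ->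
  ray_angle (mobius g z) (mobius g w) (mobius g w') = ray_angle z w w'.
Proof.
move=> d z0 w0 w0' zw zw'.
have ginj u v : inH u -> inH v -> mobius g u = mobius g v -> u = v.
  by move=> u0 v0 e; rewrite -(mobiusK d u0) e mobiusK.
have h : [set t : R | 0 <= t < 2 * pi /\
    exists2 r : R, 0 < r & cayley (mobius g z) (mobius g w') = r%:C * cis t * cayley (mobius g z) (mobius g w)] =
   [set t : R | 0 <= t < 2 * pi /\
    exists2 r : R, 0 < r & cayley z w' = r%:C * cis t * cayley z w].
  have jz : autf g z != 0 := jden_neq0 d z0.
  have jz' : conjc (autf g z) != 0 by rewrite conjc_eq0.
  apply/seteqP; split => t /= [tb [r r0 e]]; split => //; exists r => //.
    by apply: (mulfI jz'); rewrite -cayley_mobius// e -mulrA cayley_mobius//; ring.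
  by apply: (mulIf jz); rewrite cayley_mobius// e -[RHS]mulrA cayley_mobius//; ring.
by rewrite /ray_angle h.
Qed.

End Rays.

(** * The chain of triangles *)

Section DeroinTholozan.
Context {R : realType} {n : nat}.
Implicit Types (X Y : mtuple R n) (alpha : 'I_n -> R).

Lemma fixpt_inv (A : 'M[R]_2) : \det A = 1 -> (\tr A) ^+ 2 < 4 -> fixpt A^-1 = fixpt A.
Proof.
move=> d t; apply: fixpt_uniq; rewrite ?det_inv1//.
- by rewrite invmx2// mx2E oppr_eq0 ell_c.
- exact: fixpt_inH.
- apply: (mulrI (unit_det1 d)); rewrite mulrA mulmxV2// mul1r mulrA fixpt_comm//.
  by rewrite -mulrA mulmxV2// mulr1.
Qed.

Section OneRep.
Variables (alpha : 'I_n -> R) (X : mtuple R n).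
Hypothesis n_gt2 : (2 < n)%N.
Hypothesis XDT : RepDT alpha X.

Let n_gt1 : (1 < n)%N. Proof. exact: ltnW. Qed.
Local Notation c := (ngen X).
Local Notation P := (prodc (ngen X)).

Lemma DT_Rep : Rep alpha X. Proof. by case: XDT. Qed.

Lemma DT_posell m : (1 <= m < n)%N -> posell (P m).
Proof. by have [_] := (RepDTP alpha X n_gt1).1 XDT; exact. Qed.

Lemma DT_c i : (1 <= i <= n)%N -> posell (c i).
Proof. exact: (Rep_posell DT_Rep). Qed.

Lemma Bpt_P i : (i.+1 < n)%N -> Bpt X i = fixpt (P i.+1).
Proof.
move=> h; have [d c0 t] := DT_posell (h : (1 <= i.+1 < n)%N).
rewrite /Bpt; case: (Rep_gens DT_Rep (ltnW h)) => ->; last first.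
  rewrite (_ : (- P i.+1)^-1 = - (P i.+1)^-1); last by rewrite invrN.
  by rewrite fixptN fixpt_inv.
exact: fixpt_inv.
Qed.

Lemma Cpt_c i : (1 <= i <= n)%N -> Cpt X i = fixpt (c i).
Proof. exact: (Cpt_ngen DT_Rep). Qed.

Lemma Bpt_inH i : (i.+1 < n)%N -> inH (Bpt X i).
Proof. by move=> h; rewrite Bpt_P//; have [d c0 t] := DT_posell (h : (1 <= i.+1 < n)%N); exact: fixpt_inH. Qed.

Lemma Cpt_inH i : (1 <= i <= n)%N -> inH (Cpt X i).
Proof. by move=> h; rewrite Cpt_c//; have [d c0 t] := DT_c h; exact: fixpt_inH. Qed.

Lemma prodc_rotm i : (i.+1 < n)%N -> P i.+1 = rotm (hang (P i.+1)) (Bpt X i).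
Proof. by move=> h; rewrite Bpt_P// -posell_rotm//; exact: DT_posell. Qed.

Lemma c_rotm i : (1 <= i <= n)%N -> c i = rotm (hang (c i)) (Cpt X i).
Proof. by move=> h; rewrite Cpt_c// -posell_rotm//; exact: DT_c. Qed.

Lemma n3_bound i : (i <= n - 3)%N -> (i.+2 < n)%N.
Proof. move: n_gt2; lia. Qed.

Lemma n_pred : (1 <= n.-1 < n)%N.
Proof. move: n_gt2; lia. Qed.

Lemma prodc_last : P n = P n.-1 * c n.
Proof. by have := prodcS c n.-1; rewrite prednK// ltnW. Qed.

Lemma area_paramE i : (i <= n - 3)%N ->
  area_param X i = 2 * (hang (P i.+2) - hang (P i.+1) - hang (c i.+2)).
Proof.
move=> /n3_bound h; have h1 : (i.+1 < n)%N by exact: ltnW.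
have h2 : (1 <= i.+2 <= n)%N by rewrite /= ltnW.
rewrite /area_param (Bpt_P h); congr (_ * _).
have e : P i.+2 = rotm (hang (P i.+1)) (Bpt X i) * rotm (hang (c i.+2)) (Cpt X i.+2).
  by rewrite -prodc_rotm// -c_rotm// -prodcS.
rewrite e triangle_area//; [exact: hang_bounds|exact: hang_bounds|exact: Bpt_inH|exact: Cpt_inH|].
by rewrite -e; exact: DT_posell.
Qed.

Lemma kappa_cos i : (i <= n - 3)%N -> cos (hang (P i.+2)) =
  cos (hang (P i.+1)) * cos (hang (c i.+2)) -
  sin (hang (P i.+1)) * sin (hang (c i.+2)) * kappa (Bpt X i) (Cpt X i.+2).
Proof.
move=> /n3_bound h; have h1 : (i.+1 < n)%N by exact: ltnW.
have h2 : (1 <= i.+2 <= n)%N by rewrite /= ltnW.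
rewrite cos_hang; last by apply: DT_posell; rewrite h.
by rewrite prodcS {1}(prodc_rotm h1) {1}(c_rotm h2) tr_rotmM.
Qed.

Lemma area_param_ge0 i : (i <= n - 3)%N -> 0 <= area_param X i.
Proof.
move=> hi; have h := n3_bound hi; have h1 : (i.+1 < n)%N by exact: ltnW.
have h2 : (1 <= i.+2 <= n)%N by rewrite /= ltnW.
rewrite area_paramE// mulr_ge0// -addrA -opprD subr_ge0.
have e : P i.+2 = rotm (hang (P i.+1)) (Bpt X i) * rotm (hang (c i.+2)) (Cpt X i.+2).
  by rewrite -prodc_rotm// -c_rotm// -prodcS.
rewrite [X in _ <= hang X]e; apply: triangle_angles; [exact: hang_bounds|exact: hang_bounds|exact: Bpt_inH|exact: Cpt_inH|].
by rewrite -e; exact: DT_posell.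
Qed.

(** The equality case of the law of cosines: the angles add exactly when [kappa] = 1. *)
Lemma area_param_eq0 i : (i <= n - 3)%N -> (area_param X i == 0) = (Bpt X i == Cpt X i.+2).
Proof.
move=> hi; have h := n3_bound hi; have h1 : (i.+1 < n)%N by exact: ltnW.
have h2 : (1 <= i.+2 <= n)%N by rewrite /= ltnW.
rewrite -(kappa_eq1 (Bpt_inH h1) (Cpt_inH h2)) area_paramE//.
have kc := kappa_cos hi.
set a := hang (P i.+1) in kc *; set b := hang (c i.+2) in kc *; set l := hang (P i.+2) in kc *.
have /andP[a0 a1] : 0 < a < pi := hang_bounds _.
have /andP[b0 b1] : 0 < b < pi := hang_bounds _.
have /andP[l0 l1] : 0 < l < pi := hang_bounds _.
have sab : 0 < sin a * sin b by rewrite mulr_gt0// sin_gt0_pi// ?a0 ?b0.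
have le : a + b <= l.
  by have := area_param_ge0 hi; rewrite area_paramE// -/a -/b -/l; lra.
apply/eqP/eqP => e.
  have lE : l = a + b by lra.
  move: kc; rewrite lE cosD => kc.
  by apply: (mulfI (lt0r_neq0 sab)); rewrite mulr1; lra.
move: kc; rewrite e mulr1 -cosD => kc.
have : l = a + b.
  by apply: cos_inj => //; rewrite in_itv/=; apply/andP; split; lra.
lra.
Qed.

(** If the product were 1, the lift of c_n would be the inverse of P_(n-1), whose lower left entry
    is negative. *)
Lemma DT_prodn : P n = -1.
Proof.
have := Rep_closes DT_Rep; rewrite /closes => -[] // e.
have [d c0 t] := DT_posell n_pred; have nn : (1 <= n <= n)%N by rewrite leqnn ltnW.
have [d' c0' t'] := DT_c nn.
have eI : c n = (P n.-1)^-1.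
  by apply: (mulrI (unit_det1 d)); rewrite -prodc_last e mulmxV2.
by move: c0'; rewrite eI invmx2// mx2E oppr_gt0 => /(lt_trans c0); rewrite ltxx.
Qed.

Lemma hang_Nrotm (h : R) (z : R[i]) : - (rotm h z) = rotm (h + pi) z.
Proof. by rewrite /rotm cosDpi sinDpi !scaleNr opprD. Qed.

Lemma rotmM (a b : R) (z : R[i]) : inH z -> rotm a z * rotm b z = rotm (a + b) z.
Proof.
by move=> z0; apply: mx2_eq; rewrite !mxE2 /normsq cosD sinD; field; rewrite gt_eqF.
Qed.

Lemma rotm0 (z : R[i]) : rotm 0 z = 1.
Proof. by rewrite /rotm cos0 sin0 scale1r scale0r addr0. Qed.

Lemma rotm_inv (h : R) (z : R[i]) : inH z -> (rotm h z)^-1 = rotm (- h) z.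
Proof.
move=> z0; have d := det_rotm h z0; apply: (mulrI (unit_det1 d)).
by rewrite mulmxV2// rotmM// subrr rotm0.
Qed.

Lemma DT_cn : c n = - (P n.-1)^-1.
Proof.
have [d _ _] := DT_posell n_pred.
by apply: (mulrI (unit_det1 d)); rewrite mulrN mulmxV2// -prodc_last DT_prodn.
Qed.

Lemma hang_last : hang (P n.-1) = pi - hang (c n).
Proof.
have pP := DT_posell n_pred; have [d c0 t] := pP; have z0 := fixpt_inH d t.
have /andP[l0 l1] := hang_bounds (P n.-1).
rewrite DT_cn {2}(posell_rotm pP) rotm_inv// hang_Nrotm hang_rotm//; first by lra.
by apply/andP; split; lra.
Qed.

Lemma hang_prodc m : (1 <= m < n)%N -> hang (P m) =
  \sum_(1 <= j < m.+1) hang (c j) + (\sum_(0 <= i < m.-1) area_param X i) / 2.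
Proof.
elim: m => [//|m IH] h; case: m IH h => [|m] IH h.
  by rewrite prodc1 big_nat1 big_geq// mul0r addr0.
have h1 : (1 <= m.+1 < n)%N by case/andP: h => _ /ltnW.
have hm : (m <= n - 3)%N by lia.
have := IH h1; rewrite [\sum_(1 <= j < m.+3) _]big_nat_recr//=.
rewrite [\sum_(0 <= i < m.+1) _]big_nat_recr//= (area_paramE hm); lra.
Qed.

Lemma sum_area : \sum_(0 <= i < n - 2) area_param X i = lambda alpha.
Proof.
have := hang_prodc n_pred; rewrite hang_last.
have := sum_hang DT_Rep; rewrite (big_nat_recr n)//=; last exact: ltnW.
rewrite prednK; last exact: ltnW.
have -> : (n.-1).-1 = (n - 2)%N by lia.
rewrite /lambda; lra.
Qed.

End OneRep.

End DeroinTholozan.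

(** * Reconstruction of the chain from areas and angles *)

Section Chain.
Context {R : realType} {n : nat}.
Implicit Types (X Y : mtuple R n) (alpha : 'I_n -> R).

Lemma gen_mk (f : 'I_n -> 'M[R]_2) (i : 'I_n) : gen (mk_mtuple f) i.+1 = f i.
Proof. by rewrite /gen/= (insubT (fun k => k < n)%N (ltn_ord i))/= rowK mxvecK (_ : Sub _ _ = i)//; apply: val_inj. Qed.

Lemma ngen_eq X (s : nat -> 'M[R]_2) i : 0 < s i 1 0 -> gen X i = s i \/ gen X i = - s i ->
  ngen X i = s i.
Proof.
rewrite /ngen => s0 [] ->; first by rewrite gtr0_sg// scale1r.
by rewrite mxE sgrN gtr0_sg// scaleN1r opprK.
Qed.

Lemma elliptic_posell A : posell A -> elliptic (A : 'M[R]_2).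
Proof. by move=> [d c0 t]; apply/ellipticP. Qed.

Lemma ellipticN A : elliptic (A : 'M[R]_2) -> elliptic (- A).
Proof.
move=> [a b [z z0 e]]; split; [by move/eqP; rewrite eqr_oppLR => /eqP|by move/oppr_inj|].
by exists z; rewrite ?mobiusN.
Qed.

Lemma rot_angleN (A : 'M[R]_2) : \det A = 1 -> (\tr A) ^+ 2 < 4 -> rot_angle (- A) = rot_angle A.
Proof.
move=> d t; rewrite !rot_angle_hang ?hangN ?detN2//.
by rewrite raddfN sqrrN.
Qed.

(** Normalising signs recovers [s] from any tuple that agrees with it up to signs, so the lifts may
    be chosen freely. This membership test serves conjugates, constructed chains and the torus
    action alike. *)
Lemma RepDT_chain alpha Y (s : nat -> 'M[R]_2) : (1 < n)%N ->
  (forall i, (1 <= i <= n)%N -> posell (s i)) ->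
  (forall i : 'I_n, hang (s i.+1) = pi - alpha i / 2) ->
  chain_pos n s -> closes n s ->
  (forall i, (1 <= i <= n)%N -> gen Y i = s i \/ gen Y i = - s i) ->
  RepDT alpha Y.
Proof.
move=> n1 ps hs cp cl gs.
have ng i : (1 <= i <= n)%N -> ngen Y i = s i.
  by move=> hi; apply: ngen_eq (gs i hi); case: (ps i hi).
have c0 i : (1 <= i <= n)%N -> gen Y i 1 0 != 0.
  by move=> hi; have [_ h _] := ps i hi; case: (gs i hi) => ->; rewrite ?mxE ?oppr_eq0 gt_eqF.
have en : prodc (ngen Y) n = prodc s n by apply: eq_prodc.
apply/RepDTP => //; split; last first.
  move=> m hm; rewrite (@eq_prodc _ _ s); first exact: cp.
  by move=> i hi; apply: ng; lia.
split.
- by move=> i hi; have [d _ _] := ps i hi; case: (gs i hi) => ->; rewrite ?detN2.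
- case: (gens_ngen c0) => ->; rewrite en; case: cl => ->; rewrite ?opprK; by [left|right].
- move=> i; have hi : (1 <= i.+1 <= n)%N by rewrite /= ltn_ord.
  have pi_ := ps _ hi; have [d p0 t] := pi_; split.
    by case: (gs _ hi) => ->; [|apply: ellipticN]; apply: elliptic_posell.
  have -> : rot_angle (gen Y i.+1) = rot_angle (s i.+1).
    by case: (gs _ hi) => ->; rewrite ?rot_angleN.
  by rewrite rot_angle_hang// hs; lra.
Qed.

End Chain.

Section Builder.
Context {R : realType}.
Implicit Types (B C z : R[i]) (i : nat).

(** Once the angle is known, the fixed point is a rational function of the entries; [bst] uses this
    form. *)
Lemma rotm_fix (h : R) z : 0 < h < pi -> inH z ->
  (((rotm h z) 0 0 - cos h) / (rotm h z) 1 0) +i* (sin h / (rotm h z) 1 0) = z.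
Proof.
move=> h0 z0; have s0 : 0 < sin h by exact: sin_gt0_pi.
by apply: eq_cplx; rewrite /rotm !mxE2 /=; field; rewrite !gt_eqF.
Qed.

(* The cosh of the side joining the vertices with angles h and k of the
   triangle with angles h, k and pi - l. *)
Definition side (h k l : R) : R := (cos h * cos k - cos l) / (sin h * sin k).

Lemma side_ge1 (h k l : R) : 0 < h -> 0 < k -> h + k <= l < pi -> 1 <= side h k l.
Proof.
move=> h0 k0 /andP[hl lp]; rewrite /side ler_pdivlMr; last by apply: mulr_gt0; apply: sin_gt0_pi; apply/andP; split; lra.
have : cos l <= cos (h + k) by rewrite cos_le//; apply/andP; split; lra.
rewrite cosD; lra.
Qed.

Lemma side_gt1 (h k l : R) : 0 < h -> 0 < k -> h + k < l < pi -> 1 < side h k l.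
Proof.
move=> h0 k0 /andP[hl lp]; rewrite /side ltr_pdivlMr; last by apply: mulr_gt0; apply: sin_gt0_pi; apply/andP; split; lra.
have : cos l < cos (h + k) by apply: cos_lt; lra.
rewrite cosD; lra.
Qed.

(** tanh (d / 2) for a side of length d: its Euclidean length in the Cayley disc centred at one
    end. *)
Definition side_rho (h k l : R) : R := Num.sqrt ((side h k l - 1) / (side h k l + 1)).

Lemma side_rho_sqr (h k l : R) : 0 < h -> 0 < k -> h + k <= l < pi ->
  side_rho h k l ^+ 2 = (side h k l - 1) / (side h k l + 1).
Proof.
move=> h0 k0 hl; have := side_ge1 h0 k0 hl => s1; rewrite sqr_sqrtr//.
by rewrite divr_ge0; lra.
Qed.

Lemma side_rho_lt1 (h k l : R) : 0 < h -> 0 < k -> h + k <= l < pi ->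
  side_rho h k l ^+ 2 < 1.
Proof.
move=> h0 k0 hl; have := side_ge1 h0 k0 hl => s1; rewrite side_rho_sqr//.
by rewrite ltr_pdivrMr; lra.
Qed.

Variables (H hc rho : nat -> R) (e : nat -> R[i] -> R[i] -> R[i]) (z0 : R[i]).

(* [(P, B, C)] is (phi(c_1 ... c_(i+1)), B_i, C_(i+1)). *)
Fixpoint bst i : 'M[R]_2 * R[i] * R[i] :=
  if i is j.+1 then
    let C := pt (bst j).1.2 ((rho j)%:C * e j (bst j).1.2 (bst j).2) in
    let P := (bst j).1.1 * rotm (hc j.+1) C in
    (P, ((P 0 0 - cos (H j.+1)) / P 1 0) +i* (sin (H j.+1) / P 1 0), C)
  else (rotm (hc 0) z0, z0, z0).

Definition bP i := (bst i).1.1.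
Definition bB i := (bst i).1.2.
Definition bC i := (bst i).2.

Lemma bCS i : bC i.+1 = pt (bB i) ((rho i)%:C * e i (bB i) (bC i)). Proof. by []. Qed.
Lemma bPS i : bP i.+1 = bP i * rotm (hc i.+1) (bC i.+1). Proof. by []. Qed.
Lemma bBS i : bB i.+1 = ((bP i.+1 0 0 - cos (H i.+1)) / bP i.+1 1 0) +i* (sin (H i.+1) / bP i.+1 1 0).
Proof. by []. Qed.

Variable N : nat.
Hypothesis z0H : inH z0.
Hypothesis hc_gt0 : forall i, (i <= N)%N -> 0 < hc i.
Hypothesis H0 : H 0%N = hc 0%N.
Hypothesis H_le : forall i, (i < N)%N -> H i + hc i.+1 <= H i.+1.
Hypothesis H_lt : forall i, (i <= N)%N -> H i < pi.
Hypothesis rhoE : forall i, (i < N)%N -> rho i = side_rho (H i) (hc i.+1) (H i.+1).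
Hypothesis eE : forall i, (i < N)%N -> inH (bB i) -> inH (bC i) ->
  (forall j, i = j.+1 -> bB i = bC i -> H i = H j + hc i) ->
  normsq (e i (bB i) (bC i)) = 1.

Lemma H_gt0 i : (i <= N)%N -> 0 < H i.
Proof.
elim: i => [|i IH] hi; first by rewrite H0 hc_gt0.
by have := IH (ltnW hi); have := H_le hi; have := hc_gt0 hi; lra.
Qed.

Lemma H_bounds i : (i < N)%N -> H i + hc i.+1 <= H i.+1 < pi.
Proof. by move=> hi; rewrite H_le//= H_lt. Qed.

(** The induction carries along, besides the positions, that B_i = C_(i+1) happens only if the
    preceding triangle is degenerate. Otherwise the next direction can be measured from the ray B_i
    C_(i+1), which is why [eE] asks for a unit direction only under this information. *)
Lemma bst_ok i : (i <= N)%N ->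
  [/\ bP i = rotm (H i) (bB i), inH (bB i), inH (bC i) &
      forall j, i = j.+1 -> bB i = bC i -> H i = H j + hc i].
Proof.
elim: i => [|i IH] hi; first by rewrite /bP /bB /bC /= H0; split.
have [hP hB hC hN] := IH (ltnW hi).
have eN := eE hi hB hC hN.
have h0 := H_gt0 (ltnW hi); have k0 := hc_gt0 hi; have hl := H_bounds hi.
have r2 := side_rho_sqr h0 k0 hl; have r1 := side_rho_lt1 h0 k0 hl.
have s1 := side_ge1 h0 k0 hl.
have nu : normsq ((rho i)%:C * e i (bB i) (bC i)) = side_rho (H i) (hc i.+1) (H i.+1) ^+ 2.
  by rewrite normsqM eN mulr1 normsqC rhoE.
have hC' : inH (bC i.+1) by rewrite bCS; apply: pt_inH; rewrite ?nu.
have kE : kappa (bB i) (bC i.+1) = side (H i) (hc i.+1) (H i.+1).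
  have k1 := kappa_ge1 hB hC'.
  have := normsq_cayley hB hC'; rewrite {1}bCS cayley_pt ?nu// r2 => /eqP.
  rewrite eqr_div; try by apply: lt0r_neq0; lra.
  by move=> /eqP h; lra.
have hk : sin (H i) * sin (hc i.+1) != 0.
  by case/andP: hl => hl lp; rewrite gt_eqF// mulr_gt0// sin_gt0_pi//; apply/andP; split; lra.
have cl : cos (H i.+1) = cos (H i) * cos (hc i.+1) - sin (H i) * sin (hc i.+1) * kappa (bB i) (bC i.+1).
  by rewrite kE /side [X in _ = _ - X]mulrC divfK//; ring.
have [pP hg] := triangle_compose h0 k0 hl hB hC' cl.
rewrite -hP -bPS in pP hg.
have HP : 0 < H i.+1 < pi by rewrite H_gt0//= H_lt.
have PE := posell_rotm pP; rewrite hg in PE.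
have fH : inH (fixpt (bP i.+1)) by case: pP => d _ t; exact: fixpt_inH.
have BE : bB i.+1 = fixpt (bP i.+1) by rewrite bBS {1 2 3}PE rotm_fix.
split; rewrite ?BE //.
move=> j [<-] eBC.
(* If the two vertices coincide, dividing off the last generator leaves a rotation about the same
   point, so the angles add. *)
have : rotm (H i) (bB i) = rotm (H i.+1 - hc i.+1) (bC i.+1).
  rewrite -eBC -rotmM// -[rotm (- hc i.+1) _]rotm_inv// {1}eBC.
  apply: (mulIr (unit_det1 (det_rotm (hc i.+1) hC'))).
  by rewrite -mulrA [in RHS]eBC mulVmx2 ?det_rotm// mulr1 -hP -bPS -eBC.
move/(congr1 hang); rewrite !hang_rotm//; first by move=> ->; ring.
- by case/andP: hl => ? ?; apply/andP; split; lra.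
- by case/andP: hl => ? ?; apply/andP; split; lra.
Qed.

End Builder.

(** * Invariance of the coordinates under conjugation *)

Section Conjugation.
Context {R : realType} {n : nat}.
Implicit Types (X Y : mtuple R n) (alpha : 'I_n -> R).

Lemma rotm_hang_conj A (g : 'M[R]_2) : posell A -> \det g = 1 ->
  g * A * g^-1 = rotm (hang A) (mobius g (fixpt A)).
Proof.
by move=> pA dg; have [d c0 t] := pA; rewrite {1}(posell_rotm pA) rotm_conj//; exact: fixpt_inH.
Qed.

Lemma hang_conj A (g : 'M[R]_2) : posell A -> \det g = 1 -> hang (g * A * g^-1) = hang A.
Proof.
move=> pA dg; have [d c0 t] := pA; rewrite rotm_hang_conj// hang_rotm//; first exact: hang_bounds.
by apply: mobius_inH => //; exact: fixpt_inH.
Qed.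

Lemma fixpt_conj A (g : 'M[R]_2) : posell A -> \det g = 1 ->
  fixpt (g * A * g^-1) = mobius g (fixpt A).
Proof.
move=> pA dg; have [d c0 t] := pA; rewrite rotm_hang_conj// fixpt_rotm//; first exact: hang_bounds.
by apply: mobius_inH => //; exact: fixpt_inH.
Qed.

Section OneConj.
Variables (alpha : 'I_n -> R) (X Y : mtuple R n) (g : 'M[R]_2).
Hypothesis n_gt2 : (2 < n)%N.
Hypothesis XDT : RepDT alpha X.
Hypothesis dg : \det g = 1.
Hypothesis XY : forall i, (1 <= i <= n)%N ->
  gen Y i = g * gen X i * g^-1 \/ gen Y i = - (g * gen X i * g^-1).

Let s i := g * ngen X i * g^-1.

Let gs i : (1 <= i <= n)%N -> gen Y i = s i \/ gen Y i = - s i.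
Proof.
move=> hi; rewrite /s; case: (Rep_gen (DT_Rep XDT) hi) => e; have := XY hi; rewrite e.
  by [].
by rewrite mulrN mulNr opprK => -[]; [right|left].
Qed.

Let ps i : (1 <= i <= n)%N -> posell (s i).
Proof. by move=> hi; apply: posell_conj => //; exact: (DT_c XDT). Qed.

Lemma conj_ngen i : (1 <= i <= n)%N -> ngen Y i = g * ngen X i * g^-1.
Proof. by move=> hi; apply: (ngen_eq (s := s)) (gs hi); case: (ps hi). Qed.

Lemma conj_RepDT : RepDT alpha Y.
Proof.
apply: (RepDT_chain (s := s)) => //; first exact: ltnW.
- move=> i; rewrite hang_conj ?(Rep_hang (DT_Rep XDT))//.
  by apply: (DT_c XDT); rewrite /= ltn_ord.
- move=> m hm; rewrite prodc_conj//; apply: posell_conj => //.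
  exact: (DT_posell n_gt2 XDT).
- by rewrite /closes prodc_conj// (DT_prodn n_gt2 XDT); right; rewrite mulrN1 mulNr mulmxV2.
Qed.

Lemma conj_prodc m : (m <= n)%N -> prodc (ngen Y) m = g * prodc (ngen X) m * g^-1.
Proof. by move=> hm; rewrite -prodc_conj//; apply: eq_prodc => i hi; apply: conj_ngen; lia. Qed.

Lemma conj_Bpt i : (i.+1 < n)%N -> Bpt Y i = mobius g (Bpt X i).
Proof.
move=> hi; rewrite (Bpt_P n_gt2 XDT)// (Bpt_P n_gt2 conj_RepDT)// conj_prodc ?fixpt_conj//; last exact: ltnW.
exact: (DT_posell n_gt2 XDT).
Qed.

Lemma conj_Cpt i : (1 <= i <= n)%N -> Cpt Y i = mobius g (Cpt X i).
Proof.
move=> hi; rewrite (Cpt_c XDT)// (Cpt_c conj_RepDT)// conj_ngen ?fixpt_conj//.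
exact: (DT_c XDT).
Qed.

Lemma conj_area i : (i <= n - 3)%N -> area_param Y i = area_param X i.
Proof.
move=> hi; have h := n3_bound n_gt2 hi; rewrite (area_paramE n_gt2 XDT)// (area_paramE n_gt2 conj_RepDT)//.
rewrite !conj_prodc ?conj_ngen ?hang_conj//; try lia.
- by apply: (DT_c XDT); lia.
- by apply: (DT_posell n_gt2 XDT); lia.
- by apply: (DT_posell n_gt2 XDT); lia.
Qed.

End OneConj.

Section Distinct.
Variables (alpha : 'I_n -> R) (X : mtuple R n).
Hypothesis n_gt2 : (2 < n)%N.
Hypothesis XO : RepDT_open alpha X.
Let XDT : RepDT alpha X. Proof. by case: XO. Qed.

Lemma Bpt_neq_next i : (i <= n - 3)%N -> Bpt X i != Cpt X i.+2.
Proof.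
by move=> hi; rewrite -(area_param_eq0 n_gt2 XDT)// gt_eqF//; case: XO => _; exact.
Qed.

(** If B_i = C_(i+1), the product before c_(i+1) would be a rotation about that same point; the
    angles would add and triangle i - 1 would have area 0. *)
Lemma Bpt_neq_prev i : (1 <= i <= n - 3)%N -> Bpt X i != Cpt X i.+1.
Proof.
case: i => // i hi; have hi' : (i <= n - 3)%N by lia.
have h : (i.+2 < n)%N by lia.
have h1 : (1 <= i.+2 <= n)%N by lia.
have h2 : (i.+1 < n)%N by lia.
apply/eqP => e; have := Bpt_neq_next hi'; rewrite -(area_param_eq0 n_gt2 XDT)// (area_paramE n_gt2 XDT)//.
have P2 := prodc_rotm n_gt2 XDT h; have P1 := prodc_rotm n_gt2 XDT h2.
have C2 := c_rotm XDT h1.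
have cH := Cpt_inH XDT h1; have bH := Bpt_inH n_gt2 XDT h2.
have /andP[a0 a1] := hang_bounds (prodc (ngen X) i.+1).
have hh : hang (prodc (ngen X) i.+1) = hang (prodc (ngen X) i.+2) - hang (ngen X i.+2).
  have e1 : prodc (ngen X) i.+1 =
      rotm (hang (prodc (ngen X) i.+2) - hang (ngen X i.+2)) (Cpt X i.+2).
    apply: (mulIr (unit_det1 (det_rotm (hang (ngen X i.+2)) cH))).
    by rewrite rotmM// subrK -C2 -prodcS {1}P2 e.
  have := area_param_ge0 n_gt2 XDT hi'; rewrite (area_paramE n_gt2 XDT)// => ge.
  have /andP[b0 b1] := hang_bounds (prodc (ngen X) i.+2).
  have /andP[d0 d1] := hang_bounds (ngen X i.+2).
  by rewrite {1}e1 hang_rotm//; apply/andP; split; lra.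
by rewrite hh => /eqP; apply; ring.
Qed.

End Distinct.

Lemma conj_gamma alpha X Y g i : (2 < n)%N -> RepDT_open alpha X -> \det g = 1 ->
  (forall i, (1 <= i <= n)%N ->
    gen Y i = g * gen X i * g^-1 \/ gen Y i = - (g * gen X i * g^-1)) ->
  (1 <= i <= n - 3)%N -> gamma Y i = gamma X i.
Proof.
move=> n2 XO dg XY hi; have XDT : RepDT alpha X by case: XO.
rewrite /gamma (conj_Bpt n2 XDT dg XY) ?(conj_Cpt n2 XDT dg XY); try lia.
apply: ray_angle_mobius => //.
- by apply: (Bpt_inH n2 XDT); lia.
- by apply: (Cpt_inH XDT); lia.
- by apply: (Cpt_inH XDT); lia.
- by apply: (Bpt_neq_next n2 XO); lia.
- by apply: (Bpt_neq_prev n2 XO); lia.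
Qed.

Lemma coords_eq X Y : (forall j : 'I_(n - 3), area_param X j.+1 = area_param Y j.+1) ->
  (forall j : 'I_(n - 3), sigma X j.+1 = sigma Y j.+1) -> coords X = coords Y.
Proof.
move=> h1 h2.
have e (f g : 'I_(n - 3) -> R) : f =1 g -> \row_j f j = \row_j g j.
  by move=> fg; apply/rowP => j; rewrite !mxE.
exact: (f_equal2 pair (e _ _ h1) (e _ _ h2)).
Qed.

Lemma conj_rel_open alpha X Y : (2 < n)%N -> RepDT_open alpha X -> conj_rel X Y ->
  RepDT_open alpha Y /\ coords Y = coords X.
Proof.
move=> n2 XO [g dg XY]; have XDT : RepDT alpha X by case: XO.
split.
  split; first exact: (conj_RepDT n2 XDT dg XY).
  by move=> i hi; rewrite (conj_area n2 XDT dg XY)//; case: XO => _; exact.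
apply: coords_eq => j; first by apply: (conj_area n2 XDT dg XY); have := ltn_ord j; lia.
rewrite /sigma; apply: eq_big_nat => i hi.
by apply: (conj_gamma n2 XO dg XY); have := ltn_ord j; lia.
Qed.

Lemma conj_rel_sym X Y : conj_rel X Y -> conj_rel Y X.
Proof.
move=> [g dg XY]; exists g^-1; first by rewrite det_inv1.
have E (M : 'M[R]_2) : g^-1 * (g * M * g^-1) * g^-1^-1 = M.
  by rewrite invrK !mulrA mulVmx2// mul1r -mulrA mulVmx2// mulr1.
by move=> i /XY[] ->; rewrite ?mulrN ?mulNr E ?opprK; [left|right].
Qed.

Lemma conj_rel_trans X Y Z : conj_rel X Y -> conj_rel Y Z -> conj_rel X Z.
Proof.
move=> [g dg XY] [h dh YZ]; exists (h * g); first by rewrite detM2 dh dg mulr1.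
have E (M : 'M[R]_2) : h * (g * M * g^-1) * h^-1 = h * g * M * (h * g)^-1.
  by rewrite invrM ?unit_det1// !mulrA.
move=> i hi; case: (YZ i hi) => ->; case: (XY i hi) => ->; rewrite ?mulrN ?mulNr ?opprK E; by [left|right].
Qed.

End Conjugation.

(** * Angles of the partial products, and chains with given areas *)

Section AngleSums.
Context {R : realType} {n : nat}.
Variable alpha : 'I_n -> R.
Hypothesis n_gt2 : (2 < n)%N.
Hypothesis alphaP : forall i, 0 < alpha i < 2 * pi.

(** Indexed from 0: the angle of the lift of phi(c_(i+1)). The default pi / 2 keeps the bounds 0 < h
    < pi valid for every index. *)
Definition hcn (i : nat) : R := oapp (fun o => pi - alpha o / 2) (pi / 2) (insub i).

(** The angle of the product of the first i + 1 lifts, as forced by the areas a_0, ..., a_(i-1). *)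
Definition Hf (a : nat -> R) (i : nat) : R :=
  \sum_(0 <= j < i.+1) hcn j + (\sum_(0 <= j < i) a j) / 2.

Definition rhof a i := side_rho (Hf a i) (hcn i.+1) (Hf a i.+1).

Lemma hcnE (o : 'I_n) : hcn o = pi - alpha o / 2.
Proof. by rewrite /hcn (insubT (fun k => k < n)%N (ltn_ord o))/= (_ : Sub _ _ = o)//; apply: val_inj. Qed.

Lemma hcn_bounds i : 0 < hcn i < pi.
Proof.
have p0 := pi_gt0 R; rewrite /hcn; case: insubP => [k _ _|_] /=; last by apply/andP; split; lra.
by have /andP[? ?] := alphaP k; apply/andP; split; lra.
Qed.

Lemma HfS a i : Hf a i.+1 = Hf a i + hcn i.+1 + a i / 2.
Proof.
rewrite /Hf [\sum_(0 <= j < i.+2) _]big_nat_recr//= [\sum_(0 <= j < i.+1) a j]big_nat_recr//=; lra.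
Qed.

Lemma Hf0 a : Hf a 0 = hcn 0.
Proof. by rewrite /Hf big_nat1 big_geq// mul0r addr0. Qed.

(** Areas adding up to lambda are what closes the chain: the angle of the last product and that of
    c_n add up to pi. *)
Lemma Hf_last a : \sum_(0 <= j < n - 2) a j = lambda alpha -> Hf a (n - 2) = pi - hcn n.-1.
Proof.
move=> aE; have : \sum_(0 <= j < n) hcn j = pi * n%:R - (\sum_i alpha i) / 2.
  rewrite big_mkord (eq_bigr (fun o : 'I_n => pi - alpha o / 2)); last by move=> o _; exact: hcnE.
  by rewrite big_split/= sumr_const card_ord sumrN mulr_natr mulr_suml.
have e : n = n.-1.+1 by lia.
rewrite {1}e big_nat_recr//= /Hf aE /lambda (_ : (n - 2).+1 = n.-1); last by lia.
by move=> h; lra.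
Qed.

Section Areas.
Variable a : nat -> R.
Hypothesis a_ge0 : forall i, (i <= n - 3)%N -> 0 <= a i.
Hypothesis a_sum : \sum_(0 <= j < n - 2) a j = lambda alpha.

Lemma Hf_lt i : (i <= n - 2)%N -> Hf a i < pi.
Proof.
move=> hi; have mono k : (i + k <= n - 2)%N -> Hf a i <= Hf a (i + k).
  elim: k => [|k IH] hk; first by rewrite addn0.
  have := IH ltac:(lia); rewrite addnS HfS; have := a_ge0 (i := i + k) ltac:(lia).
  have /andP[? _] := hcn_bounds (i + k).+1; lra.
have := mono (n - 2 - i)%N ltac:(lia); rewrite subnKC// Hf_last//.
have /andP[? _] := hcn_bounds n.-1; lra.
Qed.

Lemma Hf_le i : (i < n - 2)%N -> Hf a i + hcn i.+1 <= Hf a i.+1.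
Proof. by move=> hi; rewrite HfS; have := a_ge0 (i := i) ltac:(lia); lra. Qed.

Lemma Hf_gt0 i : (i <= n - 2)%N -> 0 < Hf a i.
Proof.
elim: i => [|i IH] hi; first by rewrite Hf0; case/andP: (hcn_bounds 0).
by have := IH (ltnW hi); have := Hf_le hi; have /andP[? _] := hcn_bounds i.+1; lra.
Qed.

Lemma Hf_bounds i : (i < n - 2)%N -> Hf a i + hcn i.+1 <= Hf a i.+1 < pi.
Proof. by move=> hi; rewrite Hf_le//= Hf_lt. Qed.

End Areas.

Section Realize.
Variables (a : nat -> R) (e : nat -> R[i] -> R[i] -> R[i]) (z0 : R[i]).

Let B := bB (Hf a) hcn (rhof a) e z0.
Let C := bC (Hf a) hcn (rhof a) e z0.
Let P := bP (Hf a) hcn (rhof a) e z0.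

(** The last generator is placed at the final vertex B_(n-2), where its angle completes that of the
    preceding product to pi. *)
Definition bs (j : nat) : 'M[R]_2 :=
  if j is i.+1 then rotm (hcn i) (if (i < n.-1)%N then C i else B (n - 2)) else 1.

Definition bY : mtuple R n := mk_mtuple (fun i : 'I_n => bs i.+1).

Section Correct.
Hypothesis a_ge0 : forall i, (i <= n - 3)%N -> 0 <= a i.
Hypothesis a_sum : \sum_(0 <= j < n - 2) a j = lambda alpha.
Hypothesis z0H : inH z0.
Hypothesis eE : forall i, (i <= n - 3)%N -> inH (B i) -> inH (C i) ->
  (forall j, i = j.+1 -> B i = C i -> a j = 0) -> normsq (e i (B i) (C i)) = 1.

Lemma b_ok4 i : (i <= n - 2)%N ->
  [/\ P i = rotm (Hf a i) (B i), inH (B i), inH (C i) &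
      forall j, i = j.+1 -> B i = C i -> a j = 0].
Proof.
move=> hi; have [||||||h1 h2 h3 h4] := @bst_ok R (Hf a) hcn (rhof a) e z0 (n - 2) z0H _ _ _ _ _ _ i hi; last first.
- by split=> // j ij /(h4 j ij); rewrite ij HfS; lra.
- move=> k hk Bk Ck hB; apply: eE => //; first by lia.
  by move=> j kj /(hB j kj); rewrite kj HfS; lra.
- by [].
- by move=> k hk; exact: Hf_lt.
- by move=> k hk; exact: Hf_le.
- exact: Hf0.
- by move=> k _; case/andP: (hcn_bounds k).
Qed.

Lemma b_ok i : (i <= n - 2)%N ->
  [/\ P i = rotm (Hf a i) (B i), inH (B i) & inH (C i)].
Proof. by move/b_ok4 => -[]. Qed.

Lemma b_unit i : (i <= n - 3)%N -> normsq (e i (B i) (C i)) = 1.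
Proof. by move=> hi; have [|_ h2 h3 h4] := b_ok4 (i := i); [lia|exact: eE]. Qed.

Lemma bs_posell i : (1 <= i <= n)%N -> posell (bs i).
Proof.
case: i => // i hi; rewrite /bs; apply: rotm_posell; first exact: hcn_bounds.
case: ifP => h; first by have [] := b_ok (i := i) ltac:(lia).
by have [] := b_ok (leqnn _).
Qed.

Lemma prodc_bs i : (i <= n - 2)%N -> prodc bs i.+1 = P i.
Proof.
have h k : (k <= n - 2)%N -> (k < n.-1)%N by lia.
elim: i => [|i IH] hi; first by rewrite prodc1 /bs h.
by rewrite prodcS IH 1?ltnW// /P bPS /bs h.
Qed.

Lemma prodc_bsn : prodc bs n = -1.
Proof.
have e1 : n = (n - 2).+2 by lia.
rewrite {1}e1 prodcS prodc_bs// /bs ifF; last by lia.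
have [-> B0 _] := b_ok (leqnn (n - 2)).
rewrite rotmM// Hf_last// (_ : (n - 2).+1 = n.-1); last by lia.
by rewrite subrK /rotm cospi sinpi scale0r addr0 scaleN1r.
Qed.

Lemma gen_bY i : (1 <= i <= n)%N -> gen bY i = bs i.
Proof. by case: i => // i hi; have := gen_mk (fun i : 'I_n => bs i.+1) (Ordinal hi). Qed.

Lemma bY_DT : RepDT alpha bY.
Proof.
apply: (RepDT_chain (s := bs)).
- exact: ltnW.
- exact: bs_posell.
- move=> i; rewrite /bs hang_rotm ?hcnE//.
    by rewrite -hcnE hcn_bounds.
  case: ifP => h; first by have [] := b_ok (i := i) ltac:(lia).
  by have [] := b_ok (leqnn _).
- case=> // m hm; rewrite prodc_bs; last by lia.
  have [|-> B0 _] := b_ok (i := m); first by lia.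
  by apply: rotm_posell => //; rewrite Hf_gt0 ?Hf_lt//; lia.
- by right; exact: prodc_bsn.
- by move=> i hi; left; exact: gen_bY.
Qed.

Lemma ngen_bY i : (1 <= i <= n)%N -> ngen bY i = bs i.
Proof.
move=> hi; apply: (ngen_eq (s := bs)); first by case: (bs_posell hi).
by left; exact: gen_bY.
Qed.

Lemma prodc_bY i : (i <= n - 2)%N -> prodc (ngen bY) i.+1 = rotm (Hf a i) (B i).
Proof.
move=> hi; have [<- _ _] := b_ok hi; rewrite -prodc_bs//; apply: eq_prodc => j hj.
by apply: ngen_bY; lia.
Qed.

Lemma Bpt_bY i : (i <= n - 2)%N -> Bpt bY i = B i.
Proof.
move=> hi; rewrite (Bpt_P n_gt2 bY_DT); last by lia.
rewrite prodc_bY// fixpt_rotm//; last by have [] := b_ok hi.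
by rewrite Hf_gt0 ?Hf_lt.
Qed.

Lemma Cpt_bY i : (i <= n - 2)%N -> Cpt bY i.+1 = C i.
Proof.
move=> hi; rewrite (Cpt_c bY_DT); last by lia.
rewrite ngen_bY /bs ?ifT; try lia.
by rewrite fixpt_rotm ?hcn_bounds//; have [] := b_ok hi.
Qed.

Lemma area_bY i : (i <= n - 3)%N -> area_param bY i = a i.
Proof.
move=> hi; rewrite (area_paramE n_gt2 bY_DT)// !prodc_bY; try lia.
rewrite ngen_bY /bs ?ifT; try lia.
rewrite !hang_rotm ?HfS ?hcn_bounds ?Hf_gt0 ?Hf_lt//; try lia; try lra.
- by have [] := b_ok (i := i.+1) ltac:(lia).
- by have [] := b_ok (i := i) ltac:(lia).
- by rewrite -HfS Hf_gt0 ?Hf_lt//; lia.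
- by have [] := b_ok (i := i.+1) ltac:(lia).
Qed.

End Correct.
End Realize.

Section Recover.
Variable X : mtuple R n.
Hypothesis XDT : RepDT alpha X.
Let a := area_param X.

Lemma hang_gen i : (i < n)%N -> hang (ngen X i.+1) = hcn i.
Proof. by move=> hi; rewrite (Rep_hang (DT_Rep XDT) (Ordinal hi)) -hcnE. Qed.

Lemma hang_prodc_Hf i : (i <= n - 2)%N -> hang (prodc (ngen X) i.+1) = Hf a i.
Proof.
move=> hi; rewrite (hang_prodc n_gt2 XDT); last by lia.
rewrite /Hf big_add1 /=; congr (_ + _); apply: eq_big_nat => j hj; apply: hang_gen; lia.
Qed.

(** The law of cosines read backwards: three angles determine the side B_i C_(i+2). *)
Lemma normsq_side i : (i <= n - 3)%N ->
  normsq (cayley (Bpt X i) (Cpt X i.+2)) = rhof a i ^+ 2.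
Proof.
move=> hi; have h : (i.+2 < n)%N := n3_bound n_gt2 hi.
have a0 : forall i, (i <= n - 3)%N -> 0 <= a i by move=> k; exact: (area_param_ge0 n_gt2 XDT).
have as_ := sum_area n_gt2 XDT.
have hi' : (i <= n - 2)%N by lia.
have [h0 h1] := (Hf_gt0 a0 hi', Hf_bounds a0 as_ (i := i) ltac:(lia)).
have /andP[k0 k1] := hcn_bounds i.+1.
rewrite normsq_cayley ?side_rho_sqr//; [|by apply: (Bpt_inH n_gt2 XDT); lia|by apply: (Cpt_inH XDT); lia].
suff -> : kappa (Bpt X i) (Cpt X i.+2) = side (Hf a i) (hcn i.+1) (Hf a i.+1) by [].
have := kappa_cos n_gt2 XDT hi; rewrite !hang_prodc_Hf ?hang_gen//; try lia.
have s : sin (Hf a i) * sin (hcn i.+1) != 0.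
  by case/andP: h1 => ? ?; rewrite gt_eqF// mulr_gt0// sin_gt0_pi//; apply/andP; split; lra.
by rewrite /side => ->; field; move: s; rewrite mulf_eq0 negb_or => /andP[-> ->].
Qed.

Variable e : nat -> R[i] -> R[i] -> R[i].
Hypothesis eX : forall i, (i <= n - 3)%N ->
  cayley (Bpt X i) (Cpt X i.+2) = (rhof a i)%:C * e i (Bpt X i) (Cpt X i.+1).

(** Uniqueness of the construction: started at C_1, it rebuilds [X] from its areas and any
    compatible directions. A degenerate triangle has radius 0, so its direction is arbitrary; the
    density proof uses this. *)
Lemma recover_b i : (i <= n - 2)%N ->
  [/\ bP (Hf a) hcn (rhof a) e (Cpt X 1) i = prodc (ngen X) i.+1,
      bB (Hf a) hcn (rhof a) e (Cpt X 1) i = Bpt X i &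
      bC (Hf a) hcn (rhof a) e (Cpt X 1) i = Cpt X i.+1].
Proof.
have B0 : Bpt X 0 = Cpt X 1.
  by rewrite (Bpt_P n_gt2 XDT) ?(Cpt_c XDT) ?prodc1//; lia.
elim: i => [|i IH] hi.
  split=> //; rewrite /bP /= prodc1 -hang_gen; last by lia.
  by rewrite -(c_rotm XDT)//; lia.
have [eP eB eC] := IH ltac:(lia).
have hB : inH (Bpt X i) by apply: (Bpt_inH n_gt2 XDT); lia.
have hC : inH (Cpt X i.+2) by apply: (Cpt_inH XDT); lia.
have nE : normsq (cayley (Bpt X i) (Cpt X i.+2)) < 1.
  have := kappa_ge1 hB hC => k1; rewrite normsq_cayley// ltr_pdivrMr; lra.
have eC' : bC (Hf a) hcn (rhof a) e (Cpt X 1) i.+1 = Cpt X i.+2.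
  rewrite bCS eB eC -eX; last by lia.
  by apply: (cayley_inj hB); rewrite ?cayley_pt//; exact: pt_inH.
have eP' : bP (Hf a) hcn (rhof a) e (Cpt X 1) i.+1 = prodc (ngen X) i.+2.
  rewrite bPS eP eC' [in RHS]prodcS; congr (_ * _).
  rewrite -hang_gen; last by lia.
  by rewrite -(c_rotm XDT)//; lia.
split=> //; rewrite bBS eP' -hang_prodc_Hf; last by lia.
have hi2 : (i.+2 < n)%N by lia.
have PE := prodc_rotm n_gt2 XDT hi2.
have := rotm_fix (hang_bounds (prodc (ngen X) i.+2)) (Bpt_inH n_gt2 XDT hi2).
by rewrite -PE.
Qed.

Lemma recover_bs i : (1 <= i <= n)%N -> ngen X i = bs a e (Cpt X 1) i.
Proof.
case: i => // i hi; rewrite (c_rotm XDT hi) hang_gen// /bs; case: ifP => h.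
  by congr rotm; have [_ _ ->] := recover_b (i := i) ltac:(lia).
have [_ -> _] := recover_b (leqnn (n - 2)); congr rotm.
have -> : i.+1 = n by lia.
have [d c0 t] := DT_posell n_gt2 XDT (n_pred n_gt2).
rewrite (Cpt_c XDT) ?(DT_cn n_gt2 XDT) ?fixptN ?fixpt_inv//; try lia.
rewrite (Bpt_P n_gt2 XDT); last by lia.
by congr (fixpt (prodc _ _)); lia.
Qed.

End Recover.
End AngleSums.

Lemma eqmod2pi_sum (R : realType) (f h : nat -> R) m : (forall j, (1 <= j <= m)%N -> eqmod2pi (f j) (h j)) ->
  eqmod2pi (\sum_(1 <= j < m.+1) f j) (\sum_(1 <= j < m.+1) h j).
Proof.
elim: m => [|m IH] fh; first by rewrite !big_geq//; exact: eqmod2pi_refl.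
rewrite [X in eqmod2pi X _]big_nat_recr//= [X in eqmod2pi _ X]big_nat_recr//=; apply: eqmod2piD; last by apply: fh; rewrite leqnn.
by apply: IH => j hj; apply: fh; lia.
Qed.

(** * The section over the polytope and the normal form *)

Section Section_.
Context {R : realType} {n : nat}.
Variable alpha : 'I_n -> R.
Hypothesis n_gt2 : (2 < n)%N.
Hypothesis alphaP : forall i, 0 < alpha i < 2 * pi.
Local Notation W := ('rV[R]_(n - 3) * 'rV[R]_(n - 3))%type.
Implicit Types (y : W) (X Y : mtuple R n).

Definition unitc (w : R[i]) : R[i] := (Num.sqrt (normsq w))^-1%:C * w.

Definition area_of y (i : nat) : R :=
  if i is j.+1 then theta_ y.1 i else lambda alpha - \sum_k y.1 ord0 k.

Definition angle_of y (i : nat) : R := theta_ y.2 i - theta_ y.2 i.-1.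

(** The angle gamma_i runs from the ray B_i C_(i+2) to the ray B_i C_(i+1), so the new direction is
    the old one turned by - gamma_i. The value 1 at i = 0, with B_0 = i, puts C_2 on the imaginary
    axis above i and fixes the conjugation. *)
Definition dir_of y (i : nat) (B C : R[i]) : R[i] :=
  if i is j.+1 then cis (- angle_of y i) * unitc (dirv B C) else 1.

Definition rep_of y : mtuple R n := bY alpha (area_of y) (dir_of y) 'i.

Definition polytope : set W :=
  [set y : W | (forall j : 'I_(n - 3), 0 < y.1 ord0 j) /\ \sum_j y.1 ord0 j < lambda alpha].

Lemma theta_S (t : 'rV[R]_(n - 3)) (j : 'I_(n - 3)) : theta_ t j.+1 = t ord0 j.
Proof.
rewrite /theta_ (insubT (fun k => k < n - 3)%N (ltn_ord j))/=.
by congr (t ord0 _); apply: val_inj.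
Qed.

Lemma normsq_unitc w : w != 0 -> normsq (unitc w) = 1.
Proof.
move=> w0; have p : 0 < normsq w by rewrite lt_neqAle eq_sym normsq_eq0 w0 normsq_ge0.
by rewrite /unitc normsqM normsqC exprVn sqr_sqrtr ?ltW// mulVf// gt_eqF.
Qed.

Lemma normsq_cis (t : R) : normsq (cis t) = 1.
Proof. by rewrite /normsq /cis /= cos2Dsin2. Qed.

Lemma dirv_eq0 z w : inH z -> inH w -> (dirv z w == 0 :> R[i]) = (z == w).
Proof.
move=> z0 w0; rewrite -[RHS]cayley_eq0// cayleyE// mulf_eq0; have := cden_gt0 z0 w0 => c0.
by rewrite (_ : ((cden z w)^-1%:C == 0) = false)//; apply/negbTE/eqP => -[/eqP]; rewrite invr_eq0 gt_eqF.
Qed.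

Lemma area_of_sum y : \sum_(0 <= j < n - 2) area_of y j = lambda alpha.
Proof.
have -> : (n - 2 = (n - 3).+1)%N by lia.
rewrite big_nat_recl// big_mkord.
rewrite (eq_bigr (fun j : 'I_(n - 3) => y.1 ord0 j)); last by move=> j _; exact: theta_S.
exact: subrK.
Qed.

Lemma area_of_gt0 y i : polytope y -> (i <= n - 3)%N -> 0 < area_of y i.
Proof.
move=> [y0 ys]; case: i => [|i] hi; first by rewrite /= subr_gt0.
by have := theta_S y.1 (Ordinal hi) => /= ->.
Qed.

Section Correct.
Variable y : W.
Hypothesis yU : polytope y.
Let B := bB (Hf alpha (area_of y)) (hcn alpha) (rhof alpha (area_of y)) (dir_of y) 'i.
Let C := bC (Hf alpha (area_of y)) (hcn alpha) (rhof alpha (area_of y)) (dir_of y) 'i.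

Let a_ge0 i : (i <= n - 3)%N -> 0 <= area_of y i.
Proof. by move=> hi; exact/ltW/area_of_gt0. Qed.

Lemma dir_of_unit i : (i <= n - 3)%N -> inH (B i) -> inH (C i) ->
  (forall j, i = j.+1 -> B i = C i -> area_of y j = 0) -> normsq (dir_of y i (B i) (C i)) = 1.
Proof.
move=> hi B0 C0; case: i hi B0 C0 => [|i] hi B0 C0 h.
  by rewrite /dir_of /normsq /= expr1n expr0n addr0.
rewrite /dir_of normsqM normsq_cis mul1r normsq_unitc// dirv_eq0//.
apply/eqP => /(h i erefl) a0; have := area_of_gt0 yU (ltnW hi : (i <= n - 3)%N).
by rewrite a0 ltxx.
Qed.

Let i_inH : inH ('i : R[i]). Proof. by rewrite /inH /=. Qed.

Lemma rep_of_DT : RepDT alpha (rep_of y).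
Proof. exact: (bY_DT n_gt2 alphaP a_ge0 (area_of_sum y) i_inH dir_of_unit). Qed.

Lemma rep_of_area i : (i <= n - 3)%N -> area_param (rep_of y) i = area_of y i.
Proof. exact: (area_bY n_gt2 alphaP a_ge0 (area_of_sum y) i_inH dir_of_unit). Qed.

Lemma rep_of_open : RepDT_open alpha (rep_of y).
Proof. by split; [exact: rep_of_DT|move=> i hi; rewrite rep_of_area//; exact: area_of_gt0]. Qed.

Lemma rep_of_gamma i : (1 <= i <= n - 3)%N -> eqmod2pi (gamma (rep_of y) i) (angle_of y i).
Proof.
move=> hi; have BE k := Bpt_bY n_gt2 alphaP a_ge0 (area_of_sum y) i_inH dir_of_unit (i := k).
have CE k := Cpt_bY n_gt2 alphaP a_ge0 (area_of_sum y) i_inH dir_of_unit (i := k).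
have B0 : inH (Bpt (rep_of y) i) by apply: (Bpt_inH n_gt2 rep_of_DT); lia.
have C0 : inH (Cpt (rep_of y) i.+1) by apply: (Cpt_inH rep_of_DT); lia.
have C1 : inH (Cpt (rep_of y) i.+2) by apply: (Cpt_inH rep_of_DT); lia.
have N1 : Bpt (rep_of y) i != Cpt (rep_of y) i.+2 by apply: (Bpt_neq_next n_gt2 rep_of_open); lia.
have N0 : Bpt (rep_of y) i != Cpt (rep_of y) i.+1 by apply: (Bpt_neq_prev n_gt2 rep_of_open); lia.
apply: ray_angle_uniq => //.
have rho1 := normsq_side n_gt2 alphaP rep_of_DT (i := i) ltac:(lia).
have E : cayley (Bpt (rep_of y) i) (Cpt (rep_of y) i.+2) =
    (rhof alpha (area_of y) i)%:C * (cis (- angle_of y i) * unitc (dirv (Bpt (rep_of y) i) (Cpt (rep_of y) i.+1))).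
  rewrite /rep_of BE ?CE; try lia.
  case: i hi {BE CE B0 C0 C1 N1 N0 rho1} => // i hi; rewrite bCS cayley_pt//.
    by have [] := b_ok n_gt2 alphaP a_ge0 (area_of_sum y) i_inH dir_of_unit (i := i.+1) ltac:(lia).
  have [_ b1 c1] := b_ok n_gt2 alphaP a_ge0 (area_of_sum y) i_inH dir_of_unit (i := i.+1) ltac:(lia).
  have hi' : (i.+1 <= n - 3)%N by lia.
  have sl : Hf alpha (area_of y) i.+1 + hcn alpha i.+2 <= Hf alpha (area_of y) i.+2 < pi.
    by apply: (Hf_bounds n_gt2 alphaP a_ge0 (area_of_sum y)); lia.
  have sh : 0 < Hf alpha (area_of y) i.+1 by apply: (Hf_gt0 n_gt2 alphaP a_ge0); lia.
  have /andP[sk _] := hcn_bounds alphaP i.+2.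
  rewrite normsqM normsqC dir_of_unit// ?mulr1; first exact: side_rho_lt1.
  move=> j [<-] /eqP; have := Bpt_neq_prev n_gt2 rep_of_open (i := i.+1) ltac:(lia).
  rewrite /rep_of (Bpt_bY n_gt2 alphaP a_ge0 (area_of_sum y) i_inH dir_of_unit); last by lia.
  rewrite (Cpt_bY n_gt2 alphaP a_ge0 (area_of_sum y) i_inH dir_of_unit); last by lia.
  by move=> /negbTE ->.
have D0 : 0 < normsq (dirv (Bpt (rep_of y) i) (Cpt (rep_of y) i.+1)).
  by rewrite lt_neqAle eq_sym normsq_eq0 dirv_eq0// N0 normsq_ge0.
have r0 : 0 < rhof alpha (area_of y) i.
  rewrite lt_neqAle sqrtr_ge0 andbT eq_sym; apply: contraNneq N1 => r0.
  by rewrite -cayley_eq0// E r0 mul0r.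
rewrite E {1}cayleyE//; exists ((cden (Bpt (rep_of y) i) (Cpt (rep_of y) i.+1))^-1 * rhof alpha (area_of y) i *
   Num.sqrt (normsq (dirv (Bpt (rep_of y) i) (Cpt (rep_of y) i.+1)))).
  by rewrite !mulr_gt0 ?invr_gt0 ?cden_gt0// sqrtr_gt0.
set d := dirv _ _ in D0 *; set r := rhof _ _ _; set k := (cden _ _)^-1; set t := angle_of y i.
have s0 : 0 < Num.sqrt (normsq d) by rewrite sqrtr_gt0.
have sE := sqr_sqrtr (ltW D0).
rewrite /unitc; set s := Num.sqrt _ in s0 sE *; rewrite /normsq in sE.
case: (d) sE => x z /= sE; rewrite /cis cosN sinN; apply: eq_cplx => /=; field: sE; by rewrite gt_eqF.
Qed.

Lemma sum_angle_of m : \sum_(1 <= j < m.+1) angle_of y j = theta_ y.2 m.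
Proof.
elim: m => [|m IH]; first by rewrite big_geq.
by rewrite big_nat_recr//= IH /angle_of /=; ring.
Qed.

Lemma rep_of_sigma (j : 'I_(n - 3)) : eqmod2pi (sigma (rep_of y) j.+1) (y.2 ord0 j).
Proof.
rewrite -theta_S -sum_angle_of; apply: eqmod2pi_sum => i hi; apply: rep_of_gamma.
by have := ltn_ord j; lia.
Qed.

End Correct.

Lemma coords1 X (j : 'I_(n - 3)) : (coords X).1 ord0 j = area_param X j.+1.
Proof. by rewrite mxE. Qed.

Lemma coords2 X (j : 'I_(n - 3)) : (coords X).2 ord0 j = sigma X j.+1.
Proof. by rewrite mxE. Qed.

Lemma coords_rep_of y : polytope y -> torus_rel (coords (rep_of y)) y.
Proof.
move=> yU; split; last by move=> j; rewrite coords2; exact: rep_of_sigma.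
apply/rowP => j; rewrite coords1 rep_of_area//; exact: theta_S.
Qed.

Lemma coords_polytope X : RepDT_open alpha X -> polytope (coords X).
Proof.
move=> [XDT X0]; split.
  by move=> j; rewrite coords1; apply: X0; have := ltn_ord j; lia.
rewrite -(sum_area n_gt2 XDT) (eq_bigr _ (fun j _ => coords1 X j)).
have -> : (n - 2 = (n - 3).+1)%N by lia.
by rewrite big_nat_recl// big_mkord ltrDr X0.
Qed.

Lemma cis_eqmod2pi (s t : R) : eqmod2pi s t -> cis s = cis t.
Proof. by move/eqmod2piP. Qed.

Lemma eqmod2pi_theta (s t : 'rV[R]_(n - 3)) : (forall j, eqmod2pi (s ord0 j) (t ord0 j)) ->
  forall i, eqmod2pi (theta_ s i) (theta_ t i).
Proof.
move=> st [|i]; first exact: eqmod2pi_refl.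
by rewrite /theta_; case: insubP => [k _ _|_] /=; [exact: st|exact: eqmod2pi_refl].
Qed.

Lemma rep_of_torus y y' : torus_rel y y' -> rep_of y = rep_of y'.
Proof.
move=> [e1 e2]; rewrite /rep_of (_ : area_of y = area_of y'); last by rewrite /area_of e1.
suff -> : dir_of y = dir_of y' by [].
apply/funext => -[//|i]; apply/funext => B; apply/funext => C; rewrite /dir_of.
suff -> : cis (- angle_of y i.+1) = cis (- angle_of y' i.+1) by [].
apply: cis_eqmod2pi; apply: eqmod2piN; rewrite /angle_of.
by apply: eqmod2piD; [|apply: eqmod2piN]; apply: eqmod2pi_theta.
Qed.

Lemma bst_ext (H H' hc rho rho' : nat -> R) e z0 N :
  (forall i, (i <= N)%N -> H i = H' i) -> (forall i, (i < N)%N -> rho i = rho' i) ->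
  forall i, (i <= N)%N -> bst H hc rho e z0 i = bst H' hc rho' e z0 i.
Proof.
move=> hH hr; elim=> [//|i IH] hi /=; by rewrite IH ?(ltnW hi)// hH// hr.
Qed.

(** Only the areas of index at most n - 3 enter the chain; beyond them [area_param] and [area_of]
    need not agree. *)
Lemma bs_ext (a a' : nat -> R) e z0 : (forall i, (i <= n - 3)%N -> a i = a' i) ->
  forall i, bs alpha a e z0 i = bs alpha a' e z0 i.
Proof.
move=> aa; have HH i : (i <= n - 2)%N -> Hf alpha a i = Hf alpha a' i.
  by move=> hi; rewrite /Hf; congr (_ + _ / 2); apply: eq_big_nat => j hj; apply: aa; lia.
have E i : (i <= n - 2)%N -> bst (Hf alpha a) (hcn alpha) (rhof alpha a) e z0 i =
    bst (Hf alpha a') (hcn alpha) (rhof alpha a') e z0 i.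
  apply: bst_ext => // j hj; rewrite /rhof !HH//; lia.
case=> [//|i]; rewrite /bs; case: ifP => h.
  by rewrite /bC E; [|lia].
by rewrite /bB (E _ (leqnn _)).
Qed.

(** Recovers [u] from its modulus, the direction of [u'] and the angle from [u] to [u']. The factor
    [k] absorbs the positive ratio between [dirv] and [cayley]. *)
Lemma polar_dir (u u' : R[i]) (k r t : R) : 0 < k -> 0 < r -> u' != 0 -> normsq u = r ^+ 2 ->
  polar (u' * conjc u) t -> u = r%:C * (cis (- t) * unitc (k%:C * u')).
Proof.
move=> k0 r0 u0 ur [s s0 us].
have p : 0 < normsq u' by rewrite lt_neqAle eq_sym normsq_eq0 u0 normsq_ge0.
set m := Num.sqrt (normsq u'); have m0 : 0 < m by rewrite sqrtr_gt0.
have mE : m ^+ 2 = normsq u' by rewrite sqr_sqrtr// ltW.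
have sE : s = r * m.
  apply/eqP; rewrite -(eqrXn2 (n := 2)) ?mulr_ge0 ?ltW// exprMn mE -ur.
  have := congr1 (@normsq R) us; rewrite !normsqM normsqC normsq_cis mulr1 => <-.
  by rewrite [normsq u * _]mulrC; apply/eqP; congr (_ * _); rewrite /normsq; case: (u) => a b /=; ring.
have e1 : (normsq u')%:C * u = s%:C * cis (- t) * u'.
  have hh : conjc u' * u = s%:C * cis (- t).
    move: us; case: (u') => a b; case: (u) => c d; rewrite /cis cosN sinN => -[e1 e2].
    by apply: eq_cplx => /=; lra.
  by rewrite -mul_conj -mulrA hh mulrC.
rewrite /unitc (_ : Num.sqrt (normsq (k%:C * u')) = k * m); last first.
  by rewrite normsqM normsqC sqrtrM ?sqr_ge0// sqrtr_sqr gtr0_norm.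
have nz : (normsq u')%:C != 0 by apply/eqP => -[] /eqP; rewrite gt_eqF.
apply: (mulfI nz); rewrite e1 -mE sE.
case: (u') => a b; rewrite /cis; apply: eq_cplx => /=; field; by rewrite !gt_eqF.
Qed.

(** If [q] lands on the imaginary axis below i, the half turn about i exchanges the two halves of
    the axis. *)
Lemma unit_frame (p q : R[i]) : inH p -> inH q -> p != q -> exists2 g : 'M[R]_2, \det g = 1 &
  mobius g p = 'i /\ exists2 t : R, 1 < t & mobius g q = 0 +i* t.
Proof.
move=> p0 q0 pq; have [g dg [gp [t t0 gq]]] := to_axis p0 q0.
have i0 : inH ('i : R[i]) by rewrite /inH /=.
have [t1|t1|t1] := ltgtP 1 t; first by exists g => //; split=> //; exists t.
- pose J : 'M[R]_2 := rotm (pi / 2) 'i.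
  have dJ : \det J = 1 by exact: det_rotm.
  have JE : J = mx2 0 (-1) 1 0.
    by apply: mx2_eq; rewrite /J /rotm cos_pihalf sin_pihalf !mxE2 /normsq /=; field.
  exists (J * g); first by rewrite detM2 dJ dg mulr1.
  rewrite !mobiusM// gp gq; split; first exact: mobius_rotm.
  exists t^-1; first by rewrite invf_gt1.
  have tH : inH (0 +i* t) by [].
rewrite (mobiusE dJ tH).
rewrite JE; apply: eq_cplx; rewrite /jden !mx2E /=; field; by rewrite gt_eqF.
- case/eqP: pq; have : mobius g p = mobius g q by rewrite gp gq -t1.
  by move/(congr1 (mobius g^-1)); rewrite !mobiusK.
Qed.

Lemma Bpt0 X : RepDT alpha X -> Bpt X 0 = Cpt X 1.
Proof. by move=> XDT; rewrite (Bpt_P n_gt2 XDT) ?(Cpt_c XDT) ?prodc1//; lia. Qed.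

Lemma area_of_coords X i : RepDT alpha X -> (i <= n - 3)%N ->
  area_param X i = area_of (coords X) i.
Proof.
move=> XDT; case: i => [|i] hi; last first.
  by have := theta_S (coords X).1 (Ordinal hi); rewrite coords1 => <-.
rewrite /area_of -(sum_area n_gt2 XDT).
have -> : (n - 2 = (n - 3).+1)%N by lia.
rewrite big_nat_recl// big_mkord (eq_bigr _ (fun j _ => coords1 X j)).
exact: (esym (addrK _ _)).
Qed.

Lemma theta_coords X i : (i <= n - 3)%N -> theta_ (coords X).2 i = sigma X i.
Proof.
case: i => [|i] hi; first by rewrite /sigma big_geq.
by have := theta_S (coords X).2 (Ordinal hi); rewrite coords2 => ->.
Qed.

Lemma angle_of_coords X i : (1 <= i <= n - 3)%N -> angle_of (coords X) i = gamma X i.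
Proof.
case: i => // i hi; rewrite /angle_of !theta_coords; [|lia|lia].
by rewrite /sigma big_nat_recr//= [X in X - _]addrC addrK.
Qed.

Lemma cayley_it (t : R) : 1 < t -> cayley 'i (0 +i* t) = ((t - 1) / (t + 1))%:C.
Proof.
move=> t1; rewrite cayleyE; [|by rewrite /inH /=|by rewrite /inH /=; lra].
by rewrite /cden /dirv; apply: eq_cplx => /=; field; do ?[apply/andP; split]; apply: lt0r_neq0; nra.
Qed.

(** Conjugate until C_1 = i and C_2 lies above it on the imaginary axis. The radii and directions of
    the chain are then those prescribed by its own coordinates, so the construction reproduces its
    lifts. *)
Theorem normal_form X : RepDT_open alpha X -> conj_rel X (rep_of (coords X)).
Proof.
move=> XO; have XDT : RepDT alpha X by case: XO.
have h12 : (1 <= 2 <= n)%N by lia.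
have B0 := Bpt0 XDT.
have C1 : inH (Cpt X 1) by apply: (Cpt_inH XDT); lia.
have C2 : inH (Cpt X 2) by apply: (Cpt_inH XDT); lia.
have := Bpt_neq_next n_gt2 XO (i := 0) ltac:(lia); rewrite B0 => N12.
have [g dg [g1 [t t1 g2]]] := unit_frame C1 C2 N12.
have [Y XY] : exists Y, forall i, (1 <= i <= n)%N ->
    gen Y i = g * gen X i * g^-1 \/ gen Y i = - (g * gen X i * g^-1).
  exists (mk_mtuple (fun i : 'I_n => g * gen X i.+1 * g^-1)); case=> // i hi. by left; have := gen_mk (fun i : 'I_n => g * gen X i.+1 * g^-1) (Ordinal hi).
have cXY : conj_rel X Y by exists g.
apply: (conj_rel_trans cXY).
have [YO cY] := conj_rel_open n_gt2 XO cXY; rewrite -cY.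
have YDT : RepDT alpha Y by case: YO.
have Y1 : Cpt Y 1 = 'i by rewrite (conj_Cpt n_gt2 XDT dg XY); [exact: g1|lia].
have Y2 : Cpt Y 2 = 0 +i* t by rewrite (conj_Cpt n_gt2 XDT dg XY); [exact: g2|lia].
have BY0 : Bpt Y 0 = 'i.
  by rewrite (Bpt0 YDT).
have aE i (hi : (i <= n - 3)%N) := area_of_coords YDT hi.
have gE i (hi : (1 <= i <= n - 3)%N) := angle_of_coords Y hi.
have eY i : (i <= n - 3)%N -> cayley (Bpt Y i) (Cpt Y i.+2) =
    (rhof alpha (area_param Y) i)%:C * dir_of (coords Y) i (Bpt Y i) (Cpt Y i.+1).
  move=> hi; have nE := normsq_side n_gt2 alphaP YDT hi.
  have BH : inH (Bpt Y i) by apply: (Bpt_inH n_gt2 YDT); lia.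
  have CH : inH (Cpt Y i.+2) by apply: (Cpt_inH YDT); lia.
  have CH1 : inH (Cpt Y i.+1) by apply: (Cpt_inH YDT); lia.
  have BN := Bpt_neq_next n_gt2 YO hi.
  have r0 : 0 < rhof alpha (area_param Y) i.
    rewrite lt_neqAle sqrtr_ge0 andbT eq_sym; apply: contraNneq BN => r0.
    by rewrite -(cayley_eq0 BH CH) -normsq_eq0 nE r0 expr0n.
  case: i hi nE BH CH CH1 BN r0 => [|i] hi nE BH CH CH1 BN r0.
    move: nE; rewrite BY0 Y2 /dir_of mulr1.
    rewrite (cayley_it t1) normsqC => /eqP; rewrite eqrXn2; [by move/eqP=> ->|by []| |exact: ltW].
    by apply: divr_ge0; lra.
  have BN1 := Bpt_neq_prev n_gt2 YO (i := i.+1) ltac:(lia).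
  have := ray_angleP BH CH CH1 BN BN1; rewrite -/(gamma Y i.+1) => -[_ po].
  rewrite /dir_of gE; last by lia.
  have -> : dirv (Bpt Y i.+1) (Cpt Y i.+2) =
      (cden (Bpt Y i.+1) (Cpt Y i.+2))%:C * cayley (Bpt Y i.+1) (Cpt Y i.+2).
    rewrite (cayleyE BH CH1) mulrA -rmorphM /= mulfV; first by rewrite rmorph1 mul1r.
    by apply: lt0r_neq0; exact: (cden_gt0 BH CH1).
  by apply: polar_dir; [exact: (cden_gt0 BH CH1)|exact: r0|rewrite (cayley_eq0 BH CH1)|exact: nE|exact: po].
have rb := recover_bs n_gt2 YDT eY; rewrite Y1 in rb.
exists 1; first exact: det1_2.
move=> i hi; rewrite invr1 mul1r mulr1.
have -> : gen (rep_of (coords Y)) i = ngen Y i.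
  have e1 := rb i hi; have e2 := bs_ext (dir_of (coords Y)) 'i aE i.
  exact: etrans (gen_bY alpha (area_of (coords Y)) (dir_of (coords Y)) 'i hi) (esym (etrans e1 e2)).
by case: (Rep_gen (DT_Rep YDT) hi) => ->; [left|right; rewrite opprK].
Qed.

Lemma conj_rel_coords X Y : RepDT_open alpha X -> RepDT_open alpha Y ->
  (conj_rel X Y <-> torus_rel (coords X) (coords Y)).
Proof.
move=> XO YO; split=> [h|h].
  have [_ ->] := conj_rel_open n_gt2 XO h.
  by split=> // j; exact: eqmod2pi_refl.
have := normal_form XO; rewrite (rep_of_torus h) => hX.
exact: (conj_rel_trans hX (conj_rel_sym (normal_form YO))).
Qed.

End Section_.

(** * Smoothness of the coordinates *)

(** Closure properties sufficient to follow the construction of a chain. One induction then serves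
    twice: for smoothness on the polytope, and for continuity at a single parameter where triangles
    may degenerate. *)
Record fclass (R : realType) (V : Type) (D : set V) (Q : (V -> R) -> Prop) : Prop := FClass {
  fc_cst : forall c : R, Q (fun=> c);
  fcD : forall f g, Q f -> Q g -> Q (fun x => f x + g x);
  fcM : forall f g, Q f -> Q g -> Q (fun x => f x * g x);
  fcV : forall f, (forall x, D x -> f x != 0) -> Q f -> Q (fun x => (f x)^-1);
  fc_cos : forall f, Q f -> Q (fun x => cos (f x));
  fc_sin : forall f, Q f -> Q (fun x => sin (f x));
  fc_sqrt : forall f, (forall x, D x -> 0 < f x) -> Q f -> Q (fun x => Num.sqrt (f x)) }.

Section FClass.
Context {R : realType} {V : Type} (D : set V) (Q : (V -> R) -> Prop).
Hypothesis QC : fclass D Q.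

Lemma fcN f : Q f -> Q (fun x => - f x).
Proof.
move=> Qf; rewrite (_ : (fun x => _) = (fun x => (-1) * f x)); last by apply/funext => x; rewrite mulN1r.
exact: (fcM QC (fc_cst QC _) Qf).
Qed.

Lemma fcB f g : Q f -> Q g -> Q (fun x => f x - g x).
Proof. by move=> Qf Qg; exact: (fcD QC Qf (fcN Qg)). Qed.

Lemma fcX f n : Q f -> Q (fun x => f x ^+ n).
Proof.
move=> Qf; elim: n => [|n IH]; first exact: (fc_cst QC).
rewrite (_ : (fun x => _) = (fun x => f x * f x ^+ n)); last by apply/funext => x; rewrite exprS.
exact: (fcM QC Qf IH).
Qed.

Lemma fc_div f g : (forall x, D x -> g x != 0) -> Q f -> Q g -> Q (fun x => f x / g x).
Proof. by move=> g0 Qf Qg; exact: (fcM QC Qf (fcV QC g0 Qg)). Qed.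

Lemma fc_sum (f : nat -> V -> R) m n : (forall i, Q (f i)) -> Q (fun x => \sum_(m <= i < n) f i x).
Proof.
move=> Qf; elim: (index_iota m n) => [|i s IH].
  rewrite (_ : (fun x => _) = (fun=> 0)); first exact: (fc_cst QC).
  by apply/funext => x; rewrite big_nil.
rewrite (_ : (fun x => _) = (fun x => f i x + \sum_(i <- s) f i x)); last by apply/funext => x; rewrite big_cons.
exact: (fcD QC).
Qed.

Definition Qc (f : V -> R[i]) := Q (fun x => complex.Re (f x)) /\ Q (fun x => complex.Im (f x)).
Definition Qm (f : V -> 'M[R]_2) := forall i j, Q (fun x => f x i j).

Lemma QcM f g : Qc f -> Qc g -> Qc (fun x => f x * g x).
Proof.
move=> [f1 f2] [g1 g2].
have e z w : complex.Re (z * w : R[i]) = complex.Re z * complex.Re w - complex.Im z * complex.Im w by case: z; case: w.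
have e' z w : complex.Im (z * w : R[i]) = complex.Re z * complex.Im w + complex.Im z * complex.Re w by case: z; case: w.
split; [rewrite (funext (fun x => e (f x) (g x)))|rewrite (funext (fun x => e' (f x) (g x)))].
  by apply: fcB; exact: (fcM QC).
by apply: (fcD QC); exact: (fcM QC).
Qed.

Lemma Qc_real f : Q f -> Qc (fun x => (f x)%:C).
Proof. by move=> Qf; split => //=; exact: (fc_cst QC). Qed.

Lemma Qc_normsq f : Qc f -> Q (fun x => normsq (f x)).
Proof. by move=> [f1 f2]; apply: (fcD QC); exact: fcX. Qed.

Lemma QmM f g : Qm f -> Qm g -> Qm (fun x => f x * g x).
Proof.
move=> Qf Qg i j.
rewrite (_ : (fun x => _) = (fun x => f x i 0 * g x 0 j + f x i 1 * g x 1 j)).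
  by apply: (fcD QC); apply: (fcM QC).
apply/funext => x; rewrite mxE !big_ord_recl big_ord0 addr0.
by congr (_ + f x i _ * g x _ j); apply: val_inj.
Qed.

Lemma Qm_mx2 a b c d : Q a -> Q b -> Q c -> Q d -> Qm (fun x => mx2 (a x) (b x) (c x) (d x)).
Proof.
move=> Qa Qb Qc_ Qd i j.
have e x : mx2 (a x) (b x) (c x) (d x) i j =
    if i == 0 then (if j == 0 then a x else b x) else (if j == 0 then c x else d x) by rewrite mxE.
by rewrite (funext e); case: (i == 0); case: (j == 0).
Qed.

Lemma rotm_mx2 (h : R) z : rotm h z = mx2
  (cos h + sin h * (complex.Re z / complex.Im z)) (sin h * (- normsq z / complex.Im z))
  (sin h * (complex.Im z)^-1) (cos h + sin h * (- complex.Re z / complex.Im z)).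
Proof. by apply: mx2_eq; rewrite /rotm !mxE2; ring. Qed.

Lemma Qm_rotm h z : (forall x, D x -> inH (z x)) -> Q (fun x => cos (h x)) -> Q (fun x => sin (h x)) ->
  Qc z -> Qm (fun x => rotm (h x) (z x)).
Proof.
move=> z0 Qcos Qsin Qz; have [Q1 Q2] := Qz.
have n0 x : D x -> complex.Im (z x) != 0 by move=> /z0; rewrite /inH => ?; rewrite gt_eqF.
have Qn := fcN (Qc_normsq Qz).
have Qi := fcV QC n0 Q2.
rewrite (funext (fun x => rotm_mx2 (h x) (z x))); apply: Qm_mx2.
- by apply: (fcD QC) => //; apply: (fcM QC) => //; apply: (fcM QC).
- by apply: (fcM QC) => //; apply: (fcM QC).
- by apply: (fcM QC).
- by apply: (fcD QC) => //; apply: (fcM QC) => //; apply: (fcM QC) => //; apply: fcN.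
Qed.

Lemma Qc_pt z u : (forall x, D x -> normsq (u x) < 1) -> Qc z -> Qc u ->
  Qc (fun x => pt (z x) (u x)).
Proof.
move=> u1 [z1 z2] Qu; have [u_1 u_2] := Qu; have Qn := Qc_normsq Qu.
have n0 x : D x -> (1 - complex.Re (u x)) ^+ 2 + complex.Im (u x) ^+ 2 != 0.
  by move=> /u1 /pt_den_gt0 ?; rewrite gt_eqF.
have Qd : Q (fun x => (1 - complex.Re (u x)) ^+ 2 + complex.Im (u x) ^+ 2).
  by apply: (fcD QC); apply: fcX => //; apply: fcB => //; exact: (fc_cst QC).
split; rewrite /pt/=.
  apply: fcB => //; apply: fc_div => //; apply: (fcM QC) => //; apply: (fcM QC) => //; exact: (fc_cst QC).
by apply: fc_div => //; apply: (fcM QC) => //; apply: fcB => //; exact: (fc_cst QC).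
Qed.

Lemma Qc_dirv z w : Qc z -> Qc w -> Qc (fun x => dirv (z x) (w x)).
Proof.
move=> [z1 z2] [w1 w2]; have d := fcB w1 z1; split; rewrite /dirv/=.
  by apply: fcB; [apply: (fcD QC)|]; exact: fcX.
by apply: (fcM QC) => //; apply: (fcM QC) => //; exact: (fc_cst QC).
Qed.

Lemma Qc_unitc w : (forall x, D x -> w x != 0) -> Qc w -> Qc (fun x => unitc (w x)).
Proof.
move=> w0 Qw; have p x : D x -> 0 < normsq (w x).
  by move=> /w0 h; rewrite lt_neqAle eq_sym normsq_eq0 h normsq_ge0.
have Qn := Qc_normsq Qw.
apply: QcM => //; apply: Qc_real; apply: (fcV QC); last exact: (fc_sqrt QC).
by move=> x /p h; rewrite gt_eqF// sqrtr_gt0.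
Qed.

Section Bst.
Variables (H rho : V -> nat -> R) (hc : nat -> R) (e : V -> nat -> R[i] -> R[i] -> R[i]) (z0 : R[i]) (N : nat).
Let P x := bP (H x) hc (rho x) (e x) z0.
Let B x := bB (H x) hc (rho x) (e x) z0.
Let C x := bC (H x) hc (rho x) (e x) z0.
Hypothesis ok : forall x i, D x -> (i <= N)%N ->
  [/\ P x i = rotm (H x i) (B x i), inH (B x i) & inH (C x i)].
Hypothesis HB : forall x i, D x -> (i <= N)%N -> 0 < H x i < pi.
Hypothesis uB : forall x i, D x -> (i < N)%N -> normsq ((rho x i)%:C * e x i (B x i) (C x i)) < 1.
Hypothesis Qcos : forall i, Q (fun x => cos (H x i)).
Hypothesis Qsin : forall i, Q (fun x => sin (H x i)).
Hypothesis Qrho : forall i, (i < N)%N -> Q (fun x => rho x i).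
Hypothesis Qe : forall i, (i < N)%N -> Qc (fun x => B x i) -> Qc (fun x => C x i) ->
  Qc (fun x => e x i (B x i) (C x i)).

Lemma Q_bst i : (i <= N)%N ->
  [/\ Qm (fun x => P x i), Qc (fun x => B x i) & Qc (fun x => C x i)].
Proof.
elim: i => [|i IH] hi.
  by split; [move=> k l|split|split]; exact: (fc_cst QC).
have [QP QB QCc] := IH (ltnW hi).
have QC' : Qc (fun x => C x i.+1).
  apply: Qc_pt => //; first by move=> x Dx; exact: uB.
  by apply: QcM; [apply: Qc_real; exact: Qrho|exact: Qe].
have QP' : Qm (fun x => P x i.+1).
  apply: QmM => //; apply: Qm_rotm => //; try exact: (fc_cst QC).
  by move=> x Dx; have [] := ok Dx hi.
split=> //.
have n0 x : D x -> P x i.+1 1 0 != 0.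
  move=> Dx; have [-> h _] := ok Dx hi; rewrite gt_eqF// rotm10_gt0//; exact: HB.
split; first by apply: fc_div => //; apply: fcB => //; exact: QP'.
by apply: fc_div => //; exact: QP'.
Qed.

End Bst.
End FClass.

Section QbY.
Context {R : realType} {n : nat} {V : Type} (D : set V) (Q : (V -> R) -> Prop).
Hypothesis QC : fclass D Q.
Variables (alpha : 'I_n -> R) (a : V -> nat -> R) (e : V -> nat -> R[i] -> R[i] -> R[i]) (z0 : R[i]).
Hypothesis n_gt2 : (2 < n)%N.
Hypothesis alphaP : forall i, 0 < alpha i < 2 * pi.
Hypothesis a_ge0 : forall x, D x -> forall i, (i <= n - 3)%N -> 0 <= a x i.
Hypothesis a_sum : forall x, D x -> \sum_(0 <= j < n - 2) a x j = lambda alpha.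
Hypothesis z0H : inH z0.
Let B x := bB (Hf alpha (a x)) (hcn alpha) (rhof alpha (a x)) (e x) z0.
Let C x := bC (Hf alpha (a x)) (hcn alpha) (rhof alpha (a x)) (e x) z0.
Hypothesis eE : forall x, D x -> forall i, (i <= n - 3)%N -> inH (B x i) -> inH (C x i) ->
  (forall j, i = j.+1 -> B x i = C x i -> a x j = 0) -> normsq (e x i (B x i) (C x i)) = 1.
Hypothesis Qa : forall i, Q (fun x => a x i).
Hypothesis Qrho : forall i, (i < n - 2)%N -> Q (fun x => rhof alpha (a x) i).
Hypothesis Qe : forall i, (i < n - 2)%N -> Qc Q (fun x => B x i) -> Qc Q (fun x => C x i) ->
  Qc Q (fun x => e x i (B x i) (C x i)).

Lemma Q_Hf i : Q (fun x => Hf alpha (a x) i).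
Proof.
apply: (fcD QC); first exact: (fc_cst QC).
by apply: (fc_div QC); [move=> x _; apply: lt0r_neq0|exact: (fc_sum QC)|exact: (fc_cst QC)].
Qed.

Lemma Q_bBC i : (i <= n - 2)%N -> Qc Q (fun x => B x i) /\ Qc Q (fun x => C x i).
Proof.
move=> hi.
have [|||||_ hB hC] := @Q_bst R V D Q QC (fun x => Hf alpha (a x)) (fun x => rhof alpha (a x))
  (hcn alpha) e z0 (n - 2) _ _ _ _ _ Qrho Qe i hi.
- by move=> x k Dx hk; exact: (b_ok n_gt2 alphaP (a_ge0 Dx) (a_sum Dx) z0H (eE Dx) hk).
- move=> x k Dx hk; rewrite (Hf_gt0 n_gt2 alphaP (a_ge0 Dx) hk)/=.
  exact: (Hf_lt n_gt2 alphaP (a_ge0 Dx) (a_sum Dx) hk).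
- move=> x k Dx hk; have hk' : (k <= n - 3)%N by lia.
  rewrite normsqM normsqC (b_unit n_gt2 alphaP (a_ge0 Dx) (a_sum Dx) z0H (eE Dx) hk') mulr1.
  apply: side_rho_lt1.
  + by apply: (Hf_gt0 n_gt2 alphaP (a_ge0 Dx)); lia.
  + by case/andP: (hcn_bounds alphaP k.+1).
  + exact: (Hf_bounds n_gt2 alphaP (a_ge0 Dx) (a_sum Dx) hk).
- by move=> k; apply: (fc_cos QC); exact: Q_Hf.
- by move=> k; apply: (fc_sin QC); exact: Q_Hf.
by [].
Qed.

Lemma Q_bY i j : Q (fun x => bY alpha (a x) (e x) z0 i j).
Proof.
case/mxvec_indexP: j => k l.
have eb x : bY alpha (a x) (e x) z0 i (mxvec_index k l) =
   rotm (hcn alpha i) (if (i < n.-1)%N then C x i else B x (n - 2)) k l.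
  by rewrite /bY /mk_mtuple mxE mxvecE.
rewrite (funext eb); case h: (i < n.-1)%N;
  [apply: (@Qm_rotm _ _ D Q QC (fun=> hcn alpha i) (fun x => C x i) _ _ _ _ k l)
  |apply: (@Qm_rotm _ _ D Q QC (fun=> hcn alpha i) (fun x => B x (n - 2)%N) _ _ _ _ k l)];
  try exact: (fc_cst QC).
- by move=> x Dx; have [|_ _] := b_ok n_gt2 alphaP (a_ge0 Dx) (a_sum Dx) z0H (eE Dx) (i := i); [lia|].
- by have [|_] := Q_bBC (i := i); [lia|].
- by move=> x Dx; have [_] := b_ok n_gt2 alphaP (a_ge0 Dx) (a_sum Dx) z0H (eE Dx) (leqnn (n - 2)).
- by have [] := Q_bBC (leqnn (n - 2)).
Qed.

End QbY.

Section CinfClass.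
Context {R : realType} {V : normedModType R}.

Lemma fclass_Cinf (O : set V) : open O -> fclass O (@Cinf R V O).
Proof.
move=> oO; split.
- by move=> c; exact: Cinf_cst.
- by move=> f g; exact: CinfD.
- by move=> f g; exact: CinfM.
- by move=> f; exact: CinfV.
- by move=> f; exact: Cinf_cos.
- by move=> f; exact: Cinf_sin.
- by move=> f; exact: Cinf_sqrt.
Qed.

Lemma fclass_continuous (x : V) : fclass [set x] (fun f : V -> R => {for x, continuous f}).
Proof.
split.
- by move=> c; exact: cvg_cst.
- by move=> f g; exact: cvgD.
- by move=> f g; exact: cvgM.
- by move=> f f0 h; apply: cvgV => //; apply: f0.
- by move=> f h; apply: (@continuous_comp _ _ _ f cos) => //; exact: continuous_cos.
- by move=> f h; apply: (@continuous_comp _ _ _ f sin) => //; exact: continuous_sin.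
- by move=> f _ h; apply: (@continuous_comp _ _ _ f Num.sqrt) => //; exact: sqrt_continuous.
Qed.

End CinfClass.

Section SmoothSection.
Context {R : realType} {n : nat}.
Variable alpha : 'I_n -> R.
Hypothesis n_gt2 : (2 < n)%N.
Hypothesis alphaP : forall i, 0 < alpha i < 2 * pi.
Local Notation W := ('rV[R]_(n - 3) * 'rV[R]_(n - 3))%type.

Lemma Cinf_fst (O : set W) j : open O -> Cinf O (fun y : W => y.1 ord0 j).
Proof. by move=> oO k; exact: (@coords_Ck R _ _ (coordsPair (n - 3) (n - 3)) k O id (inl j) oO (Ck_id k oO)). Qed.

Lemma Cinf_snd (O : set W) j : open O -> Cinf O (fun y : W => y.2 ord0 j).
Proof. by move=> oO k; exact: (@coords_Ck R _ _ (coordsPair (n - 3) (n - 3)) k O id (inr j) oO (Ck_id k oO)). Qed.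

Lemma Cinf_sum (I : finType) (U : normedModType R) (O : set U) (F : I -> U -> R) : open O ->
  (forall i, Cinf O (F i)) -> Cinf O (fun x => \sum_i F i x).
Proof. by move=> oO h k; apply: Ck_sum => // i; exact: h. Qed.

Lemma open_forall (T : topologicalType) (I : finType) (O : I -> set T) :
  (forall i, open (O i)) -> open [set x | forall i, O i x].
Proof.
move=> oO; rewrite openE => x h; apply: filter_forall => i.
by apply: open_nbhs_nbhs; split; [exact: oO|exact: h].
Qed.

Lemma open_polytope : open (polytope alpha).
Proof.
have cont (f : W -> R) : Cinf setT f -> continuous f.
  by move=> h y; exact: (Ck_continuous (h 0) I).
have -> : polytope alpha = (\bigcap_(j in [set: 'I_(n - 3)]) [set y : W | 0 < y.1 ord0 j]) `&`
    [set y : W | \sum_j y.1 ord0 j < lambda alpha].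
  by apply/seteqP; split=> y -[h1 h2]; split=> // j; [move=> _|]; apply: h1.
apply: openI.
- rewrite (_ : \bigcap_(j in _) _ = [set y : W | forall j : 'I_(n - 3), 0 < y.1 ord0 j]); last first.
    by apply/seteqP; split=> y h j; [exact: h|move=> _; exact: h].
  apply: open_forall => j; apply: (@open_comp _ _ (fun y : W => y.1 ord0 j) [set t | 0 < t]); last exact: open_gt.
  by move=> y _; apply: cont; apply: Cinf_fst; exact: openT.
- apply: (@open_comp _ _ (fun y : W => \sum_j y.1 ord0 j) [set t | t < lambda alpha]); last exact: open_lt.
  by move=> y _; apply: cont; apply: Cinf_sum; [exact: openT|move=> j; apply: Cinf_fst; exact: openT].
Qed.

(** Positive areas enter twice: they make the radii [rhof] square roots of positive quantities, and
    they keep B_i away from C_(i+1), so that unit directions are smooth. *)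
Lemma rep_of_smooth i j : Cinf (polytope alpha) (fun y => rep_of alpha y i j).
Proof.
have oU := open_polytope; have QC := fclass_Cinf oU.
have a_ge0 y : polytope alpha y -> forall i, (i <= n - 3)%N -> 0 <= area_of alpha y i.
  by move=> yU k hk; exact/ltW/(area_of_gt0 yU).
have Qtheta1 k : Cinf (polytope alpha) (fun y => theta_ y.1 k).
  case: k => [|k]; first exact: (fc_cst QC).
  rewrite /theta_; case: insubP => [l _ _|_] /=; [exact: Cinf_fst|exact: (fc_cst QC)].
have Qtheta2 k : Cinf (polytope alpha) (fun y => theta_ y.2 k).
  case: k => [|k]; first exact: (fc_cst QC).
  rewrite /theta_; case: insubP => [l _ _|_] /=; [exact: Cinf_snd|exact: (fc_cst QC)].
have Qa k : Cinf (polytope alpha) (fun y => area_of alpha y k).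
  case: k => [|k]; last exact: Qtheta1.
  apply: (fcB QC); [exact: (fc_cst QC)|apply: Cinf_sum => // j0; exact: Cinf_fst].
apply: (Q_bY QC (a := area_of alpha) (e := dir_of (n := n))) => //.
- by move=> y _; exact: area_of_sum.
- by rewrite /inH /=.
- by move=> y yU k hk; exact: dir_of_unit.
- move=> k hk; have QH := Q_Hf QC alpha Qa; apply: (fc_sqrt QC).
    move=> y yU; have s1 : 1 < side (Hf alpha (area_of alpha y) k) (hcn alpha k.+1) (Hf alpha (area_of alpha y) k.+1).
      apply: side_gt1.
      + by apply: (Hf_gt0 n_gt2 alphaP (a_ge0 _ yU)); lia.
      + by case/andP: (hcn_bounds alphaP k.+1).
      + rewrite (Hf_lt n_gt2 alphaP (a_ge0 _ yU) (area_of_sum alpha n_gt2 y))// andbT HfS.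
        by have := area_of_gt0 yU (i := k) ltac:(lia); lra.
    by rewrite divr_gt0; lra.
  have side_smooth : Cinf (polytope alpha) (fun y => side (Hf alpha (area_of alpha y) k) (hcn alpha k.+1) (Hf alpha (area_of alpha y) k.+1)).
    apply: (fc_div QC).
    + move=> y yU; have /andP[? ?] := hcn_bounds alphaP k.+1.
      have h1 := Hf_gt0 n_gt2 alphaP (a_ge0 _ yU) (i := k) ltac:(lia).
      have h2 := Hf_lt n_gt2 alphaP (a_ge0 _ yU) (area_of_sum alpha n_gt2 y) (i := k) ltac:(lia).
      by apply: lt0r_neq0; rewrite mulr_gt0// sin_gt0_pi//; apply/andP.
    + apply: (fcB QC); last by apply: (fc_cos QC).
      by apply: (fcM QC); [apply: (fc_cos QC)|exact: (fc_cst QC)].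
    + by apply: (fcM QC); [apply: (fc_sin QC)|exact: (fc_cst QC)].
  apply: (fc_div QC).
  + move=> y yU; have := side_ge1 (h := Hf alpha (area_of alpha y) k) (k := hcn alpha k.+1) (l := Hf alpha (area_of alpha y) k.+1).
    move=> /(_ (Hf_gt0 n_gt2 alphaP (a_ge0 _ yU) (i := k) ltac:(lia))).
    have /andP[h0 _] := hcn_bounds alphaP k.+1.
    move=> /(_ h0 (Hf_bounds n_gt2 alphaP (a_ge0 _ yU) (area_of_sum alpha n_gt2 y) hk)) ?.
    by apply: lt0r_neq0; lra.
  + by apply: (fcB QC) => //; exact: (fc_cst QC).
  + by apply: (fcD QC) => //; exact: (fc_cst QC).
- move=> k hk QB QCk; case: k hk QB QCk => [|k] hk QB QCk.
    by split; exact: (fc_cst QC).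
  apply: (QcM QC).
    have Qang : Cinf (polytope alpha) (fun y => - angle_of y k.+1).
      by apply: (fcN QC); apply: (fcB QC); exact: Qtheta2.
    by split; [apply: (fc_cos QC)|apply: (fc_sin QC)].
  apply: (Qc_unitc QC); last exact: (Qc_dirv QC).
  move=> y yU.
  have [|_ h1 h2 h3] := b_ok4 n_gt2 alphaP (a_ge0 _ yU) (area_of_sum alpha n_gt2 y) _ (dir_of_unit yU) (i := k.+1) ltac:(lia).
    by rewrite /inH /=.
  rewrite (dirv_eq0 h1 h2); apply/eqP => /(h3 k erefl).
  by have := area_of_gt0 yU (i := k) ltac:(lia) => h4 h5; rewrite h5 ltxx in h4.
Qed.

Lemma rep_of_Ck k : Ck k (polytope alpha) (fun y => rep_of alpha y : mtuple R n).
Proof.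
apply: (Ck_coords (B := coordsMx n (2 * 2)) open_polytope) => -[i j].
exact: rep_of_smooth.
Qed.

End SmoothSection.

(** * Diffeomorphisms of quotients from a section and local lifts *)

Section QDiffeo.
Context {R : realType} {V W : normedModType R} (BV : coords_of V) (BW : coords_of W).
Variables (X : set V) (E : V -> V -> Prop) (Y : set W) (E' : W -> W -> Prop) (F : V -> W) (G : W -> V).
Hypothesis oY : open Y.
Hypothesis E'_sym : forall y y', E' y y' -> E' y' y.
Hypothesis YE' : forall y y', E' y y' -> Y y -> Y y'.
Hypothesis FY : forall x, X x -> Y (F x).
Hypothesis EF : forall x x', X x -> X x' -> (E x x' <-> E' (F x) (F x')).
Hypothesis GX : forall y, Y y -> X (G y).
Hypothesis FG : forall y, Y y -> E' (F (G y)) y.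
Hypothesis smoothG : forall k, Ck k Y G.
Hypothesis lift : forall x, X x -> exists O, exists L : V -> W,
  [/\ open O, O x, forall k, Ck k O L & forall y, X y -> O y -> E' (L y) (F y)].

Lemma open_preimage (V1 W1 : normedModType R) (O : set V1) (O1 : set W1) (L : V1 -> W1) :
  open O -> open O1 -> Ck 0 O L -> open (O `&` L @^-1` O1).
Proof.
move=> oO oO1 cL; rewrite openE => x [Ox O1x]; apply: filterI.
  by apply: open_nbhs_nbhs.
by apply: (Ck_continuous cL Ox); apply: open_nbhs_nbhs.
Qed.

Lemma qopen_near (V1 : normedModType R) (X1 : set V1) E1 S : saturated X1 E1 S ->
  (forall x, S x -> exists O, [/\ open O, O x & X1 `&` O `<=` S]) -> qopen X1 E1 S.
Proof.
move=> sS h; split=> //; exists (\bigcup_(O in [set O | open O /\ X1 `&` O `<=` S]) O).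
split; first by apply: bigcup_open => O [].
apply/seteqP; split=> x.
  move=> Sx; split; first by case: sS => + _; exact.
  by have [U [Uo Ux US]] := h x Sx; exists U.
by move=> [X1x [U [Uo US] Ux]]; apply: US.
Qed.

Let satF S : saturated Y E' S -> saturated X E (X `&` F @^-1` S).
Proof.
move=> [SY sS]; split=> [x []//|x y [Xx Sx] Xy xy]; split=> //.
by apply: (sS (F x)) => //; [exact: FY|apply/EF].
Qed.

(** [F] itself may jump within a class of E', so nothing is pulled back along it directly. Open sets
    and smooth functions are carried from Y to X by the lifts [L] and from X to Y by the section
    [G]; saturation and invariance identify the results. *)
Lemma qdiffeo_section : qdiffeo X E Y E' F.
Proof.
split => //.
- by move=> y Yy; exists (G y); [exact: GX|exact: FG].
- move=> S sS; have [SY sat] := sS; split=> -[_ [U [Uo SO]]].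
    apply: qopen_near => [|x [Xx Sx]]; first exact: satF.
    have [U1 [L [U1o U1x sL LF]]] := lift Xx.
    have SL y : X y -> U1 y -> S (F y) -> S (L y).
      move=> Xy U1y SFy; apply: (sat (F y)) => //; last exact/E'_sym/LF.
      by apply: YE' (FY Xy); exact/E'_sym/LF.
    exists (U1 `&` L @^-1` U); split; first exact: (open_preimage U1o Uo (sL 0%N)).
      by split=> //=; have := SL x Xx U1x Sx; rewrite SO => -[].
    move=> y [Xy [U1y Uy]]; split=> //=.
    apply: (sat (L y)); [|exact: FY|exact: LF].
    by rewrite SO; split=> //; apply: YE' (FY Xy); exact/E'_sym/LF.
  apply: qopen_near => // y Sy; have Yy := SY y Sy.
  have GS y' : Y y' -> (S y' <-> U (G y')).
    move=> Yy'; have -> : U (G y') <-> (X `&` F @^-1` S) (G y').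
      by rewrite SO; split=> [h|[]//]; split=> //; exact: GX.
    split=> [Sy'|[_ /= SFG]]; last by apply: (sat (F (G y'))) => //; exact: FG.
    by split=> /=; [exact: GX|apply: (sat y') => //; [exact/FY/GX|exact/E'_sym/FG]].
  exists (Y `&` G @^-1` U); split.
  - exact: (open_preimage oY Uo (smoothG 0%N)).
  - by split=> //=; exact/GS.
  - by move=> y' [_ [Yy' Uy']]; exact/GS.
- move=> S g [sS [U [Uo SO]]] inv; have [SY sat] := sS; split=> -[_ sm]; split=> //.
  + by move=> x y [Xx Sx] [Xy Sy] xy /=; apply: inv => //; exact/EF.
  + move=> x [Xx Sx]; have [U1 [L [U1o U1x sL LF]]] := lift Xx.
    have SL y : X y -> U1 y -> S (F y) -> S (L y).
      move=> Xy U1y SFy; apply: (sat (F y)) => //; last exact/E'_sym/LF.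
      by apply: YE' (FY Xy); exact/E'_sym/LF.
    have [U2 [K [U2o U2x sK Kg]]] := sm (L x) (SL x Xx U1x Sx).
    exists (U1 `&` L @^-1` U2), (K \o L).
    have oO12 := open_preimage U1o U2o (sL 0%N).
    split=> //.
      apply/smooth_onP => k; apply: (Ck_compose BW oO12 U2o) => [y []//||].
        by apply: (Ck_sub _ (sL k)) => y [].
      by move/smooth_onP : sK.
    move=> y [Xy SFy] [U1y U2y] /=; rewrite Kg//; last exact: SL.
    by apply: inv => //; [exact: SL|exact: LF].
  + move=> y Sy; have Yy := SY y Sy.
    have SG y' : S y' -> (X `&` F @^-1` S) (G y').
      move=> Sy'; have Yy' := SY y' Sy'; split=> /=; first exact: GX.
      by apply: (sat y') => //; [exact/FY/GX|exact/E'_sym/FG].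
    have [U2 [K [U2o U2x sK Kg]]] := sm (G y) (SG y Sy).
    have oYG := open_preimage oY U2o (smoothG 0%N).
    exists (Y `&` G @^-1` U2), (K \o G); split=> //.
      apply/smooth_onP => k; apply: (Ck_compose BV oYG U2o) => [y' []//||].
        by apply: (Ck_sub _ (smoothG k)) => y' [].
      by move/smooth_onP : sK.
    move=> y' Sy' [Yy' U2y'] /=; rewrite Kg//; last exact: SG.
    have [_ /= SFG] := SG y' Sy'.
    by apply: inv => //; exact: FG.
Qed.

End QDiffeo.

(** * Local lifts of the coordinates; density of the open stratum *)

Section Lifts.
Context {R : realType} {n : nat}.
Variable alpha : 'I_n -> R.
Hypothesis n_gt2 : (2 < n)%N.
Implicit Types (X Y : mtuple R n).

Lemma Qm_gen (O : set (mtuple R n)) i : open O -> Qm (Cinf O) (fun X => gen X i).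
Proof.
move=> oO k l; have QC := fclass_Cinf oO.
case: i => [|i]; first exact: (fc_cst QC).
rewrite /gen; case: insubP => [j _ _|_] /=; last exact: (fc_cst QC).
have e (X : mtuple R n) : (vec_mx (row j X) : 'M[R]_2) k l = X j (mxvec_index k l) by rewrite !mxE.
by rewrite (funext e); exact: Cinf_coord.
Qed.

Lemma gensS X m : gens X m.+1 = gens X m * gen X m.+1.
Proof. exact: prodcS. Qed.

Lemma Qm_gens (O : set (mtuple R n)) m : open O -> Qm (Cinf O) (fun X => gens X m).
Proof.
move=> oO; have QC := fclass_Cinf oO; elim: m => [|m IH].
  have -> : (fun X => gens X 0) = (fun=> 1) by apply/funext => X; exact: prodc0.
  by move=> k l; exact: (fc_cst QC).
rewrite (funext (gensS^~ m)); apply: (QmM QC) => //; exact: Qm_gen.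
Qed.

(** An open set of the ambient space, with no condition on determinants, where the explicit formulas
    for fixed points and angles are smooth. *)
Definition ell_dom : set (mtuple R n) := [set X | forall i : 'I_n,
  [/\ gen X i.+1 1 0 != 0, 0 < 4 - (\tr (gen X i.+1)) ^+ 2 &
    (0 < i)%N -> gens X i 1 0 != 0 /\ 0 < 4 - (\tr (gens X i)) ^+ 2]].

Lemma open_neq0f (O : set (mtuple R n)) f : open O -> Cinf O f -> open (O `&` [set X | f X != 0]).
Proof.
move=> oO cf; apply: (open_preimage (O1 := [set t : R | t != 0]) oO _ (cf 0%N)).
by rewrite (_ : [set x : R | x != 0] = ~` [set 0]); [apply: closed_openC; exact: closed_eq|apply/seteqP; split => x /= /eqP].
Qed.

Lemma open_gt0f (V : normedModType R) (O : set V) f : open O -> Cinf O f -> open (O `&` [set X | 0 < f X]).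
Proof. by move=> oO cf; apply: (open_preimage (O1 := [set t : R | 0 < t]) oO _ (cf 0%N)); exact: open_gt. Qed.

Lemma Q_tr (O : set (mtuple R n)) f : open O -> Qm (Cinf O) f -> Cinf O (fun X => 4 - (\tr (f X)) ^+ 2).
Proof.
move=> oO Qf; have QC := fclass_Cinf oO.
apply: (fcB QC); first exact: (fc_cst QC).
have e X : \tr (f X) ^+ 2 = (f X 0 0 + f X 1 1) ^+ 2 by rewrite trmx2E.
by rewrite (funext e); apply: (fcX QC); apply: (fcD QC).
Qed.

Lemma open_ell_dom : open ell_dom.
Proof.
have oT : open [set: mtuple R n] by exact: openT.
apply: open_forall => i.
have o1 := open_neq0f oT (Qm_gen i.+1 oT 1 0).
have o2 := open_gt0f oT (Q_tr oT (Qm_gen i.+1 oT)).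
have o3 := open_neq0f oT (Qm_gens i oT 1 0).
have o4 := open_gt0f oT (Q_tr oT (Qm_gens i oT)).
case: (ltnP 0 i) => hi.
  rewrite [X in open X](_ : _ = ([set: mtuple R n] `&` [set X : mtuple R n | gen X i.+1 1 0 != 0]) `&`
      ([set: mtuple R n] `&` [set X : mtuple R n | 0 < 4 - (\tr (gen X i.+1)) ^+ 2]) `&`
      (([set: mtuple R n] `&` [set X : mtuple R n | gens X i 1 0 != 0]) `&`
      ([set: mtuple R n] `&` [set X : mtuple R n | 0 < 4 - (\tr (gens X i)) ^+ 2]))).
    by apply: openI; apply: openI.
  apply/seteqP; split=> X /=.
    by move=> [a b /(_ isT)[c d]].
  by move=> [[[_ a] [_ b]] [[_ c] [_ d]]].
rewrite [X in open X](_ : _ = ([set: mtuple R n] `&` [set X : mtuple R n | gen X i.+1 1 0 != 0]) `&`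
      ([set: mtuple R n] `&` [set X : mtuple R n | 0 < 4 - (\tr (gen X i.+1)) ^+ 2])).
  by apply: openI.
apply/seteqP; split=> X /=; first by move=> [].
by move=> [[_ a] [_ b]]; split.
Qed.

Lemma ell_gen X i : ell_dom X -> (1 <= i <= n)%N -> gen X i 1 0 != 0 /\ 0 < 4 - (\tr (gen X i)) ^+ 2.
Proof. by case: i => // i h hi; have [a b _] := h (Ordinal hi). Qed.

Lemma ell_gens X i : ell_dom X -> (1 <= i < n)%N -> gens X i 1 0 != 0 /\ 0 < 4 - (\tr (gens X i)) ^+ 2.
Proof. by move=> h /andP[h1 h2]; have [_ _] := h (Ordinal h2); exact. Qed.

Lemma tr_sqrN (A : 'M[R]_2) : (\tr (- A)) ^+ 2 = (\tr A) ^+ 2.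
Proof. by rewrite raddfN sqrrN. Qed.

Lemma DT_ell_dom X : RepDT alpha X -> ell_dom X.
Proof.
move=> XDT i; have hi : (1 <= i.+1 <= n)%N by rewrite /= ltn_ord.
have XR := DT_Rep XDT.
split; [exact: (Rep_c XR)|by rewrite subr_gt0; exact: (Rep_tr XR)|].
move=> i0; have [|d c0 t] := DT_posell n_gt2 XDT (m := i); first by rewrite i0 ltn_ord.
have [|e|e] := Rep_gens XR (m := i); first by rewrite ltnW// ltn_ord.
  by rewrite e subr_gt0 gt_eqF.
by rewrite e tr_sqrN subr_gt0 mxE oppr_eq0 gt_eqF.
Qed.

Section Smooth.
Variables (V : normedModType R) (O : set V) (f : V -> 'M[R]_2).
Hypothesis oO : open O.
Hypothesis Qf : Qm (Cinf O) f.
Hypothesis f0 : forall x, O x -> f x 1 0 != 0 /\ 0 < 4 - (\tr (f x)) ^+ 2.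
Let QC := fclass_Cinf oO.

Let trE : (fun x => \tr (f x)) = (fun x => f x 0 0 + f x 1 1).
Proof. by apply/funext => x; rewrite trmx2E. Qed.

Let Qtr : Cinf O (fun x => \tr (f x)).
Proof. by rewrite trE; apply: (fcD QC). Qed.

Lemma fix_im_pos x : O x -> 0 < fix_im (f x).
Proof.
move=> /f0[a b]; rewrite sqrtr_gt0 divr_gt0// mulr_gt0//.
by rewrite exprn_even_gt0.
Qed.

Lemma Q_fix_im : Cinf O (fun x => fix_im (f x)).
Proof.
have h x : O x -> 0 < 4 * f x 1 0 ^+ 2 by move=> /f0[a b]; rewrite mulr_gt0// exprn_even_gt0.
apply: (fc_sqrt QC); first by move=> x OX; rewrite divr_gt0 ?h//; case: (f0 OX).
apply: (fc_div QC); first by move=> x /h ?; rewrite gt_eqF.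
  by apply: (fcB QC); [exact: (fc_cst QC)|exact: (fcX QC)].
by apply: (fcM QC); [exact: (fc_cst QC)|exact: (fcX QC)].
Qed.

Lemma Q_fix_re : Cinf O (fun x => fix_re (f x)).
Proof.
apply: (fc_div QC).
- by move=> x /f0[a b]; rewrite mulf_neq0.
- by apply: (fcB QC).
- by apply: (fcM QC) => //; exact: (fc_cst QC).
Qed.

Lemma Q_hang : Cinf O (fun x => hang (f x)).
Proof.
apply: (fcB QC); first exact: (fc_cst QC).
apply: Cinf_atan => //; apply: (fc_div QC) => //.
- by move=> x OX; have [a b] := f0 OX; rewrite !mulf_neq0// gt_eqF// fix_im_pos.
- apply: (fcM QC); [exact: (fc_cst QC)|apply: (fcM QC) => //; exact: Q_fix_im].
Qed.

End Smooth.

Definition fixC (A : 'M[R]_2) : R[i] := fix_re A +i* fix_im A.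

(** This equals the area parameter on [RepDT], and [angle_vec] below has argument gamma_i on the
    open stratum; both are explicit in the entries, hence smooth on [ell_dom]. *)
Definition area_lift X i := 2 * (hang (gens X i.+2) - hang (gens X i.+1) - hang (gen X i.+2)).

Definition angle_vec X i : R[i] :=
  dirv (fixC (gens X i.+1)) (fixC (gen X i.+1)) * conjc (dirv (fixC (gens X i.+1)) (fixC (gen X i.+2))).

Lemma fixC_N A : \det A = 1 -> (\tr A) ^+ 2 < 4 -> fixC (- A) = fixpt A.
Proof.
by move=> d t; rewrite -fixptN /fixC -fixptE ?detN2 ?tr_sqrN.
Qed.

Lemma DT_gens X i : RepDT alpha X -> (i < n)%N ->
  \det (gens X i) = 1 /\ hang (gens X i) = hang (prodc (ngen X) i).
Proof.
move=> XDT hi; have XR := DT_Rep XDT.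
have e := Rep_gens XR (ltnW hi); case: i hi e => [|i] hi e.
  by rewrite /gens big_geq// prodc0 det1_2.
have [d c0 t] := DT_posell n_gt2 XDT (m := i.+1) hi.
by case: e => ->; rewrite ?detN2 ?hangN.
Qed.

Lemma DT_area_lift X i : RepDT alpha X -> (i <= n - 3)%N -> area_param X i = area_lift X i.
Proof.
move=> XDT hi; have h := n3_bound n_gt2 hi; have XR := DT_Rep XDT.
rewrite (area_paramE n_gt2 XDT hi) /area_lift !(proj2 (DT_gens XDT _)); [|lia|lia].
congr (_ * (_ - _)); have [e|e] := Rep_gen XR (i := i.+2) ltac:(lia); first by rewrite e.
by rewrite [in RHS]e hangN.
Qed.

Lemma DT_fixB X i : RepDT alpha X -> (i.+1 < n)%N -> Bpt X i = fixC (gens X i.+1).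
Proof.
move=> XDT hi; rewrite (Bpt_P n_gt2 XDT hi).
have [d c0 t] := DT_posell n_gt2 XDT (m := i.+1) hi.
have [e|e] := Rep_gens (DT_Rep XDT) (ltnW hi); rewrite e; last by rewrite fixC_N.
by rewrite fixptE.
Qed.

Lemma DT_fixC X i : RepDT alpha X -> (1 <= i <= n)%N -> Cpt X i = fixC (gen X i).
Proof.
move=> XDT hi; have XR := DT_Rep XDT.
by rewrite /Cpt fixptE// ?(Rep_det XR)// ?(Rep_tr XR).
Qed.

Lemma angle_vec_polar X i : RepDT_open alpha X -> (1 <= i <= n - 3)%N ->
  polar (angle_vec X i) (gamma X i) /\ angle_vec X i != 0.
Proof.
move=> XO hi; have XDT : RepDT alpha X by case: XO.
have B0 : inH (Bpt X i) by apply: (Bpt_inH n_gt2 XDT); lia.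
have C1 : inH (Cpt X i.+1) by apply: (Cpt_inH XDT); lia.
have C2 : inH (Cpt X i.+2) by apply: (Cpt_inH XDT); lia.
have N2 : Bpt X i != Cpt X i.+2 by apply: (Bpt_neq_next n_gt2 XO); lia.
have N1 : Bpt X i != Cpt X i.+1 by apply: (Bpt_neq_prev n_gt2 XO); lia.
have e : angle_vec X i = dirv (Bpt X i) (Cpt X i.+1) * conjc (dirv (Bpt X i) (Cpt X i.+2)).
  rewrite (DT_fixB XDT); last by lia.
  rewrite (DT_fixC XDT (i := i.+1)); last by lia.
  by rewrite (DT_fixC XDT (i := i.+2)); last by lia.
have [_ h] := ray_angleP B0 C2 C1 N2 N1.
split; first by rewrite e; apply/(polar_dirv _ B0 C2 C1).
rewrite e mulf_neq0 ?(dirv_eq0 B0 C1)// conjc_eq0 (dirv_eq0 B0 C2); exact: N2.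
Qed.

Lemma Q_fixC (V : normedModType R) (O : set V) (f : V -> 'M[R]_2) : open O -> Qm (Cinf O) f ->
  (forall x, O x -> f x 1 0 != 0 /\ 0 < 4 - (\tr (f x)) ^+ 2) ->
  Qc (Cinf O) (fun x => fixC (f x)).
Proof. by move=> oO Qf f0; split; [exact: Q_fix_re|exact: Q_fix_im]. Qed.

Lemma Q_conj (V : normedModType R) (O : set V) (f : V -> R[i]) : open O -> Qc (Cinf O) f ->
  Qc (Cinf O) (fun x => conjc (f x)).
Proof.
move=> oO [f1 f2]; have QC := fclass_Cinf oO.
have e1 x : complex.Re (conjc (f x)) = complex.Re (f x) by case: (f x).
have e2 x : complex.Im (conjc (f x)) = - complex.Im (f x) by case: (f x).
by split; [rewrite (funext e1)|rewrite (funext e2); exact: (fcN QC)].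
Qed.

Lemma Q_area_lift i : (i <= n - 3)%N -> Cinf ell_dom (fun X => area_lift X i).
Proof.
move=> hi; have h := n3_bound n_gt2 hi; have QC := fclass_Cinf open_ell_dom.
apply: (fcM QC); first exact: (fc_cst QC).
apply: (fcB QC); first apply: (fcB QC).
- by apply: Q_hang; [exact: open_ell_dom|exact/Qm_gens/open_ell_dom|move=> X eX; apply: ell_gens => //; lia].
- by apply: Q_hang; [exact: open_ell_dom|exact/Qm_gens/open_ell_dom|move=> X eX; apply: ell_gens => //; lia].
- by apply: Q_hang; [exact: open_ell_dom|exact/Qm_gen/open_ell_dom|move=> X eX; apply: ell_gen => //; lia].
Qed.

Lemma Q_angle_vec i : (1 <= i <= n - 3)%N -> Qc (Cinf ell_dom) (fun X => angle_vec X i).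
Proof.
move=> hi; have oE := open_ell_dom; have QC := fclass_Cinf oE.
have QB : Qc (Cinf ell_dom) (fun X => fixC (gens X i.+1)).
  by apply: Q_fixC; [exact: oE|exact/Qm_gens/oE|move=> X eX; apply: ell_gens => //; lia].
have QCi k : (1 <= k <= n)%N -> Qc (Cinf ell_dom) (fun X => fixC (gen X k)).
  by move=> hk; apply: Q_fixC; [exact: oE|exact/Qm_gen/oE|move=> X eX; apply: ell_gen].
apply: (QcM QC); first by apply: (Qc_dirv QC) => //; apply: QCi; lia.
by apply: Q_conj => //; apply: (Qc_dirv QC) => //; apply: QCi; lia.
Qed.

Section AngleLift.
Variable X0 : mtuple R n.
Hypothesis X0O : RepDT_open alpha X0.

(** Only the argument relative to the base point is taken: near [X0] the real part is positive, and
    the arc tangent is a smooth branch of the argument. *)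
Definition angle_rel X i : R[i] := angle_vec X i * conjc (angle_vec X0 i).

Definition angle_lift X i := gamma X0 i + atan (complex.Im (angle_rel X i) / complex.Re (angle_rel X i)).

Definition angle_dom : set (mtuple R n) :=
  ell_dom `&` [set X | forall j : 'I_(n - 3), ell_dom X /\ 0 < complex.Re (angle_rel X j.+1)].

Lemma Q_angle_rel i : (1 <= i <= n - 3)%N -> Qc (Cinf ell_dom) (fun X => angle_rel X i).
Proof.
move=> hi; have oE := open_ell_dom; have QC := fclass_Cinf oE.
by apply: (QcM QC); [exact: Q_angle_vec|split; exact: (fc_cst QC)].
Qed.

Lemma open_angle_dom : open angle_dom.
Proof.
apply: openI; first exact: open_ell_dom.
apply: open_forall => j.
have hj : (1 <= j.+1 <= n - 3)%N by have := ltn_ord j; lia.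
by have [Q1 _] := Q_angle_rel hj; exact: (open_gt0f open_ell_dom Q1).
Qed.

Lemma angle_rel_gt0 X i : angle_dom X -> (1 <= i <= n - 3)%N -> 0 < complex.Re (angle_rel X i).
Proof. by case: i => // i [_ h] hi; have [] := h (Ordinal hi). Qed.

Lemma angle_dom_base : angle_dom X0.
Proof.
have XDT : RepDT alpha X0 by case: X0O.
split=> [|j]; first exact: DT_ell_dom.
split; first exact: DT_ell_dom.
have hj : (1 <= j.+1 <= n - 3)%N by have := ltn_ord j; lia.
have [_ h] := angle_vec_polar X0O hj.
by rewrite /angle_rel mul_conj /= lt_neqAle eq_sym normsq_eq0 h normsq_ge0.
Qed.

Lemma Q_angle_lift i : (1 <= i <= n - 3)%N -> Cinf angle_dom (fun X => angle_lift X i).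
Proof.
move=> hi; have oA := open_angle_dom; have QC := fclass_Cinf oA.
have [Q1 Q2] := Q_angle_rel hi.
have sub f : Cinf ell_dom f -> Cinf angle_dom f.
  by move=> h k; apply: (Ck_sub _ (h k)) => X [].
apply: (fcD QC); first exact: (fc_cst QC).
apply: Cinf_atan => //; apply: (fc_div QC); [|exact: sub|exact: sub].
by move=> X hX; rewrite gt_eqF// angle_rel_gt0.
Qed.

Lemma angle_lift_gamma X i : angle_dom X -> RepDT_open alpha X -> (1 <= i <= n - 3)%N ->
  eqmod2pi (angle_lift X i) (gamma X i).
Proof.
move=> hX XO hi; have [p h] := angle_vec_polar XO hi; have [p0 h0] := angle_vec_polar X0O hi.
have r0 := angle_rel_gt0 hX hi.
have pr : polar (angle_rel X i) (atan (complex.Im (angle_rel X i) / complex.Re (angle_rel X i))).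
  by case: (angle_rel X i) r0 => a b /= a0; exact: polar_atan.
apply/eqmod2piP/esym; have := polar_cis (polarM p (polar_conj p0)) pr.
by rewrite /angle_lift [cis (gamma X0 i + _)]cisD => <-; rewrite -cisD addrC subrK.
Qed.

Definition sigma_lift X i := \sum_(1 <= j < i.+1) angle_lift X j.

Definition coords_lift X : 'rV[R]_(n - 3) * 'rV[R]_(n - 3) :=
  (\row_j area_lift X j.+1, \row_j sigma_lift X j.+1).

Lemma Q_sigma_lift i : (i <= n - 3)%N -> Cinf angle_dom (fun X => sigma_lift X i).
Proof.
elim: i => [|i IH] hi; have QC := fclass_Cinf open_angle_dom.
  have e X : sigma_lift X 0 = 0 by rewrite /sigma_lift big_geq.
  by rewrite (funext e); exact: (fc_cst QC).
have e X : sigma_lift X i.+1 = sigma_lift X i + angle_lift X i.+1.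
  by rewrite /sigma_lift big_nat_recr.
by rewrite (funext e); apply: (fcD QC); [apply: IH; lia|apply: Q_angle_lift; lia].
Qed.

Lemma coords_lift_Ck k : Ck k angle_dom coords_lift.
Proof.
apply: (Ck_coords (B := coordsPair (n - 3) (n - 3)) open_angle_dom) => -[j|j] /=.
  have e (X : mtuple R n) : (\row_j0 area_lift X j0.+1) ord0 j = area_lift X j.+1 by rewrite mxE.
  rewrite (funext e); have hj : (j.+1 <= n - 3)%N by have := ltn_ord j; lia.
  by apply: (Ck_sub _ (Q_area_lift hj k)) => X [].
have e (X : mtuple R n) : (\row_j0 sigma_lift X j0.+1) ord0 j = sigma_lift X j.+1 by rewrite mxE.
by rewrite (funext e); apply: Q_sigma_lift; have := ltn_ord j; lia.
Qed.

Lemma sigma_liftE X i : angle_dom X -> RepDT_open alpha X -> (i <= n - 3)%N ->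
  eqmod2pi (sigma_lift X i) (sigma X i).
Proof.
move=> hX XO hi; apply: eqmod2pi_sum => j hj; apply: angle_lift_gamma => //; lia.
Qed.

Lemma coords_liftE X : angle_dom X -> RepDT_open alpha X -> torus_rel (coords_lift X) (coords X).
Proof.
move=> hX XO; have XDT : RepDT alpha X by case: XO.
split.
  apply/rowP => j; rewrite coords1 mxE (DT_area_lift XDT)//.
by move=> j; rewrite coords2 mxE; apply: sigma_liftE.
Qed.

End AngleLift.

Lemma mtuple_cvg (V : normedModType R) (f : V -> mtuple R n) x :
  (forall i j, {for x, continuous (fun y => f y i j)}) -> {for x, continuous f}.
Proof.
move=> h; pose B := coordsMx (R := R) n (2 * 2).
have -> : f = (fun y => \sum_i cfun (c := B) i (f y) *: cvec (c := B) i) by apply/funext => y; exact: cfunK.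
elim: (index_enum _) => [|[i j] s IH].
  rewrite (_ : (fun y => _) = (fun=> 0)); first exact: cvg_cst.
  by apply/funext => y; rewrite big_nil.
rewrite (_ : (fun y => _) = (fun y => cfun (c := B) (i, j) (f y) *: cvec (c := B) (i, j) +
   \sum_(i <- s) cfun (c := B) i (f y) *: cvec (c := B) i)); last by apply/funext => y; rewrite big_cons.
by apply: cvgD => //; apply: cvgZr_tmp; exact: h.
Qed.

(** A point is deformed by moving its areas towards equal positive ones while its directions stay
    fixed. The rebuilt chain is conjugate to [X] at time 0, depends continuously on time there, and
    has positive areas afterwards. *)
Lemma open_stratum_qdense : (forall i, 0 < alpha i < 2 * pi) -> 0 < lambda alpha ->
  qdense (RepDT alpha) conj_rel (RepDT_open alpha).
Proof.
move=> alphaP l0; split; first by move=> X [].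
move=> S [[SX sat] [U [Uo SU]]] [X SX0]; have XDT := SX X SX0.
pose m : R := (n - 2)%:R; have m0 : 0 < m by rewrite ltr0n; lia.
pose a0 := area_param X.
(* A convex combination with n - 2 equal areas, so the sum remains lambda. *)
pose a (t : R) i := (1 - t) * a0 i + t * (lambda alpha / m).
(* Directions in Cayley coordinates, constant during the deformation; a collapsed side receives the
   direction 1. *)
pose d i : R[i] := if Bpt X i == Cpt X i.+2 then 1 else (rhof alpha a0 i)^-1%:C * cayley (Bpt X i) (Cpt X i.+2).
pose e (i : nat) (B C : R[i]) := d i.
have a0_ge0 i : (i <= n - 3)%N -> 0 <= a0 i by exact: (area_param_ge0 n_gt2 XDT).
have a_sum t : \sum_(0 <= j < n - 2) a t j = lambda alpha.
  rewrite /a big_split/= -mulr_sumr (sum_area n_gt2 XDT) sumr_const_nat subn0 -mulr_natr -/m.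
  by field; rewrite gt_eqF.
have BC i : (i <= n - 3)%N -> inH (Bpt X i) /\ inH (Cpt X i.+2).
  by move=> hi; split; [apply: (Bpt_inH n_gt2 XDT)|apply: (Cpt_inH XDT)]; lia.
have rho2 i : (i <= n - 3)%N -> rhof alpha a0 i ^+ 2 = normsq (cayley (Bpt X i) (Cpt X i.+2)).
  by move=> hi; rewrite (normsq_side n_gt2 alphaP XDT hi).
have rho_neq i : (i <= n - 3)%N -> Bpt X i != Cpt X i.+2 -> rhof alpha a0 i != 0.
  move=> hi N; have [hB hC] := BC i hi.
  by rewrite -sqrf_eq0 (rho2 i hi) normsq_eq0 (cayley_eq0 hB hC).
have d1 i : (i <= n - 3)%N -> normsq (d i) = 1.
  move=> hi; rewrite /d; case: ifPn => [_|N]; first by rewrite /normsq /= expr1n expr0n addr0.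
  by rewrite normsqM normsqC exprVn -rho2// mulVf// sqrf_eq0 rho_neq.
have eX i : (i <= n - 3)%N ->
    cayley (Bpt X i) (Cpt X i.+2) = (rhof alpha a0 i)%:C * e i (Bpt X i) (Cpt X i.+1).
  move=> hi; have [hB hC] := BC i hi; rewrite /e /d; case: ifPn => [/eqP E|N].
    have /eqP -> : cayley (Bpt X i) (Cpt X i.+2) == 0 by rewrite (cayley_eq0 hB hC) E.
    suff /eqP -> : rhof alpha a0 i == 0 by rewrite mul0r.
    rewrite -sqrf_eq0 (rho2 i hi) normsq_eq0 (cayley_eq0 hB hC); exact/eqP.
  rewrite mulrA -rmorphM /= mulfV ?rho_neq//.
  by rewrite rmorph1 mul1r.
have a_at0 : a 0 = a0 by apply/funext => i; rewrite /a subr0 mul1r mul0r addr0.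
have z0H : inH (Cpt X 1) by apply: (Cpt_inH XDT); lia.
pose F t : mtuple R n := bY alpha (a t) e (Cpt X 1).
have F0 : S (F 0).
  apply: (sat X); first exact: SX0.
    rewrite /F a_at0; apply: (bY_DT n_gt2 alphaP a0_ge0 (sum_area n_gt2 XDT) z0H).
    by move=> i hi _ _ _; exact: d1.
  exists 1; first exact: det1_2.
  move=> i hi; rewrite invr1 mul1r mulr1 /F (gen_bY _ _ _ _ hi) a_at0.
  rewrite -(recover_bs n_gt2 XDT eX hi).
  by case: (Rep_gen (DT_Rep XDT) hi) => ->; [left|right; rewrite opprK].
have cF : {for (0 : R), continuous F}.
  apply: mtuple_cvg => i j; have QC := @fclass_continuous R R 0.
  have Qid : {for (0 : R), continuous (fun t : R => t)} by exact: cvg_id.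
  have Qa k : {for (0 : R), continuous (fun t => a t k)}.
    apply: (fcD QC); apply: (fcM QC); try exact: (fc_cst QC); try exact: Qid.
    by apply: (fcB QC); [exact: (fc_cst QC)|exact: Qid].
  have QH := Q_Hf QC alpha Qa.
  apply: (Q_bY QC (a := a) (e := fun _ => e)) => //.
  - by move=> t -> k hk; rewrite a_at0; exact: a0_ge0.
  - by move=> t -> k hk _ _ _; exact: d1.
  - move=> k hk.
    have h1 := Hf_gt0 n_gt2 alphaP a0_ge0 (i := k) ltac:(lia).
    have h2 := Hf_lt n_gt2 alphaP a0_ge0 (sum_area n_gt2 XDT) (i := k) ltac:(lia).
    have h3 := Hf_bounds n_gt2 alphaP a0_ge0 (sum_area n_gt2 XDT) hk.
    have /andP[k0 k1] := hcn_bounds alphaP k.+1.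
    have sc : {for (0 : R), continuous (fun t => side (Hf alpha (a t) k) (hcn alpha k.+1) (Hf alpha (a t) k.+1))}.
      apply: (fc_div QC).
      + move=> t ->; rewrite a_at0; apply: lt0r_neq0; rewrite mulr_gt0// sin_gt0_pi//; apply/andP; by split.
      + apply: (fcB QC); last by apply: (fc_cos QC).
        by apply: (fcM QC); [apply: (fc_cos QC)|exact: (fc_cst QC)].
      + by apply: (fcM QC); [apply: (fc_sin QC)|exact: (fc_cst QC)].
    (* A degenerate triangle has radius 0, where the square root is not smooth; its continuity
       suffices. *)
    apply: (@continuous_comp _ _ _ (fun t => (side (Hf alpha (a t) k) (hcn alpha k.+1) (Hf alpha (a t) k.+1) - 1) /
      (side (Hf alpha (a t) k) (hcn alpha k.+1) (Hf alpha (a t) k.+1) + 1)) Num.sqrt); last exact: sqrt_continuous.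
    apply: (fc_div QC).
    + by move=> t ->; rewrite a_at0; have := side_ge1 h1 k0 h3 => ?; apply: lt0r_neq0; lra.
    + by apply: (fcB QC) => //; exact: (fc_cst QC).
    + by apply: (fcD QC) => //; exact: (fc_cst QC).
  - by move=> k hk _ _; split; exact: (fc_cst QC).
have UF0 : U (F 0) by move: F0; rewrite SU => -[].
have [r /= r0 rU] : nbhs (0 : R) (F @^-1` U) by apply: cF; apply: open_nbhs_nbhs.
pose t := Num.min (r / 2) 1.
have t0 : 0 < t by rewrite lt_min ltr01 andbT divr_gt0.
have t1 : t <= 1 by rewrite ge_min lexx orbT.
have tr : t < r by rewrite gt_min; apply/orP; left; lra.
have UFt : U (F t) by apply: rU; rewrite /ball_ /= sub0r normrN gtr0_norm.
have at_gt0 i : (i <= n - 3)%N -> 0 < a t i.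
  move=> hi; have := a0_ge0 i hi => ?; apply: ltr_wpDl; first by rewrite mulr_ge0// subr_ge0.
  by rewrite mulr_gt0// divr_gt0.
have at_ge0 i : (i <= n - 3)%N -> 0 <= a t i by move=> hi; exact/ltW/at_gt0.
have eE : forall i : nat, (i <= n - 3)%N ->
   inH (bB (Hf alpha (a t)) (hcn alpha) (rhof alpha (a t)) e (Cpt X 1) i) ->
   inH (bC (Hf alpha (a t)) (hcn alpha) (rhof alpha (a t)) e (Cpt X 1) i) ->
   (forall j : nat, i = j.+1 ->
     bB (Hf alpha (a t)) (hcn alpha) (rhof alpha (a t)) e (Cpt X 1) i =
     bC (Hf alpha (a t)) (hcn alpha) (rhof alpha (a t)) e (Cpt X 1) i -> a t j = 0) ->
   normsq (e i (bB (Hf alpha (a t)) (hcn alpha) (rhof alpha (a t)) e (Cpt X 1) i)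
     (bC (Hf alpha (a t)) (hcn alpha) (rhof alpha (a t)) e (Cpt X 1) i)) = 1.
  by move=> i hi _ _ _; exact: d1.
have FDT : RepDT alpha (F t) by exact: (bY_DT n_gt2 alphaP at_ge0 (a_sum t) z0H eE).
exists (F t); split; first by rewrite SU.
split; first exact: FDT.
move=> i hi; have e1 : area_param (F t) i = a t i := area_bY n_gt2 alphaP at_ge0 (a_sum t) z0H eE hi.
by rewrite e1; exact: at_gt0.
Qed.

Lemma open_stratum_qopen : qopen (RepDT alpha) conj_rel (RepDT_open alpha).
Proof.
split.
  split=> [X []//|X Y XO YDT XY]; by have [] := conj_rel_open n_gt2 XO XY.
exists (ell_dom `&` [set X | forall j : 'I_n, (j <= n - 3)%N -> ell_dom X /\ 0 < area_lift X j]).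
split.
  apply: openI; first exact: open_ell_dom.
  apply: open_forall => j; case: (leqP j (n - 3)) => hj.
    rewrite [X in open X](_ : _ = ell_dom `&` [set X | 0 < area_lift X j]).
      exact: (open_gt0f open_ell_dom (Q_area_lift hj)).
    by apply/seteqP; split=> X /=; [exact|move=> h _].
  rewrite [X in open X](_ : _ = setT); first exact: openT.
  by apply/seteqP; split.
apply/seteqP; split=> X.
  move=> [XDT X0]; split=> //; split; first exact: DT_ell_dom.
  move=> j hj; split; first exact: DT_ell_dom.
  by rewrite -DT_area_lift//; exact: X0.
move=> [XDT [_ h]]; split=> // i hi; rewrite (DT_area_lift XDT hi).
have hi' : (i < n)%N by lia.
by have [] := h (Ordinal hi') hi.
Qed.

End Lifts.

Section MainDiffeo.
Context {R : realType} {n : nat}.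
Variable alpha : 'I_n -> R.
Hypothesis n_gt2 : (2 < n)%N.
Hypothesis alphaP : forall i, 0 < alpha i < 2 * pi.

Lemma torus_rel_sym k (p q : 'rV[R]_k * 'rV[R]_k) : torus_rel p q -> torus_rel q p.
Proof. by move=> [e h]; split=> // j; apply: eqmod2pi_sym. Qed.

Lemma polytope_torus y y' : torus_rel y y' -> polytope alpha y -> polytope alpha y'.
Proof. by move=> [e _] [h1 h2]; split; rewrite -e. Qed.

Lemma qopen_polytope : qopen setT (@torus_rel R (n - 3)) (polytope alpha).
Proof.
split; first by split=> // y y' h _ yy'; exact: (polytope_torus yy').
by exists (polytope alpha); split; [exact: open_polytope|rewrite setTI].
Qed.

Lemma coords_qdiffeo :
  qdiffeo (RepDT_open alpha) conj_rel (polytope alpha) (@torus_rel R (n - 3)) coords.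
Proof.
apply: (qdiffeo_section (G := rep_of alpha) (coordsMx n (2 * 2)) (coordsPair (n - 3) (n - 3))).
- exact: open_polytope.
- by move=> y y'; exact: torus_rel_sym.
- by move=> y y'; exact: polytope_torus.
- by move=> X; exact: coords_polytope.
- by move=> X Y; exact: conj_rel_coords.
- by move=> y; exact: rep_of_open.
- by move=> y; exact: coords_rep_of.
- by move=> k; exact: rep_of_Ck.
- move=> X XO; exists (angle_dom X), (coords_lift X); split.
  + exact: open_angle_dom.
  + exact: (angle_dom_base n_gt2 XO).
  + by move=> k; exact: coords_lift_Ck.
  + by move=> Y YO hY; exact: (coords_liftE n_gt2 XO hY YO).
Qed.

End MainDiffeo.

(** * The torus action *)

Section Torus.
Context {R : realType} {n : nat}.
Implicit Types (X Y : mtuple R n).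

Lemma jden_autf (A : 'M[R]_2) z : jden A z = normsq (autf A z).
Proof. by rewrite autfE /jden /normsq. Qed.

Lemma autf_fixed (A : 'M[R]_2) z : \det A = 1 -> inH z -> mobius A z = z -> normsq (autf A z) = 1.
Proof.
move=> d z0 e; have := mobiusE d z0; rewrite e => /(congr1 (fun w : R[i] => complex.Im w)) /= h.
have j0 := jden_gt0 d z0; rewrite -jden_autf.
apply: (mulfI (lt0r_neq0 z0)); by rewrite mulr1 [in LHS]h divfK// gt_eqF.
Qed.

(** The choice in [rotation] is inhabited by [rotm] of angle - t / 2, since the derivative is the
    power -2 of cz + d. *)
Lemma rotationP (t : R) z : inH z ->
  [/\ \det (rotation t z) = 1, mobius (rotation t z) z = z & mobius_deriv (rotation t z) z = cis t].
Proof.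
move=> z0; rewrite /rotation; case: xgetP => [A _ //|h]; exfalso.
apply: (h (rotm (- (t / 2)) z)); split; first exact: det_rotm.
  exact: mobius_rotm.
rewrite /mobius_deriv -/(autf _ _) autfE /rotm !mxE2 /= cosN sinN.
have -> : ((cos (t / 2) * 0 + - sin (t / 2) * (complex.Im z)^-1) * complex.Re z +
   (cos (t / 2) * 1 + - sin (t / 2) * (- complex.Re z / complex.Im z)))
   +i* ((cos (t / 2) * 0 + - sin (t / 2) * (complex.Im z)^-1) * complex.Im z) = cis (- (t / 2)).
  rewrite /cis cosN sinN; apply: eq_cplx => /=; field; by rewrite gt_eqF.
rewrite expr2 -cisD -opprD -splitr.
by apply: (mulfI (cis_neq0 (- t))); rewrite mulfV ?cis_neq0// -cisD addNr cis0.
Qed.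

Lemma cayley_rotate (A : 'M[R]_2) z w (t : R) : \det A = 1 -> inH z -> inH w -> mobius A z = z ->
  mobius_deriv A z = cis t -> cayley z (mobius A w) = cis t * cayley z w.
Proof.
move=> d z0 w0 fz dz; have := cayley_mobius d z0 w0; rewrite fz => h.
have u := autf_fixed d z0 fz; have a0 : autf A z != 0 by rewrite -normsq_eq0 u oner_eq0.
apply: (mulIf a0); rewrite h -dz /mobius_deriv -/(autf A z).
have c : conjc (autf A z) = (autf A z)^-1.
  by apply: (mulfI a0); rewrite mul_conj u mulfV.
by rewrite c; field.
Qed.

Variable alpha : 'I_n -> R.
Hypothesis n_gt2 : (2 < n)%N.

Section OneTorus.
Variables (X : mtuple R n) (theta : 'rV[R]_(n - 3)).
Hypothesis XDT : RepDT alpha X.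
Local Notation Rc := (torus_conj theta X).
Let r j := rotation (theta_ theta j - theta_ theta j.-1) (Bpt X j).
Let Y := torus_act theta X.
Let s i := Rc i * ngen X i * (Rc i)^-1.

Let rP j : (j <= n - 3)%N -> [/\ \det (r j) = 1, mobius (r j) (Bpt X j) = Bpt X j &
  mobius_deriv (r j) (Bpt X j) = cis (theta_ theta j - theta_ theta j.-1)].
Proof. by move=> hj; apply: rotationP; apply: (Bpt_inH n_gt2 XDT); lia. Qed.

Lemma torus_conj_low i : (i <= 2)%N -> Rc i = 1.
Proof. by move=> hi; rewrite /torus_conj big_geq//; lia. Qed.

Lemma torus_conjS i : (1 <= i <= n - 3)%N -> Rc i.+2 = Rc i.+1 * r i.
Proof.
case: i => // i hi; rewrite /torus_conj.
rewrite (_ : minn (i.+3 - 2) (n - 3) = i.+1); last by lia.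
rewrite (_ : minn (i.+2 - 2) (n - 3) = i); last by lia.
by rewrite big_nat_recr.
Qed.

Lemma det_torus_conj i : \det (Rc i) = 1.
Proof.
rewrite /torus_conj; have : (minn (i - 2) (n - 3) <= n - 3)%N by lia.
elim: (minn _ _) => [|k IH] hk; first by rewrite big_geq// det1_2.
rewrite big_nat_recr//= detM2 IH ?mul1r; last by lia.
by have [] := rP hk.
Qed.

Let gs i : (1 <= i <= n)%N -> gen Y i = s i \/ gen Y i = - s i.
Proof.
case: i => // i hi.
have e : gen Y i.+1 = Rc i.+1 * gen X i.+1 * (Rc i.+1)^-1.
  by have := gen_mk (fun i : 'I_n => Rc i.+1 * gen X i.+1 * (Rc i.+1)^-1) (Ordinal hi).
rewrite e /s; case: (Rep_gen (DT_Rep XDT) hi) => ->; first by left.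
by right; rewrite mulrN mulNr.
Qed.

Let ps i : (1 <= i <= n)%N -> posell (s i).
Proof. by move=> hi; apply: posell_conj; [exact: (DT_c XDT)|exact: det_torus_conj]. Qed.

Lemma torus_ngen i : (1 <= i <= n)%N -> ngen Y i = s i.
Proof. by move=> hi; apply: (ngen_eq (s := s)) (gs hi); case: (ps hi). Qed.

Lemma conjM_cancel (g A B : 'M[R]_2) : \det g = 1 ->
  (g * A * g^-1) * (g * B * g^-1) = g * (A * B) * g^-1.
Proof. by move=> d; rewrite !mulrA -(mulrA _ g^-1 g) mulVmx2// mulr1. Qed.

(** The rotation about B_i commutes with P_(i+1), so it can be moved across the first i + 1 factors.
    Hence each partial product of the bent chain is conjugate, by one matrix, to the old one. *)
Lemma torus_prodc_s m : (1 <= m < n)%N -> prodc s m = Rc m.+1 * prodc (ngen X) m * (Rc m.+1)^-1.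
Proof.
elim: m => // m IH hm; case: m IH hm => [|m] IH hm.
  by rewrite !prodc1 /s !torus_conj_low.
rewrite prodcS IH; last by lia.
rewrite /s conjM_cancel; last exact: det_torus_conj.
rewrite -prodcS; case: (ltnP m.+2 n.-1) => h; last first.
  (* The end of the chain, where [minn] stops adding rotations: R_n = R_(n-1). *)
  suff -> : Rc m.+3 = Rc m.+2 by [].
  by rewrite /torus_conj (_ : minn (m.+3 - 2) (n - 3) = minn (m.+2 - 2) (n - 3)); last by lia.
have hi : (1 <= m.+1 <= n - 3)%N by lia.
have hr : (m.+1 <= n - 3)%N by lia.
have [d fz _] := rP hr; rewrite (torus_conjS hi).
rewrite invrM; [|exact: (unit_det1 (det_torus_conj _))|exact: (unit_det1 d)].
have PE := prodc_rotm n_gt2 XDT (i := m.+1) ltac:(lia).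
have BH : inH (Bpt X m.+1) by apply: (Bpt_inH n_gt2 XDT); lia.
have e : r m.+1 * prodc (ngen X) m.+2 * (r m.+1)^-1 = prodc (ngen X) m.+2.
  rewrite {1}PE (rotm_conj _ d BH) fz; exact: esym PE.
by rewrite -{1}e !mulrA.
Qed.

Lemma torus_RepDT : RepDT alpha Y.
Proof.
apply: (RepDT_chain (s := s)); [exact: ltnW|exact: ps| | | |exact: gs].
- move=> i; have hi : (1 <= i.+1 <= n)%N by rewrite /= ltn_ord.
  by rewrite /s hang_conj ?(Rep_hang (DT_Rep XDT))//; [exact: (DT_c XDT)|exact: det_torus_conj].
- move=> m hm; rewrite torus_prodc_s//; apply: posell_conj; last exact: det_torus_conj.
  exact: (DT_posell n_gt2 XDT).
- right; have e : prodc s n = prodc s n.-1 * s n by have := prodcS s n.-1; rewrite prednK//; lia.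
  rewrite e torus_prodc_s; last by lia.
  rewrite prednK; last by lia.
  rewrite /s conjM_cancel; last exact: det_torus_conj.
  rewrite -(prodc_last X n_gt2) (DT_prodn n_gt2 XDT) mulrN1 mulNr mulmxV2//; exact: det_torus_conj.
Qed.

Lemma torus_prodc m : (1 <= m < n)%N ->
  prodc (ngen Y) m = Rc m.+1 * prodc (ngen X) m * (Rc m.+1)^-1.
Proof. by move=> hm; rewrite -torus_prodc_s//; apply: eq_prodc => i hi; apply: torus_ngen; lia. Qed.

Lemma torus_area i : (i <= n - 3)%N -> area_param Y i = area_param X i.
Proof.
move=> hi; have h := n3_bound n_gt2 hi.
rewrite (area_paramE n_gt2 XDT)// (area_paramE n_gt2 torus_RepDT)//.
rewrite !torus_prodc; [|lia|lia]; rewrite torus_ngen; last by lia.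
rewrite /s !hang_conj; do ?exact: det_torus_conj.
- by [].
- by apply: (DT_c XDT); lia.
- by apply: (DT_posell n_gt2 XDT); lia.
- by apply: (DT_posell n_gt2 XDT); lia.
Qed.

Lemma torus_Bpt i : (i.+1 < n)%N -> Bpt Y i = mobius (Rc i.+2) (Bpt X i).
Proof.
move=> hi; rewrite (Bpt_P n_gt2 XDT)// (Bpt_P n_gt2 torus_RepDT)// torus_prodc// fixpt_conj//.
- exact: (DT_posell n_gt2 XDT).
- exact: det_torus_conj.
Qed.

Lemma torus_Cpt i : (1 <= i <= n)%N -> Cpt Y i = mobius (Rc i) (Cpt X i).
Proof.
move=> hi; rewrite (Cpt_c XDT)// (Cpt_c torus_RepDT)// torus_ngen// /s fixpt_conj//.
- exact: (DT_c XDT).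
- exact: det_torus_conj.
Qed.

(** Both B_i and C_(i+2) are moved by R_(i+2), while C_(i+1) is moved by R_(i+1), which is R_(i+2)
    times the inverse rotation about B_i. Relative to the ray B_i C_(i+2), the other ray turns back
    by theta_i - theta_(i-1). *)
Lemma torus_gamma i : RepDT_open alpha X -> (1 <= i <= n - 3)%N ->
  eqmod2pi (gamma Y i) (gamma X i - (theta_ theta i - theta_ theta i.-1)).
Proof.
move=> XO hi; have B0 : inH (Bpt X i) by apply: (Bpt_inH n_gt2 XDT); lia.
have C1 : inH (Cpt X i.+1) by apply: (Cpt_inH XDT); lia.
have C2 : inH (Cpt X i.+2) by apply: (Cpt_inH XDT); lia.
have N2 : Bpt X i != Cpt X i.+2 by apply: (Bpt_neq_next n_gt2 XO); lia.
have N1 : Bpt X i != Cpt X i.+1 by apply: (Bpt_neq_prev n_gt2 XO); lia.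
have [d fz dz] := rP (j := i) ltac:(lia).
have d' := det_inv1 d; have dR := det_torus_conj i.+2.
have fz' : mobius (r i)^-1 (Bpt X i) = Bpt X i by rewrite -{1}fz (mobiusK d B0).
have C1' : inH (mobius (r i)^-1 (Cpt X i.+1)) := mobius_inH d' C1.
have e1 : mobius (Rc i.+1) (Cpt X i.+1) = mobius (Rc i.+2) (mobius (r i)^-1 (Cpt X i.+1)).
  rewrite -(mobiusM dR d' C1) torus_conjS// -mulrA mulmxV2// mulr1.
  by [].
have N1' : Bpt X i != mobius (r i)^-1 (Cpt X i.+1).
  apply: contraNneq N1 => e; have := congr1 (mobius (r i)) e.
  by rewrite fz (mobiusVK d C1) => ->.
rewrite {1}/gamma torus_Bpt ?torus_Cpt; [|lia|lia|lia].
rewrite e1 (ray_angle_mobius dR B0 C2 C1' N2 N1').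
apply: (ray_angle_uniq B0 C2 C1' N2 N1').
have ce := cayley_rotate d B0 C1' fz dz; rewrite (mobiusVK d C1) in ce.
have [_ h] := ray_angleP B0 C2 C1 N2 N1.
have [k k0 kE] := h; exists k => //.
rewrite cisD mulrA -kE ce cisN.
set t := _ - _; set u := cayley _ (mobius _ _).
have cn := cis_neq0 t.
rewrite -!mulrA [cis t * _]mulrC -!mulrA. 
by rewrite (mulVf cn) mulr1.
Qed.

Lemma torus_sigma (i : 'I_(n - 3)) : RepDT_open alpha X ->
  eqmod2pi (sigma Y i.+1) (sigma X i.+1 - theta ord0 i).
Proof.
move=> XO; rewrite -theta_S.
have -> : theta_ theta i.+1 = \sum_(1 <= j < i.+2) (theta_ theta j - theta_ theta j.-1).
  elim: (i.+1) => [|k IH]; first by rewrite big_geq.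
  by rewrite big_nat_recr//= -IH addrC subrK.
rewrite /sigma -sumrB; apply: eqmod2pi_sum => j hj; apply: torus_gamma => //.
by have := ltn_ord i; lia.
Qed.

End OneTorus.
End Torus.

(** * The Goldman form *)

Section PantsAlgebra.
Context {R : realType}.
Implicit Types (x y U V E N M : 'M[R]_2) (z p q r : R[i]).

Lemma mxZl (k : R) x y : (k *: x) * y = k *: (x * y).
Proof. by rewrite scalerAl. Qed.

Lemma mxZr (k : R) x y : x * (k *: y) = k *: (x * y).
Proof. by rewrite scalerAr. Qed.

(** The polarised Cayley-Hamilton identity: the square of a traceless matrix is scalar. *)
Lemma clifford x y : \tr x = 0 -> \tr y = 0 -> x * y + y * x = \tr (x * y) *: 1.
Proof.
rewrite !trmx2E => hx hy.
have ex : x 1 1 = - x 0 0 by lra.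
have ey : y 1 1 = - y 0 0 by lra.
by apply: mx2_eq; rewrite !mxE2 ex ey; ring.
Qed.

Lemma anticomm x y : \tr x = 0 -> \tr y = 0 -> \tr (x * y) = 0 -> x * y = - (y * x).
Proof. by move=> hx hy e; apply/eqP; rewrite -addr_eq0 clifford// e scale0r. Qed.

Lemma trC x y : \tr (x * y) = \tr (y * x).
Proof. exact: mxtrace_mulC. Qed.

Lemma tr_Ad (g : 'M[R]_2) x : \det g = 1 -> \tr (Ad g x) = \tr x.
Proof. by move=> d; rewrite /Ad trC mulrA mulVmx2// mul1r. Qed.

(** N, M and N M form an orthogonal basis of sl(2) for the trace form. A traceless matrix orthogonal
    to all three anticommutes with each; anticommuting with N and M it also commutes with N M, so it
    vanishes. *)
Lemma trace_basis N M W : \tr N = 0 -> \tr M = 0 -> \tr W = 0 -> \tr (N * M) = 0 ->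
  N * N = -1 -> M * M = 1 ->
  W = (- \tr (W * N) / 2) *: N + (\tr (W * M) / 2) *: M + (\tr (W * (N * M)) / 2) *: (N * M).
Proof.
move=> tN tM tW tNM N2 M2.
have aNM : M * N = - (N * M) by rewrite -(anticomm tM tN) // trC.
have t1 : \tr (1 : 'M[R]_2) = 2 by rewrite mxtrace1.
set W' := (X in W = X); apply/eqP; rewrite -subr_eq0; set D := W - W'.
have tW' : \tr W' = 0 by rewrite /W' !mxtraceD !mxtraceZ tN tM tNM !mulr0 !addr0.
have tD : \tr D = 0 by rewrite raddfB /= tW tW' subr0.
have trW'N : \tr (W' * N) = \tr (W * N).
  rewrite /W' [(_ + _) * N]mulrDl [(_ + _) * N]mulrDl !mxZl N2 aNM -[N * M * N]mulrA aNM [N * - _]mulrN [N * (N * M)]mulrA N2 mulN1r opprK.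
  rewrite !mxtraceD !mxtraceZ !raddfN /= t1 tNM tM; lra.
have trW'M : \tr (W' * M) = \tr (W * M).
  rewrite /W' [(_ + _) * M]mulrDl [(_ + _) * M]mulrDl !mxZl M2 -[N * M * M]mulrA M2 mulr1 !mxtraceD !mxtraceZ t1 tNM tN; lra.
have trW'NM : \tr (W' * (N * M)) = \tr (W * (N * M)).
  have e2 : (N * M) * (N * M) = 1.
    by rewrite mulrA -(mulrA N) aNM mulrN mulrA N2 mulN1r opprK M2.
  rewrite /W' [(_ + _) * (N * M)]mulrDl [(_ + _) * (N * M)]mulrDl !mxZl e2 [N * (N * M)]mulrA N2 mulN1r [M * (N * M)]mulrA aNM [- _ * M]mulNr -[N * M * M]mulrA M2 mulr1.
  rewrite !mxtraceD !mxtraceZ !raddfN /= t1 tM tN; lra.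
have dN : D * N = - (N * D) by apply: anticomm => //; rewrite mulrBl raddfB /= trW'N subrr.
have dM : D * M = - (M * D) by apply: anticomm => //; rewrite mulrBl raddfB /= trW'M subrr.
have dNM : D * (N * M) = - (N * M * D).
  by apply: anticomm => //; rewrite mulrBl raddfB /= trW'NM subrr.
have : D * (N * M) = N * M * D.
  by rewrite [D * (N * M)]mulrA dN mulNr -[N * D * M]mulrA dM mulrN opprK mulrA.
rewrite dNM => /eqP; rewrite eq_sym -addr_eq0 => /eqP h.
have h0 : N * M * D = 0.
  have : 2%:R *: (N * M * D) = 0 by rewrite scaler_nat mulr2n.
  by move/eqP; rewrite scaler_eq0 => /orP[|/eqP//]; rewrite pnatr_eq0.
have := congr1 (fun Z => M * (N * Z)) h0; rewrite !mulr0 !mulrA -(mulrA M) N2 mulrN1 mulNr M2 mulN1r.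
by move/eqP; rewrite oppr_eq0.
Qed.

Lemma rotm_sub (h : R) z : inH z -> (rotm h z)^-1 = (2 * cos h) *: 1 - rotm h z.
Proof. by move=> z0; rewrite rotm_inv// /rotm cosN sinN; apply: mx2_eq; rewrite !mxE2; ring. Qed.

(** On the plane orthogonal to Jm z, Ad of the rotation is a non-trivial rotation, so 1 - Ad is
    invertible there, with inverse the multiplication by (2 sin h)^-1 Jm z (rotm h z)^-1. The
    component along Jm z is the rate of change of the angle. *)
Lemma elliptic_split (h : R) z U : 0 < h < pi -> inH z -> \tr U = 0 -> exists2 x, \tr x = 0 &
  U = (- \tr (U * Jm z) / 2) *: Jm z + (x - Ad (rotm h z) x).
Proof.
move=> h0 z0 tU; have s0 : sin h != 0 by rewrite gt_eqF// sin_gt0_pi.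
have tJ := trJm z; have J2 := Jm_sqr z0.
have [U' U'E] : exists U', U' = U - (- \tr (U * Jm z) / 2) *: Jm z by eexists.
have tU' : \tr U' = 0 by rewrite U'E raddfB /= mxtraceZ tU tJ mulr0 subr0.
have UJ0 : \tr (U' * Jm z) = 0.
  by rewrite U'E mulrBl raddfB /= !mxZl J2 mxtraceZ raddfN /= mxtrace1; lra.
have UJ : U' * Jm z = - (Jm z * U') by exact: anticomm.
have e1 : rotm h z * U' = U' * (rotm h z)^-1.
  rewrite rotm_inv// /rotm cosN sinN mulrDl mulrDr !mxZl !mxZr mul1r mulr1 UJ.
  by rewrite scaleNr scalerN opprK.
exists ((2 * sin h)^-1 *: (Jm z * (rotm h z)^-1 * U')).
  rewrite mxtraceZ rotm_inv// /rotm cosN sinN mulrDr mulrDl !mxZr !mxZl mulr1 J2 mulN1r.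
  by rewrite mxtraceD !mxtraceZ raddfN /= trC UJ0 tU' oppr0 !mulr0 addr0 mulr0.
have dA := det_rotm h z0.
have cJ : rotm h z * Jm z = Jm z * rotm h z by rewrite /rotm mulrDl mulrDr !mxZl !mxZr mul1r mulr1.
have e2 : Ad (rotm h z) (Jm z * (rotm h z)^-1 * U') = Jm z * rotm h z * U'.
  by rewrite /Ad !mulrA cJ -(mulrA (Jm z)) mulmxV2// mulr1 -mulrA -e1 mulrA.
rewrite /Ad !mxZr !mxZl -/(Ad _ _) e2 -scalerBr -mulrBl -mulrBr.
have -> : (rotm h z)^-1 - rotm h z = (- (2 * sin h)) *: Jm z.
  by rewrite rotm_inv// /rotm cosN sinN opprD addrACA subrr add0r scaleNr -opprD -mulr2n -scaler_nat scalerA -scaleNr.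
by rewrite !mxZr J2 !mxZl mulN1r scalerA mulrN mulVf ?mulf_neq0// scaleN1r opprK U'E subrKC.
Qed.

(** The normalised commutator of Jm p and Jm q, which generates the translations along the geodesic
    through p and q. Its square is a positive scalar before normalisation because cosh d(p, q) >
    1. *)
Lemma axis_exists p q : inH p -> inH q -> p != q -> exists E,
  [/\ \tr E = 0, E * E = 1, E * Jm p = - (Jm p * E) & E * Jm q = - (Jm q * E)].
Proof.
move=> p0 q0 pq; have Jp := Jm_sqr p0; have Jq := Jm_sqr q0.
have k1 : 1 < kappa p q.
  by rewrite lt_neqAle eq_sym kappa_eq1// pq kappa_ge1.
pose E0 := Jm p * Jm q - Jm q * Jm p.
have sum : Jm p * Jm q + Jm q * Jm p = (- 2 * kappa p q) *: 1.
  rewrite clifford ?trJm//; congr (_ *: _); rewrite /kappa; lra.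
have E2 : E0 * E0 = (4 * (kappa p q ^+ 2 - 1)) *: 1.
  have e1 : (Jm p * Jm q) * (Jm q * Jm p) = 1 by rewrite mulrA -(mulrA (Jm p)) Jq mulrN1 mulNr Jp opprK.
  have e2 : (Jm q * Jm p) * (Jm p * Jm q) = 1 by rewrite mulrA -(mulrA (Jm q)) Jp mulrN1 mulNr Jq opprK.
  have e3 := congr1 (fun Z => Z * Z) sum.
  rewrite !mxZl mul1r scalerA mulrDl !mulrDr e1 e2 in e3.
  have -> : (4 * (kappa p q ^+ 2 - 1)) *: 1 = (- 2 * kappa p q * (- 2 * kappa p q)) *: 1 - 4 *: 1 :> 'M[R]_2.
    by rewrite -scalerBl; congr (_ *: _); ring.
  rewrite -e3 /E0 mulrBl !mulrBr e1 e2.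
  set a := Jm p * Jm q * _; set b := Jm q * Jm p * _.
  have -> : 4 *: 1 = 1 + 1 + (1 + 1) :> 'M[R]_2 by rewrite -!mulr2n -mulrnA scaler_nat.
  by apply/matrixP => i j; rewrite !mxE; ring.
have s0 : 0 < 4 * (kappa p q ^+ 2 - 1) by nra.
exists ((Num.sqrt (4 * (kappa p q ^+ 2 - 1)))^-1 *: E0); split.
- by rewrite mxtraceZ /E0 raddfB /= trC subrr mulr0.
- by rewrite !mxZr !mxZl E2 !scalerA -invfM -expr2 sqr_sqrtr ?ltW// mulVf ?scale1r// gt_eqF.
- rewrite !mxZr !mxZl -scalerN; congr (_ *: _).
  by rewrite /E0 mulrBl mulrBr -(mulrA (Jm q)) Jp mulrA Jp !mulrN1 !mulN1r !mulrA opprB !opprK addrC.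
- rewrite !mxZr !mxZl -scalerN; congr (_ *: _).
  by rewrite /E0 mulrBl mulrBr -[Jm p * Jm q * Jm q]mulrA Jq [Jm q * (Jm q * Jm p)]mulrA Jq !mulrN1 !mulN1r !mulrA opprB.
Qed.

Lemma trDl x y U : \tr ((x + y) * U) = \tr (x * U) + \tr (y * U).
Proof. by rewrite mulrDl mxtraceD. Qed.

Lemma trDr x y U : \tr (U * (x + y)) = \tr (U * x) + \tr (U * y).
Proof. by rewrite mulrDr mxtraceD. Qed.

Lemma trNl x y : \tr (- x * y) = - \tr (x * y).
Proof. by rewrite mulNr raddfN. Qed.

Lemma trNr x y : \tr (x * - y) = - \tr (x * y).
Proof. by rewrite mulrN raddfN. Qed.

Lemma trZl (a : R) x y : \tr ((a *: x) * y) = a * \tr (x * y).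
Proof. by rewrite mxZl mxtraceZ. Qed.

Lemma trZr (a : R) x y : \tr (x * (a *: y)) = a * \tr (x * y).
Proof. by rewrite mxZr mxtraceZ. Qed.

Definition trE := (trDl, trDr, trNl, trNr, trZl, trZr).

Lemma AdD (g : 'M[R]_2) x y : Ad g (x + y) = Ad g x + Ad g y.
Proof. by rewrite /Ad mulrDr mulrDl. Qed.

Lemma AdB (g : 'M[R]_2) x y : Ad g (x - y) = Ad g x - Ad g y.
Proof. by rewrite /Ad mulrBr mulrBl. Qed.

Lemma AdZ (g : 'M[R]_2) (a : R) x : Ad g (a *: x) = a *: Ad g x.
Proof. by rewrite /Ad mxZr mxZl. Qed.

Lemma AdM (g g' : 'M[R]_2) x : \det g = 1 -> \det g' = 1 -> Ad g (Ad g' x) = Ad (g * g') x.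
Proof. by move=> d d'; rewrite /Ad invrM ?unit_det1// !mulrA. Qed.

Lemma conjM_id (g x y : 'M[R]_2) : \det g = 1 -> (g * x * g^-1) * (g * y * g^-1) = Ad g (x * y).
Proof. by move=> d; rewrite /Ad !mulrA -(mulrA _ g^-1 g) mulVmx2// mulr1. Qed.

Lemma tr_AdAd (g : 'M[R]_2) x y : \det g = 1 -> \tr (Ad g x * Ad g y) = \tr (x * y).
Proof. by move=> d; rewrite /Ad conjM_id//; exact: tr_Ad. Qed.

Lemma Ad_Jm (h : R) z : inH z -> Ad (rotm h z) (Jm z) = Jm z.
Proof.
move=> z0; have d := det_rotm h z0; rewrite /Ad.
have -> : rotm h z * Jm z = Jm z * rotm h z by rewrite /rotm mulrDl mulrDr !mxZl !mxZr mul1r mulr1.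
by rewrite -mulrA mulmxV2// mulr1.
Qed.

Lemma tr_split0 (h : R) z x : inH z -> \tr ((x - Ad (rotm h z) x) * Jm z) = 0.
Proof.
move=> z0; rewrite !trE -{2}(Ad_Jm h z0) tr_AdAd ?subrr//; exact: det_rotm.
Qed.

Section Pants.
Variables (p q r : R[i]) (h k l : R) (E : 'M[R]_2).
Hypotheses (p0 : inH p) (q0 : inH q) (r0 : inH r).
Hypotheses (h0 : 0 < h < pi) (k0 : 0 < k < pi) (l0 : 0 < l < pi).
Hypothesis pq : p != q.
Local Notation A := (rotm h p).
Local Notation c := (rotm k q).
Local Notation D := (rotm l r).
Hypothesis AcD : A * c = D.
Hypotheses (E0 : \tr E = 0) (E2 : E * E = 1).
Hypotheses (Ep : E * Jm p = - (Jm p * E)) (Eq : E * Jm q = - (Jm q * E)).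

Let al := 2 * cos h.
Let t := 2 * cos k.
Let be := 2 * cos l.
(** As [E] does for the side pq, [M] and [F] generate the translations along the sides pr and qr:
    both have square 1, [M] is orthogonal to Jm p and Jm r, and [F] to Jm q and Jm r. *)
Let M := A * E.
Let F := E * c.
Let dA := det_rotm h p0.
Let dc := det_rotm k q0.
Let dD := det_rotm l r0.

Lemma axis_rotm (g : R) z : inH z -> E * Jm z = - (Jm z * E) -> E * rotm g z = (rotm g z)^-1 * E.
Proof.
move=> z0 Ez; rewrite rotm_inv// /rotm cosN sinN mulrDl mulrDr !mxZl !mxZr Ez mulr1 mul1r.
by rewrite scaleNr scalerN.
Qed.

Let EA : E * A = A^-1 * E := axis_rotm h p0 Ep.
Let Ec : E * c = c^-1 * E := axis_rotm k q0 Eq.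
Let AI : A^-1 = al *: 1 - A := rotm_sub h p0.
Let cI : c^-1 = t *: 1 - c := rotm_sub k q0.
Let DI : D^-1 = be *: 1 - D := rotm_sub l r0.

Let DA : D * A = be *: A - c^-1.
Proof.
have e : D = be *: 1 - D^-1 by rewrite DI subKr.
rewrite {1}e -AcD invrM ?unit_det1// mulrBl mxZl mul1r; congr (_ - _).
by rewrite -mulrA mulVmx2// mulr1.
Qed.

Let AA : A * A = al *: A - 1.
Proof.
have e : A = al *: 1 - A^-1 by rewrite AI subKr.
by rewrite {1}e mulrBl mxZl mul1r mulVmx2.
Qed.

Let Dinv : D^-1 = c^-1 * A^-1. Proof. by rewrite -AcD invrM ?unit_det1. Qed.
Let FE : F = c^-1 * E. Proof. exact: Ec. Qed.

Lemma tr_rotm0 (g : R) z : E * Jm z = - (Jm z * E) -> \tr (rotm g z * E) = 0 /\ \tr (Jm z * E) = 0.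
Proof.
move=> Ez; have e : \tr (Jm z * E) = 0.
  by have := congr1 mxtrace Ez; rewrite raddfN /= trC; lra.
by split=> //; rewrite /rotm !trE mul1r E0 e !mulr0 addr0.
Qed.

Let M0 : \tr M = 0. Proof. by have [] := tr_rotm0 h Ep. Qed.
Let F0 : \tr F = 0. Proof. by rewrite /F trC; have [] := tr_rotm0 k Eq. Qed.
Let NpE : \tr (Jm p * E) = 0. Proof. by have [] := tr_rotm0 h Ep. Qed.
Let tr1 : \tr (1 : 'M[R]_2) = 2. Proof. by rewrite mxtrace1. Qed.
Let trEE : \tr (E * E) = 2. Proof. by rewrite E2. Qed.
Let M2 : M * M = 1. Proof. by rewrite /M mulrA -(mulrA A E A) EA !mulrA mulmxV2// mul1r. Qed.
Let trMM : \tr (M * M) = 2. Proof. by rewrite M2. Qed.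
Let F2 : F * F = 1. Proof. by rewrite {2}FE /F mulrA -(mulrA E c) mulmxV2// mulr1. Qed.
Let trFF : \tr (F * F) = 2. Proof. by rewrite F2. Qed.
Let trrotm (g : R) z : \tr (rotm g z) = 2 * cos g.
Proof. by rewrite /rotm mxtraceD !mxtraceZ trJm mulr0 addr0 mxtrace1 mulrC. Qed.
Let trME : \tr (M * E) = al. Proof. by rewrite /M -mulrA E2 mulr1 trrotm. Qed.
Let trEF : \tr (E * F) = t. Proof. by rewrite /F mulrA E2 mul1r trrotm. Qed.
Let trMF : \tr (M * F) = be. Proof. by rewrite /M /F mulrA -(mulrA A) E2 mulr1 AcD trrotm. Qed.
Let NpM : \tr (Jm p * M) = 0.
Proof.
have -> : Jm p * M = cos h *: (Jm p * E) - sin h *: E.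
  by rewrite /M mulrA /rotm mulrDr !mxZr Jm_sqr// mulr1 mulrDl !mxZl mulN1r scalerN.
by rewrite raddfB /= !mxtraceZ NpE E0 !mulr0 subr0.
Qed.
Let sl : sin l != 0. Proof. by rewrite gt_eqF// sin_gt0_pi. Qed.
Let Nr_eq : (2 * sin l) *: Jm r = D - D^-1.
Proof. by rewrite rotm_inv// /rotm cosN sinN; apply: mx2_eq; rewrite !mxE2; ring. Qed.
Let NrMeq : (2 * sin l) *: (Jm r * M) = be *: M - 2 *: F.
Proof.
rewrite -mxZl Nr_eq mulrBl /M !mulrA DA Dinv -[c^-1 * A^-1 * A]mulrA mulVmx2// mulr1.
by rewrite mulrBl mxZl -FE -addrA -opprD -mulr2n scaler_nat.
Qed.
Let NrM : \tr (Jm r * M) = 0.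
Proof.
apply: (mulfI (mulf_neq0 (x := 2 * sin l) _ (oner_neq0 R))); rewrite ?mulr1 ?mulf_neq0//.
by rewrite -mxtraceZ NrMeq raddfB /= !mxtraceZ M0 F0 !mulr0 subr0.
Qed.
Let cF : c * F = E. Proof. by rewrite FE mulrA mulmxV2// mul1r. Qed.
Let NrF : \tr (Jm r * F) = 0.
Proof.
apply: (mulfI (mulf_neq0 (x := 2 * sin l) _ (oner_neq0 R))); rewrite ?mulr1 ?mulf_neq0//.
have DF : \tr (D * F) = 0 by rewrite -AcD -mulrA cF.
rewrite mulr0 -trZl Nr_eq DI mulrBl raddfB /= mulrBl raddfB /= mxZl mul1r mxtraceZ F0 DF; ring.
Qed.

Lemma tr_axis_end : \tr (Jm r * (E * c)) = 0.
Proof. exact: NrF. Qed.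

Let EAi : E * A^-1 = M.
Proof. by apply: (mulIr (unit_det1 dA)); rewrite /M -!mulrA mulVmx2// EA mulrA mulmxV2// mul1r mulr1. Qed.
Let cE : c * E = t *: E - F.
Proof. by rewrite FE cI mulrBl mxZl mul1r subKr. Qed.
Let Eci : E * c^-1 = c * E.
Proof. by apply: (mulIr (unit_det1 dc)); rewrite -!mulrA mulVmx2// -/F cF mulr1. Qed.
Let AM : A * M = al *: M - E.
Proof. by rewrite /M mulrA AA mulrBl mxZl mul1r. Qed.
Let DM : D * M = be *: M - F.
Proof. by rewrite /M mulrA DA mulrBl mxZl -FE. Qed.
Let AdAE : Ad A E = al *: M - E.
Proof. by rewrite /Ad -mulrA EAi AM. Qed.
Let AdcE : Ad c E = (t ^+ 2 - 1) *: E - t *: F.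
Proof.
rewrite /Ad -mulrA Eci cE mulrBr mxZr cE cF scalerBr scalerA scalerBl scale1r -expr2.
by rewrite addrAC.
Qed.
Let AdAF : Ad A F = (t * al - be) *: M - t *: E + F.
Proof.
rewrite /Ad {1}FE [A * (c^-1 * E)]mulrA -[A * c^-1 * E * A^-1]mulrA EAi cI mulrBr mxZr mulr1 AcD mulrBl mxZl AM DM.
by apply/matrixP => i j; rewrite !mxE; ring.
Qed.
Let AdDE : Ad D E = (t * be - al) *: M + E - t *: F.
Proof.
rewrite -AcD -AdM// AdcE AdB !AdZ AdAE AdAF.
by apply/matrixP => i j; rewrite !mxE; ring.
Qed.
Let AdDF : Ad D F = be *: M - F.
Proof. by rewrite /Ad Dinv {1}/F -!mulrA [c * (c^-1 * _)]mulrA mulmxV2// mul1r EAi DM. Qed.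

(** The infinitesimal isometries x, x + ta E and x + ta E + ta' F follow the vertices p, q and r of
    the moving triangle; consecutive ones differ by a translation along the side that joins the two
    vertices. U and uc are the velocities of A and c, and the multiples of Jm are changes of angle,
    absent at q. *)
Definition pants_frame U uc x (ta ta' : R) : Prop :=
  [/\ \tr x = 0,
      U = (- \tr (U * Jm p) / 2) *: Jm p + (x - Ad A x),
      uc = (x + ta *: E) - Ad c (x + ta *: E) &
      U + Ad A uc = (- \tr ((U + Ad A uc) * Jm r) / 2) *: Jm r +
        ((x + ta *: E + ta' *: F) - Ad D (x + ta *: E + ta' *: F))].

(** The field at each vertex is determined up to rotations about that vertex. This freedom is just
    enough to make consecutive fields differ by translations along the sides. *)
Lemma pants_frame_exists U y0 : \tr U = 0 -> \tr y0 = 0 ->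
  exists x ta ta', pants_frame U (y0 - Ad c y0) x ta ta'.
Proof.
move=> tU ty0; have [x0 tx0 Ux0] := elliptic_split h0 p0 tU.
have J2 := Jm_sqr p0; have tJ := trJm p.
have tJE : \tr (Jm p * E) = 0 by exact: NpE.
have Nq := trace_basis tJ E0 (trJm q) tJE J2 E2.
set a' := - _ / 2 in Nq; set d' := \tr (Jm q * (Jm p * E)) / 2 in Nq.
have tqE : \tr (Jm q * E) = 0 by have [] := tr_rotm0 k Eq.
rewrite tqE mul0r scale0r addr0 in Nq.
(* Otherwise Jm q would be a multiple of Jm p, hence equal to it, forcing p = q. *)
have d'0 : d' != 0.
  apply: contraNneq pq => d'0; apply/eqP.
  rewrite d'0 scale0r addr0 in Nq.
  have := congr1 (fun Z : 'M[R]_2 => Z * Z) Nq; rewrite Jm_sqr// mxZl mxZr J2 scalerA => /(congr1 mxtrace).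
  rewrite mxtraceZ raddfN /= mxtrace1 => a2.
  have := congr1 (fun Z : 'M[R]_2 => Z 1 0) Nq; rewrite /Jm !mxE2 => e10.
  have a1 : a' = 1.
    have /eqP : (a' - 1) * (a' + 1) = 0 by nra.
    rewrite mulf_eq0 => /orP[/eqP|/eqP] e; first by lra.
    have : 0 < (complex.Im q)^-1 by rewrite invr_gt0.
    have : 0 < (complex.Im p)^-1 by rewrite invr_gt0.
    by rewrite e10; nra.
  by apply: (Jm_inj p0 q0); rewrite Nq a1 scale1r.
have tD : \tr (y0 - x0) = 0 by rewrite raddfB /= ty0 tx0 subr0.
have := trace_basis tJ E0 tD tJE J2 E2.
set a := - _ / 2; set b := _ / 2; set d := _ / 2 => DE.
have JEq : Jm p * E = d'^-1 *: (Jm q - a' *: Jm p).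
  by rewrite Nq addrAC subrr add0r scalerA mulVf// scale1r.
(* Multiples of Jm p added to the first field, and of Jm q to the second, leave the velocities
   unchanged; they are chosen to remove from the difference everything but its component along
   [E]. *)
pose x := x0 + (a - d * d'^-1 * a') *: Jm p.
pose y := y0 - (d * d'^-1) *: Jm q.
have yE : y = x + b *: E.
  apply/eqP; rewrite /y /x -subr_eq0; apply/eqP.
  have -> : y0 = x0 + (a *: Jm p + b *: E + d *: (Jm p * E)) by rewrite -DE subrKC.
  rewrite JEq; apply/matrixP => i j; rewrite !mxE; ring.
have Ax : x - Ad A x = x0 - Ad A x0.
  by rewrite /x AdD AdZ Ad_Jm// opprD addrACA subrr addr0.
have cy : y - Ad c y = y0 - Ad c y0.
  by rewrite /y AdB AdZ Ad_Jm//; apply/matrixP => i j; rewrite !mxE; ring.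
exists x, b.
set U' := U + Ad A (y0 - Ad c y0).
have U'E : U' = (- \tr (U * Jm p) / 2) *: Jm p + (b *: (Ad A E - E)) + ((x + b *: E) - Ad D (x + b *: E)).
  rewrite /U' -cy yE AdB AdM// AcD {1}Ux0 -Ax AdD AdZ.
  by apply/matrixP => i j; rewrite !mxE; ring.
set W := _ *: Jm p + _ in U'E.
have tW : \tr W = 0.
  by rewrite /W mxtraceD !mxtraceZ tJ raddfB /= tr_Ad// E0 subrr !mulr0 addr0.
(* The remainder is orthogonal to [M], so it combines Jm r with Jm r M. The first is the change of
   angle at r; the second is proportional to Ad D F - F and is absorbed by ta'. *)
have WM : \tr (W * M) = 0.
  rewrite /W AdAE !trE NpM trMM [\tr (E * M)]trC trME; ring.
have rM : Jm r * M = - (M * Jm r) by apply: anticomm => //; exact: trJm.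
have := trace_basis (trJm r) M0 tW NrM (Jm_sqr r0) M2.
rewrite WM mul0r scale0r addr0; set a2 := - _ / 2; set d2 := _ / 2 => WE.
exists (- (d2 / (2 * sin l))).
have FDF : Ad D F - F = (2 * sin l) *: (Jm r * M).
  by rewrite AdDF NrMeq -addrA -opprD -mulr2n scaler_nat.
have U'E2 : U' = a2 *: Jm r + ((x + b *: E + - (d2 / (2 * sin l)) *: F) - Ad D (x + b *: E + - (d2 / (2 * sin l)) *: F)).
  have e : d2 *: (Jm r * M) = (d2 / (2 * sin l)) *: (Ad D F - F).
    by rewrite FDF scalerA divfK ?mulf_neq0.
  rewrite U'E WE e [Ad D (_ + _ *: F)]AdD AdZ; apply/matrixP => i j; rewrite !mxE; ring.
have a2E : a2 = - \tr (U' * Jm r) / 2.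
  by rewrite {1}U'E2 trDl tr_split0// addr0 trZl Jm_sqr// raddfN /= mxtrace1; lra.
split.
- by rewrite /x mxtraceD mxtraceZ tx0 tJ mulr0 addr0.
- by rewrite Ax.
- by rewrite -yE cy.
- by rewrite -/U' -a2E.
Qed.

(** The velocity of D = A c is computed in two ways, from p and q and at r. The field [x] drops out,
    leaving the infinitesimal closing relation between the angle rates and the translations along
    the sides. *)
Lemma pants_star U uc x ta ta' : pants_frame U uc x ta ta' ->
  (- \tr (U * Jm p) / 2) *: Jm p + ta *: (al *: M - 2 *: E) =
  (- \tr ((U + Ad A uc) * Jm r) / 2) *: Jm r + ta' *: (2 *: F - be *: M).
Proof.
move=> [tx UE ucE]; set hd := - _ / 2 in UE *; set ld := - _ / 2; rewrite {1}UE {1}ucE.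
rewrite !AdB !AdD !AdM// AcD !AdZ AdAE AdDE AdDF => /matrixP e.
apply/matrixP => i j; have := e i j; rewrite !mxE; lra.
Qed.

Section TwoFrames.
Variables (U uc x V vc x2 : 'M[R]_2) (ta ta' sa sa' : R).
Hypothesis fU : pants_frame U uc x ta ta'.
Hypothesis fV : pants_frame V vc x2 sa sa'.
Let hd := - \tr (U * Jm p) / 2.
Let ld := - \tr ((U + Ad A uc) * Jm r) / 2.
Let hd2 := - \tr (V * Jm p) / 2.
Let ld2 := - \tr ((V + Ad A vc) * Jm r) / 2.
Let X := x + ta *: E + ta' *: F.

Let trpp : \tr (Jm p * Jm p) = -2. Proof. by rewrite Jm_sqr// raddfN /= mxtrace1. Qed.
Let trrr : \tr (Jm r * Jm r) = -2. Proof. by rewrite Jm_sqr// raddfN /= mxtrace1. Qed.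
Let trEM : \tr (E * M) = al. Proof. by rewrite trC. Qed.
Let trFE : \tr (F * E) = t. Proof. by rewrite trC. Qed.
Let trFM : \tr (F * M) = be. Proof. by rewrite trC. Qed.
Let EpT : \tr (E * Jm p) = 0. Proof. by rewrite trC. Qed.
Let MpT : \tr (M * Jm p) = 0. Proof. by rewrite trC. Qed.
Let MrT : \tr (M * Jm r) = 0. Proof. by rewrite trC. Qed.
Let FrT : \tr (F * Jm r) = 0. Proof. by rewrite trC. Qed.

(** The closing relations of two cocycles, paired with each other under the trace form. [pants_RE]
    and [pants_RF] pair one of them with the side axes. *)
Lemma pants_gram : hd * hd2 - ta * sa * (4 - al ^+ 2) = ld * ld2 - ta' * sa' * (4 - be ^+ 2).
Proof.
have e1 := pants_star fU; have e2 := pants_star fV; rewrite -/hd -/ld in e1; rewrite -/hd2 -/ld2 in e2.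
have := congr1 mxtrace (f_equal2 *%R e1 e2).
rewrite !trE trpp trrr NpE NpM NrM NrF EpT MpT MrT FrT trEE trMM trFF trME trEM trFM trMF.
lra.
Qed.

Lemma pants_RE : ta * (al ^+ 2 - 4) = ld * \tr (Jm r * E) + ta' * (2 * t - be * al).
Proof.
have e1 := pants_star fU; rewrite -/hd -/ld in e1.
have := congr1 (fun Z : 'M[R]_2 => \tr (Z * E)) e1.
rewrite !trE NpE trEE trME trFE.
lra.
Qed.

Lemma pants_RF : hd * \tr (Jm p * F) + ta * (be * al - 2 * t) = ta' * (4 - be ^+ 2).
Proof.
have e1 := pants_star fU; rewrite -/hd -/ld in e1.
have := congr1 (fun Z : 'M[R]_2 => \tr (Z * F)) e1.
rewrite !trE NrF trEF trMF trFF.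
lra.
Qed.

End TwoFrames.

Lemma pants_star0 U uc x ta ta' : pants_frame U uc x ta ta' ->
  (- \tr (U * Jm p) / 2) *: Jm p + ta *: Ad A E - ta *: Ad D E =
  (- \tr ((U + Ad A uc) * Jm r) / 2) *: Jm r + (ta *: E + ta' *: F) - Ad D (ta *: E + ta' *: F).
Proof.
move=> [tx UE ucE]; set hd := - _ / 2 in UE *; set ld := - _ / 2; rewrite {1}UE {1}ucE.
rewrite !AdB !AdD !AdM// AcD !AdZ => /matrixP e.
apply/matrixP => i j; have := e i j; rewrite !mxE; lra.
Qed.

Section Telescope.
Variables (U uc x V vc x2 : 'M[R]_2) (ta ta' sa sa' : R).
Hypothesis fU : pants_frame U uc x ta ta'.
Hypothesis fV : pants_frame V vc x2 sa sa'.
Let hd := - \tr (U * Jm p) / 2.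
Let ld := - \tr ((U + Ad A uc) * Jm r) / 2.
Let hd2 := - \tr (V * Jm p) / 2.
Let ld2 := - \tr ((V + Ad A vc) * Jm r) / 2.

(** One triangle contributes to the Goldman form the cup product term and the term of c, whose
    primitive is -(x + ta E). Their sum is an expression at r minus the same expression at p. The
    product of the two angle rates is part of that expression, which lets [pants_gram] cancel the
    quadratic terms in the translations. *)
Lemma pants_telescope :
  \tr (U * Ad A vc) + \tr ((x + ta *: E) * vc) =
  (\tr ((x + ta *: E + ta' *: F) * (V + Ad A vc))
     - ld * \tr (Jm r * (x2 + sa *: E + sa' *: F)) - ld * ld2)
  - (\tr (x * V) - hd * \tr (Jm p * x2) - hd * hd2).
Proof.
have gram := pants_gram fU fV; have RE := pants_RE fU; have RE2 := pants_RE fV.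
have RF := pants_RF fU; have RF2 := pants_RF fV.
have star := pants_star0 fU.
have [tx UE _ _] := fU; have [tx2 VE vcE V'E] := fV.
rewrite -/hd in gram RF UE star; rewrite -/ld in gram RE star.
rewrite -/hd2 in gram RF2 VE; rewrite -/ld2 in gram RE2 V'E.
have [V' V'd] : exists W, W = V + Ad A vc by exists (V + Ad A vc).
rewrite -V'd in V'E *.
have e1 : \tr (U * Ad A vc) = hd * \tr (Jm p * vc) + \tr (x * V') - \tr (x * V) - \tr (x * vc).
  rewrite V'd UE !trE tr_AdAd// -{1}(Ad_Jm h p0) tr_AdAd//.
  ring.
have g1 : \tr (Jm p * Ad D x2) = \tr (Jm p * Ad c x2).
  by rewrite -AcD -AdM// -{1}(Ad_Jm h p0) tr_AdAd.
have g2 : \tr (Ad A E * Ad D x2) = \tr (E * Ad c x2) by rewrite -AcD -AdM// tr_AdAd.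
have g3 : \tr (Jm r * Ad D x2) = \tr (Jm r * x2) by rewrite -{1}(Ad_Jm l r0) tr_AdAd.
(* The closing relation of the first cocycle, paired with the field of the second moved by Ad D,
   accounts for the terms containing [x2]. *)
have gauge := congr1 (fun Z : 'M[R]_2 => \tr (Z * Ad D x2)) star.
rewrite /= !trE g1 g2 g3 !tr_AdAd// !trE in gauge.
have vcE2 : vc = x2 - Ad c x2 + sa *: (E - Ad c E).
  by rewrite vcE AdD AdZ; apply/matrixP => i j; rewrite !mxE; ring.
have V'E2 : V' = ld2 *: Jm r + (x2 - Ad D x2) + (sa *: (E - Ad D E) + sa' *: (F - Ad D F)).
  by rewrite V'E !AdD !AdZ; apply/matrixP => i j; rewrite !mxE; ring.
have trEM : \tr (E * M) = al by rewrite trC.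
have trFE : \tr (F * E) = t by rewrite trC.
have trFM : \tr (F * M) = be by rewrite trC.
have ErT : \tr (E * Jm r) = \tr (Jm r * E) by rewrite trC.
have FrT : \tr (F * Jm r) = 0 by rewrite trC.
have k1 : \tr (Jm p * vc) = \tr (Jm p * x2) - \tr (Jm p * Ad c x2) + sa * (t * \tr (Jm p * F)).
  by rewrite vcE2 AdcE !trE NpE; ring.
have k2 : \tr (E * vc) = \tr (E * x2) - \tr (E * Ad c x2) + sa * (4 - t ^+ 2).
  by rewrite vcE2 AdcE !trE trEE trEF; ring.
have k3 : \tr (E * V') = ld2 * \tr (Jm r * E) + \tr (E * x2) - \tr (E * Ad D x2)
    + sa * (t ^+ 2 - (t * be - al) * al) + sa' * (2 * t - be * al).
  by rewrite V'E2 AdDE AdDF !trE trEE trEM trEF ErT; ring.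
have k4 : \tr (F * V') = \tr (F * x2) - \tr (F * Ad D x2)
    + sa * (2 * t - (t * be - al) * be) + sa' * (4 - be ^+ 2).
  by rewrite V'E2 AdDE AdDF !trE trFF trFM trFE FrT; ring.
rewrite e1 !trE k1 k2 k3 k4 NrF.
have m1 := congr1 (fun a => sa * t * a) RF; have m2 := congr1 (fun a => sa * a) RE.
have m3 := congr1 (fun a => ta * a) RE2.
rewrite /= in m1 m2 m3.
lra.
Qed.

End Telescope.

(** Infinitesimally, the angles of a hyperbolic triangle determine its sides: with constant angles,
    [ta] and [ta'] solve a homogeneous linear system whose determinant is, up to sign, 16 (sin h sin
    k)^2 (kappa^2 - 1), non-zero since p and q differ. *)
Lemma pants_rigid U uc x ta ta' : pants_frame U uc x ta ta' ->
  \tr (U * Jm p) = 0 -> \tr ((U + Ad A uc) * Jm r) = 0 -> ta = 0 /\ ta' = 0.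
Proof.
move=> fU h1 h2; have RE := pants_RE fU; have RF := pants_RF fU.
rewrite h2 oppr0 mul0r mul0r add0r in RE; rewrite h1 oppr0 mul0r mul0r add0r in RF.
have k1 : 1 < kappa p q by rewrite lt_neqAle eq_sym kappa_eq1// pq kappa_ge1.
have cl : cos l = cos h * cos k - sin h * sin k * kappa p q.
  by rewrite -tr_rotmM AcD trrotm; field.
have ch := cos2Dsin2 h; have ck := cos2Dsin2 k.
have sh : 0 < sin h by rewrite sin_gt0_pi.
have sk : 0 < sin k by rewrite sin_gt0_pi.
have sl' : 0 < sin l by rewrite sin_gt0_pi.
have dE : (4 - al ^+ 2) * (4 - be ^+ 2) - (be * al - 2 * t) ^+ 2 =
    - (16 * (sin h * sin k) ^+ 2 * (kappa p q ^+ 2 - 1)).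
  rewrite /al /be /t cl; set s := kappa p q.
  have c1 : cos h ^+ 2 = 1 - sin h ^+ 2 by lra.
  have c2 : cos k ^+ 2 = 1 - sin k ^+ 2 by lra.
  ring: c1 c2.
have dn : (4 - al ^+ 2) * (4 - be ^+ 2) - (be * al - 2 * t) ^+ 2 != 0.
  rewrite dE oppr_eq0 !mulf_neq0 ?sqrf_eq0 ?mulf_neq0 ?gt_eqF//; nra.
have t0 : ta = 0.
  apply: (mulIf dn); rewrite mul0r.
  have m1 := congr1 (fun a => (4 - be ^+ 2) * a) RE.
  have m2 := congr1 (fun a => (be * al - 2 * t) * a) RF.
  rewrite /= in m1 m2; lra.
split=> //; rewrite t0 mul0r in RF.
have : 4 - be ^+ 2 != 0 by rewrite /be; have := cos2Dsin2 l => cs; rewrite gt_eqF//; nra.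
by move/eqP: (esym RF); rewrite mulf_eq0 => /orP[/eqP//|/eqP ->]; rewrite eqxx.
Qed.

End Pants.
End PantsAlgebra.

(** * Frames along the chain and evaluation of the form *)

Section Goldman.
Context {R : realType} {n : nat}.
Implicit Types (X u v : mtuple R n).

Lemma AdN (g x : 'M[R]_2) : Ad (- g) x = Ad g x.
Proof. by rewrite /Ad invrN mulNr mulrNN. Qed.

(** The centraliser in sl(2) of a non-trivial rotation about z is the line spanned by Jm z. *)
Lemma Ad_fixed (h : R) (z : R[i]) (x : 'M[R]_2) : 0 < h < pi -> inH z -> \tr x = 0 -> Ad (rotm h z) x = x ->
  x = (- \tr (x * Jm z) / 2) *: Jm z.
Proof.
move=> h0 z0 tx e; have s0 : sin h != 0 by rewrite gt_eqF// sin_gt0_pi.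
have d := det_rotm h z0; have J2 := Jm_sqr z0; have tJ := trJm z.
have c1 : rotm h z * x = x * rotm h z.
  by rewrite -{2}e /Ad -mulrA mulVmx2// mulr1.
have c2 : Jm z * x = x * Jm z.
  move: c1; rewrite /rotm mulrDl mulrDr !mxZl !mxZr mulr1 mul1r => /addrI /(congr1 (fun Z : 'M[R]_2 => (sin h)^-1 *: Z)).
  by rewrite !scalerA mulVf// !scale1r.
have e2 : 2 *: (x * Jm z) = \tr (x * Jm z) *: 1.
  by rewrite -clifford// c2 -mulr2n scaler_nat.
have := congr1 (fun Z : 'M[R]_2 => Z * Jm z) e2; rewrite mxZl -mulrA J2 mulrN1 mxZl mul1r => e3.
have : (- (1 / 2)) *: (2 *: - x) = (- (1 / 2)) *: (\tr (x * Jm z) *: Jm z) by rewrite e3.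
rewrite !scalerA scalerN -scaleNr => e4.
by rewrite -[LHS]scale1r (_ : 1 = - (- (1 / 2) * 2)); [rewrite e4; congr (_ *: _); field|field].
Qed.

Lemma tr_JAd (h : R) (z : R[i]) (x : 'M[R]_2) : inH z -> \tr (Jm z * (x - Ad (rotm h z) x)) = 0.
Proof. by move=> z0; rewrite trC tr_split0. Qed.

Section OneRep.
Variables (alpha : 'I_n -> R) (X : mtuple R n).
Hypothesis n_gt2 : (2 < n)%N.
Hypothesis XO : RepDT_open alpha X.
Let XDT : RepDT alpha X. Proof. by case: XO. Qed.
Let XR := DT_Rep XDT.
Local Notation c := (ngen X).
Local Notation P := (prodc (ngen X)).
Local Notation Uc u := (cocycle_gens X u).

Lemma Ad_gens m x : (m <= n)%N -> Ad (gens X m) x = Ad (P m) x.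
Proof. by move=> hm; case: (Rep_gens XR hm) => ->; rewrite ?AdN. Qed.

Lemma Ad_gen i x : (1 <= i <= n)%N -> Ad (gen X i) x = Ad (c i) x.
Proof. by move=> hi; case: (Rep_gen XR hi) => ->; rewrite ?AdN. Qed.

Lemma cocycle_gensS u m : (m < n)%N -> Uc u m.+1 = Uc u m + Ad (P m) (gen u m.+1).
Proof. by move=> hm; rewrite /cocycle_gens big_nat_recr//= Ad_gens// ltnW. Qed.

Lemma cocycle_gens1 u : Uc u 1 = gen u 1.
Proof. by rewrite /cocycle_gens big_nat1 /gens big_geq// /Ad mul1r invr1 mulr1. Qed.

Let detP m : (m < n)%N -> \det (P m) = 1.
Proof.
case: m => [|m] hm; first by rewrite prodc0 det1_2.
by have [] := DT_posell n_gt2 XDT (m := m.+1) hm.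
Qed.

(** Along a path with velocity [u] this is the derivative of the angle of P_m, as
    [hang_gens_velocity] confirms. *)
Definition hdot u m : R := - \tr (Uc u m * Jm (Bpt X m.-1)) / 2.

Let PE m : (1 <= m < n)%N -> P m = rotm (hang (P m)) (Bpt X m.-1).
Proof. by case: m => // m hm; exact: (prodc_rotm n_gt2 XDT). Qed.

Let BH m : (1 <= m < n)%N -> inH (Bpt X m.-1).
Proof. by case: m => // m hm; exact: (Bpt_inH n_gt2 XDT). Qed.

Let cE i : (1 <= i <= n)%N -> c i = rotm (hang (c i)) (Cpt X i).
Proof. exact: (c_rotm XDT). Qed.

Let CH i : (1 <= i <= n)%N -> inH (Cpt X i).
Proof. exact: (Cpt_inH XDT). Qed.

Let detc i : (1 <= i <= n)%N -> \det (c i) = 1.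
Proof. by move=> hi; have [] := DT_c XDT hi. Qed.

Section OneCocycle.
Variable u : mtuple R n.
Hypothesis uP : parabolic_cocycle X u.

Lemma tr_cocycle m : (m <= n)%N -> \tr (Uc u m) = 0.
Proof.
case: uP => tu _ _; elim: m => [|m IH] hm; first by rewrite /cocycle_gens big_geq// mxtrace0.
rewrite cocycle_gensS// mxtraceD IH ?(ltnW hm)// tr_Ad ?detP// tu ?addr0//.
Qed.

Lemma primitive_exists i : (1 <= i <= n)%N ->
  exists2 y, \tr y = 0 & gen u i = y - Ad (c i) y.
Proof.
move=> hi; case: uP => _ _ /(_ i hi)[xi [t e]]; exists (- xi); first by rewrite raddfN /= t oppr0.
by rewrite e Ad_gen// /Ad mulrN mulNr opprK addrC.
Qed.

Lemma gen_orth i : (1 <= i <= n)%N -> \tr (gen u i * Jm (Cpt X i)) = 0.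
Proof. by move=> hi; have [y _ ->] := primitive_exists hi; rewrite (cE hi) tr_split0//; exact: CH. Qed.

Lemma hdot1 : hdot u 1 = 0.
Proof.
rewrite /hdot cocycle_gens1 /= (_ : Bpt X 0 = Cpt X 1) ?gen_orth ?oppr0 ?mul0r//; first by lia.
by rewrite (Bpt_P n_gt2 XDT) ?(Cpt_c XDT) ?prodc1//; lia.
Qed.

Lemma Cpt_last : Cpt X n = Bpt X n.-2.
Proof.
have [d c0 t] := DT_posell n_gt2 XDT (n_pred n_gt2).
rewrite (Cpt_c XDT) ?(DT_cn n_gt2 XDT) ?fixptN ?fixpt_inv//; last by lia.
rewrite (Bpt_P n_gt2 XDT); last by lia.
by congr (fixpt (prodc _ _)); lia.
Qed.

Lemma cocycle_last : Ad (P n.-1) (gen u n) = - Uc u n.-1.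
Proof.
case: uP => _ un _; have := cocycle_gensS u (m := n.-1); rewrite prednK; last by lia.
by rewrite un => /(_ ltac:(lia)) /esym /eqP; rewrite addrC addr_eq0 => /eqP.
Qed.

Lemma hdot_last : hdot u n.-1 = 0.
Proof.
have h1 := n_pred n_gt2.
rewrite /hdot -[Uc u n.-1]opprK -cocycle_last trNl (PE h1).
rewrite -{1}(Ad_Jm (hang (P n.-1)) (BH h1)) tr_AdAd; last by apply: det_rotm; exact: BH.
by rewrite -Cpt_last gen_orth ?oppr0 ?mul0r//; lia.
Qed.

(** Two primitives on <c_i> differ by a multiple of Jm at the fixed point of c_i, which is
    orthogonal to every coboundary there. So the chosen primitive may be replaced by any other; the
    sign comes from writing coboundaries as y - Ad y. *)
Lemma primitive_orth i y v : (1 <= i <= n)%N -> parabolic_cocycle X v -> \tr y = 0 -> gen u i = y - Ad (c i) y ->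
  \tr (xget 0 [set xi | is_primitive (gen X i) (gen u i) xi] * gen v i) = - \tr (y * gen v i).
Proof.
move=> hi vP ty uy; case: xgetP => [xi _ [tx e]|]; last first.
  by case: uP => _ _ /(_ i hi)[xi hx] /(_ xi).
have f : Ad (c i) (xi + y) = xi + y.
  move: e; rewrite uy Ad_gen// AdD => e; apply/eqP; rewrite -subr_eq0; apply/eqP.
  rewrite opprD addrACA -e; apply/matrixP => k l; rewrite !mxE; ring.
rewrite (cE hi) in f.
have := Ad_fixed (hang_bounds _) (CH hi) _ f; rewrite mxtraceD tx ty addr0 => /(_ erefl) e2.
have : \tr ((xi + y) * gen v i) = 0.
  have [y' _ ->] : exists2 y, \tr y = 0 & gen v i = y - Ad (c i) y.
    case: vP => _ _ /(_ i hi)[xi' [t' e']]; exists (- xi'); first by rewrite raddfN /= t' oppr0.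
    by rewrite e' Ad_gen// /Ad mulrN mulNr opprK addrC.
  by rewrite e2 trZl (cE hi) tr_JAd ?mulr0//; exact: CH.
by rewrite trDl; lra.
Qed.

End OneCocycle.

(** The frame of index m belongs to the triangle Delta_(m-1), with vertices B_(m-1), C_(m+1) and
    B_m. *)
Definition chain_frame (E : nat -> 'M[R]_2) u (x : nat -> 'M[R]_2) (ta ta' : nat -> R) :=
  forall m, (1 <= m <= n - 2)%N ->
    pants_frame (Bpt X m.-1) (Cpt X m.+1) (Bpt X m) (hang (P m)) (hang (c m.+1)) (hang (P m.+1))
      (E m) (Uc u m) (gen u m.+1) (x m) (ta m) (ta' m).

Definition axes (E : nat -> 'M[R]_2) := forall m, (1 <= m <= n - 2)%N ->
  [/\ \tr (E m) = 0, E m * E m = 1, E m * Jm (Bpt X m.-1) = - (Jm (Bpt X m.-1) * E m) &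
      E m * Jm (Cpt X m.+1) = - (Jm (Cpt X m.+1) * E m)].

Let Bneq m : (1 <= m <= n - 2)%N -> Bpt X m.-1 != Cpt X m.+1.
Proof. by case: m => // m hm; apply: (Bpt_neq_next n_gt2 XO); lia. Qed.

Lemma axes_exist : exists E, axes E.
Proof.
have h m : exists Em : 'M[R]_2, (1 <= m <= n - 2)%N ->
    [/\ \tr Em = 0, Em * Em = 1, Em * Jm (Bpt X m.-1) = - (Jm (Bpt X m.-1) * Em) &
      Em * Jm (Cpt X m.+1) = - (Jm (Cpt X m.+1) * Em)].
  case: (boolP (1 <= m <= n - 2)%N) => hm; last by exists 0.
  have hB := BH (m := m) ltac:(lia); have hC := CH (i := m.+1) ltac:(lia).
  by have [Em hE] := axis_exists hB hC (Bneq hm); exists Em.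
by have [f hf] := choice h; exists f.
Qed.

Section Frames.
Variable E : nat -> 'M[R]_2.
Hypothesis EP : axes E.

Let triple m (hm : (1 <= m <= n - 2)%N) :
  [/\ inH (Bpt X m.-1), inH (Cpt X m.+1), inH (Bpt X m) &
      rotm (hang (P m)) (Bpt X m.-1) * rotm (hang (c m.+1)) (Cpt X m.+1) = rotm (hang (P m.+1)) (Bpt X m)].
Proof.
split; [by apply: BH; lia|by apply: CH; lia|by apply: (Bpt_inH n_gt2 XDT); lia|].
rewrite -PE; last by lia.
rewrite -cE; last by lia.
have := PE (m := m.+1) ltac:(lia); rewrite /= => <-.
by rewrite prodcS.
Qed.

Lemma chain_frame_exists u : parabolic_cocycle X u -> exists x ta ta', chain_frame E u x ta ta'.
Proof.
move=> uP.
suff h m : exists z : 'M[R]_2 * R * R, (1 <= m <= n - 2)%N ->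
    pants_frame (Bpt X m.-1) (Cpt X m.+1) (Bpt X m) (hang (P m)) (hang (c m.+1)) (hang (P m.+1))
      (E m) (Uc u m) (gen u m.+1) z.1.1 z.1.2 z.2.
  have [f hf] := choice h.
  by exists (fun m => (f m).1.1), (fun m => (f m).1.2), (fun m => (f m).2).
case: (boolP (1 <= m <= n - 2)%N) => hm; last by exists (0, 0, 0).
have [B0 C0 B1 AcD] := triple hm; have [E0 E2 E3 E4] := EP hm.
have hi : (1 <= m.+1 <= n)%N by lia.
have [y ty uy] := primitive_exists uP hi.
have tU : \tr (Uc u m) = 0 by apply: tr_cocycle => //; lia.
have [x [ta [ta' fr]]] := pants_frame_exists B0 C0 B1 (hang_bounds _) (hang_bounds _) (Bneq hm) AcD E0 E2 E3 E4 tU ty.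
rewrite -(cE hi) -uy in fr.
exists (x, ta, ta') => _; exact: fr.
Qed.

Lemma axis_orth m : (1 <= m <= n - 2)%N ->
  [/\ \tr (E m * Jm (Bpt X m.-1)) = 0, \tr (E m * Jm (Cpt X m.+1)) = 0,
      \tr (E m * c m.+1 * Jm (Bpt X m)) = 0 & \tr (E m * c m.+1 * Jm (Cpt X m.+1)) = 0].
Proof.
move=> hm; have hi : (1 <= m.+1 <= n)%N by lia.
have [B0 C0 B1 AcD] := triple hm; have [E0 E2 E3 E4] := EP hm.
have [_ t1] := tr_rotm0 E0 0 E3; have [_ t2] := tr_rotm0 E0 0 E4.
have t3 := tr_axis_end C0 B1 (hang_bounds _) AcD E0 E3 E4.
rewrite (cE hi); split; [by rewrite trC|by rewrite trC|by rewrite trC|].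
have cJ : rotm (hang (c m.+1)) (Cpt X m.+1) * Jm (Cpt X m.+1) = Jm (Cpt X m.+1) * rotm (hang (c m.+1)) (Cpt X m.+1).
  rewrite /rotm mulrDl mulrDr !mxZl !mxZr mul1r mulr1. by [].
have e1 : E m * rotm (hang (c m.+1)) (Cpt X m.+1) * Jm (Cpt X m.+1) = - (Jm (Cpt X m.+1) * (E m * rotm (hang (c m.+1)) (Cpt X m.+1))).
  by rewrite -mulrA cJ !mulrA E4 mulNr.
have := congr1 mxtrace e1; rewrite raddfN /= [\tr (Jm _ * _)]trC; lra.
Qed.

Section OneFrame.
Variables (u : mtuple R n) (x : nat -> 'M[R]_2) (ta ta' : nat -> R).
Hypothesis uP : parabolic_cocycle X u.
Hypothesis fr : chain_frame E u x ta ta'.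

Definition xend m := x m + ta m *: E m + ta' m *: (E m * c m.+1).

Let UD m (hm : (1 <= m <= n - 2)%N) :
  Uc u m + Ad (rotm (hang (P m)) (Bpt X m.-1)) (gen u m.+1) = Uc u m.+1.
Proof. rewrite -PE; last by lia. by rewrite cocycle_gensS//; lia. Qed.

Lemma frame_start m : (1 <= m <= n - 2)%N -> \tr (x m) = 0 /\
  Uc u m = hdot u m *: Jm (Bpt X m.-1) + (x m - Ad (P m) (x m)).
Proof. move=> hm; have [tx e _ _] := fr hm; split; first exact: tx.
by rewrite -PE in e; [exact: e|lia]. Qed.

Lemma frame_mid m : (1 <= m <= n - 2)%N ->
  gen u m.+1 = (x m + ta m *: E m) - Ad (c m.+1) (x m + ta m *: E m).
Proof. by move=> hm; have [_ _ e _] := fr hm; rewrite -cE in e; [exact: e|lia]. Qed.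

Lemma frame_end m : (1 <= m <= n - 2)%N -> \tr (xend m) = 0 /\
  Uc u m.+1 = hdot u m.+1 *: Jm (Bpt X m) + (xend m - Ad (P m.+1) (xend m)).
Proof.
move=> hm; have hi : (1 <= m.+1 <= n)%N by lia.
have [tx _ _ e] := fr hm; have [E0 E2 E3 E4] := EP hm; split.
  rewrite /xend !mxtraceD !mxtraceZ tx E0 (cE hi) trC.
  by have [-> _] := tr_rotm0 E0 (hang (c m.+1)) E4; rewrite !mulr0 !addr0.
rewrite (UD hm) -(cE hi) in e.
have Pm : P m.+1 = rotm (hang (P m.+1)) (Bpt X m) := PE (m := m.+1) ltac:(lia).
rewrite -Pm in e; exact: e.
Qed.

Definition kdot i : R := - \tr ((x i.+1 - xend i) * Jm (Bpt X i)) / 2.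

(** The last field of one triangle and the first field of the next describe the same velocity of
    P_(i+1), so their difference commutes with this rotation about B_i. *)
Lemma kdotE i : (1 <= i <= n - 3)%N -> x i.+1 - xend i = kdot i *: Jm (Bpt X i).
Proof.
move=> hi; have [t1 e1] := frame_start (m := i.+1) ltac:(lia).
have [t2 e2] := frame_end (m := i) ltac:(lia).
have Pi := PE (m := i.+1) ltac:(lia); rewrite /= in Pi.
apply: (Ad_fixed (hang_bounds (P i.+1))); first by apply: (Bpt_inH n_gt2 XDT); lia.
  by rewrite raddfB /= t1 t2 subrr.
rewrite -Pi AdB; move: e1; rewrite e2 /= => /addrI e3.
apply/eqP; rewrite -subr_eq0; apply/eqP.
have -> : Ad (P i.+1) (x i.+1) - Ad (P i.+1) (xend i) - (x i.+1 - xend i) =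
   (xend i - Ad (P i.+1) (xend i)) - (x i.+1 - Ad (P i.+1) (x i.+1)).
  by apply/matrixP => k l; rewrite !mxE; ring.
by rewrite e3 subrr.
Qed.

Lemma frame_first : gen u 1 = x 1 - Ad (c 1) (x 1).
Proof.
have [_] := frame_start (m := 1) ltac:(lia).
by rewrite (hdot1 uP) scale0r add0r cocycle_gens1 prodc1.
Qed.

Lemma frame_last : gen u n = xend (n - 2) - Ad (c n) (xend (n - 2)).
Proof.
have [_] := frame_end (m := n - 2) ltac:(lia).
have -> : (n - 2).+1 = n.-1 by lia.
rewrite (hdot_last uP) scale0r add0r => e.
have d := detP (m := n.-1) ltac:(lia); have d' := det_inv1 d.
have -> : gen u n = Ad (P n.-1)^-1 (- Uc u n.-1).
  rewrite -(cocycle_last uP) AdM// mulVmx2// /Ad mul1r invr1 mulr1 //.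
rewrite (DT_cn n_gt2 XDT) AdN e opprB AdB AdM// mulVmx2//.
by rewrite {1}/Ad mul1r invr1 mulr1.
Qed.

(** Constant angles make each triangle rigid by [pants_rigid], so its three fields coincide; without
    jumps at the B_i the fields of neighbouring triangles agree as well. The common field is the
    primitive sought. *)
Lemma frame_rigid : (forall m, (1 <= m <= n - 1)%N -> hdot u m = 0) ->
  (forall i, (1 <= i <= n - 3)%N -> kdot i = 0) ->
  exists2 eta, \tr eta = 0 & forall i, (1 <= i <= n)%N -> gen u i = eta - Ad (c i) eta.
Proof.
move=> h0 k0.
have t0 m : (1 <= m <= n - 2)%N -> ta m = 0 /\ ta' m = 0.
  move=> hm; have [B0 C0 B1 AcD] := triple hm; have [E0 E2 E3 E4] := EP hm.
  apply: (pants_rigid B0 C0 B1 (hang_bounds _) (hang_bounds _) (hang_bounds _) (Bneq hm) AcD E0 E2 E3 E4 (fr hm)).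
    by have := h0 m ltac:(lia); rewrite /hdot; lra.
  by rewrite UD//; have := h0 m.+1 ltac:(lia); rewrite /hdot /=; lra.
have xe m : (1 <= m <= n - 2)%N -> xend m = x m.
  by move=> hm; have [e1 e2] := t0 m hm; rewrite /xend e1 e2 !scale0r !addr0.
have xx m : (m < n - 2)%N -> x m.+1 = x 1.
  elim: m => // m IH hm; rewrite -IH; last by lia.
  have hi : (1 <= m.+1 <= n - 3)%N by lia.
  have := kdotE hi; rewrite k0// scale0r xe; last by lia.
  by move/eqP; rewrite subr_eq0 => /eqP.
exists (x 1); first by have [] := frame_start (m := 1) ltac:(lia).
move=> i hi; case: (ltngtP i 1) => h1; [by lia| |by rewrite h1; exact: frame_first].
case: (ltngtP i n) => h2; [|by lia|].
  case: i hi h1 h2 => // -[//|m] hi h1 h2.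
  have hm : (1 <= m.+1 <= n - 2)%N by lia.
  have := frame_mid hm; have [-> _] := t0 _ hm; rewrite scale0r addr0 xx//.
rewrite h2 frame_last xe; last by lia.
by rewrite (_ : (n - 2) = (n - 3).+1)%N ?xx//; lia.
Qed.

End OneFrame.

Lemma sum_shift (a b : nat -> R) k :
  \sum_(1 <= m < k.+2) (a m - b m) + b 1%N - a k.+1 = \sum_(1 <= i < k.+1) (a i - b i.+1).
Proof.
elim: k => [|k IH]; first by rewrite big_nat1 big_geq//; ring.
rewrite [RHS]big_nat_recr//= -IH [X in X + _ - _]big_nat_recr//=; ring.
Qed.

Lemma big_nat_last (F : nat -> R) (N : nat) : (1 < N)%N ->
  \sum_(1 <= m < N) F m = \sum_(1 <= m < N.-1) F m + F N.-1.
Proof. by case: N => // -[//|N] _; rewrite big_nat_recr. Qed.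

(** Each triangle contributes Sp m - Sm m by [pants_telescope]. The primitive of c_1 supplies Sm 1
    and the terms of c_n cancel Sp (n - 2), both because the angles of P_1 and P_(n-1) are constant;
    so only comparisons at the shared vertices B_i are left. *)
Theorem goldmanE u v x ta ta' x2 sa sa' :
  parabolic_cocycle X u -> parabolic_cocycle X v ->
  chain_frame E u x ta ta' -> chain_frame E v x2 sa sa' ->
  goldman X u v = 2 * \sum_(1 <= i < n - 2)
    (kdot x ta ta' i * hdot v i.+1 - hdot u i.+1 * kdot x2 sa sa' i).
Proof.
move=> uP vP fu fv.
pose Sm m := \tr (x m * Uc v m) - hdot u m * \tr (Jm (Bpt X m.-1) * x2 m) - hdot u m * hdot v m.
pose Sp m := \tr (xend x ta ta' m * Uc v m.+1) - hdot u m.+1 * \tr (Jm (Bpt X m) * xend x2 sa sa' m)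
   - hdot u m.+1 * hdot v m.+1.
have tel m : (1 <= m <= n - 2)%N ->
    \tr (Uc u m * Ad (gens X m) (gen v m.+1)) + \tr ((x m + ta m *: E m) * gen v m.+1) = Sp m - Sm m.
  move=> hm; have [B0 C0 B1 AcD] := triple hm; have [E0 E2 E3 E4] := EP hm.
  have := pants_telescope B0 C0 B1 (hang_bounds _) AcD E0 E2 E3 E4 (fu m hm) (fv m hm).
  rewrite -[rotm (hang (P m)) _]PE; last by lia.
  rewrite -[rotm (hang (c m.+1)) _]cE; last by lia.
  rewrite -!cocycle_gensS; try lia.
  rewrite Ad_gens; last by lia.
  by move=> ->.
have N2 : (n - 2)%N = (n - 3).+1 by lia.
have -> : goldman X u v = \sum_(1 <= m < (n - 3).+2) (Sp m - Sm m) + Sm 1%N - Sp (n - 3).+1.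
  have -> : (n - 3).+2 = n.-1 by lia.
  rewrite -N2 /goldman [\sum_(1 <= m < n) _]big_nat_last; last by lia.
  rewrite [\sum_(1 <= i < n.+1) _]big_nat_recr /=; last by lia.
  rewrite [\sum_(1 <= i < n) \tr (xget _ _ * _)]big_ltn; last by lia.
  rewrite [\sum_(2 <= i < n) _]big_add1.
  set G := \sum_(1 <= i < n.-1) \tr (Uc u i * _); set Fs := \sum_(1 <= i < n.-1) \tr (xget _ _ * _).
  have GF : G - Fs = \sum_(1 <= m < n.-1) (Sp m - Sm m).
    rewrite /G /Fs -sumrB; apply: eq_big_nat => m hm; have hm' : (1 <= m <= n - 2)%N by lia.
    rewrite -tel//; have [E0 E2 E3 E4] := EP hm'.
    have tY : \tr (x m + ta m *: E m) = 0.
      by have [tx _] := frame_start fu hm'; rewrite mxtraceD mxtraceZ tx E0 mulr0 addr0.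
    have hi : (1 <= m.+1 <= n)%N by lia.
    by rewrite (primitive_orth uP hi vP tY (frame_mid fu hm')) opprK.
  have F1 : \tr (xget 0 [set xi | is_primitive (gen X 1) (gen u 1) xi] * gen v 1) = - Sm 1.
    have [tx _] := frame_start fu (m := 1) ltac:(lia).
    rewrite (primitive_orth uP _ vP tx (frame_first uP fu)); last by lia.
    by rewrite /Sm (hdot1 uP) cocycle_gens1; ring.
  have Fn : \tr (Uc u n.-1 * Ad (gens X n.-1) (gen v n.-1.+1)) -
     \tr (xget 0 [set xi | is_primitive (gen X n) (gen u n) xi] * gen v n) = - Sp (n - 2)%N.
    have h2 : (1 <= n - 2 <= n - 2)%N by lia.
    have [tx ue] := frame_end fu h2; have e1 : (n - 2).+1 = n.-1 by lia.
    rewrite e1 in ue.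
    rewrite (primitive_orth uP _ vP tx (frame_last uP fu)); last by lia.
    rewrite Ad_gens; last by lia.
    rewrite (_ : gen v n.-1.+1 = gen v n); last by congr (gen v); lia.
    rewrite (cocycle_last vP) /Sp e1 ue (hdot_last uP) scale0r add0r.
    have d := detP (m := n.-1) ltac:(lia).
    rewrite -[\tr (xend _ _ _ _ * gen v n)](tr_AdAd _ _ d) (cocycle_last vP) !trNr mulrBl raddfB /=; ring.
  rewrite -GF -(opprK (Sm 1)) -F1 -[Sp (n - 2)%N]opprK -Fn; ring.
(* At B_i the two boundary terms involve the same cocycle values and differ only through the jump of
   the fields. *)
rewrite sum_shift mulr_sumr N2; apply: eq_big_nat => i hi.
have hi' : (1 <= i <= n - 3)%N by lia.
have ku := kdotE fu hi'; have kv := kdotE fv hi'.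
have J2 : \tr (Jm (Bpt X i) * Jm (Bpt X i)) = -2.
  by rewrite Jm_sqr ?raddfN /= ?mxtrace1//; apply: (Bpt_inH n_gt2 XDT); lia.
have xu : x i.+1 = xend x ta ta' i + kdot x ta ta' i *: Jm (Bpt X i) by rewrite -ku subrKC.
have xv : x2 i.+1 = xend x2 sa sa' i + kdot x2 sa sa' i *: Jm (Bpt X i) by rewrite -kv subrKC.
have hv : \tr (Jm (Bpt X i) * Uc v i.+1) = - 2 * hdot v i.+1.
  by rewrite /hdot /= trC; field.
rewrite /Sp /Sm xu xv /= !trDl !trDr !trZl !trZr J2 hv; ring.
Qed.

End Frames.
End OneRep.
End Goldman.

(** * Derivatives along paths *)

Section Derivatives.
Context {R : realType}.
Implicit Types (f g : R -> R) (F G : R -> 'M[R]_2) (w z : R -> R[i]).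

Definition isd f (d : R) := is_derive (0 : R) (1 : R) f d.

Lemma isd_eq f d d' : isd f d -> d = d' -> isd f d'.
Proof. by move=> + <-. Qed.

Lemma isd_uniq f d d' : isd f d -> isd f d' -> d = d'.
Proof. by move=> [_ <-] [_ <-]. Qed.

Lemma isd_ext f g d : f = g -> isd f d -> isd g d. Proof. by move=> ->. Qed.

Lemma isd_cst (a : R) : isd (fun=> a) 0. Proof. exact: is_derive_cst. Qed.

Lemma isdD f g a b : isd f a -> isd g b -> isd (fun t => f t + g t) (a + b).
Proof. exact: is_deriveD. Qed.

Lemma isdN f a : isd f a -> isd (fun t => - f t) (- a).
Proof. exact: is_deriveN. Qed.

Lemma isdB f g a b : isd f a -> isd g b -> isd (fun t => f t - g t) (a - b).
Proof. exact: is_deriveB. Qed.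

Lemma isdM f g a b : isd f a -> isd g b -> isd (fun t => f t * g t) (a * g 0 + f 0 * b).
Proof. by move=> fa gb; apply: isd_eq (is_deriveM fa gb) _; rewrite /GRing.scale/= addrC mulrC. Qed.

Lemma isdX2 f a : isd f a -> isd (fun t => f t ^+ 2) (2 * f 0 * a).
Proof. by move=> fa; apply: isd_eq (isdM fa fa) _; ring. Qed.

Lemma isd_comp f (h : R -> R) a b : is_derive (f 0) (1 : R) h b -> isd f a -> isd (fun t => h (f t)) (b * a).
Proof. by move=> hb fa; exact: is_derive1_comp. Qed.

Lemma isdV f a : f 0 != 0 -> isd f a -> isd (fun t => (f t)^-1) (- (f 0) ^- 2 * a).
Proof. by move=> f0 fa; apply: isd_eq (is_deriveV f0 fa) _; rewrite /GRing.scale/=. Qed.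

Lemma isd_div f g a b : g 0 != 0 -> isd f a -> isd g b ->
  isd (fun t => f t / g t) ((a * g 0 - f 0 * b) / g 0 ^+ 2).
Proof. by move=> g0 fa gb; apply: isd_eq (isdM fa (isdV g0 gb)) _; field. Qed.

Lemma isd_sqrt f a : 0 < f 0 -> isd f a -> isd (fun t => Num.sqrt (f t)) (a / (2 * Num.sqrt (f 0))).
Proof. by move=> f0 fa; apply: isd_eq (isd_comp (is_derive1_sqrt f0) fa) _; rewrite mulrC. Qed.

Lemma isd_atan f a : isd f a -> isd (fun t => atan (f t)) (a / (1 + f 0 ^+ 2)).
Proof. by move=> fa; apply: isd_eq (isd_comp (is_derive1_atan _) fa) _; rewrite mulrC. Qed.

Lemma isd_sum (f : nat -> R -> R) (d : nat -> R) m k : (forall i, (m <= i < k)%N -> isd (f i) (d i)) ->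
  isd (fun t => \sum_(m <= i < k) f i t) (\sum_(m <= i < k) d i).
Proof.
move=> h; elim: k h => [|k IH] h.
  by rewrite big_geq//; apply: isd_ext (isd_cst 0); apply/funext => t; rewrite big_geq.
case: (leqP m k) => mk; last first.
  by rewrite big_geq//; apply: isd_ext (isd_cst 0); apply/funext => t; rewrite big_geq.
rewrite big_nat_recr//=.
apply: (isd_ext (f := fun t => \sum_(m <= i < k) f i t + f k t)).
  by apply/funext => t; rewrite big_nat_recr.
by apply: isdD; [apply: IH => i hi; apply: h; lia|apply: h; lia].
Qed.

Definition isdm F (F' : 'M[R]_2) := forall i j, isd (fun t => F t i j) (F' i j).
Definition isdc w (w' : R[i]) :=
  isd (fun t => complex.Re (w t)) (complex.Re w') /\ isd (fun t => complex.Im (w t)) (complex.Im w').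

Lemma isdm_cst (A : 'M[R]_2) : isdm (fun=> A) 0.
Proof. by move=> i j; rewrite mxE; exact: isd_cst. Qed.

Lemma isdmM F G (F' G' : 'M[R]_2) : isdm F F' -> isdm G G' -> isdm (fun t => F t * G t) (F' * G 0 + F 0 * G').
Proof.
move=> hF hG i j.
have e (A B : 'M[R]_2) : (A * B) i j = A i 0 * B 0 j + A i 1 * B 1 j.
  rewrite mxE !big_ord_recl big_ord0 addr0.
  by congr (_ + A i _ * B _ j); apply: val_inj.
rewrite (funext (fun t => e (F t) (G t))) mxE !e.
apply: isd_eq (isdD (isdM (hF i 0) (hG 0 j)) (isdM (hF i 1) (hG 1 j))) _; ring.
Qed.

Lemma isd_tr F (F' : 'M[R]_2) : isdm F F' -> isd (fun t => \tr (F t)) (\tr F').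
Proof.
move=> hF; rewrite trmx2E (funext (fun t => trmx2E (F t))); exact: isdD.
Qed.

Lemma isdcM w z (w' z' : R[i]) : isdc w w' -> isdc z z' -> isdc (fun t => w t * z t) (w' * z 0 + w 0 * z').
Proof.
move=> [w1 w2] [z1 z2].
have e (a b : R[i]) : complex.Re (a * b) = complex.Re a * complex.Re b - complex.Im a * complex.Im b by case: a; case: b.
have e' (a b : R[i]) : complex.Im (a * b) = complex.Re a * complex.Im b + complex.Im a * complex.Re b by case: a; case: b.
have eD (a b : R[i]) : complex.Re (a + b) = complex.Re a + complex.Re b by case: a; case: b.
have eD' (a b : R[i]) : complex.Im (a + b) = complex.Im a + complex.Im b by case: a; case: b.
split.
  rewrite (funext (fun t => e (w t) (z t))) eD !e.
  apply: isd_eq (isdB (isdM w1 z1) (isdM w2 z2)) _; ring.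
rewrite (funext (fun t => e' (w t) (z t))) eD' !e'.
apply: isd_eq (isdD (isdM w1 z2) (isdM w2 z1)) _; ring.
Qed.

Lemma isdc_conj w (w' : R[i]) : isdc w w' -> isdc (fun t => conjc (w t)) (conjc w').
Proof.
move=> [w1 w2]; have e (a : R[i]) : complex.Re (conjc a) = complex.Re a by case: a.
have e' (a : R[i]) : complex.Im (conjc a) = - complex.Im a by case: a.
by split; [rewrite (funext (fun t => e (w t))) e|rewrite (funext (fun t => e' (w t))) e'; exact: isdN].
Qed.

Lemma isdc_cst (a : R[i]) : isdc (fun=> a) 0. Proof. by split; exact: isd_cst. Qed.

(* The velocity at a point of H under the infinitesimal isometry x. *)
Definition killing (x : 'M[R]_2) (a : R[i]) : R[i] :=
  (x 0 1 + (x 0 0 - x 1 1) * complex.Re a - x 1 0 * (complex.Re a ^+ 2 - complex.Im a ^+ 2))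
  +i* ((x 0 0 - x 1 1) * complex.Im a - 2 * x 1 0 * complex.Re a * complex.Im a).

Section FixpointVelocity.
Variables (F : R -> 'M[R]_2) (F' x : 'M[R]_2) (e h hd : R) (a : R[i]).
Hypothesis h0 : 0 < h < pi.
Hypothesis a0 : inH a.
Hypothesis e2 : e = 1 \/ e = -1.
Hypothesis F0 : F 0 = e *: rotm h a.
Hypothesis dF : isdm F F'.
Hypothesis F'E : F' = hd *: (Jm a * F 0) + (x * F 0 - F 0 * x).

Let s0 : 0 < sin h. Proof. exact: sin_gt0_pi. Qed.
Let cs : cos h ^+ 2 = 1 - sin h ^+ 2. Proof. by have := cos2Dsin2 h; lra. Qed.
Let y0 : complex.Im a != 0. Proof. by rewrite gt_eqF. Qed.
Let s1 : sin h != 0. Proof. by rewrite gt_eqF. Qed.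
Let e0 : e != 0. Proof. by case: e2 => ->; rewrite ?oppr_eq0 oner_eq0. Qed.
Let ee : e ^+ 2 = 1. Proof. by case: e2 => ->; ring. Qed.

Let F0E : [/\ F 0 0 0 = e * (cos h + sin h * complex.Re a / complex.Im a),
   F 0 0 1 = - e * sin h * normsq a / complex.Im a,
   F 0 1 0 = e * sin h / complex.Im a &
   F 0 1 1 = e * (cos h - sin h * complex.Re a / complex.Im a)].
Proof. by split; rewrite F0 /rotm !mxE2; field. Qed.

Let fix_im0 : fix_im (F 0) = complex.Im a.
Proof.
have [f1 f2 f3 f4] := F0E.
rewrite /fix_im trmx2E f1 f3 f4.
have -> : (4 - (e * (cos h + sin h * complex.Re a / complex.Im a) + e * (cos h - sin h * complex.Re a / complex.Im a)) ^+ 2)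
   / (4 * (e * sin h / complex.Im a) ^+ 2) = complex.Im a ^+ 2.
  field: cs ee; by rewrite y0 s1 e0.
by rewrite sqrtr_sqr gtr0_norm.
Qed.

(** The derivative of [F] is a change of angle at rate [hd] together with conjugation along the flow
    of [x]. The former leaves the fixed point in place, the latter moves it by the Killing field and
    preserves the angle, whence also [isd_hang]. The sign [e] is that of the lift. *)
Lemma isd_fixC : isdc (fun t => fixC (F t)) (killing x a).
Proof.
have [f1 f2 f3 f4] := F0E; have fi := fix_im0.
have n0 : F 0 1 0 != 0 by rewrite f3 !mulf_neq0// invr_neq0.
split; rewrite /fixC /=.
  have d10 : isd (fun t => 2 * F t 1 0) (2 * F' 1 0).
    by apply: isd_eq (isdM (isd_cst 2) (dF 1 0)) _; ring.
  have n2 : 2 * F 0 1 0 != 0 by rewrite mulf_neq0.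
  apply: isd_eq (isd_div n2 (isdB (dF 0 0) (dF 1 1)) d10) _.
  rewrite F'E !mxE2 f1 f2 f3 f4 /normsq; field; by rewrite y0 s1 e0.
have n2 : 4 * F 0 1 0 ^+ 2 != 0 by rewrite mulf_neq0// expf_neq0.
have dn : isd (fun t => 4 - \tr (F t) ^+ 2) (- (2 * \tr (F 0) * \tr F')).
  by apply: isd_eq (isdB (isd_cst 4) (isdX2 (isd_tr dF))) _; ring.
have dd : isd (fun t => 4 * F t 1 0 ^+ 2) (8 * F 0 1 0 * F' 1 0).
  by apply: isd_eq (isdM (isd_cst 4) (isdX2 (dF 1 0))) _; ring.
have im2 : (4 - \tr (F 0) ^+ 2) / (4 * F 0 1 0 ^+ 2) = complex.Im a ^+ 2.
  rewrite trmx2E f1 f3 f4; field: cs ee; by rewrite y0 s1 e0.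
have := isd_sqrt _ (isd_div n2 dn dd); rewrite im2 => /(_ (exprn_gt0 _ a0)) => D.
apply: isd_eq D _; rewrite sqrtr_sqr gtr0_norm// F'E !trmx2E !mxE2 f1 f2 f3 f4 /normsq.
field: cs ee; by rewrite y0 s1 e0.
Qed.

Lemma isd_hang : isd (fun t => hang (F t)) hd.
Proof.
have [f1 f2 f3 f4] := F0E; have fi := fix_im0; have [_ di] := isd_fixC.
have n0 : F 0 1 0 != 0 by rewrite f3 !mulf_neq0// invr_neq0.
have dd : isd (fun t => 2 * (F t 1 0 * fix_im (F t))) (2 * (F' 1 0 * fix_im (F 0) + F 0 1 0 * complex.Im (killing x a))).
  by apply: isd_eq (isdM (isd_cst 2) (isdM (dF 1 0) di)) _; rewrite /fixC /=; ring.
have n2 : 2 * (F 0 1 0 * fix_im (F 0)) != 0 by rewrite fi !mulf_neq0.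
apply: isd_eq (isdB (isd_cst (pi / 2)) (isd_atan (isd_div n2 (isd_tr dF) dd))) _.
rewrite fi /killing /= F'E !trmx2E !mxE2 f1 f2 f3 f4 /normsq.
field: cs ee; rewrite y0 s1 e0 /=.
rewrite (_ : _ + _ = 4 * complex.Im a ^+ 2); last by ring: cs ee.
by rewrite mulf_neq0// expf_neq0.
Qed.

End FixpointVelocity.

(** For distinct points, y - x is orthogonal to Jm at both, hence an infinitesimal translation along
    the geodesic through them, which does not turn the ray from [w] to [z]. Its direction therefore
    turns as under x alone, at a rate that does not depend on [z]. *)
Lemma isd_dirv w z (x y : 'M[R]_2) : inH (w 0) -> inH (z 0) ->
  isdc w (killing x (w 0)) -> isdc z (killing y (z 0)) ->
  \tr (y - x) = 0 -> \tr ((y - x) * Jm (w 0)) = 0 -> \tr ((y - x) * Jm (z 0)) = 0 ->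
  exists2 d, isdc (fun t => dirv (w t) (z t)) d &
    complex.Im (d * conjc (dirv (w 0) (z 0))) = - 2 * x 1 0 * complex.Im (w 0) * normsq (dirv (w 0) (z 0)).
Proof.
move=> w0 z0 [w1 w2] [z1 z2] t0 tw tz.
have dx := isdB z1 w1.
pose kw := killing x (w 0); pose kz := killing y (z 0).
have d1 : isd (fun t => complex.Re (dirv (w t) (z t))) (2 * (complex.Re (z 0) - complex.Re (w 0)) * (complex.Re kz - complex.Re kw)
   + 2 * complex.Im (z 0) * complex.Im kz - 2 * complex.Im (w 0) * complex.Im kw).
  exact: (isdB (isdD (isdX2 dx) (isdX2 z2)) (isdX2 w2)).
have d2 : isd (fun t => complex.Im (dirv (w t) (z t)))
   (- 2 * complex.Im kw * (complex.Re (z 0) - complex.Re (w 0)) - 2 * complex.Im (w 0) * (complex.Re kz - complex.Re kw)).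
  by apply: isd_eq (isdM (isdM (isd_cst (-2)) w2) dx) _; rewrite /kw /kz; ring.
exists ((2 * (complex.Re (z 0) - complex.Re (w 0)) * (complex.Re kz - complex.Re kw)
   + 2 * complex.Im (z 0) * complex.Im kz - 2 * complex.Im (w 0) * complex.Im kw) +i*
   (- 2 * complex.Im kw * (complex.Re (z 0) - complex.Re (w 0)) - 2 * complex.Im (w 0) * (complex.Re kz - complex.Re kw))).
  by split; [exact: d1|exact: d2].
have wn : complex.Im (w 0) != 0 by rewrite gt_eqF.
have zn : complex.Im (z 0) != 0 by rewrite gt_eqF.
move: tw tz t0; rewrite !trmx2E.
have [m mE] : exists m, m = y - x by exists (y - x).
rewrite -mE => tw tz t0.
have m11 : m 1 1 = - m 0 0 by lra.
have L u : complex.Im u != 0 -> (m * Jm u) 0 0 + (m * Jm u) 1 1 = 0 ->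
    2 * m 0 0 * complex.Re u + m 0 1 - m 1 0 * normsq u = 0.
  move=> un; rewrite !mxE2 m11 => h; apply: (mulIf (invr_neq0 un)); rewrite mul0r -[RHS]h; field.
  exact: un.
have Lw := L _ wn tw; have Lz := L _ zn tz.
have yE i j : y i j = x i j + m i j by rewrite mE !mxE subrKC.
rewrite /kw /kz /killing !yE m11 /dirv /normsq /= in Lw Lz *.
move: (complex.Re (w 0)) (complex.Im (w 0)) (complex.Re (z 0)) (complex.Im (z 0)) Lw Lz => wr wi zr zi Lw Lz.
move: (m 0 0) (m 0 1) (m 1 0) Lw Lz => a b c Lw Lz.
apply/eqP; rewrite -subr_eq0; apply/eqP.
(* A combination of the two orthogonality relations, each of which is 0. *)
transitivity (2 * wi * (2 * a * zr + b - c * (zr ^+ 2 + zi ^+ 2)) * ((zr - wr) ^+ 2 - zi ^+ 2 + wi ^+ 2)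
  + 4 * wi * zi ^+ 2 * ((2 * a * zr + b - c * (zr ^+ 2 + zi ^+ 2)) - (2 * a * wr + b - c * (wr ^+ 2 + wi ^+ 2)))).
  by ring.
by rewrite Lw Lz; ring.
Qed.

End Derivatives.

(** * Derivatives of the lifted coordinates along paths *)

Section Paths.
Context {R : realType} {n : nat}.
Variables (alpha : 'I_n -> R) (X : mtuple R n).
Hypothesis n_gt2 : (2 < n)%N.
Hypothesis XO : RepDT_open alpha X.
Let XDT : RepDT alpha X. Proof. by case: XO. Qed.
Let XR := DT_Rep XDT.
Local Notation Uc u := (cocycle_gens X u).

Lemma prodc_ngen (Y : mtuple R n) m : (forall i, (1 <= i <= m)%N -> gen Y i 1 0 != 0) ->
  prodc (ngen Y) m = (\prod_(1 <= i < m.+1) Num.sg (gen Y i 1 0)) *: gens Y m.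
Proof.
elim: m => [|m IH] h; first by rewrite prodc0 /gens !big_geq// scale1r.
rewrite prodcS IH; last by move=> i hi; apply: h; lia.
by rewrite gensS [\prod_(1 <= i < m.+2) _]big_nat_recr//= /ngen mxZl mxZr scalerA.
Qed.

(** A polynomial with the sign of the lower left entry of P_m. The normalising signs are replaced by
    the entries themselves, so that its positivity is visibly an open condition. *)
Definition orient_sign (Y : mtuple R n) m := (\prod_(1 <= i < m.+1) gen Y i 1 0) * gens Y m 1 0.

Lemma orient_sign_gt0 (Y : mtuple R n) m : (forall i, (1 <= i <= m)%N -> gen Y i 1 0 != 0) ->
  (0 < orient_sign Y m) = (0 < prodc (ngen Y) m 1 0).
Proof.
move=> h; rewrite prodc_ngen// mxE /orient_sign.
have -> : \prod_(1 <= i < m.+1) gen Y i 1 0 =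
    (\prod_(1 <= i < m.+1) `|gen Y i 1 0|) * \prod_(1 <= i < m.+1) Num.sg (gen Y i 1 0).
  by rewrite -big_split /=; apply: eq_bigr => i _; rewrite mulrC -numEsg.
rewrite -mulrA pmulr_rgt0// big_seq_cond prodr_gt0// => i.
by rewrite andbT mem_index_iota => hi; rewrite normr_gt0 h//; lia.
Qed.

Definition near_dom : set (mtuple R n) :=
  ell_dom `&` [set Y | forall j : 'I_n, ((j <= n - 3)%N -> ell_dom Y /\ 0 < area_lift Y j)] `&`
  [set Y | forall j : 'I_n, ((0 < j)%N -> ell_dom Y /\ 0 < orient_sign Y j)].

Lemma open_near_dom : open near_dom.
Proof.
have oE := @open_ell_dom R n; have QC := fclass_Cinf oE.
apply: openI; first apply: openI => //.
  apply: open_forall => j; case: (leqP j (n - 3)) => hj.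
    rewrite [Z in open Z](_ : _ = ell_dom `&` [set X : mtuple R n | 0 < area_lift X j]).
      exact: (open_gt0f oE (Q_area_lift n_gt2 hj)).
    by apply/seteqP; split=> Y /=; [exact|move=> h _].
  rewrite [Z in open Z](_ : _ = setT); first exact: openT.
  by apply/seteqP; split.
apply: open_forall => j; case: (ltnP 0 j) => hj.
  have Qo : Cinf ell_dom (fun Y : mtuple R n => orient_sign Y j).
    apply: (fcM QC); last exact: (Qm_gens _ oE).
    elim: (index_iota 1 j.+1) => [|i s IH].
      rewrite (_ : (fun Y => _) = (fun=> 1)); first exact: (fc_cst QC).
      by apply/funext => Y; rewrite big_nil.
    rewrite (_ : (fun Y => _) = (fun Y : mtuple R n => gen Y i 1 0 * \prod_(k <- s) gen Y k 1 0)); last by apply/funext => Y; rewrite big_cons.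
    by apply: (fcM QC) => //; exact: (Qm_gen _ oE).
  rewrite [Z in open Z](_ : _ = ell_dom `&` [set X : mtuple R n | 0 < orient_sign X j]).
    exact: (open_gt0f oE Qo).
  by apply/seteqP; split=> Y /=; [exact|move=> h _].
rewrite [Z in open Z](_ : _ = setT); first exact: openT.
by apply/seteqP; split.
Qed.

Lemma near_dom_base : near_dom X.
Proof.
have eX := DT_ell_dom n_gt2 XDT.
split; first split=> //.
  move=> j hj; split=> //; rewrite -(DT_area_lift n_gt2 XDT hj).
  by case: XO => _; exact.
move=> j hj; split=> //; rewrite orient_sign_gt0.
  by have [|d c0 t] := DT_posell n_gt2 XDT (m := j); first by rewrite hj ltn_ord.
by move=> i hi; apply: (Rep_c XR); have := ltn_ord j; lia.
Qed.

(** The open stratum is open in [Rep]. A path is only required to stay in [Rep], and this keeps it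
    in the stratum for small times. *)
Lemma near_dom_open Y : Rep alpha Y -> near_dom Y -> RepDT_open alpha Y.
Proof.
move=> YR [[eY hA] hS].
have YDT : RepDT alpha Y.
  apply/RepDTP; first by exact: ltnW.
  split=> // m hm.
  have c0 i : (1 <= i <= m)%N -> gen Y i 1 0 != 0 by move=> hi; apply: (Rep_c YR); lia.
  have mn : (m < n)%N by lia.
  have [g0 g1] := ell_gens eY hm.
  have [_] := hS (Ordinal mn) ltac:(by case/andP: hm); rewrite orient_sign_gt0//= => p0.
  split=> //.
    have D k : (k <= m)%N -> \det (prodc (ngen Y) k) = 1.
      elim: k => [|k IH] hk; first by rewrite prodc0 det1_2.
      rewrite prodcS detM2 IH ?mul1r; last by exact: ltnW.
      by have [|d _ _] := Rep_posell YR (i := k.+1); [lia|].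
    exact: D.
  move: g1; rewrite subr_gt0.
  by case: (Rep_gens YR (ltnW mn)) => ->; rewrite ?tr_sqrN.
split=> // i hi; rewrite (DT_area_lift n_gt2 YDT hi).
have hi' : (i < n)%N by lia.
by have [] := hA (Ordinal hi') hi.
Qed.

Section OnePath.
Variables (u : mtuple R n) (p : R -> mtuple R n).
Hypothesis uP : parabolic_cocycle X u.
Hypothesis pP : path_through alpha X u p.

Let p0 : p 0 = X. Proof. by case: pP. Qed.

Lemma path_isd i j : isd (fun t => p t i j) ('D_(1 : R) p 0 i j).
Proof.
have [/smooth_onP sp _ _ _] := pP.
have dp : derivable p (0 : R) 1 by apply: (Ck_derivable (sp 1%N) I).
have cL : continuous (cfun (c := coordsMx (R := R) n (2 * 2)) (i, j)) by exact: cfun_continuous.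
exact: (is_derive_linear cL dp).
Qed.

Lemma path_gen i : (1 <= i <= n)%N -> isdm (fun t => gen (p t) i) (gen u i * gen X i).
Proof.
move=> hi; have [_ _ _ /(_ i hi) e] := pP; rewrite -e.
case: i hi e => // i hi _ k l.
have E (Y : mtuple R n) : gen Y i.+1 k l = Y (Ordinal hi) (mxvec_index k l).
  by rewrite /gen (insubT (fun k => k < n)%N hi) /= !mxE.
rewrite E (funext (fun t => E (p t))); exact: path_isd.
Qed.

Lemma det_gens m : (m <= n)%N -> \det (gens X m) = 1.
Proof.
move=> hm; case: (ltnP m n) => h; first by have [] := DT_gens n_gt2 XDT h.
have -> : m = n by lia.
by case: XR => _ [->|->] _; rewrite ?detN2 det1_2.
Qed.

Lemma path_gens m : (m <= n)%N -> isdm (fun t => gens (p t) m) (Uc u m * gens X m).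
Proof.
elim: m => [|m IH] hm.
  rewrite /cocycle_gens big_geq// mul0r.
  have -> : (fun t => gens (p t) 0) = (fun=> 1) by apply/funext => t; rewrite /gens big_geq.
  exact: isdm_cst.
have D := isdmM (IH (ltnW hm)) (path_gen (i := m.+1) hm).
rewrite -(funext (fun t => gensS (p t) m)) in D.
have -> : Uc u m.+1 * gens X m.+1 = Uc u m * gens X m * gen (p 0) m.+1 + gens (p 0) m * (gen u m.+1 * gen X m.+1).
  rewrite p0 /cocycle_gens big_nat_recr//= gensS mulrDl mulrA; congr (_ + _).
  by rewrite /Ad -!mulrA [(gens X m)^-1 * _]mulrA mulVmx2 ?mul1r// det_gens// ltnW.
exact: D.
Qed.

Lemma path_near (O : set (mtuple R n)) : open O -> O X -> \forall t \near (0 : R), O (p t).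
Proof.
move=> oO OX; have [/smooth_onP sp _ _ _] := pP.
by apply: (Ck_continuous (sp 0%N) I); apply: open_nbhs_nbhs; split=> //; rewrite p0.
Qed.

Lemma path_near_open : \forall t \near (0 : R), RepDT_open alpha (p t).
Proof.
have [_ pR _ _] := pP; have := path_near open_near_dom near_dom_base.
by apply: filterS => t; apply: near_dom_open.
Qed.

Lemma gens_sign m : (1 <= m < n)%N -> exists2 e : R, e = 1 \/ e = -1 &
  gens X m = e *: rotm (hang (prodc (ngen X) m)) (Bpt X m.-1).
Proof.
case: m => // m hm; rewrite -(prodc_rotm n_gt2 XDT hm).
case: (Rep_gens XR (ltnW hm)) => ->; [exists 1|exists (-1)]; rewrite ?scale1r ?scaleN1r//; by [left|right].
Qed.

Lemma gen_sign i : (1 <= i <= n)%N -> exists2 e : R, e = 1 \/ e = -1 &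
  gen X i = e *: rotm (hang (ngen X i)) (Cpt X i).
Proof.
move=> hi; rewrite -(c_rotm XDT hi).
case: (Rep_gen XR hi) => ->; [exists 1|exists (-1)]; rewrite ?scale1r ?scaleN1r//; by [left|right].
Qed.

Lemma gens_velocity m x hd : (1 <= m < n)%N ->
  Uc u m = hd *: Jm (Bpt X m.-1) + (x - Ad (prodc (ngen X) m) x) ->
  isdc (fun t => fixC (gens (p t) m)) (killing x (Bpt X m.-1)) /\ isd (fun t => hang (gens (p t) m)) hd.
Proof.
move=> hm e; have hm' : (m <= n)%N by lia.
have [s s1 sE] := gens_sign hm; have D := path_gens hm'.
have BH : inH (Bpt X m.-1) by case: m hm {e hm' s s1 sE D} => // m hm; exact: (Bpt_inH n_gt2 XDT).
have sE0 : gens (p 0) m = s *: rotm (hang (prodc (ngen X) m)) (Bpt X m.-1) by rewrite p0.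
have F'E : Uc u m * gens X m = hd *: (Jm (Bpt X m.-1) * gens (p 0) m) + (x * gens (p 0) m - gens (p 0) m * x).
  rewrite p0 e mulrDl mxZl mulrBl -(Ad_gens XO _ hm').
  by rewrite {1}/Ad -[gens X m * x * _ * _]mulrA mulVmx2 ?mulr1 ?det_gens.
split; [exact: (isd_fixC (hang_bounds _) BH s1 sE0 D F'E)|exact: (isd_hang (hang_bounds _) BH s1 sE0 D F'E)].
Qed.

Lemma gen_velocity i y : (1 <= i <= n)%N -> gen u i = y - Ad (ngen X i) y ->
  isdc (fun t => fixC (gen (p t) i)) (killing y (Cpt X i)) /\ isd (fun t => hang (gen (p t) i)) 0.
Proof.
move=> hi e; have [s s1 sE] := gen_sign hi; have D := path_gen hi.
have CH : inH (Cpt X i) := Cpt_inH XDT hi.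
have sE0 : gen (p 0) i = s *: rotm (hang (ngen X i)) (Cpt X i) by rewrite p0.
have F'E : gen u i * gen X i = 0 *: (Jm (Cpt X i) * gen (p 0) i) + (y * gen (p 0) i - gen (p 0) i * y).
  rewrite p0 e scale0r add0r mulrBl -(Ad_gen XO _ hi).
  by rewrite {1}/Ad -[gen X i * y * _ * _]mulrA mulVmx2 ?mulr1// (Rep_det XR).
split; [exact: (isd_fixC (hang_bounds _) CH s1 sE0 D F'E)|exact: (isd_hang (hang_bounds _) CH s1 sE0 D F'E)].
Qed.

Lemma hang_gens_velocity m : (1 <= m < n)%N -> isd (fun t => hang (gens (p t) m)) (hdot X u m).
Proof.
move=> hm; have BH : inH (Bpt X m.-1) by case: m hm => // m hm; exact: (Bpt_inH n_gt2 XDT).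
have tU : \tr (Uc u m) = 0 by apply: (tr_cocycle n_gt2 XO uP); lia.
have [x tx xE] := elliptic_split (hang_bounds (prodc (ngen X) m)) BH tU.
have PE : prodc (ngen X) m = rotm (hang (prodc (ngen X) m)) (Bpt X m.-1).
  by case: m hm {BH tU x tx xE} => // m hm; exact: (prodc_rotm n_gt2 XDT).
rewrite -PE in xE.
by have [_] := gens_velocity hm xE.
Qed.

Lemma area_velocity i : (i <= n - 3)%N ->
  isd (fun t => area_lift (p t) i) (2 * (hdot X u i.+2 - hdot X u i.+1)).
Proof.
move=> hi; have hi2 : (1 <= i.+2 <= n)%N by lia.
have [y _ uy] := primitive_exists XO uP hi2.
have [_ d3] := gen_velocity hi2 uy.
have d1 := hang_gens_velocity (m := i.+2) ltac:(lia).
have d2 := hang_gens_velocity (m := i.+1) ltac:(lia).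
apply: isd_eq (isdM (isd_cst 2) (isdB (isdB d1 d2) d3)) _; ring.
Qed.

Section Frame.
Variables (E x : nat -> 'M[R]_2) (ta ta' : nat -> R).
Hypothesis EP : axes X E.
Hypothesis fr : chain_frame X E u x ta ta'.
Local Notation kd := (kdot X E x ta ta').

(** The direction from B_i to C_(i+1) is carried by the last field of one triangle, that to C_(i+2)
    by the first field of the next. By [isd_dirv] their angle changes at a rate given by the jump of
    the fields alone. *)
Lemma angle_vec_velocity i : (1 <= i <= n - 3)%N ->
  exists2 d, isdc (fun t => angle_vec (p t) i) d &
    complex.Im (d * conjc (angle_vec X i)) = 2 * kd i * normsq (angle_vec X i).
Proof.
move=> hi; have hB : (i.+1 < n)%N by lia.
have [E0 E2 Ep Eq] := EP (m := i) ltac:(lia).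
have [E0' E2' Ep' Eq'] := EP (m := i.+1) ltac:(lia).
have [tX UX] := frame_end n_gt2 XO EP fr (m := i) ltac:(lia).
have [tx Ux] := frame_start n_gt2 XO fr (m := i.+1) ltac:(lia).
have uc := frame_mid n_gt2 XO fr (m := i) ltac:(lia).
have uc' := frame_mid n_gt2 XO fr (m := i.+1) ltac:(lia).
have [B1 _] := gens_velocity (m := i.+1) ltac:(lia) UX.
have [B2 _] := gens_velocity (m := i.+1) ltac:(lia) Ux.
have [C1 _] := gen_velocity (i := i.+1) ltac:(lia) uc.
have [C2 _] := gen_velocity (i := i.+2) ltac:(lia) uc'.
have eB : fixC (gens (p 0) i.+1) = Bpt X i by rewrite p0 -(DT_fixB n_gt2 XDT).
have eC1 : fixC (gen (p 0) i.+1) = Cpt X i.+1 by rewrite p0 -(DT_fixC XDT)//; lia.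
have eC2 : fixC (gen (p 0) i.+2) = Cpt X i.+2 by rewrite p0 -(DT_fixC XDT)//; lia.
have BH : inH (Bpt X i) by exact: (Bpt_inH n_gt2 XDT).
have CH1 : inH (Cpt X i.+1) by apply: (Cpt_inH XDT); lia.
have CH2 : inH (Cpt X i.+2) by apply: (Cpt_inH XDT); lia.
rewrite -eB in B1 B2 BH; rewrite -eC1 in C1 CH1; rewrite -eC2 in C2 CH2.
have [_ q2 q3 q4] := axis_orth n_gt2 XO EP (m := i) ltac:(lia).
have [r1 r2 _ _] := axis_orth n_gt2 XO EP (m := i.+1) ltac:(lia).
have xe : x i + ta i *: E i - xend X E x ta ta' i = (- ta' i) *: (E i * ngen X i.+1).
  by rewrite /xend opprD addrA subrr add0r scaleNr.
have o1 : \tr ((x i + ta i *: E i - xend X E x ta ta' i) * Jm (fixC (gens (p 0) i.+1))) = 0.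
  by rewrite xe eB trZl q3 mulr0.
have o2 : \tr ((x i + ta i *: E i - xend X E x ta ta' i) * Jm (fixC (gen (p 0) i.+1))) = 0.
  by rewrite xe eC1 trZl q4 mulr0.
have o3 : \tr ((x i.+1 + ta i.+1 *: E i.+1 - x i.+1) * Jm (fixC (gens (p 0) i.+1))) = 0.
  by rewrite addrAC subrr add0r eB trZl r1 mulr0.
have o4 : \tr ((x i.+1 + ta i.+1 *: E i.+1 - x i.+1) * Jm (fixC (gen (p 0) i.+2))) = 0.
  by rewrite addrAC subrr add0r eC2 trZl r2 mulr0.
have t1 : \tr (x i + ta i *: E i - xend X E x ta ta' i) = 0.
  by rewrite raddfB /= tX mxtraceD mxtraceZ E0 (proj1 (frame_start n_gt2 XO fr (m := i) ltac:(lia))) mulr0 addr0 subrr.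
have t2 : \tr (x i.+1 + ta i.+1 *: E i.+1 - x i.+1) = 0.
  by rewrite addrC addKr mxtraceZ E0' mulr0.
have [d1 D1 e1] := isd_dirv BH CH1 B1 C1 t1 o1 o2.
have [d2 D2 e2] := isd_dirv BH CH2 B2 C2 t2 o3 o4.
exists (d1 * conjc (dirv (fixC (gens (p 0) i.+1)) (fixC (gen (p 0) i.+2))) + dirv (fixC (gens (p 0) i.+1)) (fixC (gen (p 0) i.+1)) * conjc d2).
  exact: (isdcM D1 (isdc_conj D2)).
have kE := kdotE n_gt2 XO EP fr hi.
have k10 : (x i.+1 1 0 - xend X E x ta ta' i 1 0) * complex.Im (Bpt X i) = kd i.
  have := congr1 (fun Z : 'M[R]_2 => Z 1 0) kE; rewrite /Jm !mxE2 => ->.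
  rewrite -eB divfK; first by [].
  by apply/negbT; apply: gt_eqF; exact: BH.
rewrite (_ : angle_vec X i = angle_vec (p 0) i); last by rewrite p0.
rewrite /angle_vec; move: e1 e2 k10; rewrite -eB.
move: (dirv _ _) => e1'; move: (dirv _ _) => e2' e1 e2 k10.
have -> : complex.Im ((d1 * conjc e2' + e1' * conjc d2) * conjc (e1' * conjc e2')) =
    complex.Im (d1 * conjc e1') * normsq e2' - complex.Im (d2 * conjc e2') * normsq e1'.
  by case: d1 {D1 e1} => d1a d1b; case: d2 {D2 e2} => d2a d2b; case: e1' => a b; case: e2' => a' b'; rewrite /normsq /=; ring.
rewrite e1 e2 -k10.
by case: e1' {e1} => a b; case: e2' {e2} => a' b'; rewrite /normsq /=; ring.
Qed.

Lemma angle_velocity i : (1 <= i <= n - 3)%N -> isd (fun t => angle_lift X (p t) i) (2 * kd i).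
Proof.
move=> hi; have [d D dE] := angle_vec_velocity hi.
have [_ e0] := angle_vec_polar n_gt2 XO hi.
have N0 : normsq (angle_vec X i) != 0 by rewrite normsq_eq0.
have [Dr Di] := isdcM D (isdc_cst (conjc (angle_vec X i))).
rewrite mulr0 addr0 in Dr Di.
have e1 : angle_vec (p 0) i * conjc (angle_vec X i) = (normsq (angle_vec X i))%:C by rewrite p0 mul_conj.
have n0 : complex.Re (angle_vec (p 0) i * conjc (angle_vec X i)) != 0 by rewrite e1.
apply: isd_eq (isdD (isd_cst (gamma X i)) (isd_atan (isd_div n0 Di Dr))) _.
by rewrite e1 dE /=; field.
Qed.

Lemma sigma_velocity i : (i <= n - 3)%N ->
  isd (fun t => sigma_lift X (p t) i) (\sum_(1 <= j < i.+1) 2 * kd j).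
Proof. by move=> hi; apply: isd_sum => j hj; apply: angle_velocity; lia. Qed.

End Frame.
End OnePath.
End Paths.

(** * Derivatives of functions known up to sign or modulo 2 pi *)

Section Uniqueness.
Context {R : realType}.
Implicit Types f g : R -> R.

(** Serves quantities known only up to the sign of a lift. When f(0) = 0 the constant is 0, so f
    vanishes identically. *)
Lemma isd_sqr_cst f d c : isd f d -> (forall t, f t ^+ 2 = c) -> d = 0.
Proof.
move=> fd fc.
have e : 2 * f 0 * d = 0.
  by apply: (isd_uniq (isdX2 fd)); rewrite (funext fc); exact: isd_cst.
have [f0|f0] := eqVneq (f 0) 0.
  have c0 : c = 0 by rewrite -(fc 0) f0 expr0n.
  have fe : f = fun=> 0 by apply/funext => t; apply/eqP; rewrite -sqrf_eq0 fc c0.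
  by apply: (isd_uniq fd); rewrite fe; exact: isd_cst.
by apply/eqP; move/eqP: e; rewrite !mulf_eq0 (negbTE f0) pnatr_eq0.
Qed.

Lemma isd_near f g d : (\forall t \near (0 : R), f t = g t) -> isd f d -> isd g d.
Proof. exact: near_eq_is_derive. Qed.

(** The difference is continuous at 0 with values in the multiples of 2 pi, hence constant near
    0. *)
Lemma isd_eqmod2pi f g a b : isd f a -> isd g b ->
  (\forall t \near (0 : R), eqmod2pi (f t) (g t)) -> a = b.
Proof.
move=> fa gb fg; have hab := isdB fa gb.
have ch : {for 0, continuous (fun t => f t - g t)}.
  by apply: differentiable_continuous; apply/derivable1_diffP; case: hab.
have [m0 e0] := nbhs_singleton fg.
have p2 : 0 < 2 * pi :> R by rewrite mulr_gt0// pi_gt0.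
have near_dist : \forall t \near (0 : R), `|(f 0 - g 0) - (f t - g t)| < 2 * pi.
  by have /cvgrPdist_lt/(_ _ p2) := ch.
have hn : \forall t \near (0 : R), f t - g t = f 0 - g 0.
  near=> t.
  have [m e] : eqmod2pi (f t) (g t) by near: t.
  have : `|(f 0 - g 0) - (f t - g t)| < 2 * pi by near: t.
  rewrite e e0 ![g _ + _]addrC !addrK -mulrBl normrM (gtr0_norm p2) gtr_pMl// -rmorphB /= -intr_norm.
  rewrite -[1]/(1%:~R) ltr_int => h.
  have -> : m = m0 by lia.
  by [].
apply/eqP; rewrite -subr_eq0; apply/eqP; apply: (isd_uniq hab).
apply: (@isd_near (fun=> f 0 - g 0)); last exact: isd_cst.
by apply: filterS hn => t.
Unshelve. all: by end_near.
Qed.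

End Uniqueness.

(** * Velocities of paths and differentials of the coordinates *)

Section Velocity.
Context {R : realType} {n : nat}.
Variables (alpha : 'I_n -> R) (X : mtuple R n).
Hypothesis n_gt2 : (2 < n)%N.
Hypothesis XO : RepDT_open alpha X.
Let XDT : RepDT alpha X. Proof. by case: XO. Qed.
Let XR := DT_Rep XDT.

Definition velocity (p : R -> mtuple R n) : mtuple R n :=
  mk_mtuple (fun i : 'I_n => gen ('D_(1 : R) p 0) i.+1 * (gen X i.+1)^-1).

Lemma gen_mktuple (f : nat -> 'M[R]_2) i : (1 <= i <= n)%N ->
  gen (mk_mtuple (fun i : 'I_n => f i.+1)) i = f i.
Proof. by case: i => // i hi; exact: (gen_mk _ (Ordinal hi)). Qed.

Lemma velocity_path p : smooth_on setT p -> (forall t, Rep alpha (p t)) -> p 0 = X ->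
  path_through alpha X (velocity p) p.
Proof.
move=> sp pR p0; split=> // i hi.
rewrite /velocity (gen_mktuple (fun i => gen ('D_(1 : R) p 0) i * (gen X i)^-1) hi).
by rewrite -mulrA mulVmx2 ?mulr1// (Rep_det XR).
Qed.

Lemma Rep_tr_sqr (Y : mtuple R n) (i : 'I_n) : Rep alpha Y ->
  (\tr (gen Y i.+1)) ^+ 2 = (2 * cos (pi - alpha i / 2)) ^+ 2.
Proof.
move=> YR; have hi : (1 <= i.+1 <= n)%N by rewrite ltn_ord.
rewrite -(Rep_hang YR).
have e : \tr (ngen Y i.+1) = 2 * cos (hang (ngen Y i.+1)).
  by rewrite {1}(posell_rotm (Rep_posell YR hi)) /rotm mxtraceD !mxtraceZ trJm mulr0 addr0 mxtrace1 mulrC.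
by case: (Rep_gen YR hi) => ->; rewrite ?tr_sqrN e.
Qed.

(** The defining equations are differentiated: det = 1 gives trace 0, the closed product being 1 or
    -1 gives the cocycle condition, and constant squared traces make the restriction to each <c_i>
    orthogonal to Jm, hence a coboundary. *)
Lemma velocity_parabolic p u : path_through alpha X u p -> parabolic_cocycle X u.
Proof.
move=> pP; have [_ pR p0 _] := pP.
have tu i : (1 <= i <= n)%N -> \tr (gen u i) = 0.
  move=> hi; have D := path_gen pP hi.
  have d1 : gen X i 0 0 * gen X i 1 1 = 1 + gen X i 0 1 * gen X i 1 0.
    by rewrite -(Rep_det XR hi) detmx2E subrK.
  have Dd := isdB (isdM (D 0 0) (D 1 1)) (isdM (D 0 1) (D 1 0)).
  have : isd (fun=> 1 : R) (\tr (gen u i)).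
    apply: isd_eq (isd_ext _ Dd) _.
      by apply/funext => t; rewrite -(Rep_det (pR t) hi) detmx2E.
    by rewrite p0 !trmx2E !mxE2; ring: d1.
  by move=> h; apply: (isd_uniq h); exact: isd_cst.
split=> //.
  have D := path_gens n_gt2 XO pP (leqnn n).
  have g1 t : gens (p t) n = 1 \/ gens (p t) n = -1 by case: (pR t).
  have E0 : cocycle_gens X u n * gens X n = 0.
    have z i j : (cocycle_gens X u n * gens X n) i j = 0.
      apply: (isd_sqr_cst (D i j) (c := (i == j)%:R)) => t.
      by case: (g1 t) => ->; rewrite !mxE ?sqrrN; case: (i == j); rewrite ?expr1n ?expr0n.
    by apply/matrixP => i j; rewrite z mxE.
  have dn := det_gens n_gt2 XO (leqnn n).
  by have := congr1 (fun Z : 'M[R]_2 => Z * (gens X n)^-1) E0; rewrite -mulrA mulmxV2// mulr1 mul0r.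
move=> i hi; have D := isd_tr (path_gen pP hi).
have t0 : \tr (gen u i * gen X i) = 0.
  case: i hi D => // i hi D.
  apply: (isd_sqr_cst D (c := (2 * cos (pi - alpha (Ordinal hi) / 2)) ^+ 2)) => t.
  exact: (Rep_tr_sqr (Ordinal hi) (pR t)).
have CH : inH (Cpt X i) := Cpt_inH XDT hi.
have tc : \tr (gen u i * rotm (hang (ngen X i)) (Cpt X i)) = 0.
  rewrite -(c_rotm XDT hi); case: (Rep_gen XR hi) t0 => ->//.
  by rewrite mulrN raddfN /=; lra.
have tJ : \tr (gen u i * Jm (Cpt X i)) = 0.
  move: tc; rewrite /rotm mulrDr mxtraceD !mxZr !mxtraceZ mulr1 tu// mulr0 add0r.
  by move/eqP; rewrite mulf_eq0 gt_eqF ?sin_gt0_pi ?hang_bounds//= => /eqP.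
have [x tx xE] := elliptic_split (hang_bounds (ngen X i)) CH (tu i hi).
exists (- x); split; first by rewrite raddfN /= tx oppr0.
rewrite (Ad_gen XO _ hi) {1}xE tJ oppr0 mul0r scale0r add0r -(c_rotm XDT hi).
by rewrite /Ad mulrN mulNr opprK addrC.
Qed.

(** [differential] picks some path and some lift. The given path shows that there is a choice, and
    [isd_eqmod2pi] that every choice yields the same value. *)
Lemma d_areaE u p i : parabolic_cocycle X u -> path_through alpha X u p -> (i <= n - 3)%N ->
  d_area alpha X i u = 2 * (hdot X u i.+2 - hdot X u i.+1).
Proof.
move=> uP pP hi; rewrite /d_area /differential.
have lift_near q : path_through alpha X u q ->
    \forall t \near (0 : R), eqmod2pi (area_lift (q t) i) (area_param (q t) i).
  move=> qP; apply: filterS (path_near_open n_gt2 XO qP) => t [qO _].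
  by exists 0; rewrite mul0r addr0 (DT_area_lift n_gt2 qO hi).
case: xgetP => [d _ [q [s [qP sq sd]]]|/(_ (2 * (hdot X u i.+2 - hdot X u i.+1))) []].
  apply: (isd_eqmod2pi sd (area_velocity n_gt2 XO uP qP hi)).
  near=> t; have -> : s t = area_param (q t) i by near: t.
  have [m e] : eqmod2pi (area_lift (q t) i) (area_param (q t) i) by near: t; exact: lift_near.
  by exists (- m); rewrite e mulrNz mulNr addrK.
exists p, (fun t => area_lift (p t) i); split; [exact: pP| |exact: (area_velocity n_gt2 XO uP pP hi)].
apply: filterS (path_near_open n_gt2 XO pP) => t [qO _].
by rewrite (DT_area_lift n_gt2 qO hi).
Unshelve. all: by end_near.
Qed.

Lemma d_sigmaE E u x ta ta' p i : axes X E -> chain_frame X E u x ta ta' ->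
  path_through alpha X u p -> (i <= n - 3)%N ->
  d_sigma alpha X i u = \sum_(1 <= j < i.+1) 2 * kdot X E x ta ta' j.
Proof.
move=> EP fr pP hi; rewrite /d_sigma /differential.
have lift_near q : path_through alpha X u q ->
    \forall t \near (0 : R), eqmod2pi (sigma_lift X (q t) i) (sigma (q t) i).
  move=> qP; have h1 := path_near_open n_gt2 XO qP.
  have h2 := path_near qP (@open_angle_dom _ _ n_gt2 X) (angle_dom_base n_gt2 XO).
  near=> t; apply: (sigma_liftE n_gt2 XO _ _ hi); near: t; [exact: h2|exact: h1].
case: xgetP => [d _ [q [s [qP sq sd]]]|/(_ (\sum_(1 <= j < i.+1) 2 * kdot X E x ta ta' j)) []].
  apply: (isd_eqmod2pi sd (sigma_velocity n_gt2 XO qP EP fr hi)).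
  near=> t; have [m1 ->] : eqmod2pi (s t) (sigma (q t) i) by near: t.
  have [m ->] : eqmod2pi (sigma_lift X (q t) i) (sigma (q t) i) by near: t; exact: lift_near.
  by exists (m1 - m); rewrite -addrA -mulrDl -rmorphD /= subrKC.
exists p, (fun t => sigma_lift X (p t) i); split; [exact: pP|exact: (lift_near p pP)|].
exact: (sigma_velocity n_gt2 XO pP EP fr hi).
Unshelve. all: by end_near.
Qed.

End Velocity.

(** * Moving paths by conjugations and signs *)

Section Twist.
Context {R : realType} {n : nat}.
Implicit Types (q : R -> mtuple R n) (G : R -> 'M[R]_2) (s : nat -> R).

(** The signs are needed because conjugacy in PSL(2,R) matches the chosen lifts only up to sign,
    while a path must start exactly at the given tuple. *)
Definition twist s G q (t : R) : mtuple R n :=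
  mk_mtuple (fun i : 'I_n => s i.+1 *: (G t * gen (q t) i.+1 * (G t)^-1)).

Lemma gen_twist s G q t i : (1 <= i <= n)%N ->
  gen (twist s G q t) i = s i *: (G t * gen (q t) i * (G t)^-1).
Proof. exact: (gen_mktuple (fun i => s i *: (G t * gen (q t) i * (G t)^-1))). Qed.

Lemma mtuple_eq (X Y : mtuple R n) : (forall i, (1 <= i <= n)%N -> gen X i = gen Y i) -> X = Y.
Proof.
move=> gE; apply/row_matrixP => -[m hm]; apply: (can_inj (@vec_mxK R 2 2)).
by have := gE m.+1 hm; rewrite /gen !(insubT (fun k => k < n)%N hm).
Qed.

Lemma smooth_entries q i j : smooth_on setT q -> Cinf setT (fun t => q t i j).
Proof.
move=> /smooth_onP sq k.
exact: (coords_Ck (B := coordsMx n (2 * 2)) (i, j) openT (sq k)).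
Qed.

Lemma smooth_of_entries q : (forall i j, Cinf setT (fun t => q t i j)) -> smooth_on setT q.
Proof.
move=> sq; apply/smooth_onP => k.
apply: (Ck_coords (B := coordsMx n (2 * 2)) openT) => -[i j]; exact: sq.
Qed.

Lemma Qm_gen_path q i : smooth_on setT q -> Qm (Cinf setT) (fun t => gen (q t) i).
Proof.
move=> sq k l; have QC := @fclass_Cinf R R setT openT.
case: i => [|i]; first exact: (fc_cst QC).
rewrite /gen; case: insubP => [j _ _|_] /=; last exact: (fc_cst QC).
have e (X : mtuple R n) : (vec_mx (row j X) : 'M[R]_2) k l = X j (mxvec_index k l) by rewrite !mxE.
by rewrite (funext (fun t => e (q t))); exact: smooth_entries.
Qed.

Lemma twist_smooth s G q : smooth_on setT q -> Qm (Cinf setT) G -> (forall t, \det (G t) = 1) ->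
  smooth_on setT (twist s G q).
Proof.
move=> sq sG dG; apply: smooth_of_entries => i j.
have QC := @fclass_Cinf R R setT openT.
case/mxvec_indexP: j => k l.
have e t : twist s G q t i (mxvec_index k l) = s i.+1 * (G t * gen (q t) i.+1 * mx2 (G t 1 1) (- G t 0 1) (- G t 1 0) (G t 0 0)) k l.
  by rewrite /twist /mk_mtuple mxE mxvecE [LHS]mxE invmx2.
rewrite (funext e); apply: (fcM QC); first exact: (fc_cst QC).
apply: (QmM QC); first by apply: (QmM QC) => //; exact: Qm_gen_path.
by apply: Qm_mx2 => //; apply: (fcN QC).
Qed.

Lemma twist_RepDT alpha s G q t : (2 < n)%N -> (forall i, s i = 1 \/ s i = -1) -> \det (G t) = 1 ->
  RepDT alpha (q t) -> RepDT alpha (twist s G q t).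
Proof.
move=> n_gt2 s1 dG qDT; apply: (conj_RepDT n_gt2 qDT dG) => i hi; rewrite gen_twist//.
by case: (s1 i) => ->; rewrite ?scale1r ?scaleN1r; [left|right].
Qed.

End Twist.

Section Shears.
Context {R : realType}.
Implicit Types (e : 'M[R]_2).

(* sl(2) is spanned by three nilpotent matrices, whose one-parameter groups are affine. *)
Definition unipotent e (t : R) : 'M[R]_2 :=
  mx2 (1 + t * e 0 0) (- (t * e 0 0)) (t * e 0 0) (1 - t * e 0 0) *
  mx2 1 (t * (e 0 1 + e 0 0)) 0 1 * mx2 1 0 (t * (e 1 0 - e 0 0)) 1.

Lemma det_unipotent e t : \det (unipotent e t) = 1.
Proof. by rewrite /unipotent !detM2 !detmx2E !mxE2; ring. Qed.

Lemma unipotent0 e : unipotent e 0 = 1.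
Proof. by rewrite /unipotent; apply: mx2_eq; rewrite !mxE2; ring. Qed.

Lemma Qm_unipotent e : Qm (Cinf setT) (unipotent e).
Proof.
have QC := @fclass_Cinf R R setT openT.
have L (a : R) : Cinf setT (fun t : R => t * a).
  by apply: (fcM QC); [move=> k; apply: Ck_id1; exact: openT|exact: (fc_cst QC)].
have C (a : R) : Cinf setT (fun _ : R => a) by exact: (fc_cst QC).
apply: (QmM QC); first apply: (QmM QC).
- by apply: Qm_mx2 => //; [exact: (fcD QC)|exact: (fcN QC)|exact: (fcB QC)].
- by apply: Qm_mx2.
- by apply: Qm_mx2.
Qed.

Lemma isdm_unipotent e : \tr e = 0 -> isdm (unipotent e) e.
Proof.
rewrite trmx2E => te.
have L (a : R) : isd (fun t => t * a) a.
  by apply: isd_eq (isdM (is_derive_id _ _) (isd_cst a)) _; ring.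
have M (f1 f2 f3 f4 : R -> R) (d1 d2 d3 d4 : R) : isd f1 d1 -> isd f2 d2 -> isd f3 d3 -> isd f4 d4 ->
    isdm (fun t => mx2 (f1 t) (f2 t) (f3 t) (f4 t)) (mx2 d1 d2 d3 d4).
  move=> h1 h2 h3 h4 i j; rewrite [mx2 d1 _ _ _ _ _]mxE; under eq_fun do rewrite mxE.
  by case: ifP => _; case: ifP => _.
have M1 : isdm (fun t => mx2 (1 + t * e 0 0) (- (t * e 0 0)) (t * e 0 0) (1 - t * e 0 0)) (mx2 (0 + e 0 0) (- e 0 0) (e 0 0) (0 - e 0 0)).
  by apply: M; [apply: isdD (isd_cst _) (L _)|apply: isdN|exact: L|apply: isdB (isd_cst _) (L _)].
have M2 : isdm (fun t => mx2 1 (t * (e 0 1 + e 0 0)) 0 1) (mx2 0 (e 0 1 + e 0 0) 0 0).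
  by apply: M => //; exact: isd_cst.
have M3 : isdm (fun t => mx2 1 0 (t * (e 1 0 - e 0 0)) 1) (mx2 0 0 (e 1 0 - e 0 0) 0).
  by apply: M => //; exact: isd_cst.
have D := isdmM (isdmM M1 M2) M3.
move=> i j; apply: isd_eq (D i j) _.
have eE (A : 'M[R]_2) : A = e -> A i j = e i j by move=> ->.
by apply: eE; apply: mx2_eq; rewrite !mxE2; lra.
Qed.

Lemma isdm_unipotent_inv e : \tr e = 0 -> isdm (fun t => (unipotent e t)^-1) (- e).
Proof.
move=> te i j; have D := isdm_unipotent te.
have E t : (unipotent e t)^-1 = mx2 (unipotent e t 1 1) (- unipotent e t 0 1) (- unipotent e t 1 0) (unipotent e t 0 0).
  by rewrite invmx2 ?det_unipotent.
rewrite (funext (fun t => congr1 (fun Z : 'M[R]_2 => Z i j) (E t))).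
have te' := te; rewrite trmx2E in te'.
have F : - e = mx2 (e 1 1) (- e 0 1) (- e 1 0) (e 0 0) by apply: mx2_eq; rewrite !mxE2; lra.
rewrite F [X in isd _ X]mxE; under eq_fun do rewrite mxE.
by case: ifP => _; case: ifP => _; [exact: D|exact: isdN|exact: isdN|exact: D].
Qed.

End Shears.

(** * A path for every cocycle, and the canonical form *)

Section PathExists.
Context {R : realType} {n : nat}.
Variables (alpha : 'I_n -> R) (X : mtuple R n).
Hypothesis n_gt2 : (2 < n)%N.
Hypothesis alphaP : forall i, 0 < alpha i < 2 * pi.
Hypothesis XO : RepDT_open alpha X.
Let XDT : RepDT alpha X. Proof. by case: XO. Qed.
Let XR := DT_Rep XDT.
Let W : normedModType R := ('rV[R]_(n - 3) * 'rV[R]_(n - 3))%type.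

Lemma polytope_line (D : W) : exists2 e : R, 0 < e &
  forall s : R, `|s| <= e -> polytope alpha (coords X + s *: D).
Proof.
have cl : (fun s : R => (coords X : W) + s *: D) @ (0 : R) --> (coords X : W) + 0 *: D.
  by apply: cvgD; [exact: cvg_cst|apply: cvgZr_tmp; exact: cvg_id].
have : \forall s \near (0 : R), polytope alpha ((coords X : W) + s *: D).
  apply: cl; apply: open_nbhs_nbhs; split; first exact: open_polytope.
  by rewrite scale0r addr0; exact: (coords_polytope n_gt2 XO).
move=> /nbhs_ballP[e /= e0 he]; exists (e / 2); first by rewrite divr_gt0.
move=> s hs; apply: he; rewrite /ball /= sub0r normrN; have := ltr_pdivrMr e e (ltr0n _ 2); lra.
Qed.

(* The sine keeps the path inside the polytope for all times. *)
Definition coord_path (e : R) (D : W) (t : R) : W := (coords X : W) + (e * sin (t / e)) *: D.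

Lemma isd_coord_path (e a d : R) : 0 < e -> isd (fun t => a + e * sin (t / e) * d) d.
Proof.
move=> e0; have en : e != 0 by rewrite gt_eqF.
have h1 : isd (fun t => t / e) e^-1.
  by apply: isd_eq (isdM (is_derive_id _ _) (isd_cst e^-1)) _; rewrite mulr0 addr0 mul1r.
have h2 := isd_comp (is_derive_sin (0 / e)) h1.
apply: isd_eq (isdD (isd_cst a) (isdM (isdM (isd_cst e) h2) (isd_cst d))) _.
by rewrite !mul0r cos0; field.
Qed.

Lemma Ck_coord_path (e : R) D k : Ck k setT (coord_path e D).
Proof.
have QC := @fclass_Cinf R R setT openT.
apply: (Ck_coords (B := coordsPair (n - 3) (n - 3)) openT) => i.
have E t : cfun (c := coordsPair (n - 3) (n - 3)) i (coord_path e D t) =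
    cfun (c := coordsPair (n - 3) (n - 3)) i (coords X) + e * sin (t / e) * cfun (c := coordsPair (n - 3) (n - 3)) i D.
  by rewrite /coord_path linearD linearZ.
rewrite (funext E).
have Qt : Cinf setT (fun t : R => t / e).
  by apply: (fcM QC); [move=> m; apply: Ck_id1; exact: openT|exact: (fc_cst QC)].
apply: (fcD QC (f := fun=> _)); first exact: (fc_cst QC).
apply: (fcM QC (g := fun=> _)); last exact: (fc_cst QC).
by apply: (fcM QC (f := fun=> _)); [exact: (fc_cst QC)|exact: (fc_sin QC)].
Qed.

(** The section is evaluated along a path in the polytope and then moved by the fixed conjugation
    and signs that carry its value at time 0 to [X]. Conjugation does not affect the coordinates. *)
Lemma coords_path (D : W) : exists p : R -> mtuple R n,
  [/\ smooth_on setT p, forall t, RepDT alpha (p t), p 0 = X &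
    forall j : 'I_(n - 3),
      (exists2 a, isd a (D.1 ord0 j) & forall t, a t = area_param (p t) j.+1) /\
      (exists2 b, isd b (D.2 ord0 j) & forall t, eqmod2pi (b t) (sigma (p t) j.+1))].
Proof.
have [e e0 he] := polytope_line D.
have hy t : polytope alpha (coord_path e D t).
  apply: he; rewrite normrM gtr0_norm// -[leRHS]mulr1 ler_pM2l//.
  by rewrite ler_norml sin_geN1 sin_le1.
have [g0 dg0 g0E] := conj_rel_sym (normal_form n_gt2 alphaP XO).
pose q t := rep_of alpha (coord_path e D t).
have qO t : RepDT_open alpha (q t) := rep_of_open n_gt2 alphaP (hy t).
have q0 : q 0 = rep_of alpha (coords X).
  by rewrite /q /coord_path mul0r sin0 mulr0 scale0r addr0.
have sq : smooth_on setT q.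
  apply: smooth_of_entries => i j k.
  apply: (Ck_compose (coordsPair (n - 3) (n - 3)) (g := fun y => rep_of alpha y i j) (F := coord_path e D) openT (@open_polytope R n alpha)).
  - by move=> t _; exact: hy.
  - exact: Ck_coord_path.
  - exact: rep_of_smooth.
(* The signs are read off at time 0 and kept constant, so the twisted path stays smooth. *)
pose s i : R := if gen X i == g0 * gen (q 0) i * g0^-1 then 1 else -1.
have s1 i : s i = 1 \/ s i = -1 by rewrite /s; case: ifP; [left|right].
pose p := twist s (fun=> g0) q.
have pDT t : RepDT alpha (p t).
  exact: (twist_RepDT n_gt2 s1 dg0 (proj1 (qO t))).
have pc t : conj_rel (q t) (p t).
  exists g0; first exact: dg0.
  move=> i hi; rewrite (gen_twist s (fun=> g0) q t hi).
  by case: (s1 i) => ->; rewrite ?scale1r ?scaleN1r; [left|right].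
have pcoords t : coords (p t) = coords (q t) by case: (conj_rel_open n_gt2 (qO t) (pc t)).
have QC := @fclass_Cinf R R setT openT.
exists p; split; [|exact: pDT| |].
- exact: (@twist_smooth R n s (fun=> g0) q sq (fun i j => fc_cst QC (g0 i j)) (fun=> dg0)).
- apply: mtuple_eq => i hi; rewrite (gen_twist s (fun=> g0) q 0 hi) /s q0.
  case: eqP => [e1|ne]; first by rewrite scale1r e1.
  have [e1|e1] := g0E i hi; first by case: ne.
  by rewrite scaleN1r e1.
move=> j; have cE t : torus_rel (coords (p t)) (coord_path e D t).
  by rewrite pcoords; exact: (coords_rep_of n_gt2 alphaP (hy t)).
split.
  exists (fun t => (coords X).1 ord0 j + e * sin (t / e) * D.1 ord0 j); first exact: isd_coord_path.
  by move=> t; have [h _] := cE t; rewrite -coords1 h /coord_path /= !mxE.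
exists (fun t => (coords X).2 ord0 j + e * sin (t / e) * D.2 ord0 j); first exact: isd_coord_path.
move=> t; have [_ /(_ j) [m h]] := cE t; exists (- m).
by rewrite -coords2 h /coord_path /= !mxE mulrNz mulNr addrK.
Qed.

Section Comparison.
Variables (E : nat -> 'M[R]_2) (u v : mtuple R n).
Hypothesis EP : axes X E.
Variables (x y : nat -> 'M[R]_2) (ta ta' sa sa' : nat -> R).
Hypothesis fu : chain_frame X E u x ta ta'.
Hypothesis fv : chain_frame X E v y sa sa'.

Lemma gen_sub i : (1 <= i <= n)%N -> gen (u - v) i = gen u i - gen v i.
Proof. by case: i => // i hi; rewrite /gen !insubT /= !linearB. Qed.

Lemma AdNr (g a : 'M[R]_2) : Ad g (- a) = - Ad g a.
Proof. by rewrite /Ad mulrN mulNr. Qed.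

Lemma cocycle_sub m : (m <= n)%N -> cocycle_gens X (u - v) m = cocycle_gens X u m - cocycle_gens X v m.
Proof.
move=> hm; rewrite /cocycle_gens -sumrB; apply: eq_big_nat => i hi.
by rewrite gen_sub ?AdB//; lia.
Qed.

Lemma parabolic_sub : parabolic_cocycle X u -> parabolic_cocycle X v -> parabolic_cocycle X (u - v).
Proof.
move=> [u1 u2 u3] [v1 v2 v3]; split.
- by move=> i hi; rewrite gen_sub// raddfB /= u1// v1// subrr.
- by rewrite cocycle_sub// u2 v2 subrr.
- move=> i hi; have [a [ta0 aE]] := u3 i hi; have [b [tb0 bE]] := v3 i hi.
  exists (a - b); split; first by rewrite raddfB /= ta0 tb0 subrr.
  by rewrite gen_sub// aE bE AdB; apply/matrixP => k l; rewrite !mxE; ring.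
Qed.

Lemma hdot_sub m : (m <= n)%N -> hdot X (u - v) m = hdot X u m - hdot X v m.
Proof. by move=> hm; rewrite /hdot cocycle_sub// mulrBl raddfB /=; ring. Qed.

Lemma frame_sub : chain_frame X E (u - v) (fun m => x m - y m) (fun m => ta m - sa m) (fun m => ta' m - sa' m).
Proof.
move=> m hm; have [t1 e1 f1 h1] := fu hm; have [t2 e2 f2 h2] := fv hm.
have tl (a b N : 'M[R]_2) : \tr ((a - b) * N) = \tr (a * N) - \tr (b * N) by rewrite mulrBl raddfB.
split.
- by rewrite raddfB /= t1 t2 subrr.
- rewrite cocycle_sub; last by lia.
  rewrite tl {1}e1 {1}e2 AdB; apply/matrixP => i j; rewrite !mxE; ring.
- rewrite gen_sub; last by lia.
  rewrite {1}f1 {1}f2 !AdD AdNr !AdZ; apply/matrixP => i j; rewrite !mxE; ring.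
- rewrite cocycle_sub; last by lia.
  rewrite gen_sub; last by lia.
  set U := cocycle_gens X u m in e1 h1 *; set V := cocycle_gens X v m in e2 h2 *.
  set A := rotm (hang (prodc (ngen X) m)) _ in e1 h1 e2 h2 *.
  have -> : U - V + Ad A (gen u m.+1 - gen v m.+1) = (U + Ad A (gen u m.+1)) - (V + Ad A (gen v m.+1)).
    by rewrite AdB; apply/matrixP => i j; rewrite !mxE; ring.
  move: (rotm (hang (prodc (ngen X) m.+1)) (Bpt X m)) (E m * rotm (hang (ngen X m.+1)) (Cpt X m.+1)) h1 h2 => D F h1 h2.
  rewrite tl {1}h1 {1}h2 !AdD AdNr !AdZ.
  move: (Ad _ (x m)) (Ad _ (y m)) (Ad _ (E m)) (Ad _ F) => x1 x2 x3 x4; apply/matrixP => i j; rewrite !mxE; ring.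
Qed.

Lemma kdot_sub i : kdot X E (fun m => x m - y m) (fun m => ta m - sa m) (fun m => ta' m - sa' m) i =
  kdot X E x ta ta' i - kdot X E y sa sa' i.
Proof.
rewrite /kdot /xend.
set z := _ - _ - _; set zx := x i.+1 - _; set zy := y i.+1 - _.
have -> : z = zx - zy by rewrite /z /zx /zy; apply/matrixP => k l; rewrite !mxE; ring.
by rewrite mulrBl raddfB /=; ring.
Qed.

End Comparison.

(** A path from the section with the coordinate derivatives predicted by [u] has a velocity v with
    the same angle rates and jumps. By [frame_rigid], u - v is the coboundary of some eta, and
    conjugating the path by a curve with velocity eta corrects the difference. *)
Lemma path_exists u : parabolic_cocycle X u -> exists p, path_through alpha X u p.
Proof.
move=> uP; have [E EP] := axes_exist n_gt2 XO.
have [x [ta [ta' fu]]] := chain_frame_exists n_gt2 XO EP uP.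
pose da := \row_(j < n - 3) (2 * (hdot X u j.+3 - hdot X u j.+2)).
pose ds := \row_(j < n - 3) (\sum_(1 <= k < j.+2) 2 * kdot X E x ta ta' k).
have [q [sq qDT q0 qc]] := coords_path (da, ds).
pose v := velocity X q.
have qP : path_through alpha X v q by apply: velocity_path => // t; case: (qDT t).
have vP := velocity_parabolic n_gt2 XO qP.
have [y [sa [sa' fv]]] := chain_frame_exists n_gt2 XO EP vP.
have ea j : (1 <= j <= n - 3)%N -> hdot X v j.+2 - hdot X v j.+1 = hdot X u j.+2 - hdot X u j.+1.
  case: j => // j hj; have hj' : (j < n - 3)%N by lia.
  have [[a Da aE] _] := qc (Ordinal hj'); rewrite mxE in Da.
  have hj2 : (j.+1 <= n - 3)%N by lia.
  have Dv := area_velocity n_gt2 XO vP qP hj2.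
  have e : a = (fun t => area_lift (q t) j.+1).
    by apply/funext => t; rewrite aE (DT_area_lift n_gt2 (qDT t) hj2).
  by rewrite e in Da; have := isd_uniq Dv Da; rewrite /=; lra.
have es m : (m <= n - 3)%N -> \sum_(1 <= k < m.+1) 2 * kdot X E y sa sa' k = \sum_(1 <= k < m.+1) 2 * kdot X E x ta ta' k.
  case: m => [|m] hm; first by rewrite !big_geq.
  have hm' : (m < n - 3)%N by lia.
  have [_ [b Db bE]] := qc (Ordinal hm'); rewrite mxE in Db.
  have Dv := sigma_velocity n_gt2 XO qP EP fv hm.
  apply: (isd_eqmod2pi Dv Db).
  have h1 := path_near_open n_gt2 XO qP.
  have h2 := path_near qP (@open_angle_dom _ _ n_gt2 X) (angle_dom_base n_gt2 XO).
  near=> t; have [m1 ->] : eqmod2pi (sigma_lift X (q t) m.+1) (sigma (q t) m.+1).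
    by apply: (sigma_liftE n_gt2 XO _ _ hm); near: t; [exact: h2|exact: h1].
  have [m2 ->] := bE t.
  by exists (m1 - m2); rewrite -addrA -mulrDl -rmorphD /= subrKC.
have ek i : (1 <= i <= n - 3)%N -> kdot X E x ta ta' i = kdot X E y sa sa' i.
  move=> hi; have := es i ltac:(lia); have := es i.-1 ltac:(lia).
  case: i hi => // i hi /= e1; rewrite !(big_nat_recr i.+1) //= e1; lra.
(* The areas give only differences of consecutive rates. The rates at both ends of the chain are 0,
   and a descending induction from n - 1 determines the others. *)
have eh m : (1 <= m <= n - 1)%N -> hdot X u m = hdot X v m.
  case: (ltngtP m 1) => // [m1|->] hm; last by rewrite (hdot1 n_gt2 XO uP) (hdot1 n_gt2 XO vP).
  have h k : (k <= n - 3)%N -> hdot X u (n.-1 - k) = hdot X v (n.-1 - k).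
    elim: k => [|k IH] hk.
      by rewrite subn0 (hdot_last n_gt2 XO uP) (hdot_last n_gt2 XO vP).
    have := ea (n - 3 - k)%N ltac:(lia); have := IH ltac:(lia).
    have -> : (n - 3 - k).+2 = (n.-1 - k)%N by lia.
    have -> : (n - 3 - k).+1 = (n.-1 - k.+1)%N by lia.
    lra.
  by have := h (n.-1 - m)%N ltac:(lia); rewrite subKn//; lia.
have wP := parabolic_sub uP vP.
have [eta te etaE] : exists2 eta, \tr eta = 0 &
    forall i, (1 <= i <= n)%N -> gen (u - v) i = eta - Ad (ngen X i) eta.
  apply: (frame_rigid n_gt2 XO EP wP (frame_sub fu fv)) => [m hm|i hi].
    by rewrite hdot_sub ?eh ?subrr//; lia.
  by rewrite kdot_sub ek// subrr.
pose p := twist (fun=> 1) (unipotent eta) q.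
have gE t i : (1 <= i <= n)%N -> gen (p t) i = unipotent eta t * gen (q t) i * (unipotent eta t)^-1.
  by move=> hi; rewrite (gen_twist (fun=> 1) (unipotent eta) q t hi) scale1r.
have sp : smooth_on setT p.
  by apply: twist_smooth => //; [exact: Qm_unipotent|exact: det_unipotent].
have pR t : Rep alpha (p t).
  suff [] : RepDT alpha (p t) by [].
  exact: (twist_RepDT n_gt2 (fun=> or_introl erefl) (det_unipotent eta t) (qDT t)).
have p0 : p 0 = X.
  by apply: mtuple_eq => i hi; rewrite gE// unipotent0 mul1r invr1 mulr1 q0.
have pP := velocity_path XO sp pR p0.
exists p; split=> // i hi; have [_ _ _ ->//] := pP.
have D1 := path_gen pP hi.
have D2 := isdmM (isdmM (isdm_unipotent te) (path_gen qP hi)) (isdm_unipotent_inv te).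
rewrite unipotent0 invr1 q0 mulr1 !mul1r in D2.
apply/matrixP => k l; have := D1 k l; rewrite (funext (fun t => congr1 (fun Z : 'M[R]_2 => Z k l) (gE t i hi))) => D3.
rewrite (isd_uniq D3 (D2 k l)).
have := etaE i hi; rewrite gen_sub// => /eqP; rewrite subr_eq => /eqP ->.
rewrite -(Ad_gen XO _ hi) mulrDl mulrBl /Ad -[gen X i * eta * _ * _]mulrA mulVmx2 ?(Rep_det XR)// mulr1.
by rewrite mulrN addrAC.
Unshelve. all: by end_near.
Qed.

Lemma sum_by_parts (h k : nat -> R) N :
  \sum_(1 <= i < N.+1) (h i.+2 - h i.+1) * (\sum_(1 <= j < i.+1) k j) =
  h N.+2 * (\sum_(1 <= j < N.+1) k j) - \sum_(1 <= i < N.+1) h i.+1 * k i.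
Proof.
elim: N => [|N IH]; first by rewrite !big_geq// mulr0 subr0.
by rewrite big_nat_recr//= IH [\sum_(1 <= i < N.+2) h i.+1 * k i]big_nat_recr//= [\sum_(1 <= j < N.+2) k j]big_nat_recr//=; ring.
Qed.

(** Each of da_i and dsigma_i carries a factor 2, so half their product matches the factor 2 in
    [goldmanE]. Summation by parts moves the difference from the angle rates onto the partial sums
    of the jumps; its boundary term contains the rate of P_(n-1), which is 0. *)
Theorem goldman_canonical u v : parabolic_cocycle X u -> parabolic_cocycle X v ->
  goldman X u v = 2^-1 * \sum_(1 <= i < n - 2)
    (d_area alpha X i u * d_sigma alpha X i v - d_area alpha X i v * d_sigma alpha X i u).
Proof.
move=> uP vP; have [p pP] := path_exists uP; have [q qP] := path_exists vP.
have [E EP] := axes_exist n_gt2 XO.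
have [x [ta [ta' fu]]] := chain_frame_exists n_gt2 XO EP uP.
have [y [sa [sa' fv]]] := chain_frame_exists n_gt2 XO EP vP.
rewrite (goldmanE n_gt2 XO EP uP vP fu fv).
pose ku := kdot X E x ta ta'; pose kv := kdot X E y sa sa'.
have N2 : (n - 2)%N = (n - 3).+1 by lia.
have -> : \sum_(1 <= i < n - 2) (d_area alpha X i u * d_sigma alpha X i v - d_area alpha X i v * d_sigma alpha X i u) =
  4 * (\sum_(1 <= i < (n - 3).+1) (hdot X u i.+2 - hdot X u i.+1) * (\sum_(1 <= j < i.+1) kv j)
     - \sum_(1 <= i < (n - 3).+1) (hdot X v i.+2 - hdot X v i.+1) * (\sum_(1 <= j < i.+1) ku j)).
  rewrite N2 -sumrB mulr_sumr; apply: eq_big_nat => i hi; have hi' : (i <= n - 3)%N by lia.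
  rewrite (d_areaE n_gt2 XO uP pP hi') (d_areaE n_gt2 XO vP qP hi').
  rewrite (d_sigmaE n_gt2 XO EP fu pP hi') (d_sigmaE n_gt2 XO EP fv qP hi') -!mulr_sumr; ring.
rewrite !sum_by_parts.
have -> : (n - 3).+2 = n.-1 by lia.
rewrite (hdot_last n_gt2 XO uP) (hdot_last n_gt2 XO vP) !mul0r !sub0r opprK N2.
rewrite sumrB (eq_bigr (fun i => hdot X v i.+1 * ku i)); last by move=> i _; rewrite mulrC.
by field.
Qed.

End PathExists.

Theorem theorem1 (R : realType) (n : nat) (alpha : 'I_n -> R)
    (hn : (3 <= n)%N)
    (halpha : forall i, 0 < alpha i < 2 * pi)
    (hsum : 2 * pi * (n%:R - 1) < \sum_i alpha i) :
  [/\ (* the open stratum is open and dense *)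
      qopen (RepDT alpha) conj_rel (RepDT_open alpha) /\
      qdense (RepDT alpha) conj_rel (RepDT_open alpha),
      (* (a, sigma) is a diffeomorphism onto an open subset *)
      exists U : set ('rV[R]_(n - 3) * 'rV[R]_(n - 3)),
        qopen setT (@torus_rel R (n - 3)) U /\
        qdiffeo (RepDT_open alpha) conj_rel U (@torus_rel R (n - 3)) coords,
      (* the torus acts, and the a_i are invariant *)
      forall (theta : 'rV[R]_(n - 3)) (X : mtuple R n), RepDT alpha X ->
        RepDT alpha (torus_act theta X) /\
        forall i : nat, (i <= n - 3)%N ->
          area_param (torus_act theta X) i = area_param X i,
      (* the sigma_i are translated by - theta_i *)
      forall (theta : 'rV[R]_(n - 3)) (X : mtuple R n), RepDT_open alpha X ->
        forall i : 'I_(n - 3),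
          eqmod2pi (sigma (torus_act theta X) i.+1) (sigma X i.+1 - theta ord0 i) &
      (* omega = 1/2 sum_i da_i /\ dsigma_i *)
      forall X u v : mtuple R n, RepDT_open alpha X ->
        parabolic_cocycle X u -> parabolic_cocycle X v ->
        goldman X u v =
          2^-1 * \sum_(1 <= i < n - 2)
            (d_area alpha X i u * d_sigma alpha X i v
             - d_area alpha X i v * d_sigma alpha X i u)].
Proof.
have l0 : 0 < lambda alpha by rewrite /lambda subr_gt0.
split.
- by split; [exact: (open_stratum_qopen alpha hn)|exact: (open_stratum_qdense hn halpha l0)].
- by exists (polytope alpha); split; [exact: qopen_polytope|exact: (coords_qdiffeo hn halpha)].
- move=> theta X XDT; split; first exact: (torus_RepDT hn theta XDT).
  by move=> i hi; exact: (torus_area hn theta XDT hi).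
- by move=> theta X XO i; exact: (torus_sigma hn theta (proj1 XO) i XO).
- by move=> X u v XO uP vP; exact: (goldman_canonical hn halpha XO uP vP).
Qed.
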